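(* Let $N=8$. For $\Gamma_0(8)$, write $f_m=s(m)^{-1}q^{-m}+\sum_{n=0}^\infty a_m(n)q^n$. Then for $f_1$, $$a_1(n)=\frac\pi{\sqrt n}\sin\frac{\pi(n-1)}2\,\sin\frac{\pi(n-1)}4\,I_1\left(\frac{\pi\sqrt n}2\right)+O\left(\frac{2\sqrt\pi\log\frac{\pi\sqrt n}2}{n^{1/4}}I_1\left(\frac{\pi\sqrt n}4\right)\right).$$ For $f_8$, $a_8(n)\ge0$ for all $n$, and $$a_8(n)=\frac\pi{\sqrt n}I_1(\pi\sqrt{2n})\left(1+\sqrt2\sin\frac{\pi n}2\sin\frac{\pi n}4\right)+O\left(\frac{2^{1/4}\sqrt\pi\log(\pi\sqrt{2n})}{n^{1/4}}I_1\left(\frac{\pi\sqrt n}{\sqrt2}\right)\right).$$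
   Context: $q=e^{2\pi i\tau}$; $I_1$ is the modified Bessel function of the first kind of order $1$. Here $N=8$ is the discriminant of $\mathbb Q(\sqrt2)$, $\chi_D=\left(\frac8\cdot\right)=\chi_2=\left(\frac2\cdot\right)$, and $\epsilon_2=1$. $A(8,0,\chi_D)$ is the space of holomorphic functions $f$ on the upper half plane with $f(M\tau)=\chi_D(d)f(\tau)$ for all $M=\begin{pmatrix}a&b\\c&d\end{pmatrix}\in\Gamma_0(8)$ that are meromorphic at all cusps; $A^\epsilon(8,0,\chi_D)$ is the subspace of $f=\sum_na(n)q^n$ with $a(n)=0$ whenever $n$ is odd and $\chi_2(n)=-1$. For $m\in\mathbb Z$, $s(m)=2^{\omega((m,8))}$ with $\omega$ the number of distinct prime divisors; so $s(1)=1$, $s(8)=2$. $f_m$ denotes the unique element of $A^\epsilon(8,0,\chi_D)$ with $f_m=\frac1{s(m)}q^{-m}+O(1)$ at $\infty$; $f_1$ and $f_8$ exist. The $O$-estimates are as $n\to\infty$. *)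

(* Defs.v *)
From Stdlib Require Import Reals ZArith Znumtheory List.
From Coquelicot Require Import Coquelicot.

Open Scope R_scope.

Definition Cexp (z : C) : C :=
  (exp (Re z) * cos (Im z), exp (Re z) * sin (Im z)).

(* q^x = e^(2 pi i x tau) *)
Definition qpow (x : R) (tau : C) : C :=
  Cexp (RtoC (2 * PI * x) * Ci * tau)%C.

Definition upper_half_plane (tau : C) : Prop := 0 < Im tau.

Definition moebius (a b c d : Z) (tau : C) : C :=
  ((RtoC (IZR a) * tau + RtoC (IZR b)) /
   (RtoC (IZR c) * tau + RtoC (IZR d)))%C.

(* Differentiability is over C: the scalars of [ex_derive] are [C_AbsRing]. *)
Definition holomorphic_on_H (f : C -> C) : Prop :=
  forall tau : C, upper_half_plane tau ->
    @ex_derive C_AbsRing C_NormedModule f tau.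

(* g(tau) = sum_(n >= -n0) a(n) q^(n/h) on the upper half plane, for some n0:
   only finitely many negative powers of q^(1/h) occur. *)
Definition has_qexp (h : nat) (a : Z -> C) (g : C -> C) : Prop :=
  exists n0 : nat,
    (forall n : Z, (n < - Z.of_nat n0)%Z -> a n = RtoC 0) /\
    forall tau : C, upper_half_plane tau ->
      @is_series C_AbsRing C_NormedModule
        (fun k : nat =>
           let n := (Z.of_nat k - Z.of_nat n0)%Z in
           (a n * qpow (IZR n / INR h) tau)%C)
        (g tau).

(* Every cusp is M(oo) for some M in SL_2(Z). *)
Definition meromorphic_at_cusps (f : C -> C) : Prop :=
  forall a b c d : Z, (a * d - b * c = 1)%Z ->
    exists (h : nat) (u : Z -> C),
      (0 < h)%nat /\ has_qexp h u (fun tau => f (moebius a b c d tau)).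

(* The Kronecker symbol (8/n) = (2/n). *)
Definition chi2 (n : Z) : Z :=
  if Z.even n then 0%Z
  else if ((n mod 8 =? 1) || (n mod 8 =? 7))%Z%bool then 1%Z
  else (-1)%Z.

(* A(N, 0, chi): weight 0, level N, character chi.  Only the values of f on the
   upper half plane matter. *)
Definition weakly_holomorphic (N : Z) (chi : Z -> Z) (f : C -> C) : Prop :=
  holomorphic_on_H f /\
  (forall a b c d : Z, (a * d - b * c = 1)%Z -> (N | c)%Z ->
     forall tau : C, upper_half_plane tau ->
       f (moebius a b c d tau) = (RtoC (IZR (chi d)) * f tau)%C) /\
  meromorphic_at_cusps f.

(* A^epsilon(8, 0, chi_D), with epsilon_2 = 1. *)
Definition Aeps8 (f : C -> C) : Prop :=
  weakly_holomorphic 8 chi2 f /\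
  exists a : Z -> C, has_qexp 1 a f /\
    forall n : Z, Z.Odd n -> chi2 n = (-1)%Z -> a n = RtoC 0.

(* Number of distinct prime divisors of n > 0. *)
Definition omega (n : Z) : nat :=
  length
    (filter (fun p : nat =>
       if prime_dec (Z.of_nat p) then (n mod Z.of_nat p =? 0)%Z else false)
    (seq 1 (Z.to_nat n))).

Definition s8 (m : Z) : nat := Nat.pow 2 (omega (Z.gcd m 8)).

Definition principal_part (m : Z) (tau : C) : C :=
  (RtoC (/ INR (s8 m)) * qpow (IZR (- m)) tau)%C.

(* f is f_m: it lies in A^epsilon(8, 0, chi_D), and f = q^(-m) / s(m) + O(1) as
   Im tau -> +oo. *)
Definition is_f (m : Z) (f : C -> C) : Prop :=
  Aeps8 f /\
  exists K Y : R, forall tau : C, upper_half_plane tau -> Y < Im tau ->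
    Cmod (f tau - principal_part m tau) <= K.

(* f = q^(-m) / s(m) + sum_(n >= 0) a(n) q^n *)
Definition f_expansion (m : Z) (f : C -> C) (a : nat -> C) : Prop :=
  forall tau : C, upper_half_plane tau ->
    @is_series C_AbsRing C_NormedModule
      (fun n : nat => (a n * qpow (INR n) tau)%C)
      (f tau - principal_part m tau)%C.

(* Modified Bessel function of the first kind, of integral order nu >= 0. *)
Definition BesselI (nu : nat) (x : R) : R :=
  Series (fun k : nat =>
    (x / 2) ^ (2 * k + nu) / (INR (fact k) * INR (fact (k + nu)))).

(* u(n) = v(n) + O(w(n)) as n -> oo *)
Definition eq_bigO (u : nat -> C) (v w : nat -> R) : Prop :=
  exists (K : R) (n0 : nat), forall n : nat, (n0 <= n)%nat ->
    Cmod (u n - RtoC (v n)) <= K * Rabs (w n).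

(* Main.v *)
Require Import Defs.
From Corelib Require Import ssreflect.
From Stdlib Require Import Reals ZArith Znumtheory List Lra Lia Psatz Permutation FunctionalExtensionality Classical.
From Coquelicot Require Import Coquelicot.
Open Scope R_scope.

(* Write f = f_1, chi = chi_2 and q = e^(2 pi i tau).  Gamma_0(8)-invariance and the vanishing of the
   coefficients with chi(n) = -1 express f near every cusp through its translates f(tau + k/8).  Hence a
   Gamma_0(8)-invariant polynomial in such translates whose poles cancel at the four cusps is constant, by the
   maximum principle.  Applied to a Hecke trace of f this gives
     a_8(n) = 4 (1 + chi(n)) a_1(8n) + 2 chi(n/2) a_1(2n) + chi(n/4) a_1(n/2) + a_1(n/8)/2.
   Applied to the even and odd parts E, O of f it gives 4 (E^2 + O^2) = E^2 O^2 and a relation between E, O at tau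
   and at 2 tau; these have the unique solution E = 2 theta(q^2) / theta(q^4), O = 2 theta(q^2) / Z with
   theta(q) = sum q^(n^2) and Z = theta(q) - theta(q^4).

   Positivity: sum a_1(8n) T^n = 2 theta(T) theta(T^2) G(T)^2, where G(T) = 1/theta(-T) has nonnegative coefficients
   because G(T) = theta(T) G(T^2)^2; the other terms of the Hecke relation are dominated coefficientwise.

   Asymptotics: on the line Im tau = 1/(16 sqrt n), f is compared with sum_k chi(k) e(k/8) g(tau - k/8) over
   k = 1, 3, 5, 7, where g = sum_n b(n) q^n, b(n) = pi/(4 sqrt n) I_1(pi sqrt n / 2), satisfies
   g(tau) = e(1/(64 tau)) + O(1).  The difference is bounded, up to a negligible term, by e^(pi sqrt n / 8) times
   Lorentzians of width Im tau centred at the points d/16.  The estimate for f_8 follows by the Hecke relation. *)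

(** The asymptotics cannot give positivity: their constants are not explicit, and the factor 1 +
    chi(n) vanishes when chi(n) = -1. Hence the exact evaluation of the a_1(8n). The theta quotients
    do not serve to construct f_1: its parts are known only through the two relations, and
    uniqueness of the solution comes from a contraction under x -> x^2 near 0. The height y = 1/(16
    sqrt n) is the saddle point not of the main term but of the next poles, at the odd multiples of
    1/16: there f grows like e^(2 pi/(256 y)), while q^(-n) costs e^(2 pi n y), and both equal e^(pi
    sqrt n / 8). Their product is the exponential in I_1(pi sqrt n / 4). A bound by the supremum
    would miss the factor n^(-1/2) of the error; each pole acts only on a width of about y, and
    integrating the Lorentzians recovers that factor. The main term itself is never integrated: the
    coefficients of g are Bessel values by definition, so only a difference has to be bounded. In
    the relation for f_8 the term a_1(2n) has exactly the exponential size of the allowed error. *)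

(** * Complex numbers, the function e(z) and the eighth roots of unity *)

Lemma C_ext (x y : C) : Re x = Re y -> Im x = Im y -> x = y.
Proof. case: x => a b; case: y => c d; rewrite /Re /Im /= => -> -> //. Qed.

Lemma Re_plus (x y : C) : Re (x + y) = Re x + Re y.
Proof. by []. Qed.
Lemma Im_plus (x y : C) : Im (x + y) = Im x + Im y.
Proof. by []. Qed.
Lemma Re_mult (x y : C) : Re (x * y) = Re x * Re y - Im x * Im y.
Proof. by []. Qed.
Lemma Im_mult (x y : C) : Im (x * y) = Re x * Im y + Im x * Re y.
Proof. by []. Qed.
Lemma Re_opp (x : C) : Re (- x) = - Re x.
Proof. by []. Qed.
Lemma Im_opp (x : C) : Im (- x) = - Im x.
Proof. by []. Qed.

Definition Creim := (Re_plus, Im_plus, Re_mult, Im_mult, Re_opp, Im_opp,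
  re_RtoC, im_RtoC).

Lemma Cmod_sqr (x : C) : Cmod x * Cmod x = Re x * Re x + Im x * Im x.
Proof. have := Cmod2_alt x; rewrite /= !Rmult_1_r //. Qed.

Lemma Cmod_minus_sym (x y : C) : Cmod (x - y) = Cmod (y - x).
Proof. rewrite -(Cmod_opp (x - y)); congr Cmod; ring. Qed.

Lemma Cmod_minus_triangle (x y z : C) : Cmod (x - z) <= Cmod (x - y) + Cmod (y - z).
Proof. have -> : (x - z = (x - y) + (y - z))%C by ring. exact: Cmod_triangle. Qed.

Lemma Cmod_le_add (x y : C) : Cmod x <= Cmod y + Cmod (x - y).
Proof. have {1}-> : (x = y + (x - y))%C by ring. exact: Cmod_triangle. Qed.

Lemma im_le_Cmod (x : C) : Rabs (Im x) <= Cmod x.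
Proof. exact: Rle_trans (Rmax_r _ _) (Rmax_Cmod x). Qed.

Lemma Cexp_plus (x y : C) : Cexp (x + y) = (Cexp x * Cexp y)%C.
Proof.
rewrite /Cexp !Creim exp_plus cos_plus sin_plus.
apply: C_ext; rewrite !Creim /Re /Im /=; ring.
Qed.

Lemma Cexp_0 : Cexp 0 = 1.
Proof. by rewrite /Cexp /Re /Im /= exp_0 cos_0 sin_0; apply: C_ext; rewrite /Re /Im /=; ring. Qed.

Lemma Cmod_Cexp (x : C) : Cmod (Cexp x) = exp (Re x).
Proof.
rewrite /Cmod /Cexp /=.
set e := exp _; set t := Im x.
have -> : e * cos t * (e * cos t * 1) + e * sin t * (e * sin t * 1)
  = e * e * ((sin t)² + (cos t)²) by rewrite /Rsqr; ring.
rewrite sin2_cos2 Rmult_1_r sqrt_square //; exact/Rlt_le/exp_pos.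
Qed.

Definition ee (z : C) : C := Cexp (RtoC (2 * PI) * Ci * z)%C.

Lemma ee_plus (x y : C) : ee (x + y) = (ee x * ee y)%C.
Proof. rewrite /ee -Cexp_plus; congr Cexp; ring. Qed.

Lemma ee_0 : ee 0 = 1.
Proof. rewrite /ee -[RHS]Cexp_0; congr Cexp; ring. Qed.

Lemma Cmod_ee (z : C) : Cmod (ee z) = exp (- (2 * PI * Im z)).
Proof.
rewrite /ee Cmod_Cexp; congr exp; rewrite !Creim /Ci /Re /Im /=; ring.
Qed.

Lemma ee_neq0 (z : C) : ee z <> 0.
Proof. move=> h; have := Cmod_ee z; rewrite h Cmod_0; have := exp_pos (- (2 * PI * Im z)); lra. Qed.

Lemma ee_opp (z : C) : ee (- z) = (/ ee z)%C.
Proof.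
have h := ee_neq0 z.
have e : (ee (- z) * ee z = 1)%C by rewrite -ee_plus -ee_0; congr ee; ring.
rewrite -[LHS]Cmult_1_r -(Cinv_r _ h) Cmult_assoc e; ring.
Qed.

Lemma ee_pow (n : nat) (z : C) : ee (RtoC (INR n) * z) = (ee z ^ n)%C.
Proof.
elim: n => [|n IH]; first by rewrite /= Cmult_0_l ee_0.
rewrite S_INR Cpow_S -IH -ee_plus; congr ee; rewrite RtoC_plus; ring.
Qed.

Lemma ee_R (x : R) : ee x = (cos (2 * PI * x), sin (2 * PI * x)).
Proof.
rewrite /ee /Cexp !Creim /Ci /Re /Im /=.
have -> : (2 * PI * 0 - 0 * 1) * x - (2 * PI * 1 + 0 * 0) * 0 = 0 by ring.
rewrite exp_0; congr pair; rewrite Rmult_1_l; f_equal; ring.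
Qed.

Lemma ee_1 : ee 1 = 1.
Proof. rewrite ee_R Rmult_1_r cos_2PI sin_2PI //. Qed.

Lemma ee_nat (n : nat) : ee (INR n) = 1.
Proof. by rewrite -(Cmult_1_r (INR n)) ee_pow ee_1 Cpow_1_l. Qed.

Lemma ee_Z (k : Z) : ee (IZR k) = 1.
Proof.
case: (Z_le_gt_dec 0 k) => hk.
  have -> : k = Z.of_nat (Z.to_nat k) by lia.
  by rewrite -INR_IZR_INZ ee_nat.
have -> : RtoC (IZR k) = (- RtoC (INR (Z.to_nat (- k))))%C.
  rewrite -RtoC_opp INR_IZR_INZ -opp_IZR; do 2 f_equal; lia.
rewrite ee_opp ee_nat; field.
Qed.

Lemma ee_plus_Z (z : C) (k : Z) : ee (z + IZR k) = ee z.
Proof. by rewrite ee_plus ee_Z Cmult_1_r. Qed.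

Lemma qpow_ee (x : R) (tau : C) : qpow x tau = ee (x * tau).
Proof. rewrite /qpow /ee; congr Cexp; rewrite RtoC_mult; ring. Qed.

Lemma unit_circle_angle (x y : R) : x * x + y * y = 1 ->
  exists t, x = cos t /\ y = sin t.
Proof.
move=> h.
have hx : -1 <= x <= 1 by split; nra.
have hs : sin (acos x) = sqrt (1 - x²) by exact: sin_acos.
have e : 1 - x² = y² by rewrite /Rsqr; lra.
case: (Rle_lt_dec 0 y) => hy.
  exists (acos x); rewrite cos_acos // hs e sqrt_Rsqr //.
exists (- acos x); rewrite cos_neg sin_neg cos_acos // hs e.
have -> : y² = (- y)² by rewrite /Rsqr; ring.
rewrite sqrt_Rsqr; lra.
Qed.

Lemma ee_surj (s : C) : s <> 0 -> exists z, ee z = s /\ Im z = - ln (Cmod s) / (2 * PI).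
Proof.
move=> hs; have hm : 0 < Cmod s by apply/Cmod_gt_0.
have hpi := PI_RGT_0.
have [t [ht1 ht2]] : exists t, Re s / Cmod s = cos t /\ Im s / Cmod s = sin t.
  apply: unit_circle_angle; have := Cmod_sqr s => h.
  have -> : Re s / Cmod s * (Re s / Cmod s) + Im s / Cmod s * (Im s / Cmod s)
   = (Re s * Re s + Im s * Im s) / (Cmod s * Cmod s) by field; lra.
  rewrite -h; field; lra.
exists (t / (2 * PI), - ln (Cmod s) / (2 * PI)); split=> //.
rewrite /ee /Cexp !Creim /Ci /Re /Im /=.
have -> : (2 * PI * 0 - 0 * 1) * (t / (2 * PI)) -
    (2 * PI * 1 + 0 * 0) * (- ln (Cmod s) / (2 * PI)) = ln (Cmod s) by field; lra.
have -> : (2 * PI * 0 - 0 * 1) * (- ln (Cmod s) / (2 * PI)) +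
     (2 * PI * 1 + 0 * 0) * (t / (2 * PI)) = t by field; lra.
rewrite exp_ln // -ht1 -ht2; apply: C_ext; rewrite /Re /Im /=; field; lra.
Qed.

Lemma sqrt2_sqr : sqrt 2 * sqrt 2 = 2.
Proof. by apply: sqrt_sqrt; lra. Qed.

Definition z8 : C := ee (1 / 8).

Lemma z8_def : z8 = (/ sqrt 2, / sqrt 2).
Proof.
rewrite /z8.
have -> : (1 / 8 = RtoC (1 / 8))%C by apply: C_ext; rewrite /Re /Im /=; field.
rewrite ee_R; have -> : 2 * PI * (1 / 8) = PI / 4 by field.
rewrite cos_PI4 sin_PI4; congr pair; field; exact/Rgt_not_eq/Rlt_sqrt2_0.
Qed.

Lemma z8_sqr : (z8 * z8 = Ci)%C.
Proof.
have h := sqrt2_sqr; have h0 := Rlt_sqrt2_0.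
have e : / sqrt 2 * / sqrt 2 = / 2 by rewrite -Rinv_mult h.
rewrite z8_def; apply: C_ext; rewrite /Re /Im /= ?e; lra.
Qed.

(** [- z8 ^ 3] is the inverse of [z8] because [z8 ^ 4 = -1]; the sum of both is 2 cos (pi / 4). *)
Lemma z8_add_inv : (z8 - z8 * z8 * z8 = RtoC (sqrt 2))%C.
Proof.
have h := sqrt2_sqr; have h0 := Rlt_sqrt2_0.
have e : sqrt 2 = 2 * / sqrt 2 by rewrite -{2}h; field; lra.
rewrite z8_sqr z8_def; apply: C_ext; rewrite /Re /Im /=; lra.
Qed.

Lemma Ci_sqr : (Ci * Ci = - (1))%C.
Proof. apply: C_ext; rewrite /Re /Im /=; ring. Qed.
Lemma z8_pow4 : (z8 ^ 4 = - (1))%C.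
Proof. have -> : (z8 ^ 4 = (z8 * z8) * (z8 * z8))%C by ring. by rewrite z8_sqr Ci_sqr. Qed.
Lemma z8_pow8 : (z8 ^ 8 = 1)%C.
Proof. have -> : (z8 ^ 8 = z8 ^ 4 * z8 ^ 4)%C by ring. rewrite z8_pow4; ring. Qed.
Lemma Cmod_z8 : Cmod z8 = 1.
Proof.
rewrite /z8 Cmod_ee.
have -> : Im (1 / 8) = 0 by rewrite /Im /=; field.
by rewrite Rmult_0_r Ropp_0 exp_0.
Qed.

(** * Series of complex numbers *)

Definition Cseries (a : nat -> C) (l : C) : Prop :=
  @is_series C_AbsRing C_NormedModule a l.

Definition Csum (a : nat -> C) (n : nat) : C := @sum_n C_AbelianMonoid a n.

Lemma Csum_S (a : nat -> C) n : Csum a (S n) = (Csum a n + a (S n))%C.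
Proof. exact: sum_Sn. Qed.
Lemma Csum_0 (a : nat -> C) : Csum a 0 = a 0%nat.
Proof. exact: sum_O. Qed.

Lemma Csum_Re (a : nat -> C) n : Re (Csum a n) = sum_n (fun k => Re (a k)) n.
Proof. by elim: n => [|n IH]; rewrite ?Csum_0 ?sum_O // Csum_S sum_Sn Re_plus IH. Qed.
Lemma Csum_Im (a : nat -> C) n : Im (Csum a n) = sum_n (fun k => Im (a k)) n.
Proof. by elim: n => [|n IH]; rewrite ?Csum_0 ?sum_O // Csum_S sum_Sn Im_plus IH. Qed.

Lemma Cseries_reim (a : nat -> C) (l : C) :
  Cseries a l <->
  is_series (fun n => Re (a n)) (Re l) /\ is_series (fun n => Im (a n)) (Im l).
Proof.
split=> [h|[h1 h2]].
- split; apply/filterlim_locally => eps.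
  + move/(@filterlim_locally _ _ _ _): h => /(_ eps) [N HN].
    exists N => n hn; have [h _] := HN n hn.
    rewrite -Csum_Re; exact: h.
  + move/(@filterlim_locally _ _ _ _): h => /(_ eps) [N HN].
    exists N => n hn; have [_ h] := HN n hn.
    rewrite -Csum_Im; exact: h.
- apply/filterlim_locally => eps.
  move/(@filterlim_locally _ _ _ _): h1 => /(_ eps) [N1 H1].
  move/(@filterlim_locally _ _ _ _): h2 => /(_ eps) [N2 H2].
  exists (Nat.max N1 N2) => n hn; split.
  + have := H1 n (Nat.le_trans _ _ _ (Nat.le_max_l _ _) hn).
    by rewrite -Csum_Re.
  + have := H2 n (Nat.le_trans _ _ _ (Nat.le_max_r _ _) hn).
    by rewrite -Csum_Im.
Qed.

Lemma Cseries_unique a l l' : Cseries a l -> Cseries a l' -> l = l'.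
Proof.
move=> /Cseries_reim [h1 h2] /Cseries_reim [k1 k2]; apply: C_ext.
  by rewrite -(is_series_unique _ _ h1) -(is_series_unique _ _ k1).
by rewrite -(is_series_unique _ _ h2) -(is_series_unique _ _ k2).
Qed.

Lemma Cseries_ext a b l : (forall n, a n = b n) -> Cseries a l -> Cseries b l.
Proof. exact: is_series_ext. Qed.

Lemma Cseries_plus a b l l' : Cseries a l -> Cseries b l' ->
  Cseries (fun n => a n + b n)%C (l + l')%C.
Proof. exact: is_series_plus. Qed.

Lemma Cseries_scal c a l : Cseries a l -> Cseries (fun n => c * a n)%C (c * l)%C.
Proof. exact: is_series_scal. Qed.

Lemma Cseries_opp a l : Cseries a l -> Cseries (fun n => - a n)%C (- l)%C.
Proof. exact: is_series_opp. Qed.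

Lemma Cseries_minus a b l l' : Cseries a l -> Cseries b l' ->
  Cseries (fun n => a n - b n)%C (l - l')%C.
Proof. move=> h1 h2; apply: Cseries_plus => //; exact: Cseries_opp. Qed.

Lemma Cseries_term0 a l : Cseries a l -> exists K, forall n, Cmod (a n) <= K.
Proof.
move=> /Cseries_reim [h1 h2].
have b (u : nat -> R) v : is_series u v -> exists K, forall n, Rabs (u n) <= K.
  move=> h; have := ex_series_lim_0 _ (ex_intro _ v h).
  move=> /is_lim_seq_spec /(_ (mkposreal 1 Rlt_0_1)) /= [N HN].
  have [K HK] : exists K, forall n, (n < N)%nat -> Rabs (u n) <= K.
    elim: N {HN} => [|N [K HK]]; first by exists 0 => n; lia.
    exists (Rmax K (Rabs (u N))) => n hn.
    case: (Nat.eq_dec n N) => [->|hn']; first exact: Rmax_r.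
    apply: Rle_trans (Rmax_l _ _); apply: HK; lia.
  exists (Rmax K 1) => n; case: (Nat.lt_ge_cases n N) => hn.
    apply: Rle_trans (Rmax_l _ _); exact: HK.
  apply: Rle_trans (Rmax_r _ _); have := HN n hn; rewrite Rminus_0_r; lra.
have [K1 H1] := b _ _ h1; have [K2 H2] := b _ _ h2.
exists (sqrt 2 * Rmax K1 K2) => n.
apply: Rle_trans (Cmod_2Rmax _) _; apply: Rmult_le_compat_l; first exact: sqrt_pos.
apply: Rmax_lub; [apply: Rle_trans (Rmax_l _ _); exact: H1|apply: Rle_trans (Rmax_r _ _); exact: H2].
Qed.

Lemma Csum_norm a (c : nat -> R) n : (forall k, Cmod (a k) <= c k) ->
  Cmod (Csum a n) <= sum_n c n.
Proof.
move=> h; elim: n => [|n IH]; first by rewrite Csum_0 sum_O.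
rewrite Csum_S sum_Sn; apply: Rle_trans (Cmod_triangle _ _) _.
exact: Rplus_le_compat.
Qed.

Lemma sum_n_le_series (c : nat -> R) S n : (forall k, 0 <= c k) -> is_series c S ->
  sum_n c n <= S.
Proof.
move=> h hS.
have hinc m : sum_n c n <= sum_n c (n + m)%nat.
  elim: m => [|m IH]; first by rewrite Nat.add_0_r; lra.
  rewrite Nat.add_succ_r sum_Sn /plus /=; have := h (Datatypes.S (n + m)); lra.
have hl : is_lim_seq (sum_n c) S by [].
apply: (is_lim_seq_le_loc (fun _ => sum_n c n) (sum_n c) (sum_n c n) S) => //.
- exists n => m hm; have -> : (m = n + (m - n))%nat by lia. exact: hinc.
- exact: is_lim_seq_const.
Qed.

Lemma Cseries_norm a l (c : nat -> R) S : Cseries a l -> (forall n, Cmod (a n) <= c n) ->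
  is_series c S -> Cmod l <= S.
Proof.
move=> h hc hS.
have hb n : Cmod (Csum a n) <= S.
  apply: Rle_trans (Csum_norm a c n hc) _; apply: sum_n_le_series => // k.
  exact: Rle_trans (Cmod_ge_0 _) (hc k).
apply: Rnot_lt_le => hlt.
have he : 0 < (Cmod l - S) / 2 by lra.
move/(@filterlim_locally _ _ _ _): h => /(_ (mkposreal _ he)) [N HN].
have [h1 h2] := HN N (le_n _).
(* The balls of [C] are products of intervals, so passing to [Cmod] costs a factor [sqrt 2]; the
   radius is half the gap and [sqrt 2 < 2]. *)
have hx : Cmod (Csum a N - l) < sqrt 2 * ((Cmod l - S) / 2).
  exact: (C_NormedModule_mixin_compat2 l (Csum a N) (mkposreal _ he)) (HN N (le_n _)).
have h4 : sqrt 2 < 2.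
  have := sqrt2_sqr; have := Rlt_sqrt2_0; nra.
have := Cmod_le_add l (Csum a N); rewrite (Cmod_minus_sym l).
have := hb N; nra.
Qed.

Lemma Cseries_ex a (c : nat -> R) : (forall n, Cmod (a n) <= c n) -> ex_series c ->
  exists l, Cseries a l.
Proof.
move=> hc hS.
have [x hx] : ex_series (fun n => Re (a n)).
  apply: ex_series_le hS => n; exact: Rle_trans (re_le_Cmod _) (hc n).
have [y hy] : ex_series (fun n => Im (a n)).
  apply: ex_series_le hS => n; exact: Rle_trans (im_le_Cmod _) (hc n).
exists (x, y); exact/Cseries_reim.
Qed.

Lemma sum_n_lin1 (F G H : nat -> R) n : (forall k, H k = F k + G k) ->
  sum_n H n = sum_n F n + sum_n G n.
Proof.
move=> h; elim: n => [|n IH]; first by rewrite !sum_O.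
rewrite !sum_Sn IH h /plus /=; ring.
Qed.

Lemma sum_n_lin2 (F G H : nat -> R) n : (forall k, H k = F k - G k) ->
  sum_n H n = sum_n F n - sum_n G n.
Proof.
move=> h; elim: n => [|n IH]; first by rewrite !sum_O.
rewrite !sum_Sn IH h /plus /=; ring.
Qed.

Definition Cconv (a b : nat -> C) (n : nat) : C := Csum (fun k => a k * b (n - k)%nat)%C n.

(** The majorants supply the absolute convergence asked for by the four real Cauchy products. *)
Lemma Cseries_mult a b la lb (c d : nat -> R) :
  Cseries a la -> Cseries b lb ->
  (forall n, Cmod (a n) <= c n) -> ex_series c ->
  (forall n, Cmod (b n) <= d n) -> ex_series d ->
  Cseries (Cconv a b) (la * lb)%C.
Proof.
move=> /Cseries_reim [a1 a2] /Cseries_reim [b1 b2] hc Sc hd Sd.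
have ab (u : nat -> C) (c' : nat -> R) : (forall n, Cmod (u n) <= c' n) -> ex_series c' ->
    ex_series (fun n => Rabs (Re (u n))) /\ ex_series (fun n => Rabs (Im (u n))).
  move=> h hS; split; apply: ex_series_le hS => n; rewrite /norm /= /abs /= Rabs_Rabsolu.
    exact: Rle_trans (re_le_Cmod _) (h n).
  exact: Rle_trans (im_le_Cmod _) (h n).
have [a1' a2'] := ab _ _ hc Sc; have [b1' b2'] := ab _ _ hd Sd.
apply/Cseries_reim; split.
- rewrite Re_mult; apply: (is_series_ext (fun n => minus
    (sum_f_R0 (fun k => Re (a k) * Re (b (n - k)%nat)) n)
    (sum_f_R0 (fun k => Im (a k) * Im (b (n - k)%nat)) n))).
    move=> n; rewrite /Cconv Csum_Re -!sum_n_Reals /minus /plus /opp /=.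
    symmetry; apply: sum_n_lin2 => k; exact: Re_mult.
  exact: is_series_minus (is_series_mult _ _ _ _ a1 b1 a1' b1') (is_series_mult _ _ _ _ a2 b2 a2' b2').
- rewrite Im_mult; apply: (is_series_ext (fun n => plus
    (sum_f_R0 (fun k => Re (a k) * Im (b (n - k)%nat)) n)
    (sum_f_R0 (fun k => Im (a k) * Re (b (n - k)%nat)) n))).
    move=> n; rewrite /Cconv Csum_Im -!sum_n_Reals /plus /=.
    symmetry; apply: sum_n_lin1 => k; exact: Im_mult.
  exact: is_series_plus (is_series_mult _ _ _ _ a1 b2 a1' b2') (is_series_mult _ _ _ _ a2 b1 a2' b1').
Qed.

(** * Power series on the unit disc *)

Definition pser (b : nat -> C) (s l : C) : Prop := Cseries (fun n => b n * s ^ n)%C l.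
Definition psrep (b : nat -> C) (phi : C -> C) : Prop :=
  forall s, Cmod s < 1 -> pser b s (phi s).
(** Holomorphy on the open unit disc, encoded as expansion in one power series; values outside the
    disc are unconstrained. *)
Definition hol (phi : C -> C) : Prop := exists b, psrep b phi.

Lemma geom_ex (K q : R) : 0 <= q < 1 -> is_series (fun n => K * q ^ n) (K / (1 - q)).
Proof.
move=> h; apply: (is_series_scal K); apply: is_series_geom; rewrite Rabs_pos_eq; lra.
Qed.

(** The terms at the intermediate radius [(1 + r) / 2] are bounded, so those at radius [r] decay
    geometrically. *)
Lemma psrep_bound b phi r : psrep b phi -> 0 <= r < 1 ->
  exists K q, 0 <= K /\ 0 <= q < 1 /\ forall n, Cmod (b n) * r ^ n <= K * q ^ n.
Proof.
move=> h hr; pose r' := (1 + r) / 2.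
have hr' : 0 < r' < 1 by rewrite /r'; lra.
have [|K HK] := Cseries_term0 _ _ (h r' _); first by rewrite Cmod_R Rabs_pos_eq; lra.
exists K, (r / r'); split; [|split].
- exact: Rle_trans (Cmod_ge_0 _) (HK 0%nat).
- split; first by apply: Rdiv_le_0_compat; lra.
  apply: (Rmult_lt_reg_r r'); first lra.
  rewrite Rmult_1_l /Rdiv Rmult_assoc Rinv_l; rewrite /r'; lra.
- move=> n; have := HK n; rewrite Cmod_mult Cmod_pow Cmod_R (Rabs_pos_eq r'); last lra.
  move=> hn; rewrite /Rdiv Rpow_mult_distr pow_inv.
  have hp : 0 < r' ^ n by apply: pow_lt; lra.
  have hq : 0 <= r ^ n by apply: pow_le; lra.
  apply: (Rmult_le_reg_r (r' ^ n)) => //.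
  have -> : K * (r ^ n * / r' ^ n) * r' ^ n = K * r ^ n by field; lra.
  nra.
Qed.

Lemma Cmod_pser_term b s r n : Cmod s <= r -> Cmod (b n * s ^ n)%C <= Cmod (b n) * r ^ n.
Proof.
move=> h; rewrite Cmod_mult Cmod_pow; apply: Rmult_le_compat_l; first exact: Cmod_ge_0.
apply: pow_incr; split=> //; exact: Cmod_ge_0.
Qed.

Lemma psrep_bounded b phi r : psrep b phi -> 0 <= r < 1 ->
  exists K, forall s, Cmod s <= r -> Cmod (phi s) <= K.
Proof.
move=> h hr; have [K [q [hK [hq hb]]]] := psrep_bound b phi r h hr.
exists (K / (1 - q)) => s hs.
apply: (Cseries_norm _ _ (fun n => K * q ^ n) _ (h s _)); first lra.
  move=> n; exact: Rle_trans (Cmod_pser_term _ _ _ _ hs) (hb n).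
exact: geom_ex.
Qed.

Lemma hol_bounded phi r : hol phi -> 0 <= r < 1 ->
  exists K, 0 <= K /\ forall s, Cmod s <= r -> Cmod (phi s) <= K.
Proof.
move=> [b h] hr; have [K HK] := psrep_bounded b phi r h hr; exists K; split=> //.
apply: Rle_trans (Cmod_ge_0 _) (HK 0 _); rewrite Cmod_0; lra.
Qed.

Lemma Cseries_zero_from (a : nat -> C) N : (forall n, (N < n)%nat -> a n = RtoC 0) -> Cseries a (Csum a N).
Proof.
move=> h.
have hs n : (N <= n)%nat -> Csum a n = Csum a N.
  move=> hn; have -> : (n = N + (n - N))%nat by lia.
  elim: (n - N)%nat => [|m IH]; first by rewrite Nat.add_0_r.
  rewrite Nat.add_succ_r Csum_S IH h; last lia. ring.
apply/(@filterlim_locally _ _ _ _) => eps; exists N => n hn.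
change (ball (Csum a N) eps (Csum a n)); rewrite hs //; exact: ball_center.
Qed.

Lemma psrep_at0 b phi : psrep b phi -> phi 0 = b 0%nat.
Proof.
move=> h; have h0 : Cmod 0 < 1 by rewrite Cmod_0; lra.
apply: Cseries_unique (h 0 h0) _.
have := Cseries_zero_from (fun n => b n * 0 ^ n)%C 0.
rewrite Csum_0 /= Cmult_1_r; apply=> n hn.
have -> : n = S (n - 1) by lia. rewrite /=; ring.
Qed.

Lemma hol_ext (phi psi : C -> C) : hol phi -> (forall s, Cmod s < 1 -> phi s = psi s) -> hol psi.
Proof. by move=> [b h] e; exists b => s hs; rewrite -e //; exact: h. Qed.

Lemma hol_const c : hol (fun _ => c).
Proof.
exists (fun n => match n with O => c | _ => 0 end) => s hs.
have := Cseries_zero_from (fun n => match n with O => c | _ => 0 end * s ^ n)%C 0.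
rewrite Csum_0 /= Cmult_1_r; apply=> n hn.
case: n hn => [|n] hn; first lia. ring.
Qed.

Lemma hol_id : hol (fun s => s).
Proof.
pose b (n : nat) : C := match n with S O => 1 | _ => 0 end.
exists b => s hs.
have := Cseries_zero_from (fun n => b n * s ^ n)%C 1.
have -> : Csum (fun n => b n * s ^ n)%C 1 = s by rewrite Csum_S Csum_0 /b /=; ring.
apply=> n hn; rewrite /b.
case: n hn => [|[|n]] hn /=; try lia. ring.
Qed.

Lemma hol_plus phi psi : hol phi -> hol psi -> hol (fun s => phi s + psi s)%C.
Proof.
move=> [b hb] [c hc]; exists (fun n => b n + c n)%C => s hs.
apply: Cseries_ext (Cseries_plus _ _ _ _ (hb s hs) (hc s hs)) => n /=; ring.
Qed.

Lemma psrep_mult b c phi psi : psrep b phi -> psrep c psi ->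
  psrep (Cconv b c) (fun s => phi s * psi s)%C.
Proof.
move=> hb hc s hs.
have hr : 0 <= Cmod s < 1 by split=> //; exact: Cmod_ge_0.
have [K [q [hK [hq hbn]]]] := psrep_bound b phi _ hb hr.
have [K' [q' [hK' [hq' hcn]]]] := psrep_bound c psi _ hc hr.
apply: Cseries_ext (Cseries_mult _ _ _ _ (fun n => K * q ^ n) (fun n => K' * q' ^ n)
  (hb s hs) (hc s hs) _ _ _ _).
- move=> n; rewrite /Cconv.
  have h m : (m <= n)%nat -> Csum (fun k => b k * s ^ k * (c (n - k)%nat * s ^ (n - k)))%C m
    = (Csum (fun k => b k * c (n - k)%nat) m * s ^ n)%C.
    elim: m => [|m IH] hm; rewrite ?Csum_0 ?Csum_S ?IH; try lia.
      rewrite Nat.sub_0_r /=; ring.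
    have -> : (s ^ n = s ^ (S m) * s ^ (n - S m))%C by rewrite -Cpow_add_r; congr Cpow; lia.
    ring.
  exact: h.
- move=> n; exact: Rle_trans (Cmod_pser_term _ _ _ _ (Rle_refl _)) (hbn n).
- exists (K / (1 - q)); exact: geom_ex.
- move=> n; exact: Rle_trans (Cmod_pser_term _ _ _ _ (Rle_refl _)) (hcn n).
- exists (K' / (1 - q')); exact: geom_ex.
Qed.

Lemma hol_mult phi psi : hol phi -> hol psi -> hol (fun s => phi s * psi s)%C.
Proof. by move=> [b hb] [c hc]; exists (Cconv b c); apply: psrep_mult. Qed.

Lemma hol_scal c phi : hol phi -> hol (fun s => c * phi s)%C.
Proof. move=> h; apply: hol_mult => //; exact: hol_const. Qed.

Lemma hol_opp phi : hol phi -> hol (fun s => - phi s)%C.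
Proof. move=> h; apply: hol_ext (hol_scal (- (1)) _ h) _ => s _; ring. Qed.

Lemma hol_minus phi psi : hol phi -> hol psi -> hol (fun s => phi s - psi s)%C.
Proof. move=> h1 h2; apply: hol_plus => //; exact: hol_opp. Qed.

Lemma hol_rot c phi : Cmod c <= 1 -> hol phi -> hol (fun s => phi (c * s)%C).
Proof.
move=> hc [b h]; exists (fun n => b n * c ^ n)%C => s hs.
have hs' : Cmod (c * s)%C < 1.
  rewrite Cmod_mult; have := Cmod_ge_0 s; have := Cmod_ge_0 c; nra.
by apply: Cseries_ext (h _ hs') => n; rewrite Cpow_mult_l; ring.
Qed.

Definition Ctsum (a : nat -> C) : C :=
  (Series (fun n => Re (a n)), Series (fun n => Im (a n))).

Lemma Cseries_Ctsum a l : Cseries a l -> Cseries a (Ctsum a).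
Proof.
move=> /Cseries_reim [h1 h2]; apply/Cseries_reim; split; apply: Series_correct.
  by exists (Re l).
by exists (Im l).
Qed.

(** Total in [s], so that a function can be named by its coefficients before convergence is
    known. *)
Definition psum (b : nat -> C) (s : C) : C := Ctsum (fun n => b n * s ^ n)%C.

Lemma psrep_psum b :
  (forall r, 0 <= r < 1 -> exists K, forall n, Cmod (b n) * r ^ n <= K) -> psrep b (psum b).
Proof.
move=> h s hs.
pose r := (1 + Cmod s) / 2; have h0 := Cmod_ge_0 s.
have hr : 0 < r < 1 by rewrite /r; lra.
have [|K HK] := h r; first lra.
have [l hl] : exists l, Cseries (fun n => b n * s ^ n)%C l.
  apply: (Cseries_ex _ (fun n => K * (Cmod s / r) ^ n)).
    move=> n; rewrite Cmod_mult Cmod_pow /Rdiv Rpow_mult_distr pow_inv.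
    have hp : 0 < r ^ n by apply: pow_lt; lra.
    have hq : 0 <= Cmod s ^ n by apply: pow_le.
    have hn := HK n.
    apply: (Rmult_le_reg_r (r ^ n)) => //.
    have -> : K * (Cmod s ^ n * / r ^ n) * r ^ n = K * Cmod s ^ n by field; lra.
    nra.
  exists (K / (1 - Cmod s / r)); apply: geom_ex; split.
    by apply: Rdiv_le_0_compat; lra.
  apply: (Rmult_lt_reg_r r); first lra.
  have -> : Cmod s / r * r = Cmod s by field; lra.
  rewrite /r; lra.
exact: Cseries_Ctsum hl.
Qed.

Lemma psrep_ext_b b b' phi : psrep b phi -> (forall n, b n = b' n) -> psrep b' phi.
Proof. by move=> h e s hs; apply: Cseries_ext (h s hs) => n; rewrite e. Qed.

Lemma psrep_shift b phi : psrep b phi ->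
  exists chi, psrep (fun n => b (S n)) chi /\
    forall s, Cmod s < 1 -> phi s = (phi 0 + s * chi s)%C.
Proof.
move=> h; exists (psum (fun n => b (S n))).
have hr : psrep (fun n => b (S n)) (psum (fun n => b (S n))).
  apply: psrep_psum => r hr.
  pose r' := (1 + r) / 2; have hr' : 0 < r' < 1 by rewrite /r'; lra.
  have [|K [q [hK [hq HK]]]] := psrep_bound b phi r' h; first lra.
  exists (K / r') => n.
  have hp : r ^ n <= r' ^ n by apply: pow_incr; rewrite /r'; lra.
  have hn := HK (S n); have hc := Cmod_ge_0 (b (S n)).
  have hq1 : q ^ S n <= 1 by rewrite -(pow1 (S n)); apply: pow_incr; lra.
  apply: (Rmult_le_reg_r r'); first lra.
  have -> : K / r' * r' = K by field; lra.
  have : Cmod (b (S n)) * r' ^ S n <= K by nra.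
  rewrite /= => hx.
  have hy : Cmod (b (S n)) * r ^ n <= Cmod (b (S n)) * r' ^ n by apply: Rmult_le_compat_l.
  have : Cmod (b (S n)) * r ^ n * r' <= Cmod (b (S n)) * r' ^ n * r' by apply: Rmult_le_compat_r; lra.
  lra.
split=> // s hs.
apply: Cseries_unique (h s hs) _.
have h1 := Cseries_scal s _ _ (hr s hs).
rewrite (psrep_at0 _ _ h).
have h2 : Cseries (fun n => match n with O => b 0%nat | S n => s * (b (S n) * s ^ n) end)%C
   (b 0%nat + s * psum (fun n => b (S n)) s)%C.
  apply: is_series_decr_1.
  have -> : (plus (b 0%nat + s * psum (fun n : nat => b (S n)) s) (opp (b 0%nat)) =
     s * psum (fun n : nat => b (S n)) s)%C by rewrite /plus /opp /=; ring.
  exact: h1.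
apply: Cseries_ext h2 => n; case: n => [|n] /=; ring.
Qed.

Lemma hol_shift phi : hol phi ->
  exists chi, hol chi /\ forall s, Cmod s < 1 -> phi s = (phi 0 + s * chi s)%C.
Proof. by move=> [b h]; have [chi [h1 h2]] := psrep_shift _ _ h; exists chi; split=> //; eexists; exact: h1. Qed.

Lemma hol_lip0 phi : hol phi ->
  exists K, 0 < K /\ forall s, Cmod s <= / 2 -> Cmod (phi s - phi 0)%C <= K * Cmod s.
Proof.
move=> /hol_shift [chi [h e]].
have [|K [hK HK]] := hol_bounded chi (/ 2) h; first lra.
exists (K + 1); split; first lra.
move=> s hs; rewrite e; last lra.
have -> : (phi 0 + s * chi s - phi 0 = s * chi s)%C by ring.
rewrite Cmod_mult; have := HK s hs; have := Cmod_ge_0 s; nra.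
Qed.

(** Continuity at 0 along the positive axis. Points of the half plane only reach the punctured disc;
    this lemma carries identities to its centre. *)
Lemma hol_limit0 (phi : C -> C) (c : C) d : hol phi -> 0 < d ->
  (forall x, 0 < x < d -> phi (RtoC x) = c) -> phi 0 = c.
Proof.
move=> /hol_lip0 [K [hK HK]] hd h.
have e : (c - phi 0 = 0)%C.
  apply: Cmod_eq_0; apply: Rle_antisym; last exact: Cmod_ge_0.
  apply: Rnot_lt_le => hlt.
  pose x := Rmin (/ 2) (Rmin (d / 2) (Cmod (c - phi 0) / (2 * K))).
  have hx : 0 < x.
    rewrite /x; do ! (apply: Rmin_glb_lt); try lra; apply: Rdiv_lt_0_compat; lra.
  have hx1 : x <= / 2 by exact: Rmin_l.
  have hx2 : x <= d / 2 by apply: Rle_trans (Rmin_r _ _) (Rmin_l _ _).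
  have hx3 : x <= Cmod (c - phi 0) / (2 * K) by apply: Rle_trans (Rmin_r _ _) (Rmin_r _ _).
  have := HK x; rewrite Cmod_R Rabs_pos_eq; last lra.
  move=> /(_ hx1); rewrite h; last lra.
  have : x * (2 * K) <= Cmod (c - phi 0).
    have -> : Cmod (c - phi 0) = Cmod (c - phi 0) / (2 * K) * (2 * K) by field; lra.
    apply: Rmult_le_compat_r; lra.
  lra.
have -> : c = (c - phi 0 + phi 0)%C by ring.
rewrite e; ring.
Qed.

Lemma Cmult_eq_0_r (x y : C) : x <> 0 -> (x * y = 0)%C -> y = 0.
Proof.
move=> hx e; have -> : y = (/ x * (x * y))%C by field.
rewrite e; ring.
Qed.

(** Induction on the coefficient: vanishing on [(0, d)] forces vanishing at 0, and dividing by the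
    variable shifts the series by one place. *)
Lemma psrep_zero b phi d : psrep b phi -> 0 < d ->
  (forall x, 0 < x < d -> phi (RtoC x) = 0) -> forall n, b n = 0.
Proof.
move=> h hd h0 n; elim: n b phi d hd h h0 => [|n IH] b phi d hd h h0.
  rewrite -(psrep_at0 _ _ h); apply: hol_limit0 hd h0; by exists b.
have e0 : phi 0 = 0 by apply: hol_limit0 hd h0; by exists b.
have [chi [h1 h2]] := psrep_shift _ _ h.
apply: (IH (fun n => b (S n)) chi (Rmin d 1)) => //; first by apply: Rmin_glb_lt; lra.
move=> x [hx0 hx].
have hx1 := Rlt_le_trans _ _ _ hx (Rmin_l _ _); have hx2 := Rlt_le_trans _ _ _ hx (Rmin_r _ _).
have := h2 x; rewrite Cmod_R Rabs_pos_eq; last lra.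
move=> /(_ hx2); rewrite h0 // e0 Cplus_0_l => e.
apply: (Cmult_eq_0_r x) => //; move=> [] hh; lra.
Qed.

Lemma psrep_unique b c phi psi d : psrep b phi -> psrep c psi -> 0 < d ->
  (forall x, 0 < x < d -> phi (RtoC x) = psi (RtoC x)) -> forall n, b n = c n.
Proof.
move=> hb hc hd h n.
have hm : psrep (fun n => b n - c n)%C (fun s => phi s - psi s)%C.
  move=> s hs; apply: Cseries_ext (Cseries_minus _ _ _ _ (hb s hs) (hc s hs)) => k; ring.
have e : (b n - c n = 0)%C.
  apply: (psrep_zero (fun n => b n - c n)%C _ d hm) => // x hx; rewrite h //; ring.
have -> : b n = (b n - c n + c n)%C by ring.
rewrite e; ring.
Qed.

(** The coefficients after the substitution s -> s^k. *)
Definition spread (k : nat) (b : nat -> C) (n : nat) : C :=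
  if Nat.eqb (n mod k) 0 then b (n / k)%nat else RtoC 0.

Lemma spread_mult k b n : (0 < k)%nat -> spread k b (k * n) = b n.
Proof.
move=> hk; rewrite /spread Nat.mul_comm Nat.Div0.mod_mul Nat.div_mul //; lia.
Qed.

Lemma spread_0 k b n : (n mod k <> 0)%nat -> spread k b n = 0.
Proof. by move=> h; rewrite /spread; case: Nat.eqb_spec. Qed.

Lemma Csum_spread k b n : (0 < k)%nat -> Csum (spread k b) n = Csum b (n / k).
Proof.
move=> hk; elim: n => [|n IH].
  by rewrite !Csum_0 Nat.Div0.div_0_l Csum_0 -[in LHS](Nat.mul_0_r k) spread_mult.
rewrite Csum_S IH.
have hm := Nat.div_mod (S n) k ltac:(lia); have hlt := Nat.mod_upper_bound (S n) k ltac:(lia).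
case: (Nat.eq_dec (S n mod k) 0) => h0.
  have hd : (S n / k = S (n / k))%nat.
    symmetry; rewrite h0 Nat.add_0_r in hm.
    have hpos : (0 < S n / k)%nat by case: (S n / k)%nat hm => [|m]; lia.
    suff : (n / k = S n / k - 1)%nat by lia.
    symmetry; apply: (Nat.div_unique _ _ _ (k - 1)); first lia.
    rewrite Nat.mul_sub_distr_l; have : (k * 1 <= k * (S n / k))%nat by apply: Nat.mul_le_mono_l.
    lia.
  have e : S n = (k * S (n / k))%nat by rewrite -hd; lia.
  rewrite hd Csum_S [in LHS]e spread_mult //.
have hd : (S n / k = n / k)%nat.
  apply: (Nat.div_unique _ _ _ (S n mod k - 1)); first lia. lia.
rewrite hd spread_0 //; ring.
Qed.

Lemma psrep_comp_pow k b phi : (0 < k)%nat -> psrep b phi ->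
  psrep (spread k b) (fun s => phi (s ^ k)%C).
Proof.
move=> hk h s hs.
have hs' : Cmod (s ^ k)%C < 1.
  rewrite Cmod_pow; case: k hk => [|k] hk; first lia.
  have h1 : Cmod s ^ k <= 1 by rewrite -(pow1 k); apply: pow_incr; split; [exact: Cmod_ge_0|lra].
  have := Cmod_ge_0 s; have : 0 <= Cmod s ^ k by apply: pow_le; exact: Cmod_ge_0.
  rewrite /=; nra.
have hk' := h _ hs'.
apply: (Cseries_ext (spread k (fun n => b n * (s ^ k) ^ n)%C)).
  move=> n; rewrite /spread; case: Nat.eqb_spec => [h0|_]; last ring.
  congr Cmult; rewrite -Cpow_mult_r; congr Cpow.
  have := Nat.div_mod n k ltac:(lia); rewrite h0; lia.
apply/(@filterlim_locally _ _ _ _) => eps.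
move/(@filterlim_locally _ _ _ _): hk' => /(_ eps) [N HN].
exists (k * N)%nat => n hn.
change (ball (phi (s ^ k)%C) eps (Csum (spread k (fun n => b n * (s ^ k) ^ n)%C) n)).
rewrite Csum_spread //; apply: HN.
apply: Nat.div_le_lower_bound; lia.
Qed.

Lemma hol_comp_pow k phi : (0 < k)%nat -> hol phi -> hol (fun s => phi (s ^ k)%C).
Proof. by move=> hk [b h]; exists (spread k b); exact: psrep_comp_pow. Qed.

(** * Discrete mean values and the maximum principle *)

Lemma Csum_ext a b n : (forall k, (k <= n)%nat -> a k = b k) -> Csum a n = Csum b n.
Proof. by move=> h; apply: sum_n_ext_loc. Qed.
Lemma Csum_plus a b n : Csum (fun k => a k + b k)%C n = (Csum a n + Csum b n)%C.
Proof. elim: n => [|n IH]; rewrite ?Csum_0 ?Csum_S ?IH //; ring. Qed.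
Lemma Csum_scal c a n : Csum (fun k => c * a k)%C n = (c * Csum a n)%C.
Proof. elim: n => [|n IH]; rewrite ?Csum_0 ?Csum_S ?IH //; ring. Qed.
Lemma Csum_const c n : Csum (fun _ => c) n = (INR (S n) * c)%C.
Proof.
elim: n => [|n IH]; rewrite ?Csum_0 ?Csum_S ?IH; first by rewrite /= Cmult_1_l.
rewrite (S_INR (S n)) RtoC_plus; ring.
Qed.

(** Roots of unity of order m + 1, so that averaging over [j <= m] kills the frequencies 1 to m.
    These averages replace the integral in the mean value property. *)
Definition root (m j k : nat) : C := ee (RtoC (INR j * INR k / INR (S m))).

Lemma INR_S_pos m : 0 < INR (S m).
Proof. by apply: lt_0_INR; lia. Qed.

Lemma root_Sk m j k : root m j (S k) = (root m j 1 * root m j k)%C.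
Proof.
rewrite /root -ee_plus -RtoC_plus; do 2 f_equal.
have := INR_S_pos m; rewrite !S_INR [INR 0]/= => h; field; lra.
Qed.

Lemma ee_R_neq1 x : 0 < x < 1 -> ee (RtoC x) <> 1.
Proof.
move=> hx; rewrite ee_R => [[h _]].
have hpi := PI_RGT_0.
have e : cos (2 * (PI * x)) = 1 - 2 * sin (PI * x) * sin (PI * x) by exact: cos_2a_sin.
have hs : 0 < sin (PI * x) by apply: sin_gt_0; nra.
rewrite Rmult_assoc in h; nra.
Qed.

Lemma root_sum m k : (1 <= k <= m)%nat -> Csum (fun j => root m j k) m = 0.
Proof.
move=> hk; pose w := ee (RtoC (INR k / INR (S m))).
have hp := INR_S_pos m.
have hw j : root m j k = (w ^ j)%C.
  rewrite -ee_pow /root -RtoC_mult; do 2 f_equal; field; lra.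
have hg n : ((w - 1) * Csum (fun j => w ^ j) n = w ^ S n - 1)%C.
  elim: n => [|n IH]; first by rewrite Csum_0 /=; ring.
  rewrite Csum_S Cmult_plus_distr_l IH !Cpow_S; ring.
have h1 : (w - 1)%C <> 0.
  move=> e; have : w <> 1.
    apply: ee_R_neq1; split.
      apply: Rdiv_lt_0_compat => //; apply: lt_0_INR; lia.
    apply: (Rmult_lt_reg_r (INR (S m))) => //.
    have -> : INR k / INR (S m) * INR (S m) = INR k by field; lra.
    rewrite Rmult_1_l; apply: lt_INR; lia.
  apply; have -> : w = (w - 1 + 1)%C by ring.
  rewrite e; ring.
apply: (Cmult_eq_0_r (w - 1)%C) => //.
rewrite (Csum_ext _ (fun j => w ^ j)%C) // hg -ee_pow -RtoC_mult.
have -> : INR (S m) * (INR k / INR (S m)) = INR k by field; lra.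
rewrite ee_nat; ring.
Qed.

Lemma root_0 m j : root m j 0 = 1.
Proof. by rewrite /root /= Rmult_0_r /Rdiv Rmult_0_l ee_0. Qed.

(** The factor [root m j k] is there for the induction: each factor [s + r * root] raises the
    frequency k by at most one, and [n + k <= m] keeps all frequencies below m + 1. *)
Lemma mean_pow m s r n : forall k, (n + k <= m)%nat ->
  Csum (fun j => (s + r * root m j 1) ^ n * root m j k)%C m =
  match k with O => (INR (S m) * s ^ n)%C | _ => 0 end.
Proof.
elim: n => [|n IH] k hk.
  rewrite (Csum_ext _ (fun j => root m j k)); last by move=> j _; rewrite /=; ring.
  case: k hk => [|k] hk; last by apply: root_sum; lia.
  rewrite (Csum_ext _ (fun _ => 1)); last by move=> j _; exact: root_0.
  by rewrite Csum_const.
rewrite (Csum_ext _ (fun j => s * ((s + r * root m j 1) ^ n * root m j k) +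
   r * ((s + r * root m j 1) ^ n * root m j (S k)))%C); last first.
  by move=> j _; rewrite (root_Sk m j k) Cpow_S; ring.
rewrite Csum_plus !Csum_scal (IH (S k)) ?IH; try lia.
case: k hk => [|k] hk; cbv beta iota; rewrite ?Cpow_S; ring.
Qed.

Lemma Csum_switch (f : nat -> nat -> C) m n :
  Csum (fun j => Csum (f j) n) m = Csum (fun k => Csum (fun j => f j k) m) n.
Proof.
elim: m => [|m IH]; first by rewrite Csum_0; apply: Csum_ext => k _; rewrite Csum_0.
rewrite Csum_S IH -Csum_plus; apply: Csum_ext => k _; by rewrite Csum_S.
Qed.

Lemma mean_poly b m s r :
  Csum (fun j => Csum (fun n => b n * (s + r * root m j 1) ^ n)%C m) m =
  (INR (S m) * Csum (fun n => b n * s ^ n)%C m)%C.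
Proof.
rewrite Csum_switch -Csum_scal; apply: Csum_ext => n hn.
rewrite (Csum_ext _ (fun j => b n * ((s + r * root m j 1) ^ n * root m j 0))%C); last first.
  by move=> j _; rewrite root_0; ring.
rewrite Csum_scal mean_pow; last lia. ring.
Qed.

Lemma pser_tail b phi r K q m : psrep b phi -> 0 <= r < 1 -> 0 <= q < 1 ->
  (forall n, Cmod (b n) * r ^ n <= K * q ^ n) ->
  forall s, Cmod s <= r ->
  Cmod (phi s - Csum (fun n => b n * s ^ n)%C m) <= K * q ^ S m / (1 - q).
Proof.
move=> h hr hq hb s hs.
have h1 : Cseries (fun k => b (S m + k)%nat * s ^ (S m + k))%C
   (phi s - Csum (fun n => b n * s ^ n)%C m)%C.
  apply: (is_series_incr_n (V := C_NormedModule) (fun n => b n * s ^ n)%C (S m)); first lia.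
  have e : phi s = (phi s - Csum (fun n => b n * s ^ n) m + Csum (fun n => b n * s ^ n) m)%C by ring.
  have hp := h s ltac:(lra); rewrite /pser e in hp; exact: hp.
apply: (Cseries_norm _ _ (fun k => K * q ^ S m * q ^ k) _ h1).
  move=> n; apply: Rle_trans (Cmod_pser_term _ _ _ _ hs) _.
  apply: Rle_trans (hb _) _; rewrite pow_add; lra.
exact: geom_ex.
Qed.

(** With [t = sqrt q], n t^n is at most the geometric sum 1 + t + ... + t^(n-1), hence bounded, and
    the remaining factor t^n is small. *)
Lemma npow_small q e : 0 <= q < 1 -> 0 < e ->
  exists m, INR (S m) * q ^ S m <= e.
Proof.
move=> hq he; pose t := sqrt q.
have ht : 0 <= t < 1.
  split; first exact: sqrt_pos.
  rewrite -sqrt_1; apply: sqrt_lt_1; lra.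
have htq : t * t = q by apply: sqrt_sqrt; lra.
have hb n : INR n * t ^ n <= (1 - t ^ n) / (1 - t).
  elim: n => [|n IH]; first by rewrite /= Rmult_0_l Rminus_diag /Rdiv Rmult_0_l; lra.
  have hp : 0 <= t ^ n by apply: pow_le; lra.
  have hI := pos_INR n.
  apply: (Rmult_le_reg_r (1 - t)); first lra.
  have -> : (1 - t ^ S n) / (1 - t) * (1 - t) = 1 - t ^ S n by field; lra.
  have : INR n * t ^ n * (1 - t) <= 1 - t ^ n.
    have -> : 1 - t ^ n = (1 - t ^ n) / (1 - t) * (1 - t) by field; lra.
    apply: Rmult_le_compat_r; lra.
  rewrite S_INR /=; move=> hh.
  have : t * (INR n * t ^ n * (1 - t)) <= t * (1 - t ^ n) by apply: Rmult_le_compat_l; lra.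
  have hp1 : t * t ^ n <= 1 by (have hq1 : t ^ n <= 1 by rewrite -(pow1 n); apply: pow_incr; lra); nra.
  have : t * t ^ n * (1 - t) <= 1 * (1 - t) by apply: Rmult_le_compat_r; lra.
  nra.
have [N HN] := pow_lt_1_zero t ltac:(rewrite Rabs_pos_eq; lra) (e * (1 - t)) ltac:(nra).
exists N; have h1 := hb (S N).
have h2 := HN (S N) ltac:(lia).
have hp : 0 <= t ^ S N by apply: pow_le; lra.
rewrite Rabs_pos_eq // in h2.
have h3 : INR (S N) * t ^ S N * (1 - t) <= 1.
  have h4 : (1 - t ^ S N) / (1 - t) * (1 - t) = 1 - t ^ S N by field; lra.
  have := Rmult_le_compat_r (1 - t) _ _ ltac:(lra) h1; lra.
rewrite -htq Rpow_mult_distr.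
apply: (Rmult_le_reg_r (1 - t)); first lra.
have -> : INR (S N) * (t ^ S N * t ^ S N) * (1 - t) = INR (S N) * t ^ S N * (1 - t) * t ^ S N by ring.
nra.
Qed.

Definition Csqdist (x y : C) : Cmod (x - y) * Cmod (x - y) =
  Cmod x * Cmod x - 2 * Re (x * Cconj y) + Cmod y * Cmod y.
Proof. rewrite !Cmod_sqr /Cminus !Creim /Cconj /Re /Im /=; ring. Qed.

Lemma sum_n_ge_first (c : nat -> R) n : (forall k, 0 <= c k) -> c 0%nat <= sum_n c n.
Proof.
move=> h; elim: n => [|n IH]; first by rewrite sum_O; lra.
rewrite sum_Sn /plus /=; have := h (S n); lra.
Qed.

(** A quantitative maximum principle, since the supremum M need not be attained. By the mean value
    property over a circle around s through p, the sum of the |phi(u_j) - phi(s)|^2 is at most N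
    (M^2 - |phi(s)|^2) plus an error; the point p is one of the u_j. *)
Lemma max_step b phi M r : psrep b phi -> (forall s, Cmod s < 1 -> Cmod (phi s) <= M) ->
  0 <= r < 1 -> forall e, 0 < e -> exists eta, 0 < eta /\
  forall s p, Cmod s <= r -> Cmod (p - s) <= (1 - r) / 2 -> M - eta <= Cmod (phi s) ->
    Cmod (phi p - phi s) <= e.
Proof.
move=> h hM hr e he.
(* The disc of radius [r'] contains all circles of radius at most (1 - r) / 2 around points of
   modulus at most r. *)
pose r' := (1 + r) / 2; have hr' : 0 <= r' < 1 by rewrite /r'; lra.
have [K [q [hK [hq hb]]]] := psrep_bound b phi r' h hr'.
have hM0 : 0 <= M by apply: Rle_trans (Cmod_ge_0 _) (hM 0 _); rewrite Cmod_0; lra.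
have hpos : 0 < 8 * (M + 1) * (K + 1) / (1 - q) by apply: Rdiv_lt_0_compat; nra.
(* Truncating at degree m costs about N q^N over the N = m + 1 points, so m is fixed first. Only
   then is eta chosen, because the defect M^2 - |phi(s)|^2 is multiplied by N. *)
have [m hm] := npow_small q (e * e / (8 * (M + 1) * (K + 1) / (1 - q))) hq
  ltac:(apply: Rdiv_lt_0_compat; nra).
have hN := INR_S_pos m; set N := INR (S m) in hm hN.
exists (e * e / (4 * N * (M + 1))); split; first by apply: Rdiv_lt_0_compat; nra.
set eta := e * e / _.
move=> s p hs hp hsM.
have heta : 4 * N * (M + 1) * eta = e * e by rewrite /eta; field; nra.
have htail := pser_tail b phi r' K q m h hr' hq hb.
set T := K * q ^ S m / (1 - q) in htail.
have hT : 0 <= T by apply: Rle_trans (Cmod_ge_0 _) (htail 0 _); rewrite Cmod_0; lra.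
pose u j := (s + (p - s) * root m j 1)%C.
have hu j : Cmod (u j) <= r'.
  apply: Rle_trans (Cmod_triangle _ _) _; rewrite Cmod_mult.
  have -> : Cmod (root m j 1) = 1.
    by rewrite /root Cmod_ee im_RtoC Rmult_0_r Ropp_0 exp_0.
  rewrite /r'; lra.
have hsr : Cmod s <= r' by rewrite /r'; lra.
pose err := (Csum (fun j => phi (u j)) m - N * phi s)%C.
have herr : Cmod err <= 2 * N * T.
  have -> : err = (Csum (fun j => phi (u j) - Csum (fun n => b n * u j ^ n) m) m
     - N * (phi s - Csum (fun n => b n * s ^ n) m))%C.
    rewrite /err (Csum_ext (fun j => phi (u j) - _)%C (fun j => phi (u j) +
       (- (1)) * Csum (fun n => b n * u j ^ n) m)%C); last by move=> j _; ring.
    rewrite Csum_plus Csum_scal /u mean_poly -/N; ring.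
  apply: Rle_trans (Cmod_triangle _ _) _; rewrite Cmod_opp Cmod_mult Cmod_R Rabs_pos_eq; last lra.
  have h1 := htail s hsr.
  have h2 : Cmod (Csum (fun j => phi (u j) - Csum (fun n => b n * u j ^ n) m)%C m) <= N * T.
    apply: Rle_trans (Csum_norm _ (fun _ => T) m _) _; first by move=> k; exact: htail.
    rewrite sum_n_const -/N; lra.
  nra.
(* In the expanded squares the cross terms add up to the mean of phi, which is N phi(s) up to
   [err]. *)
have hsum : sum_n (fun j => Cmod (phi (u j) - phi s) * Cmod (phi (u j) - phi s)) m
   <= N * (M * M) - 2 * Re ((N * phi s + err) * Cconj (phi s)) + N * (Cmod (phi s) * Cmod (phi s)).
  have -> : (N * phi s + err = Csum (fun j => phi (u j)) m)%C by rewrite /err; ring.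
  have h1 n : sum_n (fun j => Cmod (phi (u j) - phi s) * Cmod (phi (u j) - phi s)) n <=
     INR (S n) * (M * M) - 2 * Re (Csum (fun j => phi (u j)) n * Cconj (phi s))
      + INR (S n) * (Cmod (phi s) * Cmod (phi s)).
    have hj j : Cmod (phi (u j)) * Cmod (phi (u j)) <= M * M.
      have : Cmod (phi (u j)) <= M by apply: hM; have := hu j; lra.
      have := Cmod_ge_0 (phi (u j)); nra.
    elim: n => [|n IH].
      rewrite sum_O Csum_0 Csqdist; have := hj 0%nat; rewrite /=; lra.
    rewrite sum_Sn Csum_S Cmult_plus_distr_r Re_plus (S_INR (S n)).
    have -> : forall x y : R, plus x y = x + y by [].
    have := hj (S n); rewrite (Csqdist (phi (u (S n))) (phi s)); lra.
  exact: h1.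
have h0 : Cmod (phi p - phi s) * Cmod (phi p - phi s) <=
  sum_n (fun j => Cmod (phi (u j) - phi s) * Cmod (phi (u j) - phi s)) m.
  have -> : p = u 0%nat.
    rewrite /u /root /= Rmult_0_l /Rdiv Rmult_0_l ee_0; ring.
  apply: (sum_n_ge_first (fun j => Cmod (phi (u j) - phi s) * Cmod (phi (u j) - phi s))).
  move=> k; have := Cmod_ge_0 (phi (u k) - phi s); nra.
have hre : Re (err * Cconj (phi s)) >= - (2 * N * T * M).
  have h1 : Rabs (Re (err * Cconj (phi s))) <= 2 * N * T * M.
    apply: Rle_trans (re_le_Cmod _) _; rewrite Cmod_mult Cmod_conj.
    apply: Rmult_le_compat => //; try exact: Cmod_ge_0. apply: hM; lra.
  have := Rle_abs (- Re (err * Cconj (phi s))); rewrite Rabs_Ropp; lra.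
have hre2 : Re ((N * phi s + err) * Cconj (phi s)) =
   N * (Cmod (phi s) * Cmod (phi s)) + Re (err * Cconj (phi s)).
  rewrite Cmod_sqr !Creim /Cconj /Re /Im /=; ring.
have hNT : 4 * N * T * M <= e * e / 2.
  rewrite /T.
  have h8 : N * q ^ S m * (8 * (M + 1) * (K + 1)) <= e * e * (1 - q).
    have -> : e * e * (1 - q) = e * e / (8 * (M + 1) * (K + 1) / (1 - q)) * (8 * (M + 1) * (K + 1)).
      field; repeat split; nra.
    apply: Rmult_le_compat_r => //; have : 0 <= (M + 1) * (K + 1) by nra.
    lra.
  have hqp : 0 <= q ^ S m by apply: pow_le; lra.
  apply: (Rmult_le_reg_r (1 - q)); first lra.
  have -> : 4 * N * (K * q ^ S m / (1 - q)) * M * (1 - q) = 4 * (N * q ^ S m) * (K * M) by field; lra.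
  have : K * M <= (M + 1) * (K + 1) by nra.
  have : 0 <= N * q ^ S m by nra.
  nra.
have hfin : N * (M * M) - N * (Cmod (phi s) * Cmod (phi s)) <= e * e / 2.
  have h1 : Cmod (phi s) <= M by apply: hM; lra.
  have h2 := Cmod_ge_0 (phi s).
  have h3 : M * M - Cmod (phi s) * Cmod (phi s) <= 2 * M * eta by nra.
  have : N * (M * M - Cmod (phi s) * Cmod (phi s)) <= N * (2 * M * eta) by apply: Rmult_le_compat_l; lra.
  have : 0 < eta by rewrite /eta; apply: Rdiv_lt_0_compat; nra.
  nra.
rewrite hre2 in hsum.
have hd := Cmod_ge_0 (phi p - phi s).
apply: Rnot_lt_le => hlt; nra.
Qed.

(** A walk from s to 0 along the radius in steps of length (1 - r) / 2. Each step preserves being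
    nearly maximal, with a worse tolerance, and k bounds the number of steps. *)
Lemma max_chain b phi M r : psrep b phi -> (forall s, Cmod s < 1 -> Cmod (phi s) <= M) ->
  0 <= r < 1 -> forall k e, 0 < e -> exists eta, 0 < eta /\
  forall s, Cmod s <= r -> Cmod s <= INR k * ((1 - r) / 2) -> M - eta <= Cmod (phi s) ->
    Cmod (phi 0 - phi s) <= e.
Proof.
move=> h hM hr; elim=> [|k IH] e he.
  exists 1; split; first lra. move=> s hs; rewrite /= Rmult_0_l => hs0 _.
  have -> : s = 0 by apply: Cmod_eq_0; apply: Rle_antisym => //; exact: Cmod_ge_0.
  have -> : (phi 0 - phi 0 = 0)%C by ring.
  rewrite Cmod_0; lra.
have [e1 [he1 H1]] := IH (e / 2) ltac:(lra).
have hm : 0 < Rmin (e / 2) (e1 / 2) by apply: Rmin_glb_lt; lra.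
have [e2 [he2 H2]] := max_step b phi M r h hM hr _ hm.
have a1 := Rmin_l (e / 2) (e1 / 2); have a2 := Rmin_r (e / 2) (e1 / 2).
exists (Rmin e2 (e1 / 2)); split; first by apply: Rmin_glb_lt; lra.
have b1 := Rmin_l e2 (e1 / 2); have b2 := Rmin_r e2 (e1 / 2).
move=> s hs hsk hsM.
pose d := (1 - r) / 2; have hd : 0 < d by rewrite /d; lra.
case: (Rle_lt_dec (Cmod s) d) => hsd.
  have := H2 s 0 hs; have -> : Cmod (0 - s) = Cmod s by rewrite Cmod_minus_sym; congr Cmod; ring.
  move=> /(_ hsd ltac:(lra)); lra.
pose p := ((1 - d / Cmod s)%R * s)%C.
have hp1 : Cmod p = Cmod s - d.
  rewrite /p Cmod_mult Cmod_R Rabs_pos_eq; first by field; lra.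
  have : d / Cmod s <= 1 by apply: (Rmult_le_reg_r (Cmod s)); [lra|]; rewrite /Rdiv Rmult_assoc Rinv_l; lra.
  lra.
have hp2 : Cmod (p - s) = d.
  have -> : (p - s = (- (d / Cmod s))%R * s)%C by rewrite /p RtoC_minus RtoC_opp; ring.
  rewrite Cmod_mult Cmod_R Rabs_Ropp Rabs_pos_eq; first by field; lra.
  apply: Rdiv_le_0_compat; lra.
have h3 := H2 s p hs ltac:(rewrite hp2 /d; lra) ltac:(lra).
have h4 : M - e1 <= Cmod (phi p).
  have := Cmod_le_add (phi s) (phi p); rewrite Cmod_minus_sym; lra.
have h5 := H1 p ltac:(lra) ltac:(rewrite hp1; move: hsk; rewrite S_INR -/d; lra) h4.
have := Cmod_minus_triangle (phi 0) (phi p) (phi s); lra.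
Qed.

Lemma Cmod_small_eq (x y : C) : (forall e, 0 < e -> Cmod (x - y) <= e) -> x = y.
Proof.
move=> h; have e : (x - y = 0)%C.
  apply: Cmod_eq_0; apply: Rle_antisym; last exact: Cmod_ge_0.
  apply: Rnot_lt_le => hlt; have := h (Cmod (x - y) / 2) ltac:(lra); lra.
have -> : x = (x - y + y)%C by ring.
rewrite e; ring.
Qed.

(** The walk to the centre shows |phi(0)| >= M. Then [max_step] at s = 0 applies with every
    tolerance, so phi is constant for |s| <= 1/2, and the identity theorem extends this to the
    disc. *)
Lemma hol_max phi M r : hol phi -> (forall s, Cmod s < 1 -> Cmod (phi s) <= M) ->
  0 <= r < 1 -> (forall eta, 0 < eta -> exists s, Cmod s <= r /\ M - eta <= Cmod (phi s)) ->
  forall s, Cmod s < 1 -> phi s = phi 0.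
Proof.
move=> [b h] hM hr hsup.
have h0 : M <= Cmod (phi 0).
  apply: Rnot_lt_le => hlt; pose e := (M - Cmod (phi 0)) / 3.
  have he : 0 < e by rewrite /e; lra.
  have he3 : 3 * e = M - Cmod (phi 0) by rewrite /e; field.
  have hd : 0 < (1 - r) / 2 by lra.
  have [k hk] := INR_archimed ((1 - r) / 2) r ltac:(lra).
  have [eta [heta H]] := max_chain b phi M r h hM hr k e he.
  have hmin : 0 < Rmin eta e by apply: Rmin_glb_lt.
  have [s [hs hsM]] := hsup _ hmin.
  have a1 := Rmin_l eta e; have a2 := Rmin_r eta e.
  have h1 := H s hs ltac:(lra) ltac:(lra).
  have := Cmod_le_add (phi s) (phi 0); rewrite (Cmod_minus_sym (phi s)); lra.
have hc p : Cmod p <= / 2 -> phi p = phi 0.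
  move=> hp; apply: Cmod_small_eq => e he.
  have [eta [heta H]] := max_step b phi M 0 h hM ltac:(lra) e he.
  apply: H; rewrite ?Cmod_0; try lra.
  have -> : (p - 0 = p)%C by ring. lra.
have hb := psrep_unique b (fun n => match n with O => phi 0 | _ => 0 end) phi (fun _ => phi 0) (/ 2) h.
have hcst : psrep (fun n => match n with O => phi 0 | _ => 0 end) (fun _ => phi 0).
  move=> s hs; have := Cseries_zero_from (fun n => match n with O => phi 0 | _ => 0 end * s ^ n)%C 0.
  rewrite Csum_0 /= Cmult_1_r; apply=> n hn. case: n hn => [|n] hn; first lia. ring.
have hb' := hb hcst ltac:(lra) ltac:(move=> x hx; apply: hc; rewrite Cmod_R Rabs_pos_eq; lra).
move=> s hs; apply: Cseries_unique (h s hs) _.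
apply: Cseries_ext (hcst s hs) => n; by rewrite hb'.
Qed.

Lemma Im_neq0 (z : C) : 0 < Im z -> z <> 0.
Proof. move=> h e; rewrite e /= in h; lra. Qed.

(** * The upper half plane modulo Gamma_0(8) *)

Lemma den_neq0 (c d : Z) (z : C) : (c <> 0 \/ d <> 0)%Z -> 0 < Im z ->
  (RtoC (IZR c) * z + RtoC (IZR d))%C <> 0.
Proof.
move=> h hz e.
have := f_equal Im e; rewrite !Creim => e1.
have := f_equal Re e; rewrite !Creim => e2.
have hc : IZR c = 0 by nra.
have hd : IZR d = 0 by rewrite hc in e2; lra.
case: h; [have := eq_IZR_R0 _ hc|have := eq_IZR_R0 _ hd]; lia.
Qed.

Lemma det_cd (a b c d : Z) : (a * d - b * c = 1)%Z -> (c <> 0 \/ d <> 0)%Z.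
Proof. move=> h; case: (Z.eq_dec c 0) => hc; [right|left]; lia. Qed.

Lemma det_IZR (a b c d : Z) : (a * d - b * c = 1)%Z ->
  IZR a * IZR d - IZR b * IZR c = 1.
Proof. by rewrite -!mult_IZR -minus_IZR => ->. Qed.

Lemma Im_inv (z : C) : z <> 0 -> Im (/ z) = - Im z / (Cmod z * Cmod z).
Proof.
move=> h; have hp := proj1 (Cmod_gt_0 z) h.
rewrite Cmod_sqr /Cinv /Im /Re /=; field.
have := Cmod_sqr z; rewrite /Re /Im; nra.
Qed.

Lemma Re_inv (z : C) : z <> 0 -> Re (/ z) = Re z / (Cmod z * Cmod z).
Proof.
move=> h; have hp := proj1 (Cmod_gt_0 z) h.
rewrite Cmod_sqr /Cinv /Im /Re /=; field.
have := Cmod_sqr z; rewrite /Re /Im; nra.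
Qed.

Lemma moebius_Im (a b c d : Z) (z : C) : (a * d - b * c = 1)%Z -> 0 < Im z ->
  Im (moebius a b c d z) =
  Im z / (Cmod (RtoC (IZR c) * z + RtoC (IZR d)) * Cmod (RtoC (IZR c) * z + RtoC (IZR d))).
Proof.
move=> hdet hz; have hn := den_neq0 c d z (det_cd _ _ _ _ hdet) hz.
have hd := det_IZR _ _ _ _ hdet.
rewrite /moebius /Cdiv Im_mult Im_inv //.
rewrite Re_inv //.
move: hn; set D := (_ + _)%C => hn; have hp := proj1 (Cmod_gt_0 D) hn.
have -> : Im z = (IZR a * IZR d - IZR b * IZR c) * Im z by rewrite hd; ring.
have e1 : Im D = IZR c * Im z by rewrite /D !Creim; ring.
have e2 : Re D = IZR c * Re z + IZR d by rewrite /D !Creim; ring.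
clearbody D; rewrite !Creim e1 e2; field; lra.
Qed.

Lemma moebius_H (a b c d : Z) (z : C) : (a * d - b * c = 1)%Z -> 0 < Im z ->
  0 < Im (moebius a b c d z).
Proof.
move=> hdet hz; have hn := den_neq0 c d z (det_cd _ _ _ _ hdet) hz.
rewrite moebius_Im //; apply: Rdiv_lt_0_compat => //.
have := proj1 (Cmod_gt_0 _) hn; nra.
Qed.

Lemma moebius_comp (a b c d a' b' c' d' : Z) (z : C) :
  (a * d - b * c = 1)%Z -> (a' * d' - b' * c' = 1)%Z -> 0 < Im z ->
  moebius a b c d (moebius a' b' c' d' z) =
  moebius (a * a' + b * c') (a * b' + b * d') (c * a' + d * c') (c * b' + d * d') z.
Proof.
move=> h h' hz.
have hn' := den_neq0 c' d' z (det_cd _ _ _ _ h') hz.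
have hn := den_neq0 c d _ (det_cd _ _ _ _ h) (moebius_H _ _ _ _ _ h' hz).
have hdet : ((a * a' + b * c') * (c * b' + d * d') - (a * b' + b * d') * (c * a' + d * c') = 1)%Z.
  have -> : ((a * a' + b * c') * (c * b' + d * d') - (a * b' + b * d') * (c * a' + d * c') =
   (a * d - b * c) * (a' * d' - b' * c'))%Z by ring.
  by rewrite h h'.
have hn2 := den_neq0 _ _ z (det_cd _ _ _ _ hdet) hz.
move: hn hn2; rewrite /moebius !plus_IZR !mult_IZR !RtoC_plus !RtoC_mult => hn hn2.
field; repeat split=> //.
Qed.

Lemma moebius_id (z : C) : moebius 1 0 0 1 z = z.
Proof. by rewrite /moebius; field. Qed.

Lemma moebius_inv (a b c d : Z) (z : C) : (a * d - b * c = 1)%Z -> 0 < Im z ->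
  moebius d (- b) (- c) a (moebius a b c d z) = z.
Proof.
move=> h hz; rewrite moebius_comp //; last lia.
rewrite -[RHS]moebius_id; f_equal; lia.
Qed.

(** The height 1/2, lower than that of the usual fundamental domain, makes termination explicit: if
    Im z < 1/2, then |z - n|^2 <= 1/2 for the nearest integer n, and inversion at least doubles the
    imaginary part. *)
Lemma reduce (z : C) : 0 < Im z ->
  exists a b c d, (a * d - b * c = 1)%Z /\ 1 / 2 <= Im (moebius a b c d z).
Proof.
move=> hz.
have [k hk] : exists k : nat, 1 / 2 <= Im z * 2 ^ k.
  have [N HN] := Pow_x_infinity 2 ltac:(rewrite Rabs_pos_eq; lra) (1 / 2 / Im z).
  exists N; have := HN N (le_n _); rewrite Rabs_pos_eq; last by apply: pow_le; lra.
  move=> h; have -> : 1 / 2 = Im z * (1 / 2 / Im z) by field; lra.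
  apply: Rmult_le_compat_l; lra.
elim: k z hz hk => [|k IH] z hz hk.
  exists 1%Z, 0%Z, 0%Z, 1%Z; split=> //; rewrite moebius_id; move: hk; rewrite /=; lra.
case: (Rle_lt_dec (1 / 2) (Im z)) => hz2.
  by exists 1%Z, 0%Z, 0%Z, 1%Z; split=> //; rewrite moebius_id.
have [n [hn1 hn2]] : exists n : Z, - (1 / 2) <= Re z - IZR n <= 1 / 2.
  have [h1 h2] := archimed (Re z - 1 / 2); exists (up (Re z - 1 / 2)); lra.
have hdet : (0 * - n - -1 * 1 = 1)%Z by lia.
have him := moebius_Im 0 (-1) 1 (- n) z hdet hz.
have hH := moebius_H 0 (-1) 1 (- n) z hdet hz.
have hn := den_neq0 1 (- n) z ltac:(left; lia) hz.
have hp := proj1 (Cmod_gt_0 _) hn.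
have hlt : 2 * Im z <= Im (moebius 0 (-1) 1 (- n) z).
  rewrite him.
  have hc : Cmod (RtoC (IZR 1) * z + RtoC (IZR (- n))) * Cmod (RtoC (IZR 1) * z + RtoC (IZR (- n))) <= 1 / 2.
    rewrite Cmod_sqr !Creim opp_IZR; nra.
  move: hp hc; set X := Cmod _ => hp hc.
  have e : Im z / (X * X) * (X * X) = Im z by field; lra.
  apply: (Rmult_le_reg_r (X * X)); first nra.
  rewrite e; nra.
have hk' : 1 / 2 <= Im (moebius 0 (-1) 1 (- n) z) * 2 ^ k.
  have h2k : 0 < 2 ^ k by apply: pow_lt; lra.
  apply: Rle_trans hk _; change (2 ^ S k) with (2 * 2 ^ k); rewrite -Rmult_assoc (Rmult_comm (Im z)).
  apply: Rmult_le_compat_r; lra.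
have [a [b [c [d [h1 h2]]]]] := IH _ hH hk'.
rewrite moebius_comp // in h2.
eexists _, _, _, _; split; last exact: h2.
have -> : ((a * 0 + b * 1) * (c * -1 + d * - n) - (a * -1 + b * - n) * (c * 0 + d * 1) =
  (a * d - b * c))%Z by ring.
done.
Qed.

(* Representatives of the cusps oo, 0, 1/2, 1/4 of Gamma_0(8). *)
Inductive cusp := Cinf | C0 | C2 | C4.
(** The Moebius maps are written as c - 1/Z, the form in which f is evaluated near 0, 1/2 and
    1/4. *)
Definition cuspmap (i : cusp) (z : C) : C :=
  match i with
  | Cinf => z
  | C0 => (- (1) / z)%C
  | C2 => (1 / 2 - 1 / (4 * z + 2))%C
  | C4 => (1 / 4 - 1 / (16 * z + 4))%C
  end.

Lemma cuspmap0 z : moebius 0 (-1) 1 0 z = cuspmap C0 z.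
Proof. rewrite /moebius /=; f_equal; ring. Qed.

Lemma four_z_2 (z : C) : 0 < Im z -> (4 * z + 2)%C <> 0.
Proof. by move=> h; apply: Im_neq0; rewrite /Im /= ; rewrite /Im in h; lra. Qed.
Lemma sixteen_z_4 (z : C) : 0 < Im z -> (16 * z + 4)%C <> 0.
Proof. by move=> h; apply: Im_neq0; rewrite /Im /= ; rewrite /Im in h; lra. Qed.

Lemma C2_neq0 : RtoC 2 <> 0.
Proof. move=> [] h; lra. Qed.
Lemma C4_neq0 : RtoC 4 <> 0.
Proof. move=> [] h; lra. Qed.

Lemma cuspmap2 z : 0 < Im z -> moebius 1 0 2 1 z = cuspmap C2 z.
Proof.
move=> h; have h1 := four_z_2 z h; have h2 := den_neq0 2 1 z ltac:(lia) h.
have h3 := C2_neq0.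
rewrite /moebius /=; field; repeat split=> //.
Qed.
Lemma cuspmap4 z : 0 < Im z -> moebius 1 0 4 1 z = cuspmap C4 z.
Proof.
move=> h; have h1 := sixteen_z_4 z h; have h2 := den_neq0 4 1 z ltac:(lia) h.
have h3 := C4_neq0.
rewrite /moebius /=; field; repeat split=> //.
Qed.

Lemma cuspmap_H i z : 0 < Im z -> 0 < Im (cuspmap i z).
Proof.
case: i => h //; [rewrite -cuspmap0|rewrite -cuspmap2 //|rewrite -cuspmap4 //]; exact: moebius_H.
Qed.

Lemma moebius_T (p q r s j : Z) z : 0 < Im z -> (p * s - q * r = 1)%Z ->
  moebius p q r s z = moebius p (q - j * p) r (s - j * r) (z + IZR j)%C.
Proof.
move=> h hd.
rewrite /moebius !minus_IZR !mult_IZR !RtoC_minus !RtoC_mult; f_equal; ring.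
Qed.

(** The double coset Gamma_0(8) sigma_i T^j of a matrix, stated through the induced maps so that
    signs of matrices disappear. *)
Definition in_coset (i : cusp) (p q r s : Z) := exists a b c d j : Z,
  (a * d - b * c = 1)%Z /\ (8 | c)%Z /\
  forall z, 0 < Im z -> moebius p q r s z = moebius a b c d (cuspmap i (z + IZR j)%C).

Lemma Im_plus_Z z j : Im (z + IZR j)%C = Im z.
Proof. rewrite Im_plus im_RtoC; ring. Qed.

Lemma coset_odd p q r s : (p * s - q * r = 1)%Z -> Z.Odd r -> in_coset C0 p q r s.
Proof.
(* An odd r is its own inverse modulo 8, so [s - j * r] is divisible by 8. *)
move=> hd [k hk]; pose j := (s * r)%Z.
exists (- (q - j * p))%Z, p, (- (s - j * r))%Z, r, j; split; [lia|split].
  have [m hm] : exists m, (k * (k + 1) = 2 * m)%Z.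
    case: (Z.Even_or_Odd k) => [[m ->]|[m ->]].
      by exists (m * (2 * m + 1))%Z; ring.
    by exists ((2 * m + 1) * (m + 1))%Z; ring.
  exists (s * m)%Z; rewrite /j hk.
  have -> : (- (s - s * (2 * k + 1) * (2 * k + 1)) = 4 * s * (k * (k + 1)))%Z by ring.
  rewrite hm; ring.
move=> z hz; rewrite -cuspmap0 moebius_comp ?Im_plus_Z //; try lia.
rewrite (moebius_T _ _ _ _ j) //; f_equal; lia.
Qed.

Lemma coset_2 p q r s : (p * s - q * r = 1)%Z -> (exists r1, r = 2 * r1 /\ Z.Odd r1)%Z ->
  in_coset C2 p q r s.
Proof.
move=> hd [r1 [hr [k hk]]].
have [m hm] : exists m, (s = 2 * m + 1)%Z.
  case: (Z.Even_or_Odd s) => [[m hm]|[m hm]]; last by exists m.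
  exfalso; subst; move: hd.
  have -> : (p * (2 * m) - q * (2 * (2 * k + 1)) = 2 * (p * m - q * (2 * k + 1)))%Z by ring.
  lia.
(* With this translation the lower left entry becomes 4 j (r1 - 1) = 8 j k. *)
pose j := (m - k)%Z.
exists (p - 2 * (q - j * p))%Z, (q - j * p)%Z, (r - 2 * (s - j * r))%Z, (s - j * r)%Z, j.
split; [|split].
- have -> : ((p - 2 * (q - j * p)) * (s - j * r) - (q - j * p) * (r - 2 * (s - j * r)) = p * s - q * r)%Z by ring.
  done.
- exists (j * k)%Z; rewrite hr hk hm /j; ring.
- move=> z hz; rewrite -cuspmap2 ?moebius_comp ?Im_plus_Z //; try lia.
  rewrite (moebius_T _ _ _ _ j) //; f_equal; lia.
Qed.

Lemma coset_4 p q r s : (p * s - q * r = 1)%Z -> (exists r1, r = 4 * r1 /\ Z.Odd r1)%Z ->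
  in_coset C4 p q r s.
Proof.
move=> hd [r1 [hr [k hk]]].
have [m hm] : exists m, (s = 2 * m + 1)%Z.
  case: (Z.Even_or_Odd s) => [[m hm]|[m hm]]; last by exists m.
  exfalso; subst; move: hd.
  have -> : (p * (2 * m) - q * (4 * (2 * k + 1)) = 2 * (p * m - 2 * q * (2 * k + 1)))%Z by ring.
  lia.
exists (p - 4 * q)%Z, q, (r - 4 * s)%Z, s, 0%Z.
split; [lia|split].
- exists (k - m)%Z; lia.
- move=> z hz; rewrite Cplus_0_r -cuspmap4 // moebius_comp //; try lia.
  f_equal; lia.
Qed.

Lemma coset_8 p q r s : (p * s - q * r = 1)%Z -> (8 | r)%Z -> in_coset Cinf p q r s.
Proof.
move=> hd h8; exists p, q, r, s, 0%Z; split=> //; split=> // z hz.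
by rewrite /= Cplus_0_r.
Qed.

Lemma coset_any p q r s : (p * s - q * r = 1)%Z -> exists i, in_coset i p q r s.
Proof.
move=> hd.
case: (Z.Even_or_Odd r) => [[r1 h1]|h]; last by exists C0; exact: coset_odd.
case: (Z.Even_or_Odd r1) => [[r2 h2]|h]; last by exists C2; apply: coset_2 => //; exists r1.
case: (Z.Even_or_Odd r2) => [[r3 h3]|h].
  exists Cinf; apply: coset_8 => //; exists r3; lia.
exists C4; apply: coset_4 => //; exists r2; split=> //; lia.
Qed.

Lemma cusp_reduction (z : C) : 0 < Im z -> exists a b c d i w,
  (a * d - b * c = 1)%Z /\ (8 | c)%Z /\ 1 / 2 <= Im w /\ z = moebius a b c d (cuspmap i w).
Proof.
move=> hz; have [a [b [c [d [h1 h2]]]]] := reduce z hz.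
have [|i [a' [b' [c' [d' [j [h3 [h4 h5]]]]]]]] := coset_any d (- b) (- c) a; first lia.
exists a', b', c', d', i, (moebius a b c d z + IZR j)%C; split=> //; split=> //.
rewrite Im_plus_Z; split=> //.
rewrite -h5; last lra.
by rewrite moebius_inv.
Qed.

(** * A Liouville theorem for Gamma_0(8) *)

(** Only the modulus is invariant, which admits functions that transform with a character of values
    1 and -1. *)
Definition Gamma0_8_abs (h : C -> C) := forall a b c d : Z,
  (a * d - b * c = 1)%Z -> (8 | c)%Z -> forall z, 0 < Im z ->
  Cmod (h (moebius a b c d z)) = Cmod (h z).

Lemma exp_le (x y : R) : x <= y -> exp x <= exp y.
Proof. by case=> [h|->]; [exact/Rlt_le/exp_increasing|lra]. Qed.

Lemma ee_64_bound (z : C) : 1 / 2 <= Im z -> Cmod (ee (z / 64)) <= exp (- (PI / 64)).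
Proof.
move=> h; rewrite Cmod_ee; apply: exp_le.
have -> : Im (z / 64) = Im z / 64 by rewrite /Im /=; field.
have := PI_RGT_0; nra.
Qed.

Lemma exp_neg_lt1 x : 0 < x -> 0 <= exp (- x) < 1.
Proof.
move=> h; split; first exact/Rlt_le/exp_pos.
rewrite -exp_0; apply: exp_increasing; lra.
Qed.

Lemma ee_64_surj (s : C) : s <> 0 -> Cmod s < 1 -> exists z, 0 < Im z /\ ee (z / 64) = s.
Proof.
move=> h h1; have [z [hz1 hz2]] := ee_surj s h.
exists (64 * z)%C; split.
  have -> : Im (64 * z) = 64 * Im z by rewrite /Im /=; ring.
  rewrite hz2; have hm := proj1 (Cmod_gt_0 s) h.
  have : ln (Cmod s) < 0 by rewrite -ln_1; apply: ln_increasing.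
  have hpi := PI_RGT_0 => hl.
  have : 0 < - ln (Cmod s) / (2 * PI) by apply: Rdiv_lt_0_compat; lra.
  lra.
rewrite -hz1; congr ee; field; move=> [] hh; lra.
Qed.

Lemma hol_at0_le phi M : hol phi -> (forall s : C, s <> 0 -> Cmod s < 1 -> Cmod (phi s) <= M) ->
  forall s, Cmod s < 1 -> Cmod (phi s) <= M.
Proof.
move=> h hM s hs; case: (classic (s = 0)) => [->|hn]; last exact: hM.
have [K [hK HK]] := hol_lip0 _ h.
apply: Rnot_lt_le => hlt.
pose x := Rmin (/ 2) ((Cmod (phi 0) - M) / (2 * K)).
have hx : 0 < x by apply: Rmin_glb_lt; [lra|apply: Rdiv_lt_0_compat; lra].
have hx1 : x <= / 2 by exact: Rmin_l.
have hx2 : x <= (Cmod (phi 0) - M) / (2 * K) by exact: Rmin_r.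
have hxm : Cmod x = x by rewrite Cmod_R Rabs_pos_eq; lra.
have hxC : RtoC x <> 0 by move=> [] hh; lra.
have := HK x ltac:(lra); have := hM x hxC ltac:(lra).
have := Cmod_le_add (phi 0) (phi x); rewrite (Cmod_minus_sym (phi 0)) hxm.
have := Rmult_le_compat_r (2 * K) _ _ ltac:(lra) hx2.
have -> : (Cmod (phi 0) - M) / (2 * K) * (2 * K) = Cmod (phi 0) - M by field; lra.
lra.
Qed.

(* The supremum of the modulus is attained at a cusp or in the interior. *)
Lemma liouville (h : C -> C) (phi : cusp -> C -> C) : Gamma0_8_abs h ->
  (forall i, hol (phi i)) ->
  (forall i z, 0 < Im z -> h (cuspmap i z) = phi i (ee (z / 64))) ->
  exists i, forall z, 0 < Im z -> h z = phi i 0.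
Proof.
move=> hinv hhol hcusp.
pose r := exp (- (PI / 64)); have hr : 0 <= r < 1.
  apply: exp_neg_lt1; have := PI_RGT_0; lra.
have hred z : 0 < Im z -> exists i w, 1 / 2 <= Im w /\ Cmod (h z) = Cmod (phi i (ee (w / 64))).
  move=> hz; have [a [b [c [d [i [w [h1 [h2 [h3 h4]]]]]]]]] := cusp_reduction z hz.
  exists i, w; split=> //; rewrite {1}h4 hinv //; last by apply: cuspmap_H; lra.
  rewrite hcusp //; lra.
have [K HK] : exists K, forall i s, Cmod s <= r -> Cmod (phi i s) <= K.
  have [K0 [_ H0]] := hol_bounded _ r (hhol C0) hr; have [K1 [_ H1]] := hol_bounded _ r (hhol Cinf) hr.
  have [K2 [_ H2]] := hol_bounded _ r (hhol C2) hr; have [K4 [_ H4]] := hol_bounded _ r (hhol C4) hr.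
  exists (Rmax (Rmax K0 K1) (Rmax K2 K4)) => i s hs.
  have a1 := Rmax_l (Rmax K0 K1) (Rmax K2 K4); have a2 := Rmax_r (Rmax K0 K1) (Rmax K2 K4).
  have a3 := Rmax_l K0 K1; have a4 := Rmax_r K0 K1; have a5 := Rmax_l K2 K4; have a6 := Rmax_r K2 K4.
  case: i; [have := H1 s hs|have := H0 s hs|have := H2 s hs|have := H4 s hs]; lra.
pose S x := exists z, 0 < Im z /\ x = Cmod (h z).
have [M [hM1 hM2]] : { M | is_lub S M }.
  apply: completeness.
    exists K => x [z [hz ->]]; have [i [w [hw ->]]] := hred z hz.
    apply: HK; exact: ee_64_bound.
  have hi : 0 < Im Ci by rewrite /=; lra.
  by exists (Cmod (h Ci)), Ci.
have hle i s : Cmod s < 1 -> Cmod (phi i s) <= M.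
  apply: hol_at0_le => // {}s hs hs1; have [z [hz e]] := ee_64_surj s hs hs1.
  rewrite -e -hcusp //; apply: hM1; exists (cuspmap i z); split=> //; exact: cuspmap_H.
have hsup eta : 0 < eta -> exists i s, Cmod s <= r /\ M - eta <= Cmod (phi i s).
  move=> he; apply: NNPP => hn.
  have : M <= M - eta.
    apply: hM2 => x [z [hz ->]]; apply: Rnot_lt_le => hlt; apply: hn.
    have [i [w [hw e]]] := hred z hz.
    exists i, (ee (w / 64)); split; first exact: ee_64_bound.
    rewrite -e; lra.
  lra.
(* There are four cusps, so one of them alone approaches the supremum for every eta. *)
have [i hi] : exists i, forall eta, 0 < eta -> exists s, Cmod s <= r /\ M - eta <= Cmod (phi i s).
  apply: NNPP => hn.
  have hi i : exists eta, 0 < eta /\ forall s, Cmod s <= r -> Cmod (phi i s) < M - eta.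
    apply: NNPP => hc; apply: hn; exists i => eta he; apply: NNPP => hs; apply: hc.
    exists eta; split=> // s hs'; apply: Rnot_le_lt => hl; apply: hs; by exists s.
  have [e1 [p1 H1]] := hi C0; have [e2 [p2 H2]] := hi Cinf; have [e3 [p3 H3]] := hi C2; have [e4 [p4 H4]] := hi C4.
  pose e := Rmin (Rmin e1 e2) (Rmin e3 e4).
  have hpos : 0 < e by do ! apply: Rmin_glb_lt.
  have a1 := Rmin_l (Rmin e1 e2) (Rmin e3 e4); have a2 := Rmin_r (Rmin e1 e2) (Rmin e3 e4).
  have a3 := Rmin_l e1 e2; have a4 := Rmin_r e1 e2; have a5 := Rmin_l e3 e4; have a6 := Rmin_r e3 e4.
  have [i [s [hs hl]]] := hsup e hpos; rewrite /e in hl.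
  case: i hl; [have := H2 s hs|have := H1 s hs|have := H3 s hs|have := H4 s hs]; lra.
have hconst := hol_max _ M r (hhol i) (hle i) hr hi.
exists i => z hz.
have hcm w : 0 < Im w -> h (cuspmap i w) = phi i 0.
  move=> hw; rewrite hcusp //; apply: hconst; rewrite Cmod_ee.
  have -> : Im (w / 64) = Im w / 64 by rewrite /Im /=; field.
  apply: (proj2 (exp_neg_lt1 _ _)); have := PI_RGT_0; nra.
(* Each cusp map is a bijection of the upper half plane, so h is constant everywhere once it is
   constant along one of them. *)
case: i hconst hi hcm => _ _ hcm.
- exact: hcm z hz.
- have e := moebius_inv 0 (-1) 1 0 z ltac:(lia) hz.
  have hH := moebius_H 0 1 (-1) 0 z ltac:(lia) hz.
  rewrite -(hcm _ hH) -cuspmap0; congr h.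
  rewrite moebius_comp // -[LHS]moebius_id; f_equal; lia.
- have hH := moebius_H 1 0 (-2) 1 z ltac:(lia) hz.
  rewrite -(hcm _ hH) -cuspmap2 //; congr h.
  rewrite moebius_comp // -[LHS]moebius_id; f_equal; lia.
- have hH := moebius_H 1 0 (-4) 1 z ltac:(lia) hz.
  rewrite -(hcm _ hH) -cuspmap4 //; congr h.
  rewrite moebius_comp // -[LHS]moebius_id; f_equal; lia.
Qed.

(** * The coefficient condition and the values of f near the cusps *)

Definition modular8 (f : C -> C) : Prop := forall a b c d : Z,
  (a * d - b * c = 1)%Z -> (8 | c)%Z -> forall z, 0 < Im z ->
  f (moebius a b c d z) = (RtoC (IZR (chi2 d)) * f z)%C.

(** The coefficient condition as a functional equation. The left side is twice the odd part of f.
    The right side is twice the twist of f by chi2, because the Gauss sum of chi2 at n is 2 sqrt 2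
    chi2(n). *)
Definition plus_eq (f : C -> C) : Prop := forall z, 0 < Im z ->
  (f z - f (z + 1 / 2) =
   / sqrt 2 * (f (z + 1 / 8) - f (z + 3 / 8) - f (z + 5 / 8) + f (z + 7 / 8)))%C.

Lemma z8_pow_mod (n : nat) : (z8 ^ n = z8 ^ (n mod 8))%C.
Proof.
rewrite {1}(Nat.div_mod n 8) // Cpow_add_r Cpow_mult_r z8_pow8 Cpow_1_l; ring.
Qed.

Lemma z8_pows : (z8 ^ 2 = Ci)%C /\ (z8 ^ 3 = Ci * z8)%C /\ (z8 ^ 5 = - z8)%C /\
  (z8 ^ 6 = - Ci)%C /\ (z8 ^ 7 = - Ci * z8)%C.
Proof.
have h2 : (z8 ^ 2 = Ci)%C by rewrite -z8_sqr; ring.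
have h4 := z8_pow4.
split=> //.
have -> : (z8 ^ 3 = z8 ^ 2 * z8)%C by ring.
have -> : (z8 ^ 5 = z8 ^ 4 * z8)%C by ring.
have -> : (z8 ^ 6 = z8 ^ 4 * z8 ^ 2)%C by ring.
have -> : (z8 ^ 7 = z8 ^ 4 * z8 ^ 2 * z8)%C by ring.
rewrite h2 h4; repeat split; ring.
Qed.

Lemma ee_div8 (n : nat) : ee (RtoC (INR n / 8)) = (z8 ^ n)%C.
Proof.
rewrite /z8 -ee_pow; congr ee; rewrite RtoC_div; last lra.
field.
Qed.

Lemma Z_mod8 (n : Z) : exists m r, n = (8 * m + Z.of_nat r)%Z /\ (r < 8)%nat.
Proof.
exists (n / 8)%Z, (Z.to_nat (n mod 8)); have := Z.mod_pos_bound n 8 ltac:(lia).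
have := Z.div_mod n 8 ltac:(lia); lia.
Qed.

Lemma ee_Zdiv8 (m : Z) (r : nat) : ee (RtoC (IZR (8 * m + Z.of_nat r) / 8)) = (z8 ^ r)%C.
Proof.
rewrite -ee_div8 -[RHS](ee_plus_Z _ m) -RtoC_plus plus_IZR mult_IZR -INR_IZR_INZ.
congr ee; congr RtoC; field.
Qed.

Lemma chi2_mod (m : Z) (r : Z) : chi2 (8 * m + r) = chi2 r.
Proof.
rewrite /chi2 Z.add_comm Z.even_add_mul_even; last by exists 4%Z.
have -> : ((r + 8 * m) mod 8 = r mod 8)%Z by rewrite Z.mul_comm Z_mod_plus_full.
done.
Qed.

Lemma sqrt2_C : (RtoC (sqrt 2) * RtoC (sqrt 2) = 2)%C.
Proof. by rewrite -RtoC_mult sqrt2_sqr. Qed.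
Lemma sqrt2_C_neq0 : RtoC (sqrt 2) <> 0.
Proof. move=> [] h; have := Rlt_sqrt2_0; lra. Qed.

Lemma root8_cases (P : nat -> Prop) : P 0%nat -> P 1%nat -> P 2%nat -> P 3%nat -> P 4%nat ->
  P 5%nat -> P 6%nat -> P 7%nat -> forall r, (r < 8)%nat -> P r.
Proof.
move=> h0 h1 h2 h3 h4 h5 h6 h7 r; do 8 (case: r => [//|r]); lia.
Qed.

(** This is the factor of q^n in the functional equation, with u = e(n/8). Among the eight residues
    it fails to vanish only at 3 and 5. *)
Lemma plus_coeff (n : Z) (u : C) : u = ee (RtoC (IZR n / 8)) ->
  ~ (Z.Odd n /\ chi2 n = (-1)%Z) ->
  (1 - u ^ 4 - / sqrt 2 * (u - u ^ 3 - u ^ 5 + u ^ 7) = 0)%C.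
Proof.
move=> hu hn; have [m [r [hm hr]]] := Z_mod8 n.
have -> : u = (z8 ^ r)%C by rewrite hu hm ee_Zdiv8.
have h2 := sqrt2_C_neq0.
have [e2 [e3 [e5 [e6 e7]]]] := z8_pows.
have hs : (z8 - Ci * z8 = sqrt 2)%C by rewrite -z8_add_inv -z8_sqr; ring.
have hs' : RtoC (sqrt 2) = (z8 - Ci * z8)%C by [].
have hodd : r = 3%nat \/ r = 5%nat -> False.
  move=> hr'; apply: hn; split.
    by case: hr' => hr'; rewrite hm hr'; [exists (4 * m + 1)%Z|exists (4 * m + 2)%Z]; lia.
  by rewrite hm chi2_mod; case: hr' => ->.
suff hr4 : forall r' : nat, (r' < 8)%nat -> ~ (r' = 3%nat \/ r' = 5%nat) ->
  (1 - (z8 ^ r') ^ 4 - / sqrt 2 * (z8 ^ r' - (z8 ^ r') ^ 3 - (z8 ^ r') ^ 5 + (z8 ^ r') ^ 7) = 0)%C.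
  by apply: hr4.
move=> {r hm hr hodd} r; rewrite -!Cpow_mult_r; move: r; apply: root8_cases => hr.
all: rewrite ?(z8_pow_mod (_ * _)).
all: cbv [Nat.modulo Nat.mul Nat.add Nat.divmod Nat.sub Init.Nat.modulo Init.Nat.mul Init.Nat.add Init.Nat.divmod Init.Nat.sub fst snd].
all: rewrite ?Cpow_1_r ?e2 ?e3 ?z8_pow4 ?e5 ?e6 ?e7; change (z8 ^ 0)%C with (RtoC 1).
all: try (by exfalso; apply: hr; lia).
all: try ring.
all: transitivity (2 - 2 * (/ sqrt 2 * (z8 - Ci * z8)))%C; first by ring.
all: rewrite ?hs; try by field.
Qed.

Lemma Cminus_eq0 (x y : C) : (x - y = 0)%C -> x = y.
Proof. move=> e; have -> : x = (x - y + y)%C by ring.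
rewrite e; ring. Qed.

Lemma Cseries_0 : Cseries (fun _ => RtoC 0) 0.
Proof.
have := Cseries_zero_from (fun _ => RtoC 0) 0.
by rewrite Csum_0; apply.
Qed.

Lemma qpow_shift (n : Z) (k : nat) (z : C) :
  qpow (IZR n / INR 1) (z + RtoC (INR k) / 8)%C = (qpow (IZR n / INR 1) z * ee (RtoC (IZR n / 8)) ^ k)%C.
Proof.
rewrite !qpow_ee -ee_pow -ee_plus; congr ee.
have -> : IZR n / INR 1 = IZR n by rewrite /=; field.
rewrite RtoC_div; last lra. field.
Qed.

Lemma plus_relation (f : C -> C) (a : Z -> C) : has_qexp 1 a f ->
  (forall n, Z.Odd n -> chi2 n = (-1)%Z -> a n = RtoC 0) -> plus_eq f.
Proof.
move=> [n0 [_ h]] ha z hz.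
pose n k := (Z.of_nat k - Z.of_nat n0)%Z.
have hk (k : nat) : Cseries (fun j => a (n j) * (qpow (IZR (n j) / INR 1) z * ee (RtoC (IZR (n j) / 8)) ^ k))%C
   (f (z + RtoC (INR k) / 8)%C).
  have hz' : 0 < Im (z + RtoC (INR k) / 8)%C.
    by rewrite -RtoC_div; [rewrite Im_plus im_RtoC; lra|lra].
  by apply: Cseries_ext (h _ hz') => j; rewrite -qpow_shift.
have e0 : f z = f (z + RtoC (INR 0) / 8)%C by congr f; rewrite /=; field.
have e4 : f (z + 1 / 2)%C = f (z + RtoC (INR 4) / 8)%C by congr f; rewrite INR_IZR_INZ /=; field.
have e1 : f (z + 1 / 8)%C = f (z + RtoC (INR 1) / 8)%C by [].
have e3 : f (z + 3 / 8)%C = f (z + RtoC (INR 3) / 8)%C by rewrite INR_IZR_INZ.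
have e5 : f (z + 5 / 8)%C = f (z + RtoC (INR 5) / 8)%C by rewrite INR_IZR_INZ.
have e7 : f (z + 7 / 8)%C = f (z + RtoC (INR 7) / 8)%C by rewrite INR_IZR_INZ.
rewrite e0 e1 e3 e4 e5 e7.
have H := Cseries_minus _ _ _ _ (Cseries_minus _ _ _ _ (hk 0%nat) (hk 4%nat))
  (Cseries_scal (/ sqrt 2)%C _ _ (Cseries_plus _ _ _ _ (Cseries_minus _ _ _ _
   (Cseries_minus _ _ _ _ (hk 1%nat) (hk 3%nat)) (hk 5%nat)) (hk 7%nat))).
apply: Cminus_eq0; apply: (Cseries_unique _ _ _ H).
apply: Cseries_ext Cseries_0 => j /=.
set u := ee _; set q := qpow _ _.
case: (classic (Z.Odd (n j) /\ chi2 (n j) = (-1)%Z)) => [[h1 h2]|hn].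
  rewrite ha //; ring.
have hp := plus_coeff (n j) u eq_refl hn.
have -> : RtoC 0 = (a (n j) * q * (1 - u ^ 4 - / sqrt 2 * (u - u ^ 3 - u ^ 5 + u ^ 7)))%C by rewrite hp; ring.
rewrite /=; ring.
Qed.

Lemma chi2_vals : ((chi2 1 = 1%Z) * (chi2 3 = (-1)%Z) * (chi2 5 = (-1)%Z) * (chi2 7 = 1%Z))%type.
Proof. by []. Qed.

Lemma chi2_opp (k : Z) : chi2 (- k) = chi2 k.
Proof.
have [m [r [-> hr]]] := Z_mod8 k.
have -> : (- (8 * m + Z.of_nat r) = 8 * (- m - 1) + (8 - Z.of_nat r))%Z by ring.
rewrite !chi2_mod; move: r hr; by apply: root8_cases.
Qed.

(** The shape of f near the cusps other than infinity: at -1/(64 w) + c, f is a signed sum of its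
    eight translates at w. The patterns [sgn0], [sgn1], [sgn2], [sgn3] belong to c = 0, 1/2, 1/4,
    3/4 in this order. *)
Definition comb (s : nat -> R) (f : C -> C) (w : C) : C :=
  (/ (2 * sqrt 2) * Csum (fun k => RtoC (s k) * f (w + RtoC (INR k) / 8)) 7)%C.

Definition sgn_list (l : list R) (k : nat) : R := nth k l 0.
Definition sgn0 := sgn_list (1 :: 1 :: 1 :: 1 :: 1 :: 1 :: 1 :: 1 :: nil).
Definition sgn1 := sgn_list (1 :: -1 :: 1 :: -1 :: 1 :: -1 :: 1 :: -1 :: nil).
Definition sgn2 := sgn_list (1 :: -1 :: -1 :: 1 :: 1 :: -1 :: -1 :: 1 :: nil).
Definition sgn3 := sgn_list (1 :: 1 :: -1 :: -1 :: 1 :: 1 :: -1 :: -1 :: nil).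

Lemma comb8 (s : nat -> R) f w : comb s f w = (/ (2 * sqrt 2) *
  (s 0%nat * f (w + 0 / 8) + s 1%nat * f (w + 1 / 8) + s 2%nat * f (w + 2 / 8) +
   s 3%nat * f (w + 3 / 8) + s 4%nat * f (w + 4 / 8) + s 5%nat * f (w + 5 / 8) +
   s 6%nat * f (w + 6 / 8) + s 7%nat * f (w + 7 / 8)))%C.
Proof. by rewrite /comb !Csum_S Csum_0 !INR_IZR_INZ. Qed.

(* Proves that expressions which are affine in a point of the upper half plane do not vanish. *)
Ltac Cnz := repeat split; try done;
  try (let h := fresh "h" in intro h;
    apply (f_equal (fun x : C => (Re x, Im x))) in h;
    injection h; unfold Re, Im in *; simpl; intros; lra).

Section CuspValues.
Variables (f : C -> C) (Hf : modular8 f) (Hp : plus_eq f).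

Lemma f_per_Z (j : Z) (z : C) : 0 < Im z -> f (z + IZR j)%C = f z.
Proof.
move=> hz; have := Hf 1%Z j 0%Z 1%Z ltac:(lia) (Z.divide_0_r 8) z hz.
change (chi2 1) with 1%Z.
rewrite Cmult_1_l => <-; congr f; rewrite /moebius; field.
Qed.

Lemma f_mod (a b c d : Z) (z w : C) : (a * d - b * c = 1)%Z -> (8 | c)%Z -> 0 < Im z ->
  w = moebius a b c d z -> f z = (RtoC (IZR (chi2 d)) * f w)%C.
Proof.
move=> hd h8 hz ->; rewrite Hf //.
have : chi2 d = 1%Z \/ chi2 d = (-1)%Z.
  have [r hr] := h8.
  have : Z.odd d = true.
    rewrite -Z.negb_even; case E: (Z.even d) => //; move/Z.even_spec: E => [m hm].
    exfalso; subst; move: hd.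
    have -> : (a * (2 * m) - b * (r * 8) = 2 * (a * m - b * (r * 4)))%Z by ring.
    lia.
  rewrite /chi2 -Z.negb_even; case: (Z.even d) => // _; case: (_ || _)%bool; by [left|right].
by case=> ->; rewrite Cmult_assoc -RtoC_mult -mult_IZR /= Cmult_1_l.
Qed.

Lemma Im_inv64 (w : C) : 0 < Im w -> 0 < Im (- (1) / (64 * w))%C.
Proof.
move=> h; have h64 : RtoC 64 <> 0 by move=> [] hh; lra.
have hn := Im_neq0 w h.
have -> : (- (1) / (64 * w) = - (/ 64)%R * / w)%C by rewrite RtoC_inv; [field|lra].
have hp := proj1 (Cmod_gt_0 w) hn.
rewrite Im_mult Im_inv // Re_opp Im_opp re_RtoC im_RtoC.
have : 0 < Im w / (Cmod w * Cmod w) by apply: Rdiv_lt_0_compat => //; nra.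
rewrite /Rdiv; lra.
Qed.

Lemma Im_plus_R (z : C) (x : R) : Im (z + x)%C = Im z.
Proof. by rewrite Im_plus im_RtoC Rplus_0_r. Qed.
Lemma Im_plus_div8 (z : C) (x : R) : Im (z + x / 8)%C = Im z.
Proof. by rewrite -RtoC_div ?Im_plus_R //; lra. Qed.

(** The matrix (-k, b; 8, -k) carries -1/(64 w) + k/8 to w - k/8. It exists for odd k, since k^2 is
    1 modulo 8; all these points are equivalent to infinity. *)
Lemma f_near8 (k b : Z) (w : C) : (k * k - 1 = 8 * b)%Z -> 0 < Im w ->
  f (- (1) / (64 * w) + RtoC (IZR k) / 8)%C = (RtoC (IZR (chi2 k)) * f (w + RtoC (IZR (- k)) / 8))%C.
Proof.
move=> hk hw; have hd := Im_inv64 w hw; have hw0 := Im_neq0 w hw.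
rewrite -(chi2_opp k); apply: (f_mod (- k) b 8 (- k)); try lia; first by exists 1%Z.
  by rewrite Im_plus_div8.
have hb : RtoC (IZR b) = ((IZR k * IZR k - 1) / 8)%C.
  rewrite -RtoC_mult -RtoC_minus -RtoC_div; last lra.
  congr RtoC; rewrite -mult_IZR; have -> : (k * k = 8 * b + 1)%Z by lia.
  rewrite plus_IZR mult_IZR; field.
rewrite /moebius hb opp_IZR RtoC_opp; field; split=> //.
move=> [] h; lra.
Qed.

(** In [plus_eq] the translate by k/8 carries the sign chi2(k), and [f_near8] brings the same sign
    again; hence only plus signs remain. *)
Lemma plus_at (w : C) : 0 < Im w ->
  (f (- (1) / (64 * w)) - f (- (1) / (64 * w) + 1 / 2) =
   / sqrt 2 * (f (w + 1 / 8) + f (w + 3 / 8) + f (w + 5 / 8) + f (w + 7 / 8)))%C.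
Proof.
move=> hw; rewrite Hp; last exact: Im_inv64.
have h k := f_near8 k _ w.
rewrite (f_near8 1 0 w) // (f_near8 3 1 w) // (f_near8 5 3 w) // (f_near8 7 6 w) //.
have e (k : Z) : f (w + RtoC (IZR (- k)) / 8)%C = f (w + RtoC (IZR (8 - k)) / 8)%C.
  have := f_per_Z 1 (w + RtoC (IZR (- k)) / 8)%C; rewrite Im_plus_div8 => /(_ hw) <-; congr f.
  rewrite minus_IZR opp_IZR RtoC_minus RtoC_opp; field.
rewrite !e !chi2_vals /=; ring.
Qed.

(** This is [plus_at] at w - 1/8. Moving back to w, f at -1/(64 w) is unchanged by (1, 0; 8, 1), but
    f at the point shifted by 1/2 changes sign, since chi2(-3) = -1; the difference becomes a
    sum. *)
Lemma plus_at' (w : C) : 0 < Im w ->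
  (f (- (1) / (64 * w)) + f (- (1) / (64 * w) + 1 / 2) =
   / sqrt 2 * (f (w + 0 / 8) + f (w + 2 / 8) + f (w + 4 / 8) + f (w + 6 / 8)))%C.
Proof.
move=> hw.
have hw' : 0 < Im (w + RtoC (-1) / 8)%C by rewrite Im_plus_div8.
have h0 := Im_neq0 w hw; have h0' := Im_neq0 _ hw'.
have h8 : (8 * w - 1)%C <> 0.
  move=> h; apply: h0'; have -> : (w + RtoC (-1) / 8 = (8 * w - 1) / 8)%C by field.
  rewrite h; field.
have := plus_at _ hw'.
rewrite (f_mod 1 0 8 1 (- (1) / (64 * w)) (- (1) / (64 * (w + RtoC (-1) / 8)))) //;
  [|by exists 1%Z|exact: Im_inv64|]; last first.
  rewrite /moebius; field; Cnz.
have hi : 0 < Im (- (1) / (64 * w) + 1 / 2)%C.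
  have -> : (1 / 2 = RtoC (1 / 2))%C by rewrite RtoC_div //; lra.
  rewrite Im_plus_R; exact: Im_inv64.
rewrite (f_mod 5 (-2) 8 (-3) (- (1) / (64 * w) + 1 / 2) (- (1) / (64 * (w + RtoC (-1) / 8)) + 1 / 2)) //;
  [|by exists 1%Z|]; last first.
  rewrite /moebius; field; Cnz.
have e1 : (w + RtoC (-1) / 8 + 1 / 8 = w + 0 / 8)%C by field.
have e3 : (w + RtoC (-1) / 8 + 3 / 8 = w + 2 / 8)%C by field.
have e5 : (w + RtoC (-1) / 8 + 5 / 8 = w + 4 / 8)%C by field.
have e7 : (w + RtoC (-1) / 8 + 7 / 8 = w + 6 / 8)%C by field.
rewrite e1 e3 e5 e7 !chi2_vals; change (chi2 (-3)) with (-1)%Z; move=> <- /=; ring.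
Qed.

Lemma half_sum (x y A B : C) : (x - y = / sqrt 2 * A)%C -> (x + y = / sqrt 2 * B)%C ->
  x = (/ (2 * sqrt 2) * (A + B))%C /\ y = (/ (2 * sqrt 2) * (B - A))%C.
Proof.
move=> h1 h2; have hs := sqrt2_C_neq0.
split; [transitivity ((x - y + (x + y)) / 2)%C|transitivity ((x + y - (x - y)) / 2)%C];
  try field; rewrite h1 h2; field => //.
Qed.

Lemma cusp_value0 (w : C) : 0 < Im w -> f (- (1) / (64 * w))%C = comb sgn0 f w.
Proof.
move=> hw; have [-> _] := half_sum _ _ _ _ (plus_at w hw) (plus_at' w hw).
rewrite comb8 /sgn0 /sgn_list /=; congr Cmult; ring.
Qed.
Lemma cusp_value1 (w : C) : 0 < Im w -> f (- (1) / (64 * w) + 1 / 2)%C = comb sgn1 f w.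
Proof.
move=> hw; have [_ ->] := half_sum _ _ _ _ (plus_at w hw) (plus_at' w hw).
rewrite comb8 /sgn1 /sgn_list /=; congr Cmult; ring.
Qed.

Lemma plus_at4 (w : C) : 0 < Im w ->
  (f (- (1) / (64 * w) + 1 / 4) - f (- (1) / (64 * w) + 3 / 4) =
   / sqrt 2 * (f (w + 7 / 8) - f (w + 5 / 8) + f (w + 3 / 8) - f (w + 1 / 8)))%C.
Proof.
move=> hw; set d := (- (1) / (64 * w))%C; have hd : 0 < Im d by exact: Im_inv64.
have e2 : (d + 1 / 4 = d + 2 / 8)%C by field.
have e3 : (d + 3 / 4 = d + 2 / 8 + 1 / 2)%C by field.
rewrite e3 e2 Hp; last by rewrite Im_plus_div8.
have e (k : Z) : f (w + RtoC (IZR (- k)) / 8)%C = f (w + RtoC (IZR (8 - k)) / 8)%C.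
  have := f_per_Z 1 (w + RtoC (IZR (- k)) / 8)%C; rewrite Im_plus_div8 => /(_ hw) <-; congr f.
  rewrite minus_IZR opp_IZR RtoC_minus RtoC_opp; field.
have a1 : (d + 2 / 8 + 1 / 8 = d + 3 / 8)%C by field.
have a3 : (d + 2 / 8 + 3 / 8 = d + 5 / 8)%C by field.
have a5 : (d + 2 / 8 + 5 / 8 = d + 7 / 8)%C by field.
have a7 : (d + 2 / 8 + 7 / 8 = d + 1 / 8 + 1)%C by field.
have p1 := f_per_Z 1 (d + 1 / 8)%C; rewrite Im_plus_div8 in p1.
rewrite a1 a3 a5 a7 (p1 hd) /d (f_near8 1 0 w) // (f_near8 3 1 w) // (f_near8 5 3 w) // (f_near8 7 6 w) //.
rewrite !e !chi2_vals /=; ring.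
Qed.

(** The same device with w + 1/8. The points near 1/4 and 3/4 are exchanged, and one of the two
    exchanging matrices has character value chi2(3) = -1. *)
Lemma plus_at4' (w : C) : 0 < Im w ->
  (f (- (1) / (64 * w) + 1 / 4) + f (- (1) / (64 * w) + 3 / 4) =
   / sqrt 2 * (f (w + 0 / 8) - f (w + 6 / 8) + f (w + 4 / 8) - f (w + 2 / 8)))%C.
Proof.
move=> hw.
have hw' : 0 < Im (w + 1 / 8)%C by rewrite Im_plus_div8.
have h0 := Im_neq0 w hw; have h0' := Im_neq0 _ hw'.
have h8 : (8 * w + 1)%C <> 0.
  move=> h; apply: h0'; have -> : (w + 1 / 8 = (8 * w + 1) / 8)%C by field.
  rewrite h; field.
have hd := Im_inv64 w hw; have hd' := Im_inv64 _ hw'.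
have hi (x : R) : x <> 0 -> 0 < Im (- (1) / (64 * w) + x / 4)%C.
  by move=> _; rewrite -RtoC_div ?Im_plus_R //; lra.
have h4 := C4_neq0.
have q1 : f (- (1) / (64 * w) + 3 / 4)%C = f (- (1) / (64 * (w + 1 / 8)) + 1 / 4)%C.
  rewrite (f_mod (-1) 1 (-8) 7 _ (- (1) / (64 * (w + 1 / 8)) + 1 / 4)%C) //.
  - change (chi2 7) with 1%Z; ring.
  - by exists (-1)%Z.
  - apply: hi; lra.
  - rewrite /moebius; field; Cnz.
have q2 : f (- (1) / (64 * w) + 1 / 4)%C = (- f (- (1) / (64 * (w + 1 / 8)) + 3 / 4))%C.
  rewrite (f_mod (-5) 2 (-8) 3 _ (- (1) / (64 * (w + 1 / 8)) + 3 / 4)%C) //.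
  - change (chi2 3) with (-1)%Z; ring.
  - by exists (-1)%Z.
  - apply: hi; lra.
  - rewrite /moebius; field; Cnz.
have := plus_at4 _ hw'.
have p8 := f_per_Z 1 (w + 0 / 8)%C; rewrite Im_plus_div8 in p8.
have e7 : (w + 1 / 8 + 7 / 8 = w + 0 / 8 + 1)%C by field.
have e5 : (w + 1 / 8 + 5 / 8 = w + 6 / 8)%C by field.
have e3 : (w + 1 / 8 + 3 / 8 = w + 4 / 8)%C by field.
have e1 : (w + 1 / 8 + 1 / 8 = w + 2 / 8)%C by field.
rewrite e1 e3 e5 e7 p8 // q1 q2 => <-; ring.
Qed.

Lemma cusp_value2 (w : C) : 0 < Im w -> f (- (1) / (64 * w) + 1 / 4)%C = comb sgn2 f w.
Proof.
move=> hw; have [-> _] := half_sum _ _ _ _ (plus_at4 w hw) (plus_at4' w hw).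
rewrite comb8 /sgn2 /sgn_list /=; congr Cmult; ring.
Qed.
Lemma cusp_value3 (w : C) : 0 < Im w -> f (- (1) / (64 * w) + 3 / 4)%C = comb sgn3 f w.
Proof.
move=> hw; have [_ ->] := half_sum _ _ _ _ (plus_at4 w hw) (plus_at4' w hw).
rewrite comb8 /sgn3 /sgn_list /=; congr Cmult; ring.
Qed.
End CuspValues.

(** * Limits at the cusps *)

(* The parameter e^(2 pi i z / 64) is fine enough for all four cusps and all translates by eighths. *)
Definition cusplim (g : C -> C) (l : C) : Prop := exists phi, hol phi /\ phi 0 = l /\
  forall z, 0 < Im z -> g z = phi (ee (z / 64)).

Lemma cusplim_ext (g h : C -> C) (l : C) : cusplim g l ->
  (forall z, 0 < Im z -> g z = h z) -> cusplim h l.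
Proof.
by move=> [phi [h1 [h2 h3]]] e; exists phi; split=> //; split=> // z hz; rewrite -e // h3.
Qed.

Lemma cusplim_const c : cusplim (fun _ => c) c.
Proof. by exists (fun _ => c); split; [exact: hol_const|]. Qed.

Lemma cusplim_plus g h l m : cusplim g l -> cusplim h m ->
  cusplim (fun z => g z + h z)%C (l + m)%C.
Proof.
move=> [p [p1 [p2 p3]]] [q [q1 [q2 q3]]]; exists (fun s => p s + q s)%C.
by split; [exact: hol_plus|split; [rewrite p2 q2|move=> z hz; rewrite p3 // q3]].
Qed.

Lemma cusplim_mult g h l m : cusplim g l -> cusplim h m ->
  cusplim (fun z => g z * h z)%C (l * m)%C.
Proof.
move=> [p [p1 [p2 p3]]] [q [q1 [q2 q3]]]; exists (fun s => p s * q s)%C.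
by split; [exact: hol_mult|split; [rewrite p2 q2|move=> z hz; rewrite p3 // q3]].
Qed.

Lemma cusplim_scal c g l : cusplim g l -> cusplim (fun z => c * g z)%C (c * l)%C.
Proof. move=> h; apply: cusplim_mult h; exact: cusplim_const. Qed.

Lemma cusplim_minus g h l m : cusplim g l -> cusplim h m ->
  cusplim (fun z => g z - h z)%C (l - m)%C.
Proof.
move=> h1 h2; have h3 := cusplim_plus _ _ _ _ h1 (cusplim_scal (- (1)) _ _ h2).
have -> : (l - m = l + - (1) * m)%C by ring.
by apply: cusplim_ext h3 _ => z _; ring.
Qed.

Lemma Im_div64 (z : C) : Im (z / 64) = Im z / 64.
Proof. rewrite /Im /=; field. Qed.

Lemma cusplim_affine F (k : nat) (b : R) : (0 < k)%nat -> hol F ->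
  cusplim (fun z => F (ee (RtoC (INR k) * (z / 64) + b)%C)) (F 0).
Proof.
move=> hk hF; exists (fun s => F (ee b * s ^ k)%C).
have h1 : Cmod (ee b) <= 1.
  by rewrite Cmod_ee im_RtoC Rmult_0_r Ropp_0 exp_0; lra.
split; [|split].
- apply: (hol_comp_pow k (fun s => F (ee b * s)%C)) => //; exact: hol_rot.
- congr F; case: k hk => [|k] hk; first lia. rewrite Cpow_S; ring.
- by move=> z hz; rewrite ee_plus ee_pow Cmult_comm.
Qed.

(** The constant is also the limit at every cusp. This turns constancy into equations between the
    leading coefficients at different cusps. *)
Lemma liouville8 (h : C -> C) : Gamma0_8_abs h ->
  (forall i, exists l, cusplim (fun z => h (cuspmap i z)) l) ->
  exists c, (forall z, 0 < Im z -> h z = c) /\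
    forall i l, cusplim (fun z => h (cuspmap i z)) l -> l = c.
Proof.
move=> hinv hc.
have [l0 [p0 [a0 [b0 c0]]]] := hc Cinf; have [l1 [p1 [a1 [b1 c1]]]] := hc C0.
have [l2 [p2 [a2 [b2 c2]]]] := hc C2; have [l4 [p4 [a4 [b4 c4]]]] := hc C4.
pose phi i := match i with Cinf => p0 | C0 => p1 | C2 => p2 | C4 => p4 end.
have [||i hi] := liouville h phi hinv; [by case|by case|].
exists (phi i 0); split=> // j l [p [hp [e hz]]].
rewrite -e; apply: (hol_limit0 p (phi i 0) 1) => //; first lra.
move=> x hx.
have hx0 : RtoC x <> 0 by move=> [] hh; lra.
have hx1 : Cmod x < 1 by rewrite Cmod_R Rabs_pos_eq; lra.
have [z [hz1 hz2]] := ee_64_surj x hx0 hx1.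
rewrite -hz2 -hz //; apply: hi; exact: cuspmap_H.
Qed.

(** * Expansions of f_1 and f_8 at the cusps *)

Definition qexp_data (p : C) (m : nat) (a : nat -> C) (f : C -> C) : Prop :=
  psrep a (psum a) /\
  forall z, 0 < Im z -> f z = (p * ee (- (RtoC (INR m) * z)) + psum a (ee z))%C.

Lemma f_expansion_data (m : nat) (f : C -> C) (a : nat -> C) :
  f_expansion (Z.of_nat m) f a -> qexp_data (RtoC (/ INR (s8 (Z.of_nat m)))) m a f.
Proof.
move=> h.
have hs z : 0 < Im z -> pser a (ee z) (f z - principal_part (Z.of_nat m) z)%C.
  move=> hz; apply: Cseries_ext (h z hz) => n.
  by rewrite qpow_ee ee_pow.
have hr : psrep a (psum a).
  apply: psrep_psum => r hr; pose r' := (1 + r) / 2.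
  have hr' : 0 < r' < 1 by rewrite /r'; lra.
  have hx : RtoC r' <> 0 by move=> [] hh; lra.
  have [z [hz1 hz2]] := ee_surj r' hx.
  have hz : 0 < Im z.
    rewrite hz2 Cmod_R Rabs_pos_eq; last lra.
    have : ln r' < 0 by rewrite -ln_1; apply: ln_increasing; lra.
    have := PI_RGT_0 => hpi hl; apply: Rdiv_lt_0_compat; lra.
  have := hs z hz; rewrite hz1 => /Cseries_term0 [K HK].
  exists K => n; apply: Rle_trans (HK n); rewrite Cmod_mult Cmod_pow Cmod_R Rabs_pos_eq; last lra.
  apply: Rmult_le_compat_l; first exact: Cmod_ge_0.
  apply: pow_incr; rewrite /r'; lra.
split=> // z hz.
have h1 : Cmod (ee z) < 1.
  rewrite Cmod_ee; apply: (proj2 (exp_neg_lt1 _ _)); have := PI_RGT_0; nra.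
have := Cseries_unique _ _ _ (hs z hz) (hr _ h1).
rewrite /principal_part qpow_ee opp_IZR -INR_IZR_INZ => <-.
have -> : (RtoC (- INR m) * z = - (RtoC (INR m) * z))%C by rewrite RtoC_opp; ring.
ring.
Qed.

(** [prime_dec] is destructed rather than evaluated. Among the divisors of 8 only 2 is prime; for
    the numbers that do not divide 8 both outcomes give the same count. *)
Lemma omega_8 : omega 8 = 1%nat.
Proof.
rewrite /omega; change (Z.to_nat 8) with 8%nat.
cbn [seq filter].
have np (p : Z) : (p = 1 \/ p = 4 \/ p = 8)%Z -> ~ prime p.
  move=> hp pr; have h2 := prime_ge_2 p pr.
  have hd := prime_divisors p pr 2.
  case: hp => [e|[e|e]]; first lia.
    by have := hd ltac:(exists 2%Z; lia); lia.
  by have := hd ltac:(exists 4%Z; lia); lia.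
case: prime_dec => [h|_]; first by case: (np _ _ h); left.
case: prime_dec => [_|h]; last by case: h; exact: prime_2.
change (8 mod Z.of_nat 2 =? 0)%Z with true; cbv beta iota.
case: prime_dec => h3; (case: prime_dec => [h|_]; first by (case: (np _ _ h); right; left)).
all: change (8 mod Z.of_nat 3 =? 0)%Z with false.
all: change (8 mod Z.of_nat 5 =? 0)%Z with false.
all: change (8 mod Z.of_nat 6 =? 0)%Z with false.
all: change (8 mod Z.of_nat 7 =? 0)%Z with false.
all: cbv beta iota.
all: case: prime_dec => h5; case: prime_dec => h6; case: prime_dec => h7;
  (case: prime_dec => [h|_]; first by (case: (np _ _ h); right; right)); by [].
Qed.

Lemma s8_8 : s8 8 = 2%nat.
Proof. by rewrite /s8; change (Z.gcd 8 8) with 8%Z; rewrite omega_8. Qed.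

Lemma s8_1 : s8 1 = 1%nat.
Proof.
rewrite /s8; change (Z.gcd 1 8) with 1%Z; rewrite /omega; change (Z.to_nat 1) with 1%nat.
cbn [seq filter]; case: prime_dec => [h|_] //.
by have := prime_ge_2 _ h; lia.
Qed.

Lemma Aeps8_modular f : Aeps8 f -> modular8 f /\ plus_eq f.
Proof.
move=> [[_ [h _]] [a [ha hn]]]; split; first by move=> a' b c d h1 h2 z hz; apply: h.
exact: plus_relation ha hn.
Qed.

Definition comb_hol (s : nat -> R) (ft : C -> C) (x : C) : C :=
  (/ (2 * sqrt 2) * Csum (fun k => RtoC (s k) * ft (z8 ^ k * x)) 7)%C.

Lemma Cmod_z8_pow k : Cmod (z8 ^ k) = 1.
Proof. by rewrite Cmod_pow Cmod_z8 pow1. Qed.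

Lemma hol_Csum (g : nat -> C -> C) n : (forall k, hol (g k)) -> hol (fun s => Csum (fun k => g k s) n).
Proof.
move=> h; elim: n => [|n IH].
  apply: hol_ext (h 0%nat) _ => s _; by rewrite Csum_0.
apply: hol_ext (hol_plus _ _ IH (h (S n))) _ => s _; by rewrite Csum_S.
Qed.

Lemma hol_comb s ft : hol ft -> hol (comb_hol s ft).
Proof.
move=> h; apply: hol_scal; apply: hol_Csum => k; apply: hol_scal.
apply: hol_rot => //; rewrite Cmod_z8_pow; lra.
Qed.

Lemma ee_add_div8 (w : C) (k : nat) : ee (w + RtoC (INR k) / 8)%C = (z8 ^ k * ee w)%C.
Proof. by rewrite ee_plus -RtoC_div ?ee_div8; [ring|lra]. Qed.

(** The pole of f_1 cancels: the signs have period 4 in k, while the translates of q^(-1) change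
    sign under k -> k + 4. So f_1 has its only pole at infinity. *)
Lemma comb_f1 (s : nat -> R) f ft w : (forall k, (k < 4)%nat -> s (k + 4)%nat = s k) ->
  (forall z, 0 < Im z -> f z = (ee (- z) + ft (ee z))%C) -> 0 < Im w ->
  comb s f w = comb_hol s ft (ee w).
Proof.
move=> hs hf hw; rewrite /comb /comb_hol; congr Cmult.
rewrite (Csum_ext _ (fun k => s k * (ee (- w) * (/ z8) ^ k) + s k * ft (z8 ^ k * ee w))%C); last first.
  move=> k _; rewrite hf ?Im_plus_div8 // ee_add_div8 ee_opp ee_add_div8.
  rewrite Cpow_inv; last exact: ee_neq0.
  have n1 := ee_neq0 w; have n2 : (z8 ^ k)%C <> 0 by apply: Cpow_nz; exact: ee_neq0.
  by rewrite ee_opp; field.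
rewrite Csum_plus -[RHS]Cplus_0_l; congr Cplus.
have e4 : ((/ z8) ^ 4 = - (1))%C.
  rewrite Cpow_inv ?z8_pow4; last exact: ee_neq0. by field.
rewrite !Csum_S Csum_0 -(hs 0%nat) -?(hs 1%nat) -?(hs 2%nat) -?(hs 3%nat); try lia.
change (0 + 4)%nat with 4%nat; change (1 + 4)%nat with 5%nat; change (2 + 4)%nat with 6%nat; change (3 + 4)%nat with 7%nat.
set u := (/ z8)%C in e4 *.
have -> : (u ^ 5 = u * u ^ 4)%C by ring.
have -> : (u ^ 6 = u ^ 2 * u ^ 4)%C by ring.
have -> : (u ^ 7 = u ^ 3 * u ^ 4)%C by ring.
rewrite e4; ring.
Qed.

(** q^(-8) is invariant under the translations by eighths, so the pole survives with the sum of the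
    signs as a factor. By [sgn_sums] it is present at the cusp 0 and absent at 1/2 and 1/4. *)
Lemma comb_f8 (s : nat -> R) f ft p w :
  (forall z, 0 < Im z -> f z = (p * ee (- (8 * z)) + ft (ee z))%C) -> 0 < Im w ->
  comb s f w = (/ (2 * sqrt 2) * p * ee (- (8 * w)) * Csum (fun k => RtoC (s k)) 7 + comb_hol s ft (ee w))%C.
Proof.
move=> hf hw; rewrite /comb /comb_hol.
rewrite (Csum_ext _ (fun k => p * ee (- (8 * w)) * s k + s k * ft (z8 ^ k * ee w))%C); last first.
  move=> k _; rewrite hf ?Im_plus_div8 // ee_add_div8.
  have -> : (- (8 * (w + RtoC (INR k) / 8)) = - (8 * w) + RtoC (IZR (- Z.of_nat k)))%C.
    rewrite opp_IZR -INR_IZR_INZ RtoC_opp; field.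
  rewrite ee_plus_Z; ring.
rewrite Csum_plus Csum_scal; ring.
Qed.

Lemma sgn_sums : (Csum (fun k => RtoC (sgn0 k)) 7 = 8)%C /\ (Csum (fun k => RtoC (sgn1 k)) 7 = 0)%C /\
  (Csum (fun k => RtoC (sgn2 k)) 7 = 0)%C /\ (Csum (fun k => RtoC (sgn3 k)) 7 = 0)%C.
Proof. rewrite !Csum_S !Csum_0 /sgn0 /sgn1 /sgn2 /sgn3 /sgn_list /=; repeat split; ring. Qed.

Lemma sgn_per : (forall k, (k < 4)%nat -> sgn0 (k + 4)%nat = sgn0 k) /\
  (forall k, (k < 4)%nat -> sgn1 (k + 4)%nat = sgn1 k) /\
  (forall k, (k < 4)%nat -> sgn2 (k + 4)%nat = sgn2 k) /\
  (forall k, (k < 4)%nat -> sgn3 (k + 4)%nat = sgn3 k).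
Proof.
by split; [|split; [|split]]; move=> k; do 4 (case: k => [//|k]); lia.
Qed.

Lemma C64_neq0 : RtoC 64 <> 0.
Proof. move=> [] h; lra. Qed.

Lemma inv64_shape (Z : C) : Z <> 0 -> (- (1) / (64 * (Z / 64)) = - (1) / Z)%C.
Proof. move=> h; by field. Qed.

Section At0.
Variables (f : C -> C) (Hf : modular8 f) (Hp : plus_eq f) (Z : C) (HZ : 0 < Im Z).
Let Z0 := Im_neq0 Z HZ.
Let HZ64 : 0 < Im (Z / 64).
Proof. rewrite Im_div64; lra. Qed.

Lemma val0 : f (- (1) / Z)%C = comb sgn0 f (Z / 64)%C.
Proof. by rewrite -cusp_value0 // inv64_shape. Qed.
Lemma val1 : f (1 / 2 - 1 / Z)%C = comb sgn1 f (Z / 64)%C.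
Proof. rewrite -cusp_value1 // inv64_shape //; congr f; field => //. Qed.
Lemma val2 : f (1 / 4 - 1 / Z)%C = comb sgn2 f (Z / 64)%C.
Proof. rewrite -cusp_value2 // inv64_shape //; congr f; field => //. Qed.
Lemma val3 : f (3 / 4 - 1 / Z)%C = comb sgn3 f (Z / 64)%C.
Proof. rewrite -cusp_value3 // inv64_shape //; congr f; field => //. Qed.
End At0.

Lemma comb_hol_0 s ft : comb_hol s ft 0 = (/ (2 * sqrt 2) * (Csum (fun k => RtoC (s k)) 7 * ft (RtoC 0)))%C.
Proof.
rewrite /comb_hol; congr Cmult; rewrite Cmult_comm -Csum_scal; apply: Csum_ext => k _.
rewrite Cmult_0_r; ring.
Qed.

Lemma Im_affine (k : nat) (b : R) (z : C) : (0 < k)%nat -> 0 < Im z ->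
  0 < Im (RtoC (INR k) * (z / 64) + b)%C.
Proof.
move=> hk hz; rewrite Im_plus_R Im_mult re_RtoC im_RtoC Im_div64.
have : 0 < INR k by apply: lt_0_INR.
move=> h; have : 0 < INR k * (Im z / 64) by apply: Rmult_lt_0_compat; lra.
lra.
Qed.

Definition data1 (a : nat -> C) (f : C -> C) :=
  modular8 f /\ plus_eq f /\ qexp_data 1 1 a f.

Lemma data1_exp a f : data1 a f -> forall z, 0 < Im z -> f z = (ee (- z) + psum a (ee z))%C.
Proof.
move=> [_ [_ [_ h]]] z hz; rewrite h // Cmult_1_l; congr Cplus; congr ee; rewrite /=; ring.
Qed.

Lemma data1_hol a f : data1 a f -> hol (psum a).
Proof. by move=> [_ [_ [h _]]]; exists a. Qed.

Lemma data1_comb a f s w : data1 a f -> (forall k, (k < 4)%nat -> s (k + 4)%nat = s k) ->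
  0 < Im w -> comb s f w = comb_hol s (psum a) (ee w).
Proof. move=> h hs hw; apply: comb_f1 => //; exact: data1_exp. Qed.

Definition cusp_lim (a : nat -> C) (i : cusp) : C :=
  match i with C0 => (2 * sqrt 2 * a 0%nat)%C | _ => RtoC 0 end.

Lemma INR_C (n : nat) : RtoC (INR n) = RtoC (IZR (Z.of_nat n)).
Proof. by rewrite INR_IZR_INZ. Qed.

Lemma data1_cusp a f i (j : Z) : data1 a f -> i <> Cinf ->
  cusplim (fun z => f (cuspmap i (z + IZR j)%C)) (cusp_lim a i).
Proof.
move=> h hi; have hh := data1_hol _ _ h; have [h1 [h2 [h3 _]]] := h.
have [p0 [p1 [p2 p3]]] := sgn_per; have [q0 [q1 [q2 q3]]] := sgn_sums.
have ha := psrep_at0 _ _ h3.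
have hs := sqrt2_C_neq0.
case: i hi => // _.
- have -> : cusp_lim a C0 = comb_hol sgn0 (psum a) 0.
    rewrite comb_hol_0 q0 ha /=.
    have -> : (/ (2 * sqrt 2) * (8 * a 0%nat) = 4 * a 0%nat / sqrt 2)%C by field.
    have -> : (2 * sqrt 2 * a 0%nat = 2 * (sqrt 2 * sqrt 2) * a 0%nat / sqrt 2)%C by field.
    rewrite sqrt2_C; field => //.
  apply: cusplim_ext (cusplim_affine _ 1 (IZR j / 64) _ (hol_comb _ _ hh)) _; first lia.
  move=> z hz; rewrite -(data1_comb a f) //; last by apply: Im_affine => //; lia.
  rewrite /cuspmap val0 ?Im_plus_R //; congr comb.
  rewrite RtoC_div; last lra. rewrite /=; field.
- have -> : cusp_lim a C2 = comb_hol sgn1 (psum a) 0 by rewrite comb_hol_0 q1 /=; ring.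
  apply: cusplim_ext (cusplim_affine _ 4 ((4 * IZR j + 2) / 64) _ (hol_comb _ _ hh)) _; first lia.
  move=> z hz; rewrite -(data1_comb a f) //; last by apply: Im_affine => //; lia.
  rewrite /cuspmap val1 //.
    congr comb; rewrite RtoC_div; last lra. rewrite INR_C RtoC_plus RtoC_mult /=; field.
  by move: hz; rewrite /Im /=; lra.
- have -> : cusp_lim a C4 = comb_hol sgn2 (psum a) 0 by rewrite comb_hol_0 q2 /=; ring.
  apply: cusplim_ext (cusplim_affine _ 16 ((16 * IZR j + 4) / 64) _ (hol_comb _ _ hh)) _; first lia.
  move=> z hz; rewrite -(data1_comb a f) //; last by apply: Im_affine => //; lia.
  rewrite /cuspmap val2 //.
    congr comb; rewrite RtoC_div; last lra. rewrite INR_C RtoC_plus RtoC_mult /=; field.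
  by move: hz; rewrite /Im /=; lra.
Qed.

Lemma data1_coset a f i p q r s : data1 a f -> i <> Cinf -> in_coset i p q r s ->
  exists l, cusplim (fun z => f (moebius p q r s z)) l.
Proof.
move=> h hi [a' [b [c [d [j [h1 [h2 h3]]]]]]].
have [hm _] := h.
eexists; apply: cusplim_ext (cusplim_scal (RtoC (IZR (chi2 d))) _ _ (data1_cusp a f i j h hi)) _.
move=> z hz; rewrite h3 // hm //; apply: cuspmap_H; by rewrite Im_plus_Z.
Qed.

(** a d is 1 modulo 8 and units modulo 8 are their own inverses, so a and d agree modulo 8. *)
Lemma chi2_det (a b c d : Z) : (a * d - b * c = 1)%Z -> (8 | c)%Z -> chi2 a = chi2 d.
Proof.
move=> h [c' hc].
have [m [r [ha hr]]] := Z_mod8 a; have [m' [r' [hd hr']]] := Z_mod8 d.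
rewrite ha hd !chi2_mod.
have : exists x, (Z.of_nat r * Z.of_nat r' = 8 * x + 1)%Z.
  exists (b * c' - 8 * m * m' - m * Z.of_nat r' - m' * Z.of_nat r)%Z; subst; lia.
clear - hr hr'; move: r hr; apply: root8_cases; move: r' hr'; apply: root8_cases => -[x hx] //; exfalso; lia.
Qed.

Lemma chi2_odd_sqr (d : Z) : Z.odd d = true -> (RtoC (IZR (chi2 d)) * RtoC (IZR (chi2 d)) = 1)%C.
Proof.
rewrite /chi2 -Z.negb_even; case: (Z.even d) => // _; case: (_ || _)%bool;
  rewrite -RtoC_mult -mult_IZR //.
Qed.

Lemma det8_odd (a b c d : Z) : (a * d - b * c = 1)%Z -> (8 | c)%Z -> Z.odd d = true.
Proof.
move=> hd [r hr].
rewrite -Z.negb_even; case E: (Z.even d) => //; move/Z.even_spec: E => [m hm].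
exfalso; subst; move: hd.
have -> : (a * (2 * m) - b * (r * 8) = 2 * (a * m - b * (r * 4)))%Z by ring.
lia.
Qed.

(** * The trace of f_1 over the cusp 0 and the Hecke relation *)

Lemma sum8_shift (P : Z -> C) (j : Z) : (forall k, P (k + 8)%Z = P k) ->
  Csum (fun k => P (Z.of_nat k + j)%Z) 7 = Csum (fun k => P (Z.of_nat k)) 7.
Proof.
move=> h.
have hm m k : P (k + 8 * m)%Z = P k.
  move: k; apply: (Z.peano_ind (fun m => forall k, P (k + 8 * m)%Z = P k)) => {m} [k|m IH k|m IH k].
  - by rewrite Z.mul_0_r Z.add_0_r.
  - by rewrite -(IH k) -(h (k + 8 * m)%Z); congr P; lia.
  - by rewrite -(h (k + 8 * Z.pred m)%Z) -(IH k); congr P; lia.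
have [m [r [-> hr]]] := Z_mod8 j.
clear hr; elim: r => [|r IH].
  by apply: Csum_ext => k _; rewrite -[RHS](hm m); congr P; lia.
rewrite -IH !Csum_S !Csum_0.
have e (x y : Z) : (x = y)%Z -> P x = P y by move=> ->.
have -> : P (Z.of_nat 7 + (8 * m + Z.of_nat (S r)))%Z = P (Z.of_nat 0 + (8 * m + Z.of_nat r))%Z.
  rewrite -[RHS]h; apply: e; lia.
rewrite (e (Z.of_nat 0 + (8 * m + Z.of_nat (S r)))%Z (Z.of_nat 1 + (8 * m + Z.of_nat r))%Z); last lia.
rewrite (e (Z.of_nat 1 + (8 * m + Z.of_nat (S r)))%Z (Z.of_nat 2 + (8 * m + Z.of_nat r))%Z); last lia.
rewrite (e (Z.of_nat 2 + (8 * m + Z.of_nat (S r)))%Z (Z.of_nat 3 + (8 * m + Z.of_nat r))%Z); last lia.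
rewrite (e (Z.of_nat 3 + (8 * m + Z.of_nat (S r)))%Z (Z.of_nat 4 + (8 * m + Z.of_nat r))%Z); last lia.
rewrite (e (Z.of_nat 4 + (8 * m + Z.of_nat (S r)))%Z (Z.of_nat 5 + (8 * m + Z.of_nat r))%Z); last lia.
rewrite (e (Z.of_nat 5 + (8 * m + Z.of_nat (S r)))%Z (Z.of_nat 6 + (8 * m + Z.of_nat r))%Z); last lia.
rewrite (e (Z.of_nat 6 + (8 * m + Z.of_nat (S r)))%Z (Z.of_nat 7 + (8 * m + Z.of_nat r))%Z); last lia.
ring.
Qed.

Section Trace.
Variables (f : C -> C) (Hf : modular8 f).

(** The conjugate of f by (0, -1; 1, k). For k modulo 8 these matrices represent the cosets of
    Gamma_0(8) over the cusp 0, whose width is 8. *)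
Definition tr (k : Z) (z : C) : C := f (moebius 0 (-1) 1 k z).

Lemma tr_per k z : 0 < Im z -> tr (k + 8) z = tr k z.
Proof.
move=> hz; rewrite /tr.
have h1 := Hf 1%Z 0%Z (-8)%Z 1%Z ltac:(lia) ltac:(by exists (-1)%Z) _ (moebius_H 0 (-1) 1 k z ltac:(lia) hz).
change (chi2 1) with 1%Z in h1; rewrite Cmult_1_l in h1; rewrite -h1 moebius_comp //; congr f; f_equal; lia.
Qed.

(** Gamma_0(8) permutes the eight conjugates by k -> k + a b, up to the common factor chi2(d); hence
    their sum transforms like f. *)
Lemma tr_equiv (a b c d k : Z) z : (a * d - b * c = 1)%Z -> (8 | c)%Z -> 0 < Im z ->
  tr k (moebius a b c d z) = (RtoC (IZR (chi2 d)) * tr (k + a * b) z)%C.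
Proof.
move=> hd h8 hz; rewrite /tr.
have hA : chi2 (a + k * c) = chi2 d.
  rewrite -(chi2_det a b c d) //; have [c' ->] := h8.
  have -> : (a + k * (c' * 8) = 8 * (k * c') + a)%Z by ring.
  exact: chi2_mod.
set A := (a + k * c)%Z in hA *.
(* Modulo 8 the new index must solve a j = b + k d; since a is its own inverse and a d = 1, this is
   j = k + a b. *)
set j := (k + a * b)%Z.
have hdet : ((- (c * j) + d) * A - (- c) * (A * j - (b + k * d)) = 1)%Z.
  rewrite /A; transitivity (a * d - b * c)%Z => //; ring.
have h8' : (8 | A * j - (b + k * d))%Z.
  have [c' hc] := h8.
  have [m [r [ha hr]]] := Z_mod8 a; have [m' [r' [hd' hr']]] := Z_mod8 d.
  have [x hx] : exists x, (a - d = 8 * x)%Z.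
    have : exists x, (Z.of_nat r * Z.of_nat r' = 8 * x + 1)%Z.
      exists (b * c' - 8 * m * m' - m * Z.of_nat r' - m' * Z.of_nat r)%Z; subst; lia.
    move=> hx; have e : r = r'.
      move: hx; clear - hr hr'; move: r hr; apply: root8_cases; move: r' hr'; apply: root8_cases => -[x hx] //; exfalso; lia.
    exists (m - m')%Z; subst; lia.
  have [y hy] : exists y, (a * a - 1 = 8 * y)%Z.
    exists (b * c' + a * x)%Z.
    have -> : (a * a - 1 = a * (a - d) + (a * d - 1))%Z by ring.
    rewrite hx; have -> : (a * d = 1 + b * c)%Z by lia.
    rewrite hc; ring.
  exists (k * x + b * y + k * c' * j)%Z.
  have -> : (A * j - (b + k * d) = k * (a - d) + b * (a * a - 1) + k * c * j)%Z by rewrite /A /j; ring.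
  rewrite hx hy hc; ring.
have hH := moebius_H 0 (-1) 1 j z ltac:(lia) hz.
have e := Hf _ _ _ _ hdet h8' _ hH; rewrite hA in e; rewrite -e.
rewrite !moebius_comp //; try lia.
congr f; f_equal; rewrite /A; ring.
Qed.
End Trace.

Definition data8 (a : nat -> C) (f : C -> C) :=
  modular8 f /\ plus_eq f /\ qexp_data (RtoC (/ 2)) 8 a f.

Lemma data8_exp a f : data8 a f -> forall z, 0 < Im z ->
  f z = (RtoC (/ 2) * ee (- (8 * z)) + psum a (ee z))%C.
Proof. by move=> [_ [_ [_ h]]] z hz; rewrite h // INR_IZR_INZ. Qed.

Lemma data8_hol a f : data8 a f -> hol (psum a).
Proof. by move=> [_ [_ [h _]]]; exists a. Qed.

Lemma Csum_S_left (a : nat -> C) n : Csum a (S n) = (a 0%nat + Csum (fun k => a (S k)) n)%C.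
Proof. elim: n => [|n IH]; rewrite Csum_S ?Csum_0 // IH Csum_S; ring. Qed.

Lemma cusplim_Csum (g : nat -> C -> C) n : (forall k, (k <= n)%nat -> exists l, cusplim (g k) l) ->
  exists l, cusplim (fun z => Csum (fun k => g k z) n) l.
Proof.
elim: n => [|n IH] h.
  have [l hl] := h 0%nat (le_n _); exists l; apply: cusplim_ext hl _ => z _; by rewrite Csum_0.
have [|l hl] := IH; first by move=> k hk; apply: h; lia.
have [m hm] := h (S n) (le_n _).
exists (l + m)%C; apply: cusplim_ext (cusplim_plus _ _ _ _ hl hm) _ => z _; by rewrite Csum_S.
Qed.

Section Hecke.
Variables (f1 f8 : C -> C) (a1 a8 : nat -> C) (H1 : data1 a1 f1) (H8 : data8 a8 f8).
Let M1 : modular8 f1. Proof. by case: H1. Qed.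
Let M8 : modular8 f8. Proof. by case: H8. Qed.
Let Q8 : plus_eq f8. Proof. by case: H8 => _ []. Qed.
Let Q1 : plus_eq f1. Proof. by case: H1 => _ []. Qed.

(* hk = 0 is a Hecke relation: it recovers f_8 from the translates of f_1. *)
Definition hk (z : C) : C := (/ (2 * sqrt 2) * f8 (- (1) / (8 * z)) - / 2 * f1 z
  - / (4 * sqrt 2) * Csum (fun k => tr f1 (Z.of_nat k) z) 7)%C.

Lemma Im_8z (z : C) : 0 < Im z -> 0 < Im (8 * z).
Proof. by rewrite /Im /=; lra. Qed.

(** The Fricke involution z -> -1/(8 z) normalises Gamma_0(8) and exchanges a and d, on which chi2
    agrees. *)
Lemma f8_W_equiv a b c d z : (a * d - b * c = 1)%Z -> (8 | c)%Z -> 0 < Im z ->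
  f8 (- (1) / (8 * moebius a b c d z))%C = (RtoC (IZR (chi2 d)) * f8 (- (1) / (8 * z)))%C.
Proof.
move=> hd h8 hz; have [c' hc] := h8.
have hz8 : 0 < Im (- (1) / (8 * z))%C by exact: (cuspmap_H C0 _ (Im_8z z hz)).
have hm := M8 d (- c')%Z (- 8 * b)%Z a ltac:(lia) ltac:(by exists (- b)%Z; lia) _ hz8.
rewrite (chi2_det a b c d) // in hm; rewrite -hm; congr f8.
have n1 := den_neq0 c d z (det_cd _ _ _ _ hd) hz.
have n2 : (RtoC (IZR a) * z + RtoC (IZR b))%C <> 0.
  apply: den_neq0 hz; case: (Z.eq_dec a 0) => ha; [right|left]; lia.
have n0 := Im_neq0 z hz.
have e1 : RtoC (IZR c) = (8 * RtoC (IZR c'))%C by rewrite -RtoC_mult -mult_IZR; congr RtoC; congr IZR; lia.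
have e2 : RtoC (IZR (- 8 * b)) = (- 8 * RtoC (IZR b))%C by rewrite -RtoC_mult -mult_IZR.
have e3 : RtoC (IZR (- c')) = (- RtoC (IZR c'))%C by rewrite opp_IZR RtoC_opp.
rewrite /moebius e1 e2 e3; rewrite e1 in n1.
have n3 : (- 8 * IZR b * - (1) + IZR a * (8 * z))%C <> 0.
  have -> : (- 8 * IZR b * - (1) + IZR a * (8 * z) = 8 * (IZR a * z + IZR b))%C by ring.
  move=> /Cmult_eq_0_r h; apply: n2; apply: h => -[] hh; lra.
field; repeat split => //.
- move=> e; apply: n3; rewrite -e; ring.
Qed.

Lemma hk_equiv a b c d z : (a * d - b * c = 1)%Z -> (8 | c)%Z -> 0 < Im z ->
  hk (moebius a b c d z) = (RtoC (IZR (chi2 d)) * hk z)%C.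
Proof.
move=> hd h8 hz; rewrite /hk f8_W_equiv // M1 //.
rewrite (Csum_ext _ (fun k => RtoC (IZR (chi2 d)) * tr f1 (Z.of_nat k + a * b) z)%C); last first.
  by move=> k _; rewrite (tr_equiv f1 M1 a b c d).
rewrite Csum_scal (sum8_shift (fun k => tr f1 k z)); last by move=> k; exact: tr_per.
ring.
Qed.

Lemma Cmod_chi_odd d : Z.odd d = true -> Cmod (RtoC (IZR (chi2 d))) = 1.
Proof.
move=> h; have e := f_equal Cmod (chi2_odd_sqr d h); move: e.
rewrite Cmod_mult !Cmod_R Rabs_R1; have := Rabs_pos (IZR (chi2 d)); nra.
Qed.

Lemma hk_abs : Gamma0_8_abs hk.
Proof.
move=> a b c d hd h8 z hz; rewrite hk_equiv // Cmod_mult Cmod_chi_odd ?Rmult_1_l //.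
exact: (det8_odd a b c d).
Qed.

(** The normalisation of [hk]: at infinity the pole of f_8(-1/(8 z)) at its cusp 0 must cancel that
    of f_1 / 2. *)
Lemma sqrt2_quot : (/ (2 * sqrt 2) * (/ (2 * sqrt 2) * RtoC (/ 2) * 8) = / 2)%C.
Proof.
have hs := sqrt2_C_neq0; rewrite RtoC_inv; last lra.
have -> : (/ (2 * sqrt 2) * (/ (2 * sqrt 2) * / 2 * 8) = / (sqrt 2 * sqrt 2))%C by field.
by rewrite sqrt2_C.
Qed.

Lemma tr_C0 k z : 0 < Im z -> tr f1 k (cuspmap C0 z) = f1 (moebius (-1) 0 k (-1) z).
Proof.
move=> hz; rewrite -cuspmap0 /tr moebius_comp //.
by congr f1; f_equal; ring.
Qed.

Lemma hk_inf : exists l, cusplim (fun z => hk (cuspmap Cinf z)) l.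
Proof.
have [l hl] : exists l, cusplim (fun z => Csum (fun k => tr f1 (Z.of_nat k) z) 7) l.
  apply: cusplim_Csum => k hk; apply: (data1_coset a1 f1 C0) => //.
  by apply: coset_odd => //; exists 0%Z.
have h8 := cusplim_affine _ 8 0 ltac:(lia) (hol_comb sgn0 _ (data8_hol _ _ H8)).
have h1 := cusplim_affine _ 64 0 ltac:(lia) (data1_hol _ _ H1).
eexists; apply: cusplim_ext (cusplim_minus _ _ _ _ (cusplim_minus _ _ _ _
  (cusplim_scal (/ (2 * sqrt 2))%C _ _ h8) (cusplim_scal (/ 2)%C _ _ h1))
  (cusplim_scal (/ (4 * sqrt 2))%C _ _ hl)) _ => z hz.
rewrite /cuspmap /hk; congr Cminus.
have e8 : (RtoC (INR 8) * (z / 64) + 0 = 8 * z / 64)%C by rewrite INR_C /=; field.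
have e1 : (RtoC (INR 64) * (z / 64) + 0 = z)%C by rewrite INR_C /=; field.
rewrite e8 e1 (val0 f8) //; last exact: Im_8z.
have hw : 0 < Im (8 * z / 64) by rewrite Im_div64; have := Im_8z z hz; lra.
rewrite (comb_f8 _ _ _ _ _ (data8_exp _ _ H8)) // (proj1 sgn_sums) (data1_exp a1 f1 H1 z) //.
have -> : (8 * (8 * z / 64) = z)%C by field.
set A := comb_hol _ _ _; set B := psum _ _; set E := ee (- z).
have -> : (/ (2 * sqrt 2) * (/ (2 * sqrt 2) * RtoC (/ 2) * E * 8 + A) - / 2 * (E + B) =
   / (2 * sqrt 2) * (/ (2 * sqrt 2) * RtoC (/ 2) * 8) * E + / (2 * sqrt 2) * A - / 2 * (E + B))%C by ring.
rewrite sqrt2_quot; ring.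
Qed.

(** Seen from the cusp 0, only the conjugate with k = 0 returns to infinity. Its pole, with factor
    1/(4 sqrt 2), cancels that of f_8(z/8) with factor 1/(2 sqrt 2) times 1/2. *)
Lemma hk_0 : exists l, cusplim (fun z => hk (cuspmap C0 z)) l.
Proof.
have [l hl] : exists l, cusplim (fun z => Csum (fun k => f1 (moebius (-1) 0 (Z.of_nat (S k)) (-1) z)) 6) l.
  apply: cusplim_Csum => k hk.
  have [i [hi hc]] : exists i, i <> Cinf /\ in_coset i (-1) 0 (Z.of_nat (S k)) (-1).
    have hk' : (k < 7)%nat by lia.
    clear hk; case: k hk' => [|[|[|[|[|[|[|k]]]]]]] hk'.
    - by exists C0; split=> //; apply: coset_odd => //; exists 0%Z.
    - by exists C2; split=> //; apply: coset_2 => //; exists 1%Z; split=> //; exists 0%Z.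
    - by exists C0; split=> //; apply: coset_odd => //; exists 1%Z.
    - by exists C4; split=> //; apply: coset_4 => //; exists 1%Z; split=> //; exists 0%Z.
    - by exists C0; split=> //; apply: coset_odd => //; exists 2%Z.
    - by exists C2; split=> //; apply: coset_2 => //; exists 3%Z; split=> //; exists 1%Z.
    - by exists C0; split=> //; apply: coset_odd => //; exists 3%Z.
    - lia.
  exact: (data1_coset a1 f1 i).
have h8 := cusplim_affine _ 8 0 ltac:(lia) (data8_hol _ _ H8).
have h1 := cusplim_affine _ 64 0 ltac:(lia) (data1_hol _ _ H1).
have h0 := data1_cusp a1 f1 C0 0 H1 ltac:(by []).
eexists; apply: cusplim_ext (cusplim_minus _ _ _ _ (cusplim_minus _ _ _ _
  (cusplim_scal (/ (2 * sqrt 2))%C _ _ h8) (cusplim_scal (/ 2)%C _ _ h0))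
  (cusplim_scal (/ (4 * sqrt 2))%C _ _ (cusplim_plus _ _ _ _ h1 hl))) _ => z hz.
rewrite /hk [in RHS]Csum_S_left; cbv beta; rewrite tr_C0 //.
rewrite (Csum_ext (fun k => tr f1 (Z.of_nat (S k)) (cuspmap C0 z))
   (fun k => f1 (moebius (-1) 0 (Z.of_nat (S k)) (-1) z))); last by move=> k _; exact: tr_C0.
have hn := Im_neq0 z hz.
have -> : (- (1) / (8 * cuspmap C0 z) = z / 8)%C by rewrite /cuspmap; field.
have -> : moebius (-1) 0 (Z.of_nat 0) (-1) z = z by rewrite /moebius; field.
have e8 : (RtoC (INR 8) * (z / 64) + 0 = z / 8)%C by rewrite INR_C /=; field.
have e1 : (RtoC (INR 64) * (z / 64) + 0 = z)%C by rewrite INR_C /=; field.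
have hz8 : 0 < Im (z / 8) by move: hz; rewrite /Im /=; lra.
rewrite e8 e1 (data8_exp a8 f8) // (data1_exp a1 f1 H1 z) //.
have -> : (8 * (z / 8) = z)%C by field.
rewrite Cplus_0_r.
have hs := sqrt2_C_neq0.
rewrite RtoC_inv; last lra. field => //.
Qed.

Lemma f8_per j z : 0 < Im z -> f8 (z + IZR j)%C = f8 z.
Proof. exact: f_per_Z. Qed.

(** No pole occurs here: all conjugates of f_1 now lie over the cusp 0, and f_8 is evaluated near
    3/4, where its signs add up to 0. The cusp 1/4 is similar, with f_8 evaluated near 1/2. *)
Lemma hk_2 : exists l, cusplim (fun z => hk (cuspmap C2 z)) l.
Proof.
have [l hl] : exists l, cusplim (fun z => Csum (fun k => f1 (moebius (-2) (-1) (1 + 2 * Z.of_nat k) (Z.of_nat k) z)) 7) l.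
  apply: cusplim_Csum => k hk; apply: (data1_coset a1 f1 C0) => //.
  by apply: coset_odd; [lia|exists (Z.of_nat k); lia].
have h8 := cusplim_affine _ 8 0 ltac:(lia) (hol_comb sgn3 _ (data8_hol _ _ H8)).
have h0 := data1_cusp a1 f1 C2 0 H1 ltac:(by []).
eexists; apply: cusplim_ext (cusplim_minus _ _ _ _ (cusplim_minus _ _ _ _
  (cusplim_scal (/ (2 * sqrt 2))%C _ _ h8) (cusplim_scal (/ 2)%C _ _ h0))
  (cusplim_scal (/ (4 * sqrt 2))%C _ _ hl)) _ => z hz.
rewrite /hk.
rewrite (Csum_ext (fun k => tr f1 (Z.of_nat k) (cuspmap C2 z))
   (fun k => f1 (moebius (-2) (-1) (1 + 2 * Z.of_nat k) (Z.of_nat k) z))); last first.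
  move=> k _; rewrite -cuspmap2 // /tr moebius_comp //; congr f1; f_equal; ring.
congr Cminus; congr Cminus; last by rewrite Cplus_0_r.
congr Cmult.
have hn := Im_neq0 z hz; have n2 := four_z_2 z hz; have n1 := den_neq0 2 1 z ltac:(lia) hz.
have h3 := C2_neq0.
have -> : (- (1) / (8 * cuspmap C2 z) = 3 / 4 - 1 / (8 * z) + IZR (-1))%C.
  rewrite -cuspmap2 // /moebius; field; repeat split=> //.
have hw : 0 < Im (8 * z / 64) by rewrite Im_div64; have := Im_8z z hz; lra.
rewrite f8_per; last first.
  have -> : (3 / 4 - 1 / (8 * z) = - (1) / (64 * (z / 8)) + RtoC (3 / 4))%C.
    rewrite RtoC_div; last lra. field => //.
  rewrite Im_plus_R; apply: Im_inv64; move: hz; rewrite /Im /=; lra.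
rewrite (val3 f8) //; last exact: Im_8z.
rewrite (comb_f8 _ _ _ _ _ (data8_exp _ _ H8)) // (proj2 (proj2 (proj2 sgn_sums))).
have e8 : (RtoC (INR 8) * (z / 64) + 0 = 8 * z / 64)%C by rewrite INR_C /=; field.
rewrite e8; ring.
Qed.

Lemma hk_4 : exists l, cusplim (fun z => hk (cuspmap C4 z)) l.
Proof.
have [l hl] : exists l, cusplim (fun z => Csum (fun k => f1 (moebius (-4) (-1) (1 + 4 * Z.of_nat k) (Z.of_nat k) z)) 7) l.
  apply: cusplim_Csum => k hk; apply: (data1_coset a1 f1 C0) => //.
  by apply: coset_odd; [lia|exists (2 * Z.of_nat k)%Z; lia].
have h8 := cusplim_affine _ 8 0 ltac:(lia) (hol_comb sgn1 _ (data8_hol _ _ H8)).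
have h0 := data1_cusp a1 f1 C4 0 H1 ltac:(by []).
eexists; apply: cusplim_ext (cusplim_minus _ _ _ _ (cusplim_minus _ _ _ _
  (cusplim_scal (/ (2 * sqrt 2))%C _ _ h8) (cusplim_scal (/ 2)%C _ _ h0))
  (cusplim_scal (/ (4 * sqrt 2))%C _ _ hl)) _ => z hz.
rewrite /hk.
rewrite (Csum_ext (fun k => tr f1 (Z.of_nat k) (cuspmap C4 z))
   (fun k => f1 (moebius (-4) (-1) (1 + 4 * Z.of_nat k) (Z.of_nat k) z))); last first.
  move=> k _; rewrite -cuspmap4 // /tr moebius_comp //; congr f1; f_equal; ring.
congr Cminus; congr Cminus; last by rewrite Cplus_0_r.
congr Cmult.
have hn := Im_neq0 z hz; have n1 := den_neq0 4 1 z ltac:(lia) hz.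
have h3 := C4_neq0; have h2 := C2_neq0.
have -> : (- (1) / (8 * cuspmap C4 z) = 1 / 2 - 1 / (8 * z) + IZR (-1))%C.
  rewrite -cuspmap4 // /moebius; field; repeat split=> //.
have hw : 0 < Im (8 * z / 64) by rewrite Im_div64; have := Im_8z z hz; lra.
rewrite f8_per; last first.
  have -> : (1 / 2 - 1 / (8 * z) = - (1) / (64 * (z / 8)) + RtoC (1 / 2))%C.
    rewrite RtoC_div; last lra. field => //.
  rewrite Im_plus_R; apply: Im_inv64; move: hz; rewrite /Im /=; lra.
rewrite (val1 f8) //; last exact: Im_8z.
rewrite (comb_f8 _ _ _ _ _ (data8_exp _ _ H8)) // (proj1 (proj2 sgn_sums)).
have e8 : (RtoC (INR 8) * (z / 64) + 0 = 8 * z / 64)%C by rewrite INR_C /=; field.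
rewrite e8; ring.
Qed.

(** A nonzero constant is incompatible with the character: the matrix (3, 1; 8, 3) has chi2(3) =
    -1. *)
Lemma hk_zero z : 0 < Im z -> hk z = 0.
Proof.
have [|c [hc _]] := liouville8 hk hk_abs.
  by case; [exact: hk_inf|exact: hk_0|exact: hk_2|exact: hk_4].
move=> hz.
have h := hk_equiv 3 1 8 3 z ltac:(lia) ltac:(by exists 1%Z) hz.
rewrite !hc // in h; last exact: moebius_H.
rewrite chi2_vals in h.
have e : (2 * c = 0)%C.
  transitivity (c - -1 * c)%C; first ring. rewrite -h; ring.
rewrite hc //; apply: (Cmult_eq_0_r 2) => //; exact: C2_neq0.
Qed.

End Hecke.

(** * The Hecke relation between coefficients *)

(** The finite Fourier transform of the sign pattern: the factor by which [comb_hol] multiplies the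
    n-th coefficient. *)
Definition cb (s : nat -> R) (n : nat) : C :=
  (/ (2 * sqrt 2) * Csum (fun k => RtoC (s k) * z8 ^ (k * n)) 7)%C.

Lemma psrep_plus b c phi psi : psrep b phi -> psrep c psi ->
  psrep (fun n => b n + c n)%C (fun s => phi s + psi s)%C.
Proof.
move=> hb hc s hs; apply: Cseries_ext (Cseries_plus _ _ _ _ (hb s hs) (hc s hs)) => n /=; ring.
Qed.

Lemma psrep_scal c b phi : psrep b phi -> psrep (fun n => c * b n)%C (fun s => c * phi s)%C.
Proof.
move=> hb s hs; apply: Cseries_ext (Cseries_scal c _ _ (hb s hs)) => n /=; ring.
Qed.

Lemma psrep_rot c b phi : Cmod c <= 1 -> psrep b phi ->
  psrep (fun n => b n * c ^ n)%C (fun s => phi (c * s)%C).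
Proof.
move=> hc h s hs.
have hs' : Cmod (c * s)%C < 1.
  rewrite Cmod_mult; have := Cmod_ge_0 s; have := Cmod_ge_0 c; nra.
by apply: Cseries_ext (h _ hs') => n; rewrite Cpow_mult_l; ring.
Qed.

Lemma psrep_Csum (b : nat -> nat -> C) (g : nat -> C -> C) n : (forall k, psrep (b k) (g k)) ->
  psrep (fun j => Csum (fun k => b k j) n) (fun s => Csum (fun k => g k s) n).
Proof.
move=> h; elim: n => [|n IH].
  by move=> s hs; rewrite Csum_0; apply: Cseries_ext (h 0%nat s hs) => j; rewrite Csum_0.
move=> s hs; rewrite Csum_S.
apply: Cseries_ext (psrep_plus _ _ _ _ IH (h (S n)) s hs) => j; by rewrite Csum_S.
Qed.

Lemma psrep_comb a ft s : psrep a ft -> psrep (fun n => cb s n * a n)%C (comb_hol s ft).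
Proof.
move=> h.
have h1 k : psrep (fun n => RtoC (s k) * (a n * (z8 ^ k) ^ n))%C (fun x => RtoC (s k) * ft (z8 ^ k * x))%C.
  by apply: psrep_scal; apply: psrep_rot => //; rewrite Cmod_z8_pow; lra.
apply: psrep_ext_b (psrep_scal (/ (2 * sqrt 2))%C _ _ (psrep_Csum _ _ 7 h1)) _ => n.
rewrite /cb -Cmult_assoc; congr Cmult; rewrite Cmult_comm -Csum_scal; apply: Csum_ext => k _.
rewrite Cpow_mult_r; ring.
Qed.

Lemma cb_mod s n : cb s n = cb s (n mod 8).
Proof.
rewrite /cb; congr Cmult; apply: Csum_ext => k _; congr Cmult.
rewrite (z8_pow_mod (k * n)) (z8_pow_mod (k * (n mod 8))); congr Cpow.
by rewrite Nat.Div0.mul_mod_idemp_r.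
Qed.

Lemma cb_0 : cb sgn0 0 = (2 * sqrt 2)%C.
Proof.
rewrite /cb !Csum_S Csum_0 /sgn0 /sgn_list /=.
have hs := sqrt2_C_neq0.
transitivity (4 / sqrt 2)%C; first by field.
have -> : RtoC 4 = (2 * (sqrt 2 * sqrt 2))%C by rewrite sqrt2_C; ring.
by field.
Qed.

Ltac z8red := rewrite ?(z8_pow_mod (_ * _));
  cbv [Nat.modulo Nat.mul Nat.add Nat.divmod Nat.sub Init.Nat.modulo Init.Nat.mul
       Init.Nat.add Init.Nat.divmod Init.Nat.sub fst snd].

Lemma cb_1_even n : (n < 8)%nat -> n <> 4%nat -> (n mod 2 = 0)%nat -> cb sgn1 n = 0.
Proof.
have [e2 [e3 [e5 [e6 e7]]]] := z8_pows.
move: n; apply: root8_cases => // _ _; rewrite /cb !Csum_S Csum_0 /sgn1 /sgn_list; cbn [nth]; z8red;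
  rewrite ?Cpow_1_r ?e2 ?e3 ?e5 ?e6 ?e7 ?z8_pow4;
  change (z8 ^ 0)%C with (RtoC 1); ring.
Qed.

Lemma cb_1_4 : cb sgn1 4 = (2 * sqrt 2)%C.
Proof.
rewrite -cb_0 /cb !Csum_S !Csum_0 /sgn0 /sgn1 /sgn_list; cbn [nth]; z8red;
  rewrite z8_pow4; change (z8 ^ 0)%C with (RtoC 1); congr Cmult; ring.
Qed.

Lemma z8_sqrt2 : (z8 * sqrt 2 = 1 + Ci)%C.
Proof.
rewrite -z8_add_inv.
have -> : (z8 * (z8 - z8 * z8 * z8) = z8 * z8 - (z8 * z8) * (z8 * z8))%C by ring.
rewrite z8_sqr Ci_sqr; ring.
Qed.

Lemma cb_3_2 : cb sgn3 2 = (2 * z8)%C.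
Proof.
have hs := sqrt2_C_neq0; have [e2 [_ [_ [e6 _]]]] := z8_pows.
rewrite /cb !Csum_S !Csum_0 /sgn3 /sgn_list; cbn [nth]; z8red.
rewrite e2 e6 z8_pow4; change (z8 ^ 0)%C with (RtoC 1).
transitivity (2 * (1 + Ci) / sqrt 2)%C; first by field.
rewrite -z8_sqrt2; by field.
Qed.

Lemma cb_3_6 : cb sgn3 6 = (- (2 * z8 ^ 3))%C.
Proof.
have hs := sqrt2_C_neq0; have [e2 [_ [_ [e6 _]]]] := z8_pows.
rewrite /cb !Csum_S !Csum_0 /sgn3 /sgn_list; cbn [nth]; z8red.
rewrite e2 e6 z8_pow4; change (z8 ^ 0)%C with (RtoC 1).
transitivity (- (2 * (Ci * (1 + Ci)) / sqrt 2))%C.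
  have -> : (Ci * (1 + Ci) = Ci + Ci * Ci)%C by ring.
  rewrite Ci_sqr; by field.
have -> : (z8 ^ 3 = (z8 * z8) * z8)%C by ring.
rewrite -z8_sqrt2 z8_sqr; by field.
Qed.

Lemma cb_3_other n : (n < 8)%nat -> n <> 2%nat -> n <> 6%nat -> cb sgn3 n = 0.
Proof.
have [e2 [e3 [e5 [e6 e7]]]] := z8_pows.
move: n; apply: root8_cases => // _ _; rewrite /cb !Csum_S Csum_0 /sgn3 /sgn_list; cbn [nth]; z8red;
  rewrite ?Cpow_1_r ?e2 ?e3 ?e5 ?e6 ?e7 ?z8_pow4;
  change (z8 ^ 0)%C with (RtoC 1); ring.
Qed.

Lemma hecke_solve (X A T : C) :
  (/ (2 * sqrt 2) * X - / 2 * A - / (4 * sqrt 2) * T = 0)%C -> X = (sqrt 2 * A + / 2 * T)%C.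
Proof.
move=> h; have hs := sqrt2_C_neq0.
transitivity (2 * sqrt 2 * (/ (2 * sqrt 2) * X - / 2 * A - / (4 * sqrt 2) * T) + sqrt 2 * A + / 2 * T)%C.
  by field.
rewrite h; ring.
Qed.

Section HeckeCoeff.
Variables (f1 f8 : C -> C) (a1 a8 : nat -> C) (H1 : data1 a1 f1) (H8 : data8 a8 f8).
Let M1 : modular8 f1. Proof. by case: H1. Qed.
Let Q1 : plus_eq f1. Proof. by case: H1 => _ []. Qed.
Let F s := comb_hol s (psum a1).

(** For odd k the matrix (k, -1; 1 - k^2, k) lies in Gamma_0(8) and moves the conjugate back to the
    cusp 0, at the point z - k. *)
Lemma tr_odd (k b : Z) z : (k * k - 1 = 8 * b)%Z -> 0 < Im z ->
  tr f1 k (cuspmap C0 z) = (RtoC (IZR (chi2 k)) * F sgn0 (ee (z / 64 + RtoC (IZR (- k) / 64))))%C.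
Proof.
move=> hb hz; rewrite (tr_C0 f1) //.
have hw : 0 < Im (z + IZR (- k))%C by rewrite Im_plus_Z.
have hx : 0 < Im (- (1) / (z + IZR (- k)))%C by exact: (cuspmap_H C0 _ hw).
have hm := M1 k (-1)%Z (1 - k * k)%Z k ltac:(lia) ltac:(by exists (- b)%Z; lia) _ hx.
have -> : moebius (-1) 0 k (-1) z = moebius k (-1) (1 - k * k) k (- (1) / (z + IZR (- k))).
  have n1 := Im_neq0 _ hw; have n2 := den_neq0 k (-1) z ltac:(lia) hz.
  move: n1; rewrite /moebius minus_IZR mult_IZR opp_IZR RtoC_minus RtoC_mult RtoC_opp => n1.
  field; repeat split=> //.
  move=> e; apply: n2; rewrite -e; ring.
rewrite hm (val0 f1) //; congr Cmult.
rewrite (data1_comb a1 f1 _ _ H1) //; first last.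
- by rewrite Im_div64; lra.
- exact: (proj1 sgn_per).
rewrite /F; congr comb_hol; congr ee.
rewrite RtoC_div; last lra. field.
Qed.

(** This is [hk] = 0 at -1/z, where f_8 appears at z/8. The conjugates are sorted by the gcd of k
    and 8: k = 0 gives infinity, odd k the cusp 0, k = 2 and 6 the cusp 1/2, k = 4 the cusp 1/4. *)
Lemma f8_formula z : 0 < Im z ->
  f8 (z / 8)%C = (sqrt 2 * F sgn0 (ee (z / 64)) + / 2 * (f1 z
   + F sgn0 (ee (z / 64 + RtoC (- 1 / 64))) - F sgn0 (ee (z / 64 + RtoC (- 3 / 64)))
   - F sgn0 (ee (z / 64 + RtoC (- 5 / 64))) + F sgn0 (ee (z / 64 + RtoC (- 7 / 64)))
   + F sgn1 (ee (4 * (z / 64) + RtoC (- 2 / 64))) + F sgn1 (ee (4 * (z / 64) + RtoC (2 / 64)))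
   + F sgn3 (ee (16 * (z / 64) + RtoC (- 4 / 64)))))%C.
Proof.
move=> hz; have hs := sqrt2_C_neq0.
have hH := cuspmap_H C0 z hz.
have h0 := hk_zero f1 f8 a1 a8 H1 H8 _ hH; move: h0.
rewrite /hk !Csum_S Csum_0.
rewrite (tr_odd 1 0) // (tr_odd 3 1) // (tr_odd 5 3) // (tr_odd 7 6) // !chi2_vals.
have n0 := Im_neq0 z hz.
have e8 : (- (1) / (8 * cuspmap C0 z) = z / 8)%C by rewrite /cuspmap; field.
have e1 : f1 (cuspmap C0 z) = F sgn0 (ee (z / 64)).
  rewrite /cuspmap (val0 f1) // (data1_comb a1 f1 _ _ H1) //; first exact: (proj1 sgn_per).
  rewrite Im_div64; lra.
have t0 : tr f1 (Z.of_nat 0) (cuspmap C0 z) = f1 z.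
  by rewrite (tr_C0 f1) //; congr f1; rewrite /moebius; field.
have h2 := C2_neq0; have h4 := C4_neq0.
have hm2 : 0 < Im (4 * z + IZR (-2))%C by rewrite Im_plus_Z; move: hz; rewrite /Im /=; lra.
have hp2 : 0 < Im (4 * z + IZR 2)%C by rewrite Im_plus_Z; move: hz; rewrite /Im /=; lra.
have hm4 : 0 < Im (16 * z + IZR (-4))%C by rewrite Im_plus_Z; move: hz; rewrite /Im /=; lra.
have pos (x : C) (y : R) : 0 < Im x -> 0 < Im (RtoC y - 1 / x)%C.
  move=> hx; have := cuspmap_H C0 x hx; rewrite /cuspmap => h.
  have -> : (y - 1 / x = - (1) / x + y)%C by rewrite /Cdiv; ring.
  by rewrite Im_plus_R.
have t2 : tr f1 (Z.of_nat 2) (cuspmap C0 z) = F sgn1 (ee (4 * (z / 64) + RtoC (- 2 / 64))).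
  rewrite (tr_C0 f1) //.
  have -> : moebius (-1) 0 (Z.of_nat 2) (-1) z = (1 / 2 - 1 / (4 * z + IZR (-2)) + IZR (-1))%C.
    have n1 := Im_neq0 _ hm2; have n2 := den_neq0 2 (-1) z ltac:(lia) hz.
    rewrite /moebius; field; repeat split=> //.
  have hp := pos (4 * z + IZR (-2))%C (1 / 2)%R hm2.
  rewrite RtoC_div in hp; last lra.
  rewrite (f_per_Z f1) // (val1 f1) // (data1_comb a1 f1 _ _ H1) //; first last.
  - by rewrite Im_div64; lra.
  - exact: (proj1 (proj2 sgn_per)).
  rewrite /F; congr comb_hol; congr ee; rewrite RtoC_div; last lra.
  rewrite -[(-2)%R]/(IZR (-2)); field.
have t6 : tr f1 (Z.of_nat 6) (cuspmap C0 z) = F sgn1 (ee (4 * (z / 64) + RtoC (2 / 64))).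
  have -> : Z.of_nat 6 = (-2 + 8)%Z by [].
  rewrite tr_per // (tr_C0 f1) //.
  have -> : moebius (-1) 0 (-2) (-1) z = (1 / 2 - 1 / (4 * z + IZR 2))%C.
    have n1 := Im_neq0 _ hp2; have n2 := den_neq0 (-2) (-1) z ltac:(lia) hz.
    rewrite /moebius; field; repeat split=> //.
  rewrite (val1 f1) // (data1_comb a1 f1 _ _ H1) //; first last.
  - by rewrite Im_div64; lra.
  - exact: (proj1 (proj2 sgn_per)).
  rewrite /F; congr comb_hol; congr ee; rewrite RtoC_div; last lra. field.
have t4 : tr f1 (Z.of_nat 4) (cuspmap C0 z) = F sgn3 (ee (16 * (z / 64) + RtoC (- 4 / 64))).
  rewrite (tr_C0 f1) //.
  have -> : moebius (-1) 0 (Z.of_nat 4) (-1) z = (3 / 4 - 1 / (16 * z + IZR (-4)) + IZR (-1))%C.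
    have n1 := Im_neq0 _ hm4; have n2 := den_neq0 4 (-1) z ltac:(lia) hz.
    rewrite /moebius; field; repeat split=> //.
  have hp := pos (16 * z + IZR (-4))%C (3 / 4)%R hm4.
  rewrite RtoC_div in hp; last lra.
  rewrite (f_per_Z f1) // (val3 f1) // (data1_comb a1 f1 _ _ H1) //; first last.
  - by rewrite Im_div64; lra.
  - exact: (proj2 (proj2 (proj2 sgn_per))).
  rewrite /F; congr comb_hol; congr ee; rewrite RtoC_div; last lra.
  rewrite -[(-4)%R]/(IZR (-4)); field.
rewrite t0 t2 t4 t6 e8 e1.
move=> h0.
rewrite (hecke_solve _ _ _ h0); cbn [Z.opp]; ring.
Qed.

Lemma a8_formula_raw n : a8 n = (4 * a1 (8 * n)%nat + / 2 * (spread 64 a1 (8 * n)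
   + 2 * sqrt 2 * a1 (8 * n)%nat * (ee (RtoC (- 1 / 64)) ^ (8 * n) - ee (RtoC (- 3 / 64)) ^ (8 * n)
       - ee (RtoC (- 5 / 64)) ^ (8 * n) + ee (RtoC (- 7 / 64)) ^ (8 * n))
   + cb sgn1 (2 * n) * a1 (2 * n)%nat * (ee (RtoC (- 2 / 64)) ^ (2 * n) + ee (RtoC (2 / 64)) ^ (2 * n))
   + spread 16 (fun m => cb sgn3 m * a1 m * ee (RtoC (- 4 / 64)) ^ m) (8 * n)))%C.
Proof.
have [h11 h12] := proj2 (proj2 H1); have [h81 h82] := proj2 (proj2 H8).
have hr (x : R) : Cmod (ee x) <= 1 by rewrite Cmod_ee im_RtoC Rmult_0_r Ropp_0 exp_0; lra.
have p0 := psrep_comb _ _ sgn0 h11.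
have p1 := psrep_comb _ _ sgn1 h11.
have p3 := psrep_comb _ _ sgn3 h11.
have r0 x := psrep_rot _ _ _ (hr x) p0.
have r1 x := psrep_comp_pow 4 _ _ ltac:(lia) (psrep_rot _ _ _ (hr x) p1).
have r3 x := psrep_comp_pow 16 _ _ ltac:(lia) (psrep_rot _ _ _ (hr x) p3).
have r64 := psrep_comp_pow 64 _ _ ltac:(lia) h11.
have L := psrep_comp_pow 8 _ _ ltac:(lia) h81.
have R := psrep_plus _ _ _ _ (psrep_scal (sqrt 2) _ _ p0) (psrep_scal (/ 2)%C _ _
 (psrep_plus _ _ _ _ (psrep_plus _ _ _ _ (psrep_plus _ _ _ _ (psrep_plus _ _ _ _ (psrep_plus _ _ _ _
 (psrep_plus _ _ _ _ (psrep_plus _ _ _ _ r64 (r0 (- 1 / 64))) (psrep_scal (- (1))%C _ _ (r0 (- 3 / 64))))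
   (psrep_scal (- (1))%C _ _ (r0 (- 5 / 64)))) (r0 (- 7 / 64)))
   (r1 (- 2 / 64))) (r1 (2 / 64))) (r3 (- 4 / 64)))).
(* In the variable x = e(z/64), f_8(z/8) is a series in x^8, so a_8(n) is read off at the exponent 8
   n. *)
move: (fun h => psrep_unique _ _ _ _ 1 L R Rlt_0_1 h (8 * n)%nat).
match goal with |- (?P -> _) -> _ => have hP : P end.
  move=> x hx.
  have hx0 : RtoC x <> 0 by move=> [] hh; lra.
  have hx1 : Cmod x < 1 by rewrite Cmod_R Rabs_pos_eq; lra.
  have [z [hz1 hz2]] := ee_64_surj x hx0 hx1.
  have hf := f8_formula z hz1.
  have hz8 : 0 < Im (z / 8) by move: hz1; rewrite /Im /=; lra.
  rewrite (data8_exp a8 f8) // (data1_exp a1 f1 H1 z) // in hf.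
  have e8 : ee (z / 8) = (RtoC x ^ 8)%C.
    rewrite -hz2 -ee_pow; congr ee; rewrite INR_C /=; field.
  have e64 : ee z = (RtoC x ^ 64)%C.
    rewrite -hz2 -ee_pow; congr ee; rewrite INR_C /=; field.
  have e4 : ee (4 * (z / 64)) = (RtoC x ^ 4)%C.
    rewrite -hz2 -ee_pow; congr ee; rewrite INR_C /=; field.
  have e16 : ee (16 * (z / 64)) = (RtoC x ^ 16)%C.
    rewrite -hz2 -ee_pow; congr ee; rewrite INR_C /=; field.
  have ez : (8 * (z / 8) = z)%C by field.
  rewrite !ee_plus e8 e64 e4 e16 hz2 ez in hf.
  rewrite !(Cmult_comm (ee (RtoC _))) in hf *.
  transitivity (RtoC (/ 2) * ee (- z) + psum a8 (RtoC x ^ 8) - RtoC (/ 2) * ee (- z))%C; first ring.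
  rewrite hf /F RtoC_inv; last lra.
  ring.
move=> /(_ hP); rewrite spread_mult; last lia.
have e0 : cb sgn0 (8 * n) = (2 * sqrt 2)%C.
  by rewrite cb_mod Nat.mul_comm Nat.Div0.mod_mul cb_0.
have e4 : (8 * n = 4 * (2 * n))%nat by lia.
rewrite e0 => ->.
have sp c : spread 4 c (8 * n) = c (2 * n)%nat by rewrite e4 spread_mult //; lia.
rewrite !sp.
have -> : (4 * a1 (8 * n)%nat = sqrt 2 * sqrt 2 * 2 * a1 (8 * n)%nat)%C by rewrite sqrt2_C; ring.
ring.
Qed.

Lemma gauss_sum n : (z8 ^ n - z8 ^ (3 * n) - z8 ^ (5 * n) + z8 ^ (7 * n) =
  2 * sqrt 2 * RtoC (IZR (chi2 (Z.of_nat n))))%C.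
Proof.
have hn := Nat.div_mod n 8 ltac:(lia).
have hc : chi2 (Z.of_nat n) = chi2 (Z.of_nat (n mod 8)).
  rewrite {1}hn Nat2Z.inj_add Nat2Z.inj_mul; exact: chi2_mod.
have hz k : (z8 ^ (k * n) = z8 ^ (k * (n mod 8)))%C.
  by rewrite (z8_pow_mod (k * n)) (z8_pow_mod (k * (n mod 8))) Nat.Div0.mul_mod_idemp_r.
rewrite (z8_pow_mod n) !hz hc.
have hlt := Nat.mod_upper_bound n 8 ltac:(lia).
have [e2 [e3 [e5 [e6 e7]]]] := z8_pows.
have hs : RtoC (sqrt 2) = (z8 - Ci * z8)%C by rewrite -z8_add_inv -z8_sqr; ring.
move: (n mod 8)%nat hlt; apply: root8_cases; z8red;
  rewrite ?Cpow_1_r ?e2 ?e3 ?e5 ?e6 ?e7 ?z8_pow4;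
  change (z8 ^ 0)%C with (RtoC 1);
  match goal with |- context [chi2 ?x] => let y := eval vm_compute in (chi2 x) in change (chi2 x) with y end;
  rewrite ?hs; ring.
Qed.

Lemma ee_neg_pow (k n : nat) : (ee (RtoC (- INR k / 64)) ^ (8 * n) = / z8 ^ (k * n))%C.
Proof.
rewrite -ee_div8 -ee_opp -ee_pow -RtoC_mult -RtoC_opp; congr ee; congr RtoC.
rewrite !mult_INR [INR 8]INR_IZR_INZ /=; field.
Qed.

Lemma z8_inv_pow7 n : (/ z8 ^ n = z8 ^ (7 * n))%C.
Proof.
have h : (z8 ^ n * z8 ^ (7 * n) = 1)%C.
  rewrite -Cpow_add_r; have -> : (n + 7 * n = 8 * n)%nat by lia.
  by rewrite Cpow_mult_r z8_pow8 Cpow_1_l.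
have hn : (z8 ^ n)%C <> 0 by apply: Cpow_nz; exact: ee_neq0.
transitivity (/ z8 ^ n * (z8 ^ n * z8 ^ (7 * n)))%C; first by rewrite h; ring.
by field.
Qed.

Lemma gauss_term n : (ee (RtoC (- 1 / 64)) ^ (8 * n) - ee (RtoC (- 3 / 64)) ^ (8 * n)
       - ee (RtoC (- 5 / 64)) ^ (8 * n) + ee (RtoC (- 7 / 64)) ^ (8 * n) =
   2 * sqrt 2 * RtoC (IZR (chi2 (Z.of_nat n))))%C.
Proof.
have h k := ee_neg_pow k n.
have -> : ee (RtoC (-1 / 64)) = ee (RtoC (- INR 1 / 64)) by [].
have -> : ee (RtoC (-3 / 64)) = ee (RtoC (- INR 3 / 64)) by rewrite INR_IZR_INZ.
have -> : ee (RtoC (-5 / 64)) = ee (RtoC (- INR 5 / 64)) by rewrite INR_IZR_INZ.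
have -> : ee (RtoC (-7 / 64)) = ee (RtoC (- INR 7 / 64)) by rewrite INR_IZR_INZ.
rewrite !h !z8_inv_pow7 -gauss_sum.
have e (x y : nat) : (x mod 8 = y mod 8)%nat -> (z8 ^ x = z8 ^ y)%C.
  by move=> hxy; rewrite (z8_pow_mod x) hxy -z8_pow_mod.
rewrite (e (7 * (3 * n))%nat (5 * n)%nat); last by have -> : (7 * (3 * n) = 5 * n + 2 * n * 8)%nat by [lia]; rewrite Nat.Div0.mod_add.
rewrite (e (7 * (5 * n))%nat (3 * n)%nat); last by have -> : (7 * (5 * n) = 3 * n + 4 * n * 8)%nat by [lia]; rewrite Nat.Div0.mod_add.
rewrite (e (7 * (7 * n))%nat n); last by have -> : (7 * (7 * n) = n + 6 * n * 8)%nat by [lia]; rewrite Nat.Div0.mod_add.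
have -> : (7 * (1 * n) = 7 * n)%nat by lia.
ring.
Qed.

(** [cb sgn1] selects n = 4 t + 2 among the even indices 2 n; the two conjugate roots of unity then
    add up to sqrt 2 or - sqrt 2, and [cb] contributes 2 sqrt 2. *)
Lemma term1 n : exists e : R, Rabs e <= 1 /\ (Nat.Odd n -> e = 0) /\
  (cb sgn1 (2 * n) * (ee (RtoC (- 2 / 64)) ^ (2 * n) + ee (RtoC (2 / 64)) ^ (2 * n)) = 4 * e)%C.
Proof.
have hn := Nat.div_mod n 4 ltac:(lia); have hlt := Nat.mod_upper_bound n 4 ltac:(lia).
set t := (n / 4)%nat in hn; set r := (n mod 4)%nat in hn hlt.
have z : cb sgn1 (2 * n) = 0 -> exists e : R, Rabs e <= 1 /\ (Nat.Odd n -> e = 0) /\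
  (cb sgn1 (2 * n) * (ee (RtoC (- 2 / 64)) ^ (2 * n) + ee (RtoC (2 / 64)) ^ (2 * n)) = 4 * e)%C.
  move=> ->; exists 0; rewrite Rabs_R0; split; [lra|split=> //]; ring.
have hm : ((2 * n) mod 8 = 2 * r)%nat.
  have -> : (2 * n = 2 * r + t * 8)%nat by lia.
  rewrite Nat.Div0.mod_add Nat.mod_small //; lia.
case: (Nat.eq_dec r 2) => hr; last first.
  apply: z; rewrite cb_mod hm; apply: cb_1_even; try lia.
  by rewrite Nat.mul_comm Nat.Div0.mod_mul.
rewrite cb_mod hm hr cb_1_4.
have e1 : (ee (RtoC (2 / 64)) ^ (2 * n) = z8 ^ (2 * t + 1))%C.
  rewrite -ee_div8 -ee_pow -RtoC_mult; congr ee; congr RtoC.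
  have h1 : INR (2 * n) = 2 * (4 * INR t + 2).
    have -> : (2 * n = 8 * t + 4)%nat by lia.
    rewrite plus_INR mult_INR [INR 8]INR_IZR_INZ [INR 4]INR_IZR_INZ /=; ring.
  have h2 : INR (2 * t + 1) = 2 * INR t + 1 by rewrite plus_INR mult_INR /=; ring.
  rewrite h1 h2; field.
have e2 : (ee (RtoC (- 2 / 64)) ^ (2 * n) = z8 ^ (7 * (2 * t + 1)))%C.
  rewrite -z8_inv_pow7 -e1 -Cpow_inv; last exact: ee_neq0.
  congr Cpow; rewrite -ee_opp -RtoC_opp; congr ee; congr RtoC; field.
rewrite e1 e2.
have hodd : ~ Nat.Odd n by move=> [m hm']; lia.
have hs : RtoC (sqrt 2) = (z8 - Ci * z8)%C by rewrite -z8_add_inv -z8_sqr; ring.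
have hq : (sqrt 2 * (z8 - Ci * z8) = 2)%C by rewrite -hs sqrt2_C.
have hq' : (2 * sqrt 2 * (z8 - Ci * z8) = 4)%C by rewrite -Cmult_assoc hq; ring.
suff [e [he1 he2]] : exists e : R, Rabs e <= 1 /\
   (2 * sqrt 2 * (z8 ^ (7 * (2 * t + 1)) + z8 ^ (2 * t + 1)) = 4 * e)%C.
  by exists e; split.
have ht := Nat.div_mod t 4 ltac:(lia); have htl := Nat.mod_upper_bound t 4 ltac:(lia).
rewrite (z8_pow_mod (7 * _)) (z8_pow_mod (2 * t + 1)).
have -> : ((2 * t + 1) mod 8 = 2 * (t mod 4) + 1)%nat.
  rewrite {1}ht; have -> : (2 * (4 * (t / 4) + t mod 4) + 1 = 2 * (t mod 4) + 1 + (t / 4) * 8)%nat by lia.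
  rewrite Nat.Div0.mod_add Nat.mod_small //; lia.
have -> : ((7 * (2 * t + 1)) mod 8 = (7 * (2 * (t mod 4) + 1)) mod 8)%nat.
  rewrite {1}ht; have -> : (7 * (2 * (4 * (t / 4) + t mod 4) + 1) = 7 * (2 * (t mod 4) + 1) + (7 * (t / 4)) * 8)%nat by lia.
  by rewrite Nat.Div0.mod_add.
have [e2' [e3 [e5 [e6 e7]]]] := z8_pows.
have r1 : Rabs 1 <= 1 by rewrite Rabs_R1; lra.
have r2 : Rabs (-1) <= 1 by rewrite Rabs_left; lra.
case: (t mod 4)%nat htl => [|[|[|[|k]]]] htl; last lia.
all: cbv [Nat.modulo Nat.mul Nat.add Nat.divmod Nat.sub Init.Nat.modulo Init.Nat.mul
       Init.Nat.add Init.Nat.divmod Init.Nat.sub fst snd]; rewrite ?Cpow_1_r ?e3 ?e5 ?e7.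
- exists 1; split=> //; transitivity (2 * sqrt 2 * (z8 - Ci * z8))%C; [ring|rewrite hq'; ring].
- exists (-1); split=> //; transitivity (- (2 * sqrt 2 * (z8 - Ci * z8)))%C; [ring|rewrite hq'; ring].
- exists (-1); split=> //; transitivity (- (2 * sqrt 2 * (z8 - Ci * z8)))%C; [ring|rewrite hq'; ring].
- exists 1; split=> //; transitivity (2 * sqrt 2 * (z8 - Ci * z8))%C; [ring|rewrite hq'; ring].
Qed.

(** [cb sgn3] leaves only n / 2 congruent to 2 or 6 modulo 8, hence n divisible by 4; the remaining
    root of unity is a sign. *)
Lemma term3 n : exists e : R, Rabs e <= 1 /\ (e <> 0 -> exists m, n = (4 * m)%nat) /\
  (spread 16 (fun m => cb sgn3 m * a1 m * ee (RtoC (- 4 / 64)) ^ m) (8 * n) = 2 * e * a1 (n / 2)%nat)%C.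
Proof.
have z : spread 16 (fun m => cb sgn3 m * a1 m * ee (RtoC (- 4 / 64)) ^ m)%C (8 * n) = 0 ->
  exists e : R, Rabs e <= 1 /\ (e <> 0 -> exists m, n = (4 * m)%nat) /\
  (spread 16 (fun m => cb sgn3 m * a1 m * ee (RtoC (- 4 / 64)) ^ m) (8 * n) = 2 * e * a1 (n / 2)%nat)%C.
  move=> ->; exists 0; rewrite Rabs_R0; split; [lra|split=> //]; ring.
case: (Nat.Even_or_Odd n) => [[m hm]|[m hm]]; last first.
  apply: z; apply: spread_0.
  have -> : (8 * n = 8 + m * 16)%nat by lia.
  by rewrite Nat.Div0.mod_add.
have e16 : (8 * n = 16 * m)%nat by lia.
have hd : (n / 2 = m)%nat by rewrite hm Nat.mul_comm Nat.div_mul.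
rewrite hd e16 spread_mult; last lia.
rewrite e16 spread_mult in z; last lia. rewrite hd in z.
have hn := Nat.div_mod m 8 ltac:(lia); have hlt := Nat.mod_upper_bound m 8 ltac:(lia).
set u := (m / 8)%nat in hn.
have ep k : (ee (RtoC (- 4 / 64)) ^ (2 * k) = / z8 ^ k)%C.
  rewrite -ee_div8 -ee_opp -ee_pow -RtoC_mult -RtoC_opp; congr ee; congr RtoC.
  rewrite mult_INR !INR_IZR_INZ /=; field.
have hsg : exists s : R, ((z8 ^ 4) ^ u = RtoC s)%C /\ Rabs s <= 1 /\ s * s = 1.
  rewrite z8_pow4; exists ((-1) ^ u); split; [|split].
  - by rewrite RtoC_pow RtoC_opp.
  - rewrite pow_1_abs; lra.
  - rewrite -Rpow_mult_distr; have -> : -1 * -1 = 1 by lra. exact: pow1.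
have [s [hs1 [hs2 hs3]]] := hsg.
have hs0 : RtoC s <> 0 by move=> [] h; rewrite h in hs3; lra.
have hsi : (/ RtoC s = RtoC s)%C.
  rewrite -RtoC_inv; last by move=> h; apply: hs0; rewrite h.
  congr RtoC; field_simplify_eq; last by move=> h; apply: hs0; rewrite h.
  rewrite /=; lra.
have hz : z8 <> 0 by exact: ee_neq0.
case: (Nat.eq_dec (m mod 8) 2) => h2.
  exists s; split=> //; split; first by move=> _; exists (4 * u + 1)%nat; lia.
  rewrite cb_mod h2 cb_3_2.
  have -> : (ee (RtoC (- 4 / 64)) ^ m = / (z8 * RtoC s))%C.
    have -> : (m = 2 * (4 * u + 1))%nat by lia.
    by rewrite ep Cpow_add_r Cpow_mult_r hs1 Cpow_1_r Cmult_comm.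
  transitivity (2 * / RtoC s * a1 m)%C; first by field.
  by rewrite hsi.
case: (Nat.eq_dec (m mod 8) 6) => h6.
  exists (- s); split; first by rewrite Rabs_Ropp.
  split; first by move=> _; exists (4 * u + 3)%nat; lia.
  rewrite cb_mod h6 cb_3_6.
  have -> : (ee (RtoC (- 4 / 64)) ^ m = / (z8 ^ 3 * RtoC s))%C.
    have -> : (m = 2 * (4 * u + 3))%nat by lia.
    by rewrite ep Cpow_add_r Cpow_mult_r hs1 Cmult_comm.
  transitivity (- (2 * / RtoC s * a1 m))%C; first by field.
  rewrite hsi RtoC_opp; ring.
apply: z; rewrite cb_mod cb_3_other //; ring.
Qed.

(** The numbers e1, e2, e3 are chi2(n/2), chi2(n/4) and the indicator of 8 | n; what is kept of them
    are bounds and supports. *)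
Lemma a8_formula n : exists e1 e2 e3 : R,
  a8 n = (RtoC (4 * (1 + IZR (chi2 (Z.of_nat n)))) * a1 (8 * n)%nat + RtoC (2 * e1) * a1 (2 * n)%nat
     + RtoC e2 * a1 (n / 2)%nat + RtoC (/ 2 * e3) * a1 (n / 8)%nat)%C /\
  Rabs e1 <= 1 /\ Rabs e2 <= 1 /\ 0 <= e3 <= 1 /\ (Nat.Odd n -> e1 = 0) /\
  (e2 <> 0 -> exists m, n = (4 * m)%nat) /\ (e3 <> 0 -> exists m, n = (8 * m)%nat).
Proof.
have [e1 [he1 [ho1 t1]]] := term1 n; have [e2 [he2 [ho2 t2]]] := term3 n.
have [e3 [he3 [ho3 t3]]] : exists e : R, 0 <= e <= 1 /\ (e <> 0 -> exists m, n = (8 * m)%nat) /\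
   spread 64 a1 (8 * n) = (RtoC e * a1 (n / 8)%nat)%C.
  case: (Nat.eq_dec (n mod 8) 0) => h.
    have hn := Nat.div_mod n 8 ltac:(lia); rewrite h Nat.add_0_r in hn.
    exists 1; split; [lra|split]; first by move=> _; exists (n / 8)%nat.
    have -> : (8 * n = 64 * (n / 8))%nat by lia.
    rewrite spread_mult; [ring|lia].
  exists 0; split; [lra|split=> //]; rewrite spread_0; first ring.
  have hn := Nat.div_mod n 8 ltac:(lia); have hlt := Nat.mod_upper_bound n 8 ltac:(lia).
  have -> : (8 * n = 8 * (n mod 8) + (n / 8) * 64)%nat by lia.
  rewrite Nat.Div0.mod_add Nat.mod_small; lia.
exists e1, e2, e3; split=> //.
rewrite a8_formula_raw t2 t3 gauss_term.
have -> : (cb sgn1 (2 * n) * a1 (2 * n)%nat * (ee (RtoC (- 2 / 64)) ^ (2 * n) + ee (RtoC (2 / 64)) ^ (2 * n)) =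
   4 * e1 * a1 (2 * n)%nat)%C.
  transitivity (cb sgn1 (2 * n) * (ee (RtoC (- 2 / 64)) ^ (2 * n) + ee (RtoC (2 / 64)) ^ (2 * n)) * a1 (2 * n)%nat)%C; first ring.
  by rewrite t1.
rewrite (RtoC_mult 4) (RtoC_mult 2 e1) (RtoC_mult (/ 2) e3) RtoC_plus RtoC_inv; last lra.
transitivity (4 * a1 (8 * n)%nat + / 2 * (e3 * a1 (n / 8)%nat + 4 * (sqrt 2 * sqrt 2) * RtoC (IZR (chi2 (Z.of_nat n))) * a1 (8 * n)%nat +
  4 * e1 * a1 (2 * n)%nat + 2 * e2 * a1 (n / 2)%nat))%C; first ring.
rewrite sqrt2_C; by field.
Qed.
End HeckeCoeff.

(** * The even and odd parts of f_1 *)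

(** Comparison at x and -x shows that the first difference quotient is odd, so it vanishes at 0 and
    a second factor x splits off. *)
Lemma hol_even_shift phi : hol phi -> (forall x, Cmod x < 1 -> phi (- x)%C = phi x) ->
  exists chi, hol chi /\ forall x, Cmod x < 1 -> phi x = (phi 0 + x * x * chi x)%C.
Proof.
move=> h he; have [c1 [h1 e1]] := hol_shift _ h.
have e0 : c1 0 = 0.
  have hs : hol (fun x => c1 x + c1 (- x))%C.
    apply: hol_plus => //; apply: hol_ext (hol_rot (- (1))%C _ _ h1) _; first by rewrite Cmod_m1; lra.
    by move=> s _; congr c1; ring.
  have e := hol_limit0 _ 0 1 hs Rlt_0_1.
  have {e} : (c1 0 + c1 (- 0))%C = 0.
    apply: e => x hx.
    have hx1 : Cmod x < 1 by rewrite Cmod_R Rabs_pos_eq; lra.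
    have hx0 : RtoC x <> 0 by move=> [] hh; lra.
    have k1 := e1 x hx1; have k2 := e1 (- x)%C ltac:(by rewrite Cmod_opp).
    rewrite he // k1 in k2.
    apply: (Cmult_eq_0_r x) => //.
    transitivity (phi 0 + x * c1 x - (phi 0 + - x * c1 (- x)))%C; first ring.
    rewrite -k2; ring.
  have -> : (- (0) = 0)%C by ring.
  move=> e; apply: (Cmult_eq_0_r 2) (C2_neq0) _.
  transitivity (c1 0 + c1 0)%C; [ring|exact: e].
have [c2 [h2 e2]] := hol_shift _ h1.
exists c2; split=> // x hx; rewrite e1 // e2 // e0; ring.
Qed.

Lemma psrep_shift2 b phi : psrep b phi -> b 0%nat = 0 -> b 1%nat = 0 ->
  exists chi, hol chi /\ forall x, Cmod x < 1 -> phi x = (x * x * chi x)%C.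
Proof.
move=> h b0 b1; have [c1 [h1 e1]] := psrep_shift _ _ h.
have [c2 [h2 e2]] := psrep_shift _ _ h1.
exists c2; split; first by eexists; exact: h2.
move=> x hx; rewrite e1 // e2 // (psrep_at0 _ _ h) (psrep_at0 _ _ h1) b0 b1; ring.
Qed.

(** Vanishing of order two of f_1 in its parameter at 1/4 and at 3/4; it compensates a double pole
    in the second relation. *)
Lemma cb_2_01 : cb sgn2 0 = 0 /\ cb sgn2 1 = 0 /\ cb sgn3 0 = 0 /\ cb sgn3 1 = 0.
Proof.
have [e2 [e3 [e5 [e6 e7]]]] := z8_pows.
rewrite /cb !Csum_S !Csum_0 /sgn2 /sgn3 /sgn_list; cbn [nth]; z8red.
rewrite ?Cpow_1_r ?e2 ?e3 ?e5 ?e6 ?e7 ?z8_pow4; change (z8 ^ 0)%C with (RtoC 1).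
repeat split; ring.
Qed.

Section Identities.
Variables (f : C -> C) (a : nat -> C) (H : data1 a f).
Let M : modular8 f. Proof. by case: H. Qed.
Let Q : plus_eq f. Proof. by case: H => _ []. Qed.
Let ft := psum a.
Let hft : hol ft. Proof. exact: data1_hol H. Qed.
Let e0 := a 0%nat.

(** With x = e(z), [ev] is the even part of f in x, and [ov] is x times the odd part; the 1 in [ov]
    is the pole 1/x. *)
Definition ev (x : C) : C := ((psum a x + psum a (- x)) / 2)%C.
Definition ov (x : C) : C := (1 + x * ((psum a x - psum a (- x)) / 2))%C.

Lemma hol_ft_opp : hol (fun x => ft (- x)%C).
Proof.
apply: hol_ext (hol_rot (- (1))%C _ _ hft) _; first by rewrite Cmod_m1; lra.
by move=> s _; congr ft; ring.
Qed.

Lemma hol_ev : hol ev.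
Proof.
apply: hol_ext (hol_scal (/ 2)%C _ (hol_plus _ _ hft hol_ft_opp)) _ => s _.
rewrite /ev /ft; by field.
Qed.
Lemma hol_ov : hol ov.
Proof.
apply: hol_ext (hol_plus _ _ (hol_const 1) (hol_mult _ _ hol_id
  (hol_scal (/ 2)%C _ (hol_minus _ _ hft hol_ft_opp)))) _ => s _.
rewrite /ov /ft; by field.
Qed.

Lemma ft_0 : ft 0 = e0. Proof. exact: psrep_at0 (proj1 (proj2 (proj2 H))). Qed.
Lemma ev_0 : ev 0 = e0.
Proof. rewrite /ev; have -> : (- (0) = 0)%C by ring. rewrite -/ft ft_0; by field. Qed.
Lemma ov_0 : ov 0 = 1.
Proof. rewrite /ov; ring. Qed.

Lemma ev_shift : exists e2, hol e2 /\ forall x, Cmod x < 1 -> ev x = (e0 + x * x * e2 x)%C.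
Proof.
have [|c [h e]] := hol_even_shift _ hol_ev.
  move=> x _; rewrite /ev; have -> : (- - x = x)%C by ring.
  by rewrite Cplus_comm.
by exists c; split=> // x hx; rewrite e // ev_0.
Qed.
Lemma ov_shift : exists o2, hol o2 /\ forall x, Cmod x < 1 -> ov x = (1 + x * x * o2 x)%C.
Proof.
have [|c [h e]] := hol_even_shift _ hol_ov.
  move=> x _; rewrite /ov; have -> : (- - x = x)%C by ring.
  by field.
by exists c; split=> // x hx; rewrite e // ov_0.
Qed.

Lemma Cmod_ee_lt1 z : 0 < Im z -> Cmod (ee z) < 1.
Proof.
move=> hz; rewrite Cmod_ee; apply: (proj2 (exp_neg_lt1 _ _)); have := PI_RGT_0; nra.
Qed.

Lemma ee_half_neg z : ee (z + 1 / 2)%C = (- ee z)%C.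
Proof.
have -> : (z + 1 / 2 = z + RtoC (1 / 2))%C by rewrite RtoC_div //; lra.
rewrite ee_plus ee_R.
have -> : 2 * PI * (1 / 2) = PI by field.
rewrite cos_PI sin_PI; apply: C_ext; rewrite !Creim /Re /Im /=; ring.
Qed.

Lemma Im_half z : Im (z + 1 / 2)%C = Im z.
Proof. have -> : (z + 1 / 2 = z + RtoC (1 / 2))%C by [rewrite RtoC_div //; lra]. exact: Im_plus_R. Qed.

Lemma f_split z : 0 < Im z ->
  f z = (ev (ee z) + ov (ee z) / ee z)%C /\ f (z + 1 / 2)%C = (ev (ee z) - ov (ee z) / ee z)%C.
Proof.
move=> hz; have hn := ee_neq0 z.
rewrite (data1_exp a f H z) // (data1_exp a f H (z + 1 / 2)%C) ?Im_half //.
rewrite ee_half_neg ee_opp (ee_opp (z + 1 / 2)) ee_half_neg /ev /ov.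
split; by field.
Qed.

(** Conjugation by the translation by 1/2 preserves Gamma_0(8): a and d are odd, so (d - a)/2 is an
    integer, and c/4 is even. The square removes the character, which is taken at the changed entry
    d - c/2. *)
Lemma g_sqr_inv p b c d z : (p * d - b * c = 1)%Z -> (8 | c)%Z -> 0 < Im z ->
  (f (moebius p b c d z + 1 / 2) * f (moebius p b c d z + 1 / 2) = f (z + 1 / 2) * f (z + 1 / 2))%C.
Proof.
move=> hd h8 hz; have [c' hc] := h8.
have hod := det8_odd _ _ _ _ hd h8.
have hop : Z.odd p = true by apply: (det8_odd d b c p) => //; lia.
have [m hm] : exists m, (d - p = 2 * m)%Z.
  move/Z.odd_spec: hod => [x hx]; move/Z.odd_spec: hop => [y hy]; exists (x - y)%Z; lia.
have hdet : ((p + 4 * c') * (d - 4 * c') - (b + m - 2 * c') * c = 1)%Z.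
  rewrite -hd hc; have -> : (d = p + 2 * m)%Z by lia. ring.
have hz2 : 0 < Im (z + 1 / 2)%C by rewrite Im_half.
have e := M _ _ _ _ hdet h8 _ hz2.
have hn := den_neq0 c d z (det_cd _ _ _ _ hd) hz.
have <- : moebius (p + 4 * c') (b + m - 2 * c') c (d - 4 * c') (z + 1 / 2) = (moebius p b c d z + 1 / 2)%C.
  have ec : RtoC (IZR c) = (8 * RtoC (IZR c'))%C by rewrite -RtoC_mult -mult_IZR; congr RtoC; congr IZR; lia.
  have ed : RtoC (IZR d) = (RtoC (IZR p) + 2 * RtoC (IZR m))%C.
    by rewrite -RtoC_mult -mult_IZR -RtoC_plus -plus_IZR; congr RtoC; congr IZR; lia.
  rewrite /moebius !minus_IZR !plus_IZR (mult_IZR 4) (mult_IZR 2) !RtoC_minus !RtoC_plus (RtoC_mult 4) (RtoC_mult 2).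
  rewrite ec ed in hn *.
  field; (try split) => //.
  move=> h; apply: hn; apply: (Cmult_eq_0_r 2) C2_neq0 _; rewrite -h; ring.
rewrite e.
transitivity (RtoC (IZR (chi2 (d - 4 * c'))) * RtoC (IZR (chi2 (d - 4 * c'))) * (f (z + 1 / 2) * f (z + 1 / 2)))%C; first ring.
rewrite chi2_odd_sqr; first ring.
by rewrite Z.odd_sub Z.odd_mul hod.
Qed.

Lemma f_sqr_inv p b c d z : (p * d - b * c = 1)%Z -> (8 | c)%Z -> 0 < Im z ->
  (f (moebius p b c d z) * f (moebius p b c d z) = f z * f z)%C.
Proof.
move=> hd h8 hz; rewrite M //.
transitivity (RtoC (IZR (chi2 d)) * RtoC (IZR (chi2 d)) * (f z * f z))%C; first ring.
rewrite chi2_odd_sqr; first ring.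
exact: (det8_odd p b c d).
Qed.

(** The translation by 1/2 exchanges the cusps 0 and 1/2 and moves 1/4 to 3/4, so the nonzero limit
    belongs to f at the cusp 0 and to its translate at the cusp 1/2. *)
Lemma cusp_fg (i : cusp) : i <> Cinf -> exists G1 G2 : C -> C,
  cusplim G1 (match i with C0 => 2 * sqrt 2 * e0 | _ => 0 end)%C /\
  cusplim G2 (match i with C2 => 2 * sqrt 2 * e0 | _ => 0 end)%C /\
  forall z, 0 < Im z -> f (cuspmap i z) = G1 z /\ f (cuspmap i z + 1 / 2)%C = G2 z.
Proof.
move=> hi; have h0 j i' hi' := data1_cusp a f i' j H hi'.
have [p0 [p1 [p2 p3]]] := sgn_per; have [q0 [q1 [q2 q3]]] := sgn_sums.
exists (fun z => f (cuspmap i z)), (fun z => f (cuspmap i z + 1 / 2)%C).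
split; [|split=> //].
  have := h0 0%Z i hi; case: i hi {h0} => // _ h; apply: cusplim_ext h _ => z _; by rewrite Cplus_0_r.
case: i hi {h0} => // _.
- have -> : RtoC 0 = comb_hol sgn1 ft 0 by rewrite comb_hol_0 q1; ring.
  apply: cusplim_ext (cusplim_affine _ 1 0 _ (hol_comb _ _ hft)) _; first lia.
  move=> z hz; rewrite /cuspmap.
  have -> : (- (1) / z + 1 / 2 = 1 / 2 - 1 / z)%C by rewrite /Cdiv; ring.
  rewrite (val1 f) // (data1_comb a f _ _ H) //; last by rewrite Im_div64; lra.
  congr comb_hol; congr ee; rewrite /=; ring.
- have -> : (2 * sqrt 2 * e0 = comb_hol sgn0 ft 0)%C.
    have hs := sqrt2_C_neq0; rewrite comb_hol_0 q0 ft_0.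
    have -> : (/ (2 * sqrt 2) * (8 * e0) = 4 * e0 / sqrt 2)%C by field.
    have -> : (2 * sqrt 2 * e0 = 2 * (sqrt 2 * sqrt 2) * e0 / sqrt 2)%C by field.
    rewrite sqrt2_C; by field.
  apply: cusplim_ext (cusplim_affine _ 4 (2 / 64) _ (hol_comb _ _ hft)) _; first lia.
  move=> z hz; rewrite /cuspmap.
  have hz4 : 0 < Im (4 * z + 2)%C by move: hz; rewrite /Im /=; lra.
  have n4 := four_z_2 z hz.
  have hx := cuspmap_H C0 _ hz4; rewrite /cuspmap in hx.
  have -> : (1 / 2 - 1 / (4 * z + 2) + 1 / 2 = - (1) / (4 * z + 2) + IZR 1)%C by [field].
  rewrite (f_per_Z f) // (val0 f) // (data1_comb a f _ _ H) //; last by rewrite Im_div64; lra.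
  congr comb_hol; congr ee; rewrite RtoC_div; last lra. rewrite INR_C /=; field.
- have -> : RtoC 0 = comb_hol sgn3 ft 0 by rewrite comb_hol_0 q3; ring.
  apply: cusplim_ext (cusplim_affine _ 16 (4 / 64) _ (hol_comb _ _ hft)) _; first lia.
  move=> z hz; rewrite /cuspmap.
  have hz4 : 0 < Im (16 * z + 4)%C by move: hz; rewrite /Im /=; lra.
  have n4 := sixteen_z_4 z hz; have c4 := C4_neq0; have c2 := C2_neq0.
  have -> : (1 / 4 - 1 / (16 * z + 4) + 1 / 2 = 3 / 4 - 1 / (16 * z + 4))%C by field.
  rewrite (val3 f) // (data1_comb a f _ _ H) //; last by rewrite Im_div64; lra.
  congr comb_hol; congr ee; rewrite RtoC_div; last lra. rewrite INR_C /=; field.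
Qed.

(** In terms of the even and odd parts E, O of f this is e0^2 (E^2 + O^2) - E^2 O^2, written with
    the squares of f(z) and f(z + 1/2), which are invariant. *)
Definition hA (z : C) : C :=
  (e0 * e0 * ((f z * f z + f (z + 1 / 2) * f (z + 1 / 2)) / 2)
   - (f z * f z - f (z + 1 / 2) * f (z + 1 / 2)) * (f z * f z - f (z + 1 / 2) * f (z + 1 / 2)) / 16)%C.

Lemma cusplim_hol F (k : nat) : (0 < k)%nat -> hol F ->
  cusplim (fun z => F (ee (RtoC (INR k) * (z / 64))%C)) (F 0).
Proof.
move=> hk hF; apply: cusplim_ext (cusplim_affine F k 0 hk hF) _ => z _.
by rewrite Cplus_0_r.
Qed.

(** The constant is found at the cusp 1/4, where both f and its translate tend to 0. *)
Lemma hA_zero z : 0 < Im z -> hA z = 0.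
Proof.
have hinv : Gamma0_8_abs hA.
  move=> p b c d hd h8 w hw; rewrite /hA; congr Cmod.
  by rewrite !(g_sqr_inv p b c d) // !(f_sqr_inv p b c d).
have [G1 [G2 [g1 [g2 e]]]] := cusp_fg C4 ltac:(by []).
have [F1 [F2 [k1 [k2 e']]]] := cusp_fg C0 ltac:(by []).
have [L1 [L2 [l1 [l2 e'']]]] := cusp_fg C2 ltac:(by []).
have comb g h x y : cusplim g x -> cusplim h y -> exists l, cusplim (fun z => e0 * e0 * ((g z * g z + h z * h z) / 2)
   - (g z * g z - h z * h z) * (g z * g z - h z * h z) / 16)%C l /\
   l = (e0 * e0 * ((x * x + y * y) / 2) - (x * x - y * y) * (x * x - y * y) / 16)%C.
  move=> hg hh; eexists; split; last by [].
  have q1 := cusplim_mult _ _ _ _ hg hg; have q2 := cusplim_mult _ _ _ _ hh hh.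
  have q3 := cusplim_minus _ _ _ _ q1 q2.
  apply: (cusplim_minus _ _ _ _ (cusplim_mult _ _ _ _ (cusplim_const (e0 * e0)%C)
    (cusplim_mult _ _ _ _ (cusplim_plus _ _ _ _ q1 q2) (cusplim_const (/ 2)%C)))
   (cusplim_mult _ _ _ _ (cusplim_mult _ _ _ _ q3 q3) (cusplim_const (/ 16)%C))).
have [m4 [m4' em4]] := comb _ _ _ _ g1 g2.
have [m0 [m0' _]] := comb _ _ _ _ k1 k2.
have [m2 [m2' _]] := comb _ _ _ _ l1 l2.
have c4 : cusplim (fun z => hA (cuspmap C4 z)) m4.
  by apply: cusplim_ext m4' _ => w hw; have [<- <-] := e w hw.
have [|c [hc hl]] := liouville8 hA hinv.
  case.
  - have [e2 [he2 ee2]] := ev_shift; have [o2 [ho2 eo2]] := ov_shift.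
    (* The double pole is O^2 (e0^2 - E^2), and E differs from e0 by a multiple of x^2; this is why
       the relation carries the factor e0^2. *)
    have hX : hol (fun x => e0 * e0 * (ev x * ev x) - (1 + x * x * o2 x) * (1 + x * x * o2 x)
        * (e2 x * (2 * e0 + x * x * e2 x)))%C.
      have hxx := hol_mult _ _ hol_id hol_id.
      have ho := hol_plus _ _ (hol_const 1) (hol_mult _ _ hxx ho2).
      have he := hol_plus _ _ (hol_const (2 * e0)%C) (hol_mult _ _ hxx he2).
      exact: (hol_minus _ _ (hol_mult _ _ (hol_const (e0 * e0)%C) (hol_mult _ _ hol_ev hol_ev))
        (hol_mult _ _ (hol_mult _ _ ho ho) (hol_mult _ _ he2 he))).
    eexists; apply: cusplim_ext (cusplim_hol _ 64 ltac:(lia) hX) _ => w hw.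
    have -> : (RtoC (INR 64) * (w / 64) = w)%C by rewrite INR_C /=; field.
    rewrite /hA /cuspmap; have [-> ->] := f_split w hw.
    have hx := Cmod_ee_lt1 w hw; have hn := ee_neq0 w; set x := ee w in hx hn *.
    rewrite eo2 // ee2 //; by field.
  - exists m0; apply: cusplim_ext m0' _ => w hw; by have [<- <-] := e' w hw.
  - exists m2; apply: cusplim_ext m2' _ => w hw; by have [<- <-] := e'' w hw.
  - by exists m4.
move=> hz; rewrite hc // -(hl C4 m4 c4) em4; by field.
Qed.

Lemma ident_A (x : C) : x <> 0 -> Cmod x < 1 ->
  (e0 * e0 * (x * x * (ev x * ev x) + ov x * ov x) = ev x * ev x * (ov x * ov x))%C.
Proof.
move=> hx hx1; have [z [hz1 hz2]] := ee_64_surj x hx hx1.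
have hz : 0 < Im (z / 64) by rewrite Im_div64; lra.
have h := hA_zero _ hz; move: h; rewrite /hA; have [-> ->] := f_split _ hz.
rewrite hz2 => h.
apply: Cminus_eq0.
match type of h with ?L = _ => transitivity (x * x * L)%C end; last by rewrite h; ring.
by field.
Qed.
End Identities.

(** * The relation between z / 2 and z *)

Section IdentB.
Variables (f : C -> C) (a : nat -> C) (H : data1 a f).
Let M : modular8 f. Proof. by case: H. Qed.
Let Q : plus_eq f. Proof. by case: H => _ []. Qed.
Let ft := psum a.
Let hft : hol ft. Proof. exact: data1_hol H. Qed.
Let e0 := a 0%nat.

(** With s, t the values at z/2 and z/2 + 1/2 this is E(z) O(z) E(z/2)^2 - e0^3 O(z/2)^2. In x =
    e(z/2) both products have the leading term e0^3 / x^2, and everything is even in x, so the pole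
    at infinity cancels. *)
Definition polyB (u v s t : C) : C :=
  ((u * u - v * v) / 4 * ((s + t) / 2 * ((s + t) / 2)) - e0 * e0 * e0 * ((s - t) / 2 * ((s - t) / 2)))%C.

Definition hB (z : C) : C := polyB (f z) (f (z + 1 / 2)%C) (f (z / 2)%C) (f (z / 2 + 1 / 2)%C).

Lemma cusplim_polyB g1 g2 g3 g4 l1 l2 l3 l4 : cusplim g1 l1 -> cusplim g2 l2 -> cusplim g3 l3 -> cusplim g4 l4 ->
  cusplim (fun z => polyB (g1 z) (g2 z) (g3 z) (g4 z)) (polyB l1 l2 l3 l4).
Proof.
move=> h1 h2 h3 h4.
have hs := cusplim_mult _ _ _ _ (cusplim_plus _ _ _ _ h3 h4) (cusplim_const (/ 2)%C).
have hd := cusplim_mult _ _ _ _ (cusplim_minus _ _ _ _ h3 h4) (cusplim_const (/ 2)%C).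
exact: (cusplim_minus _ _ _ _ (cusplim_mult _ _ _ _ (cusplim_mult _ _ _ _
  (cusplim_minus _ _ _ _ (cusplim_mult _ _ _ _ h1 h1) (cusplim_mult _ _ _ _ h2 h2)) (cusplim_const (/ 4)%C))
   (cusplim_mult _ _ _ _ hs hs))
  (cusplim_mult _ _ _ _ (cusplim_const (e0 * e0 * e0)%C) (cusplim_mult _ _ _ _ hd hd))).
Qed.

Lemma Im_div2 z : 0 < Im z -> 0 < Im (z / 2).
Proof. by rewrite /Im /=; lra. Qed.

(** Gamma_0(8) fixes or swaps the pair z/2, z/2 + 1/2 according to the parity of b, with the same
    character value on both. A swap changes the sign of s - t only, which [polyB] squares. *)
Lemma half_orbit p b c d z : (p * d - b * c = 1)%Z -> (8 | c)%Z -> 0 < Im z ->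
  (f (moebius p b c d z / 2) = RtoC (IZR (chi2 d)) * f (z / 2) /\
   f (moebius p b c d z / 2 + 1 / 2) = RtoC (IZR (chi2 d)) * f (z / 2 + 1 / 2))%C \/
  (f (moebius p b c d z / 2) = RtoC (IZR (chi2 d)) * f (z / 2 + 1 / 2) /\
   f (moebius p b c d z / 2 + 1 / 2) = RtoC (IZR (chi2 d)) * f (z / 2))%C.
Proof.
move=> hd h8 hz; have [c' hc] := h8.
have hod := det8_odd _ _ _ _ hd h8.
have hop : Z.odd p = true by apply: (det8_odd d b c p) => //; lia.
move/Z.odd_spec: hod => [y hy]; move/Z.odd_spec: hop => [x hx].
have hz1 := Im_div2 z hz.
have hz2 : 0 < Im (z / 2 + 1 / 2)%C by rewrite Im_half.
have hn := den_neq0 c d z (det_cd _ _ _ _ hd) hz.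
have hchi : chi2 (d - c) = chi2 d.
  have -> : (d - c = 8 * (- c') + d)%Z by lia. exact: chi2_mod.
have key A B C' D w : (A * D - B * C' = 1)%Z -> (8 | C')%Z -> 0 < Im w -> forall t, t = moebius A B C' D w ->
   f t = (RtoC (IZR (chi2 D)) * f w)%C by move=> h1 h2 h3 t ->; exact: M.
have h16 : (8 | 2 * c)%Z by exists (2 * c')%Z; lia.
have e2c : RtoC (IZR (2 * c)) = (2 * RtoC (IZR c))%C by rewrite mult_IZR RtoC_mult.
have epc : RtoC (IZR (p + c)) = (RtoC (IZR p) + RtoC (IZR c))%C by rewrite plus_IZR RtoC_plus.
have edc : RtoC (IZR (d - c)) = (RtoC (IZR d) - RtoC (IZR c))%C by rewrite minus_IZR RtoC_minus.
have c2 := C2_neq0.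
have hn2 : (2 * RtoC (IZR c) * (z / 2) + RtoC (IZR d))%C <> 0.
  move=> h; apply: hn; rewrite -h; by field.
have hn3 : (2 * RtoC (IZR c) * (z / 2 + 1 / 2) + (RtoC (IZR d) - RtoC (IZR c)))%C <> 0.
  move=> h; apply: hn; rewrite -h; by field.
have frac (A B D E : C) : D <> 0 -> E <> 0 -> (A * E = B * D)%C -> (A / D = B / E)%C.
  move=> h1 h2 h3; have -> : (A / D = A * E / (D * E))%C by field.
  by rewrite h3; field.
case E : (Z.even b).
  move/Z.even_spec: E => [b' hb]; left; split.
    apply: (key p b' (2 * c)%Z) => //; first by rewrite -hd hb; ring.
    rewrite /moebius e2c hb (mult_IZR 2) (RtoC_mult 2); field.
    by repeat split.
  rewrite -hchi; apply: (key (p + c)%Z (b' + y - x - 4 * c')%Z (2 * c)%Z (d - c)%Z) => //.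
    rewrite -hd hb hc hx hy; ring.
  have eb : (2 * RtoC (IZR (b' + y - x - 4 * c')) = RtoC (IZR b) + RtoC (IZR d) - RtoC (IZR p) - RtoC (IZR c))%C.
    rewrite -!RtoC_plus -!RtoC_minus -RtoC_mult -plus_IZR -!minus_IZR -mult_IZR; congr RtoC; congr IZR; lia.
  rewrite /moebius e2c epc edc.
  transitivity (((RtoC (IZR p) + RtoC (IZR c)) * z + (RtoC (IZR b) + RtoC (IZR d))) / (2 * (RtoC (IZR c) * z + RtoC (IZR d))))%C.
    by field.
  apply: frac => //.
    by move=> /Cmult_eq_0_r h; apply: hn; apply: h.
  transitivity (((RtoC (IZR p) + RtoC (IZR c)) * (z / 2 + 1 / 2) * 2 + 2 * RtoC (IZR (b' + y - x - 4 * c'))) * (RtoC (IZR c) * z + RtoC (IZR d)))%C; last by ring.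
  rewrite eb; by field.
move: E; rewrite -Z.negb_odd => /Bool.negb_false_iff /Z.odd_spec [b' hb]; right; split.
  rewrite -hchi; apply: (key p (b' - x)%Z (2 * c)%Z (d - c)%Z) => //.
    rewrite -hd hb hx; ring.
  have eb : (2 * RtoC (IZR (b' - x)) = RtoC (IZR b) - RtoC (IZR p))%C.
    rewrite -RtoC_minus -RtoC_mult -minus_IZR -mult_IZR; congr RtoC; congr IZR; lia.
  rewrite /moebius e2c edc.
  transitivity ((RtoC (IZR p) * z + RtoC (IZR b)) / (2 * (RtoC (IZR c) * z + RtoC (IZR d))))%C; first by field.
  apply: frac => //.
    by move=> /Cmult_eq_0_r h; apply: hn; apply: h.
  transitivity ((RtoC (IZR p) * (z / 2 + 1 / 2) * 2 + 2 * RtoC (IZR (b' - x))) * (RtoC (IZR c) * z + RtoC (IZR d)))%C; last by ring.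
  rewrite eb; by field.
apply: (key (p + c)%Z (b' + y + 1)%Z (2 * c)%Z d) => //.
  by transitivity (p * d - b * c)%Z; [rewrite hb hy; ring|].
have eb : (2 * RtoC (IZR (b' + y + 1)) = RtoC (IZR b) + RtoC (IZR d))%C.
  rewrite -RtoC_plus -RtoC_mult -plus_IZR -mult_IZR; congr RtoC; congr IZR; lia.
rewrite /moebius e2c epc.
transitivity (((RtoC (IZR p) + RtoC (IZR c)) * z + (RtoC (IZR b) + RtoC (IZR d))) / (2 * (RtoC (IZR c) * z + RtoC (IZR d))))%C.
  by field.
apply: frac => //.
  by move=> /Cmult_eq_0_r h; apply: hn; apply: h.
transitivity (((RtoC (IZR p) + RtoC (IZR c)) * (z / 2) * 2 + 2 * RtoC (IZR (b' + y + 1))) * (RtoC (IZR c) * z + RtoC (IZR d)))%C; last by ring.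
rewrite eb; by field.
Qed.

Lemma hB_inv p b c d z : (p * d - b * c = 1)%Z -> (8 | c)%Z -> 0 < Im z ->
  hB (moebius p b c d z) = hB z.
Proof.
move=> hd h8 hz; have hod := det8_odd _ _ _ _ hd h8; have hs := chi2_odd_sqr d hod.
have e1 := f_sqr_inv f a H p b c d z hd h8 hz.
have e2 := g_sqr_inv f a H p b c d z hd h8 hz.
rewrite /hB /polyB e1 e2.
set chi := RtoC (IZR (chi2 d)) in hs.
have hq (X : C) : (chi * X * (chi * X) = X * X)%C.
  transitivity (chi * chi * (X * X))%C; first ring. by rewrite hs; ring.
case: (half_orbit p b c d z hd h8 hz) => -[-> ->]; rewrite -/chi;
  set s := f (z / 2); set t := f (z / 2 + 1 / 2)%C.
- have -> : ((chi * s + chi * t) / 2 = chi * ((s + t) / 2))%C by rewrite /Cdiv; ring.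
  have -> : ((chi * s - chi * t) / 2 = chi * ((s - t) / 2))%C by rewrite /Cdiv; ring.
  by rewrite !hq.
- have -> : ((chi * t + chi * s) / 2 = chi * ((s + t) / 2))%C by rewrite /Cdiv; ring.
  have -> : ((chi * t - chi * s) / 2 = chi * (- ((s - t) / 2)))%C by rewrite /Cdiv; ring.
  rewrite !hq; ring.
Qed.

Lemma val_lim (v : C -> C) s (k : nat) (b : R) : (0 < k)%nat ->
  (forall j, (j < 4)%nat -> s (j + 4)%nat = s j) ->
  (forall Z, 0 < Im Z -> f (v Z) = comb s f (Z / 64)%C) ->
  cusplim (fun z => f (v (RtoC (INR k) * z + b)%C)) (comb_hol s ft 0).
Proof.
move=> hk hs hv.
apply: cusplim_ext (cusplim_affine _ k (b / 64) hk (hol_comb _ _ hft)) _ => z hz.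
have hZ : 0 < Im (RtoC (INR k) * z + b)%C.
  rewrite Im_plus_R Im_mult re_RtoC im_RtoC.
  have := lt_0_INR k ltac:(lia); nra.
rewrite hv // (data1_comb a f _ _ H) //; last by rewrite Im_div64; lra.
congr comb_hol; congr ee; rewrite RtoC_div; last lra. by field.
Qed.

(** At the cusp 1/2 the points z/2 and z/2 + 1/2 go to 1/4 and 3/4, where f tends to 0. *)
Lemma hB_cusp_2 : exists l, cusplim (fun z => hB (cuspmap C2 z)) l /\ l = 0.
Proof.
have [F1 [F2 [k1 [k2 e']]]] := cusp_fg f a H C2 ltac:(by []).
have [p0 [p1 [p2 p3]]] := sgn_per; have [q0 [q1 [q2 q3]]] := sgn_sums.
have k3 := val_lim _ _ 8 4 ltac:(lia) p2 (val2 f M Q).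
have k4 := val_lim _ _ 8 4 ltac:(lia) p3 (val3 f M Q).
eexists; split.
  apply: cusplim_ext (cusplim_polyB _ _ _ _ _ _ _ _ k1 k2 k3 k4) _ => w hw.
  have [<- <-] := e' w hw; rewrite /hB /cuspmap.
  have n4 := four_z_2 w hw; have c2 := C2_neq0; have c4 := C4_neq0.
  have n8 : (8 * w + 4)%C <> 0.
    move=> h; apply: n4; apply: (Cmult_eq_0_r 2) c2 _; rewrite -h; ring.
  rewrite INR_C; congr polyB; congr f; rewrite /=; by field.
have hs := sqrt2_C_neq0; rewrite !comb_hol_0 q2 q3 /polyB; by field.
Qed.

(** Half of the argument stays at the cusp 0 and the other half at 1/2. With the limit 2 sqrt 2 e0
    at 0 the two products tend to 4 e0^4 and 2 e0^5. *)
Lemma hB_cusp_0 : exists l, cusplim (fun z => hB (cuspmap C0 z)) l /\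
  l = (2 * (e0 * e0 * e0 * e0) * (2 - e0))%C.
Proof.
have [F1 [F2 [k1 [k2 e']]]] := cusp_fg f a H C0 ltac:(by []).
have [p0 [p1 [p2 p3]]] := sgn_per; have [q0 [q1 [q2 q3]]] := sgn_sums.
have k3 := val_lim _ _ 2 0 ltac:(lia) p0 (val0 f M Q).
have k4 := val_lim _ _ 2 0 ltac:(lia) p1 (val1 f M Q).
eexists; split.
  apply: cusplim_ext (cusplim_polyB _ _ _ _ _ _ _ _ k1 k2 k3 k4) _ => w hw.
  have [<- <-] := e' w hw; rewrite /hB /cuspmap.
  have n4 := Im_neq0 w hw; have c2 := C2_neq0.
  rewrite INR_C Cplus_0_r; congr polyB; congr f; rewrite /=; by field.
have hs := sqrt2_C_neq0; have hss := sqrt2_C.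
rewrite !comb_hol_0 q0 q1 /ft (ft_0 f a H) -/e0 /polyB.
set r := RtoC (sqrt 2) in hs hss *.
have -> : (/ (2 * r) * (8 * e0) = 4 * e0 * r / (r * r))%C by field.
rewrite hss.
transitivity (r * r * (e0 * e0) * (/ 4 * (r * r * e0 * e0) * 4 - e0 * e0 * e0))%C; first by field.
rewrite hss; by field.
Qed.

Lemma hB_cusp_inf : exists l, cusplim (fun z => hB (cuspmap Cinf z)) l.
Proof.
have [e2 [he2 ee2]] := ev_shift f a H; have [o2 [ho2 eo2]] := ov_shift f a H.
have L k F : (0 < k)%nat -> hol F -> cusplim (fun z => F (ee (RtoC (INR k) * (z / 64))%C)) (F 0).
  move=> hk hF; apply: cusplim_ext (cusplim_affine F k 0 hk hF) _ => z _; by rewrite Cplus_0_r.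
have x1 := L 32%nat _ ltac:(lia) hol_id.
have xx := cusplim_mult _ _ _ _ x1 x1.
have E1 := L 32%nat _ ltac:(lia) he2. have O1 := L 32%nat _ ltac:(lia) ho2.
have E2 := L 64%nat _ ltac:(lia) he2. have O2 := L 64%nat _ ltac:(lia) ho2.
have V1 := L 32%nat _ ltac:(lia) (hol_ev f a H). have W2 := L 64%nat _ ltac:(lia) (hol_ov f a H).
have c0 := cusplim_const e0; have ct := cusplim_const 2.
have p := cusplim_mult _ _ _ _ xx (cusplim_plus _ _ _ _ (cusplim_mult _ _ _ _ E2 W2) (cusplim_mult _ _ _ _ c0 O2)).
have r := cusplim_mult _ _ _ _ E1 (cusplim_plus _ _ _ _ (cusplim_mult _ _ _ _ ct c0) (cusplim_mult _ _ _ _ xx E1)).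
have s := cusplim_mult _ _ _ _ O1 (cusplim_plus _ _ _ _ ct (cusplim_mult _ _ _ _ xx O1)).
have tot := cusplim_minus _ _ _ _ (cusplim_plus _ _ _ _ (cusplim_mult _ _ _ _ c0 r)
   (cusplim_mult _ _ _ _ p (cusplim_mult _ _ _ _ V1 V1)))
   (cusplim_mult _ _ _ _ (cusplim_const (e0 * e0 * e0)%C) s).
eexists; apply: cusplim_ext tot _ => w hw.
have a1 : (RtoC (INR 32) * (w / 64) = w / 2)%C by rewrite INR_C /=; field.
have a2 : (RtoC (INR 64) * (w / 64) = w / 2 + w / 2)%C by rewrite INR_C /=; field.
rewrite a1 a2 ee_plus /cuspmap /hB.
have hw2 := Im_div2 w hw.
have [-> ->] := f_split f a H w hw; have [-> ->] := f_split f a H _ hw2.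
have -> : ee w = (ee (w / 2) * ee (w / 2))%C by rewrite -ee_plus; congr ee; field.
have hx := Cmod_ee_lt1 _ hw2; have hn := ee_neq0 (w / 2); set x := ee (w / 2) in hx hn *.
have hxx : Cmod (x * x) < 1 by rewrite Cmod_mult; have := Cmod_ge_0 x; nra.
rewrite /polyB !eo2 // !ee2 // -/e0; by field.
Qed.

(** The critical cusp: the half arguments return to infinity and produce the double pole of
    O(w/2)^2. The factor u^2 - v^2 vanishes to order two in e(w/2) by [cb_2_01] and cancels it. *)
Lemma hB_cusp_4 : exists l, cusplim (fun z => hB (cuspmap C4 z)) l.
Proof.
have [p0 [p1 [p2 p3]]] := sgn_per; have [z2 [z2' [z3 z3']]] := cb_2_01.
have hps : psrep a ft by case: H => _ [_ []].
have [G2 [hG2 eG2]] := psrep_shift2 _ _ (psrep_comb a ft sgn2 hps) ltac:(by cbv beta; rewrite z2; ring) ltac:(by cbv beta; rewrite z2'; ring).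
have [G3 [hG3 eG3]] := psrep_shift2 _ _ (psrep_comb a ft sgn3 hps) ltac:(by cbv beta; rewrite z3; ring) ltac:(by cbv beta; rewrite z3'; ring).
have L2 := cusplim_affine _ 16 (4 / 64) ltac:(lia) hG2.
have L3 := cusplim_affine _ 16 (4 / 64) ltac:(lia) hG3.
have E := cusplim_affine _ 32 0 ltac:(lia) (hol_ev f a H).
have O := cusplim_affine _ 32 0 ltac:(lia) (hol_ov f a H).
have tot := cusplim_minus _ _ _ _ (cusplim_mult _ _ _ _ (cusplim_const (z8 * z8 / 4)%C)
   (cusplim_mult _ _ _ _ (cusplim_minus _ _ _ _ (cusplim_mult _ _ _ _ L2 L2) (cusplim_mult _ _ _ _ L3 L3))
     (cusplim_mult _ _ _ _ O O)))
   (cusplim_mult _ _ _ _ (cusplim_const (e0 * e0 * e0)%C) (cusplim_mult _ _ _ _ E E)).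
eexists; apply: cusplim_ext tot _ => w hw.
have a1 : (RtoC (INR 32) * (w / 64) + 0 = w / 2)%C by rewrite INR_C /=; field.
set y := (RtoC (INR 16) * (w / 64) + RtoC (4 / 64))%C.
have ey : y = ((16 * w + 4) / 64)%C by rewrite /y INR_C RtoC_div; [rewrite /=; field|lra].
have hZ : 0 < Im (16 * w + 4)%C by move: hw; rewrite /Im /=; lra.
have hy : 0 < Im y by rewrite ey Im_div64; lra.
have hw2 := Im_div2 w hw.
have n4 := sixteen_z_4 w hw; have c4 := C4_neq0; have c2 := C2_neq0.
have f1 : f (cuspmap C4 w) = (ee y * ee y * G2 (ee y))%C.
  by rewrite /cuspmap (val2 f) // -ey (data1_comb a f _ _ H) // eG2 //; exact: Cmod_ee_lt1.
have f2 : f (cuspmap C4 w + 1 / 2)%C = (ee y * ee y * G3 (ee y))%C.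
  have -> : (cuspmap C4 w + 1 / 2 = 3 / 4 - 1 / (16 * w + 4))%C by rewrite /cuspmap; field.
  by rewrite (val3 f) // -ey (data1_comb a f _ _ H) // eG3 //; exact: Cmod_ee_lt1.
have hu : 0 < Im (w / 2 + RtoC (IZR 1) / 8)%C by rewrite Im_plus_div8.
have n8 : (64 * (w / 2 + 1 / 8))%C <> 0.
  move=> h; apply: n4; apply: (Cmult_eq_0_r 2) c2 _; rewrite -h; by field.
have n82 : (w * 8 + 2)%C <> 0 by move=> h; apply: n4; transitivity (2 * (w * 8 + 2))%C; [ring|rewrite h; ring].
have f3 : f (cuspmap C4 w / 2)%C = f (w / 2)%C.
  have -> : (cuspmap C4 w / 2 = - (1) / (64 * (w / 2 + RtoC (IZR 1) / 8)) + RtoC (IZR 1) / 8)%C.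
    rewrite /cuspmap; by field.
  rewrite (f_near8 f M 1 0) // chi2_vals Cmult_1_l; congr f; rewrite /=; field.
have f4 : f (cuspmap C4 w / 2 + 1 / 2)%C = (- f (w / 2 + 1 / 2))%C.
  have -> : (cuspmap C4 w / 2 + 1 / 2 = - (1) / (64 * (w / 2 + RtoC (IZR 1) / 8)) + RtoC (IZR 5) / 8)%C.
    rewrite /cuspmap; by field.
  rewrite (f_near8 f M 5 3) // !chi2_vals.
  have -> : (w / 2 + 1 / 2 = w / 2 + RtoC (IZR 1) / 8 + RtoC (IZR (-5)) / 8 + RtoC (IZR 1))%C.
    rewrite /=; by field.
  rewrite (f_per_Z f) //; last by rewrite !Im_plus_div8.
  rewrite /=; ring.
rewrite a1 /hB f1 f2 f3 f4; have [-> ->] := f_split f a H _ hw2.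
have hyy : (ee y * ee y = z8 * ee (w / 2))%C.
  rewrite /z8 -!ee_plus; congr ee; rewrite ey; by field.
rewrite /polyB hyy; have hn := ee_neq0 (w / 2); set x := ee (w / 2) in hn *.
by field.
Qed.

Lemma hB_zero : (forall z, 0 < Im z -> hB z = 0) /\ (2 * (e0 * e0 * e0 * e0) * (2 - e0))%C = 0.
Proof.
have [l0 [h0 e]] := hB_cusp_0; have [l2 [h2 e']] := hB_cusp_2.
have hinv : Gamma0_8_abs hB by move=> p b c d hd h8 w hw; rewrite hB_inv.
have [|c [hc hl]] := liouville8 hB hinv.
  by case; [exact: hB_cusp_inf|exists l0|exists l2|exact: hB_cusp_4].
have ec : c = 0 by rewrite -(hl C2 l2 h2) e'.
split; first by move=> z hz; rewrite hc.
by rewrite -e (hl C0 l0 h0).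
Qed.

(** If the even part vanished, f would change sign under z -> z + 1/2. The eight translates in the
    expansion at the cusp 0 would then cancel in pairs, so f would be 0, against its pole. *)
Lemma not_zero_near (d : R) : 0 < d -> (forall x, 0 < x < d -> ev a (RtoC x) = 0) -> False.
Proof.
move=> hd h; have [b hb] := hol_ev f a H; have hb0 := psrep_zero _ _ _ hb hd h.
have hz z : 0 < Im z -> f (z + 1 / 2)%C = (- f z)%C.
  move=> hz; have [-> ->] := f_split f a H z hz.
  have -> : ev a (ee z) = 0.
    apply: Cseries_unique (hb _ (Cmod_ee_lt1 _ hz)) _.
    have e n : (b n * ee z ^ n)%C = 0 by rewrite hb0; ring.
    by have := Cseries_zero_from _ 0 (fun n _ => e n); rewrite Csum_0 e.
  ring.
have f0 z : 0 < Im z -> f z = 0.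
  move=> hw; set Z := (- (1) / z)%C.
  have hZ : 0 < Im Z by exact: (cuspmap_H C0 _ hw).
  have hn := Im_neq0 z hw.
  have -> : z = (- (1) / Z)%C by rewrite /Z; field.
  rewrite (val0 f M Q Z hZ) /comb !Csum_S Csum_0 /sgn0 /sgn_list; cbn [nth]; cbv beta.
  have p (k : nat) : f (Z / 64 + RtoC (INR (k + 4)) / 8)%C = (- f (Z / 64 + RtoC (INR k) / 8))%C.
    rewrite -hz; last by rewrite -RtoC_div ?Im_plus_R ?Im_div64; lra.
    congr f; rewrite plus_INR RtoC_plus (_ : INR 4 = 4); last by rewrite /=; lra. by field.
  rewrite (p 0%nat) (p 1%nat) (p 2%nat) (p 3%nat); ring.
have : (RtoC 0 * ft 0)%C = (- (1))%C.
  apply: (hol_limit0 (fun x => x * ft x)%C _ 1 (hol_mult _ _ hol_id hft) Rlt_0_1) => x hx.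
  have hx1 : Cmod x < 1 by rewrite Cmod_R Rabs_pos_eq; lra.
  have hx0 : RtoC x <> 0 by move=> [] hh; lra.
  have [z [hz1 hz2]] := ee_64_surj x hx0 hx1.
  have hz64 : 0 < Im (z / 64) by rewrite Im_div64; lra.
  have := f0 _ hz64; rewrite (data1_exp a f H) // ee_opp hz2 => e.
  transitivity (x * (/ x + psum a x) - 1)%C; first by rewrite /ft; field.
  rewrite e; ring.
rewrite Cmult_0_l => -[] hh; lra.
Qed.

(** The limits of [hB] at the cusps 0 and 1/2 agree, so e0 is 0 or 2. For e0 = 0 the first relation
    gives E O = 0 with [ov] close to 1, so the even part vanishes near 0. *)
Lemma a0_eq_2 : e0 = 2.
Proof.
have [_ h] := hB_zero.
have hn : e0 <> 0.
  move=> he; have [K [hK hk]] := hol_lip0 _ (hol_ov f a H).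
  have hd : 0 < Rmin (/ 2) (/ (2 * K)) by apply: Rmin_glb_lt; apply: Rinv_0_lt_compat; lra.
  apply: (not_zero_near _ hd) => x hx.
  have hx2 : x < / 2 by have := Rmin_l (/ 2) (/ (2 * K)); lra.
  have hxK : x * (2 * K) < 1.
    have hxx : x < / (2 * K) by have := Rmin_r (/ 2) (/ (2 * K)); lra.
    have := Rmult_lt_compat_r (2 * K) _ _ ltac:(lra) hxx; rewrite Rinv_l; lra.
  have hx1 : Cmod x < 1 by rewrite Cmod_R Rabs_pos_eq; lra.
  have hx0 : RtoC x <> 0 by move=> [] hh; lra.
  have := ident_A f a H x hx0 hx1; rewrite -/e0 he => hA.
  have hov : ov a x <> 0.
    move=> ho; have := hk x; rewrite ho (ov_0 a) Cmod_R Rabs_pos_eq; last lra.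
    have -> : (0 - 1 = - (1))%C by ring.
    rewrite Cmod_opp Cmod_1; nra.
  case: (classic (ev a x = 0)) => // hev; exfalso.
  have : (ev a x * ev a x * (ov a x * ov a x))%C <> 0 by apply: Cmult_neq_0; apply: Cmult_neq_0.
  apply; rewrite -hA; ring.
have h4 : (2 * (e0 * e0 * e0 * e0) <> 0)%C.
  by apply: Cmult_neq_0; [exact: C2_neq0|do 2 (apply: Cmult_neq_0 => //); apply: Cmult_neq_0].
have h2 := Cmult_eq_0_r _ _ h4 h.
apply: eq_sym; exact: Cminus_eq0.
Qed.

Lemma ident_A2 (x : C) : x <> 0 -> Cmod x < 1 ->
  (4 * (x * x * (ev a x * ev a x) + ov a x * ov a x) = ev a x * ev a x * (ov a x * ov a x))%C.
Proof. by move=> h1 h2; rewrite -(ident_A f a H) // -/e0 a0_eq_2; ring. Qed.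

Lemma ident_B (x : C) : x <> 0 -> Cmod x < 1 ->
  (ev a x * ev a x * (ev a (x * x) * ov a (x * x)) = 8 * (ov a x * ov a x))%C.
Proof.
move=> hx hx1; have [z [hz1 hz2]] := ee_64_surj x hx hx1.
have hz : 0 < Im (z / 64) by rewrite Im_div64; lra.
have hw : 0 < Im (2 * (z / 64)) by move: hz; rewrite /Im /=; lra.
have h := proj1 hB_zero _ hw; move: h; rewrite /hB.
have -> : (2 * (z / 64) / 2 = z / 64)%C by field.
have [-> ->] := f_split f a H _ hz; have [-> ->] := f_split f a H _ hw.
have -> : (2 * (z / 64) = z / 64 + z / 64)%C by ring.
rewrite ee_plus hz2 /polyB a0_eq_2 => h; apply: Cminus_eq0.
match type of h with ?L = _ => transitivity (x * x * L)%C end; last by rewrite h; ring.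
by field.
Qed.
End IdentB.

(** * Formal power series with real coefficients *)

Definition fps := nat -> R.
Definition fadd (a b : fps) : fps := fun n => a n + b n.
Definition fopp (a : fps) : fps := fun n => - a n.
Definition fsub (a b : fps) : fps := fun n => a n - b n.
Definition fmul (a b : fps) : fps := PS_mult a b.
Definition fcst (c : R) : fps := fun n => match n with O => c | _ => 0 end.

Lemma sum_rev (u : nat -> R) n : sum_f_R0 (fun k => u (n - k)%nat) n = sum_f_R0 u n.
Proof.
elim: n u => [|n IH] u //.
rewrite tech5 Nat.sub_diag (decomp_sum u); last lia.
rewrite -(IH (fun k => u (S k))) Rplus_comm /=; congr Rplus.
by apply: sum_eq => i hi; congr u; case: i hi => [|i] hi; lia.
Qed.

Lemma sum_triangle (F : nat -> nat -> R) n :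
  sum_f_R0 (fun k => sum_f_R0 (fun i => F i (k - i)%nat) k) n =
  sum_f_R0 (fun i => sum_f_R0 (F i) (n - i)) n.
Proof.
elim: n => [|n IH] //.
rewrite !tech5 IH Nat.sub_diag -Rplus_assoc -plus_sum; congr Rplus.
apply: sum_eq => i hi.
have -> : (S n - i = S (n - i))%nat by lia.
by rewrite tech5.
Qed.

Lemma fps_ring : ring_theory (fcst 0) (fcst 1) fadd fmul fsub fopp (@eq fps).
Proof.
have comm a b : fmul a b = fmul b a.
  apply: functional_extensionality => n; rewrite /fmul /PS_mult.
  rewrite -[in RHS]sum_rev; apply: sum_eq => i hi.
  have -> : (n - (n - i) = i)%nat by lia. ring.
split=> //.
- by move=> a; apply: functional_extensionality => -[|n]; rewrite /fadd /=; ring.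
- by move=> a b; apply: functional_extensionality => n; rewrite /fadd; ring.
- by move=> a b c; apply: functional_extensionality => n; rewrite /fadd; ring.
- move=> a; apply: functional_extensionality => n; rewrite /fmul /PS_mult.
  case: n => [|n]; first by rewrite /=; ring.
  rewrite decomp_sum; last lia.
  rewrite (sum_eq _ (fun _ => 0)) ?sum_cte /=; first ring.
  by move=> i hi; ring.
- move=> a b c; apply: functional_extensionality => n; rewrite /fmul /PS_mult.
  transitivity (sum_f_R0 (fun i => sum_f_R0 (fun j => a i * b j * c (n - i - j)%nat) (n - i)) n).
    apply: sum_eq => i hi; rewrite scal_sum; apply: sum_eq => j hj; ring.
  rewrite -(sum_triangle (fun i j => a i * b j * c (n - i - j)%nat)).
  apply: sum_eq => k hk; rewrite Rmult_comm scal_sum; apply: sum_eq => i hi.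
  by have -> : (n - i - (k - i) = n - k)%nat by lia.
- move=> a b c; apply: functional_extensionality => n; rewrite /fmul /fadd /PS_mult -plus_sum.
  by apply: sum_eq => i hi; ring.
- by move=> a; apply: functional_extensionality => -[|n]; rewrite /fadd /fopp /=; ring.
Qed.
Add Ring fps_ring_inst : fps_ring.

Lemma fmul_0 a b : fmul a b 0%nat = a 0%nat * b 0%nat.
Proof. by []. Qed.

Lemma fcst_mul c a n : fmul (fcst c) a n = c * a n.
Proof.
rewrite /fmul /PS_mult; case: n => [|n] //.
rewrite decomp_sum; last lia.
rewrite (sum_eq _ (fun _ => 0)) ?sum_cte /=; first ring.
by move=> i hi; ring.
Qed.

(* q -> q^2 and q -> -q *)
Definition dil (a : fps) : fps := fun n => if Nat.even n then a (Nat.div2 n) else 0.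
Definition tw (a : fps) : fps := fun n => (-1) ^ n * a n.

Lemma dil_even a (n : nat) : dil a (2 * n)%nat = a n.
Proof. by rewrite /dil Nat.even_mul /= -/(2 * n)%nat Nat.div2_double. Qed.
Lemma dil_odd a (n : nat) : dil a (S (2 * n))%nat = 0.
Proof. by rewrite /dil Nat.even_succ Nat.odd_mul. Qed.

Lemma even_odd_ind (P : nat -> Prop) : (forall n, P (2 * n)%nat) -> (forall n, P (S (2 * n))%nat) -> forall n, P n.
Proof.
move=> h1 h2 n; have [[k hk]|[k hk]] := Nat.Even_or_Odd n; rewrite hk //.
have -> : (2 * k + 1 = S (2 * k))%nat by lia. exact: h2.
Qed.

Lemma sum_dil u (n : nat) : sum_f_R0 (dil u) (2 * n)%nat = sum_f_R0 u n.
Proof.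
elim: n => [|n IH] //.
have -> : (2 * S n = S (S (2 * n)))%nat by lia.
rewrite !tech5 IH dil_odd.
have -> : (S (S (2 * n)) = 2 * S n)%nat by lia.
by rewrite dil_even Rplus_0_r.
Qed.

Lemma dil_inj a b : dil a = dil b -> a = b.
Proof. by move=> h; apply: functional_extensionality => n; rewrite -dil_even h dil_even. Qed.

Lemma dil_mul a b : dil (fmul a b) = fmul (dil a) (dil b).
Proof.
apply: functional_extensionality; apply: even_odd_ind => n; rewrite ?dil_even ?dil_odd /fmul /PS_mult.
  rewrite -sum_dil; apply: sum_eq => i _; move: i; apply: even_odd_ind => i; rewrite ?dil_even ?dil_odd; last ring.
  by have -> : (2 * n - 2 * i = 2 * (n - i))%nat by [lia]; rewrite dil_even.
rewrite (sum_eq _ (fun _ => 0)) ?sum_cte; first ring.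
move=> i; move: i; apply: even_odd_ind => i hi; rewrite ?dil_odd; last ring.
have -> : (S (2 * n) - 2 * i = S (2 * (n - i)))%nat by lia.
rewrite dil_odd; ring.
Qed.

Lemma dil_cst c : dil (fcst c) = fcst c.
Proof.
by apply: functional_extensionality; apply: even_odd_ind => n; rewrite ?dil_even ?dil_odd; case: n.
Qed.

Lemma tw_mul a b : tw (fmul a b) = fmul (tw a) (tw b).
Proof.
apply: functional_extensionality => n; rewrite /tw /fmul /PS_mult scal_sum; apply: sum_eq => i hi.
have -> : (-1) ^ n = (-1) ^ i * (-1) ^ (n - i) by rewrite -pow_add; congr pow; lia.
ring.
Qed.

Lemma tw_tw a : tw (tw a) = a.
Proof.
apply: functional_extensionality => n; rewrite /tw -Rmult_assoc -pow_add.
by have -> : (n + n = 2 * n)%nat by [lia]; rewrite pow_1_even Rmult_1_l.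
Qed.

Lemma tw_cst c : tw (fcst c) = fcst c.
Proof. by apply: functional_extensionality => -[|n]; rewrite /tw /=; ring. Qed.

(** The values up to n are tabulated so that the recursion on all earlier coefficients is
    structural. The result is the reciprocal of [a] when [a 0 = 1]. *)
Fixpoint finv_upto (a : fps) (n : nat) : fps :=
  match n with
  | O => fcst 1
  | S m => let b := finv_upto a m in
           fun k => if Nat.leb k m then b k
                    else - sum_f_R0 (fun j => b j * a (S m - j)%nat) m
  end.
Definition finv (a : fps) : fps := fun n => finv_upto a n n.

Lemma finv_upto_le a n k : (k <= n)%nat -> finv_upto a n k = finv a k.
Proof.
elim: n => [|n IH] hk; first by have -> : k = 0%nat by lia.
have [e|e] := Nat.eq_dec k (S n); first by rewrite e.
by rewrite /= (proj2 (Nat.leb_le k n)) ?IH //; lia.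
Qed.

Lemma finv_mul a : a 0%nat = 1 -> fmul (finv a) a = fcst 1.
Proof.
move=> ha; apply: functional_extensionality => -[|n]; rewrite /fmul /PS_mult.
  by rewrite /= ha /finv /=; ring.
rewrite tech5 Nat.sub_diag ha.
have -> : finv a (S n) = if Nat.leb (S n) n then finv_upto a n (S n)
  else - sum_f_R0 (fun j => finv_upto a n j * a (S n - j)%nat) n by [].
rewrite (proj2 (Nat.leb_gt (S n) n)); last lia.
rewrite (sum_eq (fun j => finv_upto a n j * _) (fun j => finv a j * a (S n - j)%nat)); last first.
  by move=> j hj; rewrite finv_upto_le.
change (fcst 1 (S n)) with 0; ring.
Qed.

(** The relation that b is a majorant of a. It is compatible with products and dilations, so bounds
    for theta products are proved factor by factor. *)
Definition fle (a b : fps) := forall n, Rabs (a n) <= b n.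
Definition fnn (a : fps) := forall n, 0 <= a n.

Lemma fle_nn a b : fle a b -> fnn b.
Proof. by move=> h n; apply: Rle_trans (Rabs_pos _) (h n). Qed.
Lemma fnn_fle a : fnn a -> fle a a.
Proof. by move=> h n; rewrite Rabs_pos_eq //; exact: Rle_refl. Qed.
Lemma fle_trans a b c : fle a b -> fle b c -> fle a c.
Proof. by move=> h1 h2 n; apply: Rle_trans (h1 n) (Rle_trans _ _ _ (Rle_abs _) (h2 n)). Qed.
Lemma fnn_mul a b : fnn a -> fnn b -> fnn (fmul a b).
Proof. by move=> ha hb n; apply: cond_pos_sum => k; apply: Rmult_le_pos. Qed.
Lemma fle_mul a b c d : fle a b -> fle c d -> fle (fmul a c) (fmul b d).
Proof.
move=> h1 h2 n; rewrite /fmul /PS_mult; apply: Rle_trans (Rsum_abs _ _) _.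
apply: sum_Rle => k hk; rewrite Rabs_mult; apply: Rmult_le_compat => //; exact: Rabs_pos.
Qed.
Lemma fle_dil a b : fle a b -> fle (dil a) (dil b).
Proof.
move=> h; apply: even_odd_ind => n; rewrite ?dil_even ?dil_odd ?Rabs_R0 //; exact: Rle_refl.
Qed.
Lemma fnn_dil a : fnn a -> fnn (dil a).
Proof. by move=> h; apply: even_odd_ind => n; rewrite ?dil_even ?dil_odd //; exact: Rle_refl. Qed.
Lemma fnn_cst c : 0 <= c -> fnn (fcst c).
Proof. move=> h [|n] //; exact: Rle_refl. Qed.
Lemma fnn_term a b k n : fnn a -> fnn b -> (k <= n)%nat -> a k * b (n - k)%nat <= fmul a b n.
Proof.
move=> ha hb hk; rewrite /fmul /PS_mult.
have hp j : 0 <= a j * b (n - j)%nat by apply: Rmult_le_pos.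
suff : forall m, (k <= m)%nat -> a k * b (n - k)%nat <= sum_f_R0 (fun j => a j * b (n - j)%nat) m by apply.
elim=> [|m IH] {}hk; first by have -> : k = 0%nat by [lia]; apply: Rle_refl.
rewrite tech5; have [e|e] := Nat.eq_dec k (S m).
  rewrite e; have := cond_pos_sum (fun j => a j * b (n - j)%nat) m hp; lra.
have := IH ltac:(lia); have := hp (S m); lra.
Qed.
(** The single term [c 0 * b n] of the product already suffices; all others are nonnegative. *)
Lemma fle_mul_one a b c : fle a b -> fnn c -> c 0%nat = 1 -> fle a (fmul c b).
Proof.
move=> h hc h1 n; apply: Rle_trans (h n) _.
have := fnn_term c b 0 n hc (fle_nn _ _ h) ltac:(lia).
by rewrite h1 Nat.sub_0_r Rmult_1_l.
Qed.

Definition rrep (b : fps) (phi : C -> C) := psrep (fun n => RtoC (b n)) phi.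

Lemma Csum_RtoC (u : nat -> R) n : Csum (fun k => RtoC (u k)) n = RtoC (sum_f_R0 u n).
Proof. by elim: n => [|n IH]; rewrite ?Csum_0 ?Csum_S ?IH // -RtoC_plus. Qed.

Lemma rrep_mul b c phi psi : rrep b phi -> rrep c psi -> rrep (fmul b c) (fun s => phi s * psi s)%C.
Proof.
move=> h1 h2; apply: psrep_ext_b (psrep_mult _ _ _ _ h1 h2) _ => n.
rewrite /Cconv -Csum_RtoC; apply: Csum_ext => k _; by rewrite RtoC_mult.
Qed.
Lemma rrep_add b c phi psi : rrep b phi -> rrep c psi -> rrep (fadd b c) (fun s => phi s + psi s)%C.
Proof. by move=> h1 h2; apply: psrep_ext_b (psrep_plus _ _ _ _ h1 h2) _ => n; rewrite -RtoC_plus. Qed.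
Lemma rrep_scal c b phi : rrep b phi -> rrep (fmul (fcst c) b) (fun s => RtoC c * phi s)%C.
Proof. by move=> h1; apply: psrep_ext_b (psrep_scal _ _ _ h1) _ => n; rewrite fcst_mul -RtoC_mult. Qed.
Lemma rrep_dil b phi : rrep b phi -> rrep (dil b) (fun s => phi (s * s)%C).
Proof.
move=> h s hs.
have h2 : (s ^ 2 = s * s)%C by rewrite /=; ring.
have := psrep_comp_pow 2 _ _ ltac:(lia) h s hs; rewrite h2; apply: Cseries_ext => n; congr Cmult.
move: n; apply: even_odd_ind => n.
  by rewrite dil_even spread_mult //; lia.
rewrite dil_odd spread_0 //.
have -> : (S (2 * n) = 1 + n * 2)%nat by lia.
by rewrite Nat.Div0.mod_add.
Qed.
Lemma rrep_tw b phi : rrep b phi -> rrep (tw b) (fun s => phi (- s)%C).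
Proof.
move=> h s hs.
have e : (- (1) * s = - s)%C by ring.
have := psrep_rot (- (1))%C _ _ ltac:(by rewrite Cmod_m1; lra) h s hs; rewrite e; apply: Cseries_ext => n.
congr Cmult; rewrite /tw RtoC_mult Cmult_comm; congr Cmult.
by elim: n => [|n IH] //=; rewrite IH -RtoC_opp RtoC_mult.
Qed.
Lemma rrep_unique b c phi psi d : rrep b phi -> rrep c psi -> 0 < d ->
  (forall x, 0 < x < d -> phi (RtoC x) = psi (RtoC x)) -> b = c.
Proof.
move=> h1 h2 hd h; apply: functional_extensionality => n.
by case: (psrep_unique _ _ _ _ _ h1 h2 hd h n).
Qed.
(** * Theta series *)

Definition is_sq (n : nat) : bool := Nat.eqb (Nat.sqrt n * Nat.sqrt n) n.
Definition theta : fps := fun n => match n with O => 1 | _ => if is_sq n then 2 else 0 end.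

Lemma is_sqP n : is_sq n = true <-> exists s, (n = s * s)%nat.
Proof.
rewrite /is_sq; split; first by move/Nat.eqb_eq => h; exists (Nat.sqrt n).
by move=> [s ->]; rewrite Nat.sqrt_square Nat.eqb_refl.
Qed.

Definition lsum {T : Type} (f : T -> R) (l : list T) : R := fold_right (fun i s => f i + s) 0 l.

Lemma lsum_ext {T} (f g : T -> R) l : (forall i, f i = g i) -> lsum f l = lsum g l.
Proof. by move=> h; elim: l => [|i l IH] //=; rewrite h IH. Qed.
Lemma lsum_scal {T} c (f : T -> R) l : c * lsum f l = lsum (fun i => c * f i) l.
Proof. elim: l => [|i l IH] /=; rewrite -?IH; ring. Qed.
Lemma sum_lsum {T} (f : nat -> T -> R) l n :
  sum_f_R0 (fun k => lsum (f k) l) n = lsum (fun i => sum_f_R0 (fun k => f k i) n) l.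
Proof.
elim: l => [|i l IH] /=; last by rewrite -IH -plus_sum.
by rewrite sum_cte; ring.
Qed.
Lemma lsum_prod {T} (f : T -> T -> R) l l' :
  lsum (fun i => lsum (f i) l') l = lsum (fun p => f (fst p) (snd p)) (list_prod l l').
Proof.
elim: l => [|i l IH] //=; rewrite IH.
move: (list_prod l l') => r; elim: l' {IH} => [|j l' IH] /=; first ring.
by rewrite -IH; ring.
Qed.
Lemma lsum_count {T} (P : T -> bool) l :
  lsum (fun i => if P i then 1 else 0) l = INR (length (filter P l)).
Proof.
elim: l => [|i l IH] //; rewrite /= IH; case: (P i); last by rewrite Rplus_0_l.
by have := S_INR (length (filter P l)); rewrite /=; lra.
Qed.

Definition rng (N : nat) : list Z := map (fun k => Z.of_nat k - Z.of_nat N)%Z (seq 0 (2 * N + 1)).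

Lemma rng_In N i : In i (rng N) <-> (Z.abs i <= Z.of_nat N)%Z.
Proof.
rewrite /rng in_map_iff; split.
  by move=> [k [<-]] /in_seq; lia.
move=> h; exists (Z.to_nat (i + Z.of_nat N)); split; first lia.
apply/in_seq; lia.
Qed.
Lemma rng_NoDup N : NoDup (rng N).
Proof.
apply: FinFun.Injective_map_NoDup (seq_NoDup _ _) => x y; lia.
Qed.

Lemma same_length {T} (l l' : list T) : NoDup l -> NoDup l' -> (forall i, In i l <-> In i l') -> length l = length l'.
Proof. by move=> h1 h2 h; apply: Permutation_length; apply: NoDup_Permutation. Qed.

Lemma NoDup_prod {T} (l l' : list T) : NoDup l -> NoDup l' -> NoDup (list_prod l l').
Proof.
move=> h h'; elim: h => [|x {}l hx hl IH] /=; first by constructor.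
apply: NoDup_app => //.
  by apply: FinFun.Injective_map_NoDup => // y z [].
by move=> [u v] /in_map_iff [y [[<- _] _]] /in_prod_iff [].
Qed.

Definition dlt (z : Z) (k : nat) : R := if (z =? Z.of_nat k)%Z then 1 else 0.

Lemma theta_count N n : (n <= N)%nat -> theta n = lsum (fun i => dlt (i * i) n) (rng N).
Proof.
move=> hN; rewrite /dlt (lsum_count (fun i => (i * i =? Z.of_nat n)%Z)).
have key l : NoDup l -> (forall i, In i l <-> (i * i = Z.of_nat n)%Z) ->
    length (filter (fun i => (i * i =? Z.of_nat n)%Z) (rng N)) = length l.
  move=> h1 h2; apply: same_length => //; first by apply: NoDup_filter; exact: rng_NoDup.
  move=> i; rewrite filter_In rng_In Z.eqb_eq h2; split; first by case.
  by move=> e; split=> //; nia.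
case: n hN key => [|n] hN key.
  rewrite (key (0%Z :: nil)) //; first by constructor=> //; constructor.
  by move=> i /=; split; [move=> [<-|[]]|move=> h; left; nia].
rewrite /theta; case E: (is_sq (S n)).
  move/is_sqP: E => [s hs].
  rewrite (key (Z.of_nat s :: (- Z.of_nat s)%Z :: nil)) //.
    constructor; last by constructor=> //; constructor.
    by move=> /= -[h|[]]; lia.
  move=> i; rewrite hs Nat2Z.inj_mul [In _ _]/=; split; first by move=> [<-|[<-|[]]]; ring.
  move=> h; have : ((i - Z.of_nat s) * (i + Z.of_nat s) = 0)%Z by lia.
  by move=> /Z.mul_eq_0 [h'|h']; [left|right; left]; lia.
rewrite (key nil) //; first by constructor.
move=> i; split=> //= h.
have : is_sq (S n) = true by apply/is_sqP; exists (Z.abs_nat i); lia.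
by rewrite E.
Qed.

Lemma dlt_conv (x y : Z) n : (0 <= x)%Z -> (0 <= y)%Z ->
  sum_f_R0 (fun k => dlt x k * dlt y (n - k)) n = dlt (x + y) n.
Proof.
move=> hx hy.
have key g m : sum_f_R0 (fun k => dlt x k * g k) m = if (x <=? Z.of_nat m)%Z then g (Z.to_nat x) else 0.
  elim: m => [|m IH].
    rewrite /= /dlt; case: (Z.eqb_spec x 0) => e.
      by rewrite e /=; ring.
    by rewrite (proj2 (Z.leb_gt _ _)) //; [ring|lia].
  rewrite tech5 IH /dlt; case: (Z.eqb_spec x (Z.of_nat (S m))) => e.
    rewrite (proj2 (Z.leb_gt _ _)) ?(proj2 (Z.leb_le _ _)); try lia.
    by rewrite e Nat2Z.id; ring.
  case: (Z.leb_spec x (Z.of_nat m)) => h.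
    by rewrite (proj2 (Z.leb_le _ _)); [ring|lia].
  by rewrite (proj2 (Z.leb_gt _ _)); [ring|lia].
rewrite (key (fun k => dlt y (n - k))) /dlt.
case: (Z.leb_spec x (Z.of_nat n)) => h.
  case: (Z.eqb_spec y _) => e; case: (Z.eqb_spec (x + y) _) => e' //; lia.
by case: (Z.eqb_spec (x + y) _) => e' //; lia.
Qed.

Definition reps (N n : nat) : list (Z * Z) :=
  filter (fun p => (fst p * fst p + snd p * snd p =? Z.of_nat n)%Z) (list_prod (rng N) (rng N)).

Lemma theta_sq_count N n : (n <= N)%nat -> fmul theta theta n = INR (length (reps N n)).
Proof.
move=> hN; rewrite -lsum_count -(lsum_prod (fun i j => dlt (i * i + j * j) n)) /fmul /PS_mult.
transitivity (sum_f_R0 (fun k => lsum (fun i => lsum (fun j => dlt (i * i) k * dlt (j * j) (n - k)) (rng N)) (rng N)) n).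
  apply: sum_eq => k hk; rewrite (theta_count N k); last lia. rewrite (theta_count N (n - k)); last lia.
  rewrite Rmult_comm lsum_scal; apply: lsum_ext => i; rewrite Rmult_comm lsum_scal.
  by apply: lsum_ext.
rewrite sum_lsum; apply: lsum_ext => i; rewrite sum_lsum; apply: lsum_ext => j.
by apply: dlt_conv; nia.
Qed.

Lemma reps_In N n p : (n <= N)%nat -> In p (reps N n) <-> (fst p * fst p + snd p * snd p = Z.of_nat n)%Z.
Proof.
move=> hN; case: p => i j; rewrite /reps filter_In in_prod_iff !rng_In Z.eqb_eq /=; split; first by case.
by move=> e; split=> //; split; nia.
Qed.
Lemma reps_NoDup N n : NoDup (reps N n).
Proof. by apply: NoDup_filter; apply: NoDup_prod; exact: rng_NoDup. Qed.

(* (i, j) |-> (i + j, i - j) maps the representations of n as a sum of two squares onto those of 2n. *)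
Lemma theta_sq_double (n : nat) : fmul theta theta (2 * n)%nat = fmul theta theta n.
Proof.
rewrite !(theta_sq_count (2 * n)); try lia.
congr INR; rewrite -(length_map (fun p : Z * Z => (fst p + snd p, fst p - snd p)%Z) (reps _ n)).
apply: same_length; first exact: reps_NoDup.
  apply: FinFun.Injective_map_NoDup (reps_NoDup _ _) => -[i j] [i' j'] /= [h1 h2].
  by have [-> ->] : i = i' /\ j = j' by lia.
move=> [u v]; rewrite reps_In // in_map_iff [fst _]/= [snd _]/=; split.
  move=> h; have [w hw] : exists w, (u = v + 2 * w)%Z.
    have [[b hb]|[b hb]] := Z.Even_or_Odd u; have [[c hc]|[c hc]] := Z.Even_or_Odd v; subst.
    - by exists (b - c)%Z; lia.
    - by exfalso; lia.
    - by exfalso; lia.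
    - by exists (b - c)%Z; lia.
  exists (v + w, w)%Z; split; first by f_equal => /=; lia.
  by apply/reps_In => /=; [lia|nia].
move=> [[i j] [[<- <-]]] /=; rewrite reps_In /=; last lia.
move=> h; nia.
Qed.

(** Odd coefficients cancel on the left, and at even indices the number of representations by two
    squares satisfies r(2n) = r(n). *)
Lemma theta_even_odd : fadd (fmul theta theta) (tw (fmul theta theta)) = fmul (fcst 2) (dil (fmul theta theta)).
Proof.
apply: functional_extensionality; apply: even_odd_ind => n; rewrite fcst_mul /fadd /tw.
  rewrite dil_even theta_sq_double pow_1_even; ring.
rewrite dil_odd pow_1_odd; ring.
Qed.

(** The series psi(q) = sum of q^(k(k+1)/2) over k >= 0: 8 m + 1 is a square exactly when m is
    triangular. *)
Definition psi : fps := fun m => theta (8 * m + 1)%nat / 2.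

Lemma theta_0 : theta 0%nat = 1. Proof. by []. Qed.
Lemma psi_0 : psi 0%nat = 1. Proof. by rewrite /psi /theta /=; lra. Qed.
Lemma theta_bounds n : 0 <= theta n <= 2.
Proof. by case: n => [|n] /=; [lra|case: is_sq; lra]. Qed.
Lemma psi_bounds n : 0 <= psi n <= 1.
Proof. rewrite /psi; have := theta_bounds (8 * n + 1); lra. Qed.

Lemma theta_nonsq n : (0 < n)%nat -> (forall s, n <> s * s)%nat -> theta n = 0.
Proof.
case: n => [|n] hn h; first lia.
rewrite /theta; case E: (is_sq (S n)) => //; by move/is_sqP: E => [s /h].
Qed.
Lemma square_mod8 (s : nat) : exists k : nat, (s * s = 4 * k \/ s * s = 8 * k + 1)%nat.
Proof.
have [[u hu]|[u hu]] := Nat.Even_or_Odd s; first by exists (u * u)%nat; left; subst; ring.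
have [[v hv]|[v hv]] := Nat.Even_or_Odd u.
  by exists (v * (2 * v + 1))%nat; right; subst; ring.
by exists ((2 * v + 1) * (v + 1))%nat; right; subst; ring.
Qed.
Lemma theta_4 m : theta (4 * m)%nat = theta m.
Proof.
case: m => [|m] //; have e : (4 * S m = S (4 * m + 3))%nat by lia.
rewrite e /theta; suff -> : is_sq (S (4 * m + 3)) = is_sq (S m) by [].
rewrite -e; apply/Bool.eq_iff_eq_true; rewrite !is_sqP; split=> -[s hs]; last first.
  by exists (2 * s)%nat; rewrite hs; ring.
have [[u hu]|[u hu]] := Nat.Even_or_Odd s; exists u; subst; nia.
Qed.

(* Squares are 0 mod 4 or 1 mod 8. *)
Lemma theta_split n : theta n = dil (dil theta) n +
  match n with O => 0 | S m => 2 * dil (dil (dil psi)) m end.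
Proof.
have ns m r : (forall k, m <> 4 * k /\ m <> 8 * k + 1)%nat -> theta m = r -> r = 0.
  move=> h <-; apply: theta_nonsq; first by have := h 0%nat; lia.
  by move=> s; have [k hk] := square_mod8 s; have := h k; lia.
move: n; apply: even_odd_ind => m.
  have -> : match (2 * m)%nat with O => 0 | S m => 2 * dil (dil (dil psi)) m end = 0.
    case: m => [|m] //; have -> : (2 * S m = S (S (2 * m)))%nat by lia.
    rewrite dil_odd; ring.
  rewrite dil_even Rplus_0_r; move: m; apply: even_odd_ind => k.
    by rewrite dil_even -(theta_4 k); congr theta; lia.
  by rewrite dil_odd; apply: (ns _ _ _ (eq_refl _)); lia.
rewrite dil_odd dil_even Rplus_0_l; move: m; apply: even_odd_ind => k; last first.
  by rewrite dil_odd Rmult_0_r; apply: (ns _ _ _ (eq_refl _)); lia.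
rewrite dil_even; move: k; apply: even_odd_ind => j; last first.
  by rewrite dil_odd Rmult_0_r; apply: (ns _ _ _ (eq_refl _)); lia.
rewrite dil_even /psi.
have -> : (8 * j + 1 = S (2 * (2 * (2 * j))))%nat by lia.
by field.
Qed.

Definition Th : C -> C := psum (fun n => RtoC (theta n)).
Definition Ps : C -> C := psum (fun n => RtoC (psi n)).

Lemma rrep_bounded b : (forall n, 0 <= b n <= 2) -> rrep b (psum (fun n => RtoC (b n))).
Proof.
move=> h; apply: psrep_psum => r hr; exists 2 => n.
rewrite Cmod_R Rabs_pos_eq; last by case: (h n).
have h1 : 0 <= r ^ n by apply: pow_le; lra.
have h2 : r ^ n <= 1 by rewrite -(pow1 n); apply: pow_incr; lra.
have := h n; nra.
Qed.
Lemma Th_rep : rrep theta Th. Proof. exact: rrep_bounded theta_bounds. Qed.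
Lemma Ps_rep : rrep psi Ps.
Proof. apply: rrep_bounded => n; have := psi_bounds n; lra. Qed.

Definition pw2 (x : C) : C := (x * x)%C.
Lemma Cmod_pw2 x : Cmod x < 1 -> Cmod (pw2 x) < 1.
Proof. by rewrite /pw2 Cmod_mult => h; have := Cmod_ge_0 x; nra. Qed.

Lemma Th_split x : Cmod x < 1 -> Th x = (Th (pw2 (pw2 x)) + 2 * x * Ps (pw2 (pw2 (pw2 x))))%C.
Proof.
move=> hx; have h1 := rrep_dil _ _ (rrep_dil _ _ Th_rep).
have h2 := rrep_dil _ _ (rrep_dil _ _ (rrep_dil _ _ Ps_rep)).
have hid : rrep (fun n => match n with 1%nat => 1 | _ => 0 end) (fun s => s).
  move=> s hs; have := Cseries_zero_from (fun n => RtoC (match n with 1%nat => 1 | _ => 0 end) * s ^ n)%C 1.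
  rewrite Csum_S Csum_0 /= => h.
  have e : (0 * 1 + 1 * (s * 1))%C = s by ring.
  rewrite e in h; apply: h => -[|[|n]] hn; try lia; ring.
have h3 := rrep_add _ _ _ _ h1 (rrep_scal 2 _ _ (rrep_mul _ _ _ _ hid h2)).
have -> : Th x = (Th (pw2 (pw2 x)) + 2 * (x * Ps (pw2 (pw2 (pw2 x)))))%C; last by ring.
apply: Cseries_unique (Th_rep x hx) _; have := h3 x hx; apply: Cseries_ext => n; congr Cmult; congr RtoC.
rewrite theta_split /fadd fcst_mul; congr Rplus.
case: n => [|n]; first by rewrite fmul_0; ring.
rewrite /fmul /PS_mult; case: n => [|n]; first by rewrite /=; ring.
rewrite decomp_sum; last lia. rewrite decomp_sum; last by rewrite /=; lia.
rewrite (sum_eq _ (fun _ => 0)) ?sum_cte; last by move=> i hi; ring.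
rewrite /= ; ring.
Qed.

Lemma Th_sq x : Cmod x < 1 ->
  (Th x * Th x + Th (- x) * Th (- x) = 2 * (Th (pw2 x) * Th (pw2 x)))%C.
Proof.
move=> hx; have h0 := rrep_mul _ _ _ _ Th_rep Th_rep.
have h1 := rrep_add _ _ _ _ h0 (rrep_tw _ _ h0).
have h2 := rrep_scal 2 _ _ (rrep_dil _ _ h0).
rewrite theta_even_odd in h1.
exact: Cseries_unique (h1 x hx) (h2 x hx).
Qed.

(** Insert the splitting theta(x) = theta(x^4) + 2 x psi(x^8) at x and -x into [Th_sq]; the mixed
    terms cancel. *)
Lemma Th_XZ x : Cmod x < 1 ->
  (Th (pw2 (pw2 x)) * Th (pw2 (pw2 x)) + 4 * pw2 x * (Ps (pw2 (pw2 (pw2 x))) * Ps (pw2 (pw2 (pw2 x))))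
   = Th (pw2 x) * Th (pw2 x))%C.
Proof.
move=> hx; have hx' : Cmod (- x)%C < 1 by rewrite Cmod_opp.
have e : pw2 (- x)%C = pw2 x by rewrite /pw2; ring.
have h := Th_sq x hx; rewrite (Th_split x) // (Th_split (- x)%C) // e in h.
apply: Cminus_eq0; apply: (Cmult_eq_0_r 2) C2_neq0 _; set X := Th (pw2 (pw2 x)) in h *.
set Y := Ps _ in h *; set W := Th (pw2 x) in h *.
transitivity ((X + 2 * x * Y) * (X + 2 * x * Y) + (X + 2 * - x * Y) * (X + 2 * - x * Y) - 2 * (W * W))%C.
  rewrite /pw2; ring.
rewrite h; ring.
Qed.

(** The classical theta(q) theta(-q) = theta(-q^2)^2. *)
Lemma theta_tw : fmul theta (tw theta) = dil (fmul (tw theta) (tw theta)).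
Proof.
have h1 := rrep_mul _ _ _ _ Th_rep (rrep_tw _ _ Th_rep).
have h2 := rrep_dil _ _ (rrep_mul _ _ _ _ (rrep_tw _ _ Th_rep) (rrep_tw _ _ Th_rep)).
apply: (rrep_unique _ _ _ _ 1 h1 h2 Rlt_0_1) => x hx.
have hx1 : Cmod x < 1 by rewrite Cmod_R Rabs_pos_eq; lra.
have hx' : Cmod (- x)%C < 1 by rewrite Cmod_opp.
(* At i x the sum of squares in [Th_XZ] becomes the difference theta(x^4)^2 - 4 x^2 psi(x^8)^2,
   which factors as theta(x) theta(-x). *)
have hix : Cmod (Ci * x)%C < 1 by rewrite Cmod_mult Cmod_Ci Rmult_1_l.
have := Th_XZ _ hix.
have -> : pw2 (Ci * x)%C = (- pw2 x)%C.
  rewrite /pw2; transitivity (Ci * Ci * (x * x))%C; [ring|rewrite Ci_sqr; ring].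
have -> : pw2 (- pw2 x)%C = pw2 (pw2 x) by rewrite {1 3}/pw2; ring.
rewrite -/(pw2 (RtoC x)) => <-.
have e : pw2 (- x)%C = pw2 x by rewrite /pw2; ring.
rewrite (Th_split x) // (Th_split (- x)%C) // e.
set A := Th _; set B := Ps _; rewrite /pw2; ring.
Qed.

(** After q -> q^8 this is the difference of [Th_XZ] at x and at x^2, divided by 4 x^2; the
    dilations are removed by [dil_inj]. *)
Lemma psi_sq : fmul psi psi = fmul theta (dil psi).
Proof.
have h1 := rrep_dil _ _ (rrep_dil _ _ (rrep_dil _ _ (rrep_mul _ _ _ _ Ps_rep Ps_rep))).
have h2 := rrep_dil _ _ (rrep_dil _ _ (rrep_dil _ _ (rrep_mul _ _ _ _ Th_rep (rrep_dil _ _ Ps_rep)))).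
do 3 apply: dil_inj.
apply: (rrep_unique _ _ _ _ 1 h1 h2 Rlt_0_1) => x hx.
have hx1 : Cmod x < 1 by rewrite Cmod_R Rabs_pos_eq; lra.
have hx0 : RtoC x <> 0 by move=> [] hh; lra.
have hx2 := Cmod_pw2 _ hx1.
have e1 := Th_XZ _ hx1; have e2 := Th_XZ _ hx2.
rewrite -!/(pw2 _) in e1 e2 *.
rewrite (Th_split (pw2 x)) // in e1; rewrite -e2 in e1.
apply: Cminus_eq0.
have h4 : (4 * pw2 x)%C <> 0.
  apply: Cmult_neq_0; first exact: C4_neq0. by apply: Cmult_neq_0.
apply: (Cmult_eq_0_r _ _ h4).
set A := Th _ in e1 *; set B := Ps (pw2 (pw2 (pw2 (pw2 x)))) in e1 *; set D := Ps _ in e1 *.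
move: (pw2 x) A B D e1 => X A B D; rewrite /pw2 => e1.
match type of e1 with ?L = ?R => transitivity (L - R)%C end; first ring.
rewrite e1; ring.
Qed.

(** * The reciprocal of theta(-T) and coefficient bounds *)

(** The generating series of overpartitions. *)
Definition G : fps := finv (tw theta).

Lemma tw_theta_0 : tw theta 0%nat = 1. Proof. by rewrite /tw /=; ring. Qed.
Lemma G_mul : fmul G (tw theta) = fcst 1. Proof. exact: finv_mul tw_theta_0. Qed.
Lemma G_0 : G 0%nat = 1. Proof. by rewrite /G /finv. Qed.

(** The reciprocal form of theta(T) theta(-T) = theta(-T^2)^2. *)
Lemma G_dil : G = fmul theta (fmul (dil G) (dil G)).
Proof.
have h2 : fmul (dil G) (dil (tw theta)) = fcst 1 by rewrite -dil_mul G_mul dil_cst.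
have hJ := theta_tw; rewrite dil_mul in hJ.
have e : fmul (fmul (fmul (dil G) (dil (tw theta))) (fmul (dil G) (dil (tw theta)))) G = G by rewrite h2; ring.
rewrite -{1}e.
transitivity (fmul (fmul (dil G) (dil G)) (fmul (fmul (dil (tw theta)) (dil (tw theta))) G)); first ring.
rewrite -hJ.
transitivity (fmul (fmul theta (fmul (dil G) (dil G))) (fmul G (tw theta))); first ring.
rewrite G_mul; ring.
Qed.

Lemma theta_nn : fnn theta. Proof. by move=> n; case: (theta_bounds n). Qed.

(** [G_dil] expresses the n-th coefficient by earlier ones with nonnegative weights; the weight
    [theta 0] = 1 for even n or [theta 1] = 2 for odd n already gives 1. The bound 1 instead of 0
    later absorbs the bounded coefficients of theta and psi. *)
Lemma G_ge1 n : 1 <= G n.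
Proof.
elim/(well_founded_ind lt_wf): n => n IH.
have [->|hn] := Nat.eq_dec n 0; first by rewrite G_0; lra.
have hsq m : (m < n)%nat -> 1 <= fmul G G m.
  move=> hm; rewrite /fmul /PS_mult.
  have h0 : G 0%nat * G (m - 0)%nat <= sum_f_R0 (fun k => G k * G (m - k)%nat) m.
    have hp k : (k <= m)%nat -> 0 <= G k * G (m - k)%nat.
      move=> hk; apply: Rmult_le_pos; apply: Rle_trans Rle_0_1 (IH _ _); lia.
    case: m hm hp => [|m] hm hp; first exact: Rle_refl.
    rewrite decomp_sum; last lia.
    have : 0 <= sum_f_R0 (fun i => G (S i) * G (S m - S i)%nat) m.
      rewrite -(Rmult_0_l (INR (S m))) -sum_cte; apply: sum_Rle => i hi; apply: hp; lia.
    by rewrite [Init.Nat.pred _]/=; lra.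
  rewrite G_0 Nat.sub_0_r in h0; have := IH m hm; lra.
have hd m : (m <= n)%nat -> 0 <= dil (fmul G G) m.
  move: m; apply: even_odd_ind => m hm; rewrite ?dil_even ?dil_odd; last exact: Rle_refl.
  by have := hsq m ltac:(lia); lra.
have -> : G n = sum_f_R0 (fun k => theta k * dil (fmul G G) (n - k)%nat) n by rewrite {1}G_dil -dil_mul.
have hp k : (k <= n)%nat -> 0 <= theta k * dil (fmul G G) (n - k)%nat.
  move=> hk; apply: Rmult_le_pos (theta_nn _) (hd _ _); lia.
have key k : (k <= n)%nat -> theta k * dil (fmul G G) (n - k)%nat <= sum_f_R0 (fun k => theta k * dil (fmul G G) (n - k)%nat) n.
  move=> hk; have gen u m : (forall k, (k <= m)%nat -> 0 <= u k) -> forall k, (k <= m)%nat -> u k <= sum_f_R0 u m.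
    elim: m => [|m IHm] hu j hj; first by have -> : j = 0%nat by [lia]; exact: Rle_refl.
    rewrite tech5; have [->|hj'] := Nat.eq_dec j (S m).
      have : 0 <= sum_f_R0 u m.
        apply: Rle_trans (hu 0%nat _) (IHm _ 0%nat _); try lia. by move=> i hi; apply: hu; lia.
      lra.
    have := IHm (fun i hi => hu i ltac:(lia)) j ltac:(lia); have := hu (S m) ltac:(lia); lra.
  exact: (gen (fun k => theta k * dil (fmul G G) (n - k)%nat) n).
move: n hn hsq key {IH hd hp}; apply: even_odd_ind => m hn hsq key.
  have := key 0%nat ltac:(lia); rewrite theta_0 Nat.sub_0_r dil_even.
  by have := hsq m ltac:(lia); lra.
have := key 1%nat ltac:(lia); have -> : (S (2 * m) - 1 = 2 * m)%nat by lia.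
rewrite dil_even; have -> : theta 1%nat = 2 by [].
by have := hsq m ltac:(lia); lra.
Qed.

Lemma G_nn : fnn G. Proof. by move=> n; have := G_ge1 n; lra. Qed.

Lemma tw_dil a : tw (dil a) = dil a.
Proof.
apply: functional_extensionality; apply: even_odd_ind => n; rewrite /tw ?dil_even ?dil_odd ?pow_1_even; ring.
Qed.
Lemma twG_theta : fmul (tw G) theta = fcst 1.
Proof. by rewrite -{1}(tw_tw theta) -tw_mul G_mul tw_cst. Qed.
Lemma twG_fle : fle (tw G) G.
Proof.
move=> n; rewrite /tw Rabs_mult -RPow_abs.
have -> : Rabs (-1) = 1 by rewrite Rabs_left; lra.
rewrite pow1 Rmult_1_l Rabs_pos_eq; [exact: Rle_refl|exact: G_nn].
Qed.

Lemma fnn_dil0 a : dil a 0%nat = a 0%nat. Proof. by []. Qed.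

Lemma G_refl : fle G G. Proof. exact: fnn_fle G_nn. Qed.
Lemma theta_refl : fle theta theta. Proof. exact: fnn_fle theta_nn. Qed.

(* From G = theta * (dil G)^2, all coefficients nonnegative and all constant terms 1. *)
Lemma dilG2_G : fle (fmul (dil G) (dil G)) G.
Proof.
rewrite {3}G_dil; apply: fle_mul_one theta_nn theta_0.
apply: fle_mul; exact: fle_dil G_refl.
Qed.
Lemma dilG_G : fle (dil G) G.
Proof.
apply: fle_trans dilG2_G; apply: fle_mul_one; first exact: fle_dil G_refl.
  exact: fnn_dil G_nn.
exact: G_0.
Qed.
Lemma theta_G : fle theta G.
Proof.
rewrite G_dil.
have -> : fmul theta (fmul (dil G) (dil G)) = fmul (fmul (dil G) (dil G)) theta by ring.
apply: fle_mul_one theta_refl _ _.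
  by apply: fnn_mul; exact: fnn_dil G_nn.
by rewrite fmul_0 fnn_dil0 G_0; ring.
Qed.

(** The operator U_2. Series in T^2 pass through it as factors. *)
Definition ep (a : fps) : fps := fun n => a (2 * n)%nat.

Lemma ep_mul a b : ep (fmul a (dil b)) = fmul (ep a) b.
Proof.
apply: functional_extensionality => n; rewrite /ep /fmul /PS_mult -[RHS]sum_dil; apply: sum_eq => k.
move: k; apply: even_odd_ind => k hk; rewrite ?dil_even ?dil_odd.
  by have -> : (2 * n - 2 * k = 2 * (n - k))%nat by [lia]; rewrite dil_even.
have -> : (2 * n - S (2 * k) = S (2 * (n - k - 1)))%nat by lia.
rewrite dil_odd; ring.
Qed.
Lemma ep_theta : ep theta = dil theta.
Proof.
apply: functional_extensionality => n; rewrite /ep theta_split dil_even.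
case: n => [|n]; first by rewrite Nat.mul_0_r; ring.
have -> : (2 * S n = S (S (2 * n)))%nat by lia.
rewrite dil_odd; ring.
Qed.
Lemma ep_tw a : ep (tw a) = ep a.
Proof. by apply: functional_extensionality => n; rewrite /ep /tw pow_1_even; ring. Qed.

(* The generating series of the numbers a_1(8n) *)
Definition P8 : fps := fmul (fcst 2) (fmul (fmul theta (dil theta)) (fmul G G)).

Section Coeffs.
(** [e] stands for the series of the a_1(2n) and [y] for that of the a_1(2n - 1), whose coefficient
    at n = 0 is the pole coefficient 1. *)
Variables (e y : fps).
Hypothesis He : fmul e (dil theta) = fmul (fcst 2) theta.
Hypothesis Hy : fmul y (dil (dil psi)) = theta.

Lemma e_eq : e = fmul (fcst 2) (fmul theta (dil (tw G))).
Proof.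
have h : fmul (dil (tw G)) (dil theta) = fcst 1 by rewrite -dil_mul twG_theta dil_cst.
transitivity (fmul (fmul e (dil theta)) (dil (tw G))); last by rewrite He; ring.
transitivity (fmul e (fmul (dil (tw G)) (dil theta))); last by ring.
rewrite h; ring.
Qed.

Lemma ep_cst c a : ep (fmul (fcst c) a) = fmul (fcst c) (ep a).
Proof. by apply: functional_extensionality => n; rewrite /ep !fcst_mul. Qed.

Lemma ep_twG : ep (tw G) = fmul (dil theta) (fmul G G).
Proof.
have -> : tw G = fmul (tw theta) (dil (fmul G G)).
  by rewrite {1}G_dil tw_mul -dil_mul tw_dil.
by rewrite ep_mul ep_tw ep_theta.
Qed.

Lemma ep_e : ep e = fmul (fcst 2) (fmul (dil theta) (tw G)).
Proof. by rewrite e_eq ep_cst ep_mul ep_theta. Qed.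
(** Two applications of U_2 lead from the a_1(2n) to the a_1(8n). *)
Lemma ep_ep_e : ep (ep e) = P8.
Proof.
rewrite ep_e ep_cst.
have -> : fmul (dil theta) (tw G) = fmul (tw G) (dil theta) by ring.
rewrite ep_mul ep_twG /P8; ring.
Qed.

Lemma e_P8 : fle e P8.
Proof.
have h0 : fle e (fmul (fcst 2) (fmul theta (dil G))).
  rewrite e_eq; apply: fle_mul; first by apply: fnn_fle; apply: fnn_cst; lra.
  apply: fle_mul theta_refl _; exact: fle_dil twG_fle.
apply: fle_trans h0 _; apply: fle_mul; first by apply: fnn_fle; apply: fnn_cst; lra.
have -> : fmul (fmul theta (dil theta)) (fmul G G) = fmul theta (fmul (fmul (dil theta) G) G) by ring.
apply: fle_mul theta_refl _.
apply: fle_mul_one; first exact: dilG_G.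
  apply: fnn_mul G_nn; exact: fnn_dil theta_nn.
by rewrite fmul_0 G_0 fnn_dil0 theta_0; ring.
Qed.

Lemma GG_P8 : fle (fmul (fcst 2) (fmul G G)) P8.
Proof.
apply: fle_mul; first by apply: fnn_fle; apply: fnn_cst; lra.
apply: fle_mul_one; first by apply: fle_mul; exact: G_refl.
  by apply: fnn_mul; [exact: theta_nn|exact: fnn_dil theta_nn].
by rewrite fmul_0 fnn_dil0 theta_0; ring.
Qed.

Let G2 := dil G. Let G4 := dil G2. Let G8 := dil G4.
Let sq (a : fps) := fmul a a.

Lemma fle_sq a b : fle a b -> fle (sq a) (sq b).
Proof. by move=> h; apply: fle_mul. Qed.

Lemma G4_8 : fle (sq (sq (sq G4))) (sq G).
Proof.
have h1 : fle (sq G4) G2 by rewrite /sq /G4 -dil_mul; apply: fle_dil; exact: dilG2_G.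
apply: fle_trans (fle_sq _ _ (fle_sq _ _ h1)) _; apply: fle_sq; exact: dilG2_G.
Qed.

(** Both theta factors of P8(T^4) are majorised by G(T^4), which leaves G(T^4)^4. It is enlarged to
    G(T^4)^8, because repeated use of G(T^2)^2 <= G(T) bounds the latter by G^2. *)
Lemma P8_dil : fle (dil (dil P8)) P8.
Proof.
apply: fle_trans GG_P8; rewrite /P8 !dil_mul !dil_cst.
apply: fle_mul; first by apply: fnn_fle; apply: fnn_cst; lra.
apply: fle_trans G4_8; rewrite -/G2 -/G4.
have hG4 : fle G4 G4 by do 2 apply: fle_dil; exact: G_refl.
have h1 : fle (dil (dil theta)) G4 by do 2 apply: fle_dil; exact: theta_G.
have h2 : fle (dil (dil (dil theta))) G4.
  by do 2 apply: fle_dil; apply: fle_trans (fle_dil _ _ theta_G) dilG_G.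
have -> : sq (sq (sq G4)) = fmul (sq (sq G4)) (fmul (fmul G4 G4) (fmul G4 G4)) by rewrite /sq; ring.
have h44 := fle_mul _ _ _ _ hG4 hG4.
apply: fle_mul_one; first by apply: fle_mul => //; apply: fle_mul.
  by apply: fle_nn; apply: fle_sq; apply: fle_sq; exact: hG4.
by rewrite /sq !fmul_0 /G4 /G2 !fnn_dil0 G_0; ring.
Qed.

Definition G5 : fps := fmul G (fmul (fmul G G) (fmul G G)).

(** A bridge from index j to index 8 (2 j + 1): G^5 is dilated by 2, shifted by one with the
    coefficient [theta 1] = 2, and dilated by 8. The other factor 2 is the constant of P8. *)
Lemma P8_G5 j : 4 * G5 j <= P8 (8 * S (2 * j))%nat.
Proof.
have hG4 : fle G4 G4 by do 2 apply: fle_dil; exact: G_refl.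
have h8 : fle G8 G4 by do 2 apply: fle_dil; exact: dilG_G.
have hG8 : fle G8 G8 by do 3 apply: fle_dil; exact: G_refl.
have g0 : G4 0%nat = 1 by rewrite /G4 /G2 !fnn_dil0 G_0.
(* G4^8 >= G4^5 >= theta8 * (theta8^4 G16^10) >= theta8 * G16^5 *)
have e1 : fle (fmul G8 (fmul (sq G8) (sq G8))) (sq (sq (sq G4))).
  have -> : sq (sq (sq G4)) = fmul (fmul G4 (fmul G4 G4)) (fmul G4 (fmul (sq G4) (sq G4))) by rewrite /sq; ring.
  apply: fle_mul_one.
  - by apply: fle_mul => //; apply: fle_mul; apply: fle_sq.
  - by apply: fle_nn; repeat apply: fle_mul; exact: hG4.
  - by rewrite !fmul_0 g0; ring.
set H := fmul theta (dil G5).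
have e2 : fle (dil (dil (dil H))) (fmul G8 (fmul (sq G8) (sq G8))).
  rewrite /sq /G8 /G4 /G2 -!dil_mul; do 3 apply: fle_dil.
  rewrite -/G5 /H {2}/G5.
  have hd : fle G2 G2 by apply: fle_dil; exact: G_refl.
  have hm : fle G2 (fmul G2 G2).
    by apply: fle_mul_one hd (fle_nn _ _ hd) _; rewrite /G2 fnn_dil0 G_0.
  have hg : fle (fmul G2 G2) G by exact: dilG2_G.
  have hg' : fle G2 G := fle_trans _ _ _ hm hg.
  apply: fle_mul; first exact: theta_G.
  rewrite /G5 !dil_mul -/G2.
  have -> : fmul G2 (fmul (fmul G2 G2) (fmul G2 G2)) = fmul (fmul G2 G2) (fmul G2 (fmul G2 G2)) by ring.
  have -> : fmul (fmul G G) (fmul G G) = fmul G (fmul G (fmul G G)) by ring.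
  exact: (fle_mul _ _ _ _ hg (fle_mul _ _ _ _ hg' (fle_mul _ _ _ _ hg' hg'))).
have e3 := GG_P8 (8 * S (2 * j))%nat.
have e4 := G4_8 (8 * S (2 * j))%nat.
have e5 := e1 (8 * S (2 * j))%nat; have e6 := e2 (8 * S (2 * j))%nat.
have e7 : dil (dil (dil H)) (8 * S (2 * j))%nat = H (S (2 * j))%nat.
  by have -> : (8 * S (2 * j) = 2 * (2 * (2 * S (2 * j))))%nat by [lia]; rewrite !dil_even.
have hG5 : fnn G5 by apply: fle_nn; rewrite /G5; repeat apply: fle_mul; exact: G_refl.
have e8 : theta 1%nat * dil G5 (S (2 * j) - 1)%nat <= H (S (2 * j))%nat.
  by apply: fnn_term; [exact: theta_nn|exact: fnn_dil|lia].
have e9 : (S (2 * j) - 1 = 2 * j)%nat by lia.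
rewrite e9 dil_even in e8; have t1 : theta 1%nat = 2 by [].
rewrite fcst_mul in e3; rewrite e7 in e6.
rewrite t1 in e8.
have r (x : R) := Rle_abs x.
have := r (H (S (2 * j))%nat).
move: e3 e4 e5 e6 => /(Rle_trans _ _ _ (r _)) e3 /(Rle_trans _ _ _ (r _)) e4 /(Rle_trans _ _ _ (r _)) e5 /(Rle_trans _ _ _ (r _)) e6.
change (sq G) with (fmul G G) in e4; lra.
Qed.

Definition Psi : fps := finv psi.
Definition G3 : fps := fmul G (fmul G G).

(** The coefficients of psi are at most 1, those of the majorant at least 1: at even indices because
    of G, at odd indices because of the term 4 T of theta^2. *)
Lemma psi_theta : fle psi (fmul (fmul theta theta) (dil G)).
Proof.
move=> n; have [h0 h1] := psi_bounds n; rewrite Rabs_pos_eq //; apply: Rle_trans h1 _.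
have tt : fnn (fmul theta theta) := fnn_mul _ _ theta_nn theta_nn.
have dd := fnn_dil _ G_nn.
move: n {h0}; apply: even_odd_ind => n.
  have := fnn_term _ _ 0 (2 * n) tt dd ltac:(lia); rewrite Nat.sub_0_r dil_even fmul_0 theta_0.
  have := G_ge1 n; lra.
have := fnn_term _ _ 1 (S (2 * n)) tt dd ltac:(lia).
have -> : (S (2 * n) - 1 = 2 * n)%nat by lia.
have -> : fmul theta theta 1%nat = 4 by rewrite /fmul /PS_mult /theta /=; lra.
rewrite dil_even; have := G_ge1 n; lra.
Qed.

(** [psi_sq] gives the recursion 1/psi(T) = psi(T) / (theta(T) psi(T^2)), and G^3 is a supersolution
    of its majorant; strong induction compares the two. *)
Lemma Psi_G3 : fle Psi G3.
Proof.
have hpq : fmul Psi psi = fcst 1 := finv_mul _ psi_0.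
have hpq2 : fmul (dil Psi) (dil psi) = fcst 1 by rewrite -dil_mul hpq dil_cst.
have hrec : Psi = fmul (fmul psi (tw G)) (dil Psi).
  transitivity (fmul (fmul (fmul psi (tw G)) (dil Psi)) (fmul Psi psi)); last by rewrite hpq; ring.
  transitivity (fmul (fmul (fmul (tw G) (dil Psi)) Psi) (fmul psi psi)); last by ring.
  rewrite psi_sq.
  transitivity (fmul Psi (fmul (fmul (tw G) theta) (fmul (dil Psi) (dil psi)))); last by ring.
  rewrite twG_theta hpq2; ring.
have hb : fle (fmul (fmul psi G) (dil G3)) G3.
  (* Two of the three factors G are replaced by theta(T) G(T^2)^2. *)
  have e3 : G3 = fmul (fmul (fmul (fmul theta theta) (dil G)) G) (dil G3).
    rewrite {1}/G3.
    transitivity (fmul G (fmul (fmul theta (fmul (dil G) (dil G))) (fmul theta (fmul (dil G) (dil G))))).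
      by rewrite -G_dil.
    rewrite /G3 !dil_mul; ring.
  rewrite [X in fle _ X]e3.
  apply: fle_mul; first by apply: fle_mul; [exact: psi_theta|exact: G_refl].
  by apply: fle_dil; repeat apply: fle_mul; exact: G_refl.
move=> n; elim/(well_founded_ind lt_wf): n => n IH.
have [->|hn] := Nat.eq_dec n 0.
  rewrite /Psi /finv /= /G3 !fmul_0 G_0 Rabs_R1; lra.
have hpg : fle (fmul psi (tw G)) (fmul psi G).
  apply: fle_mul twG_fle; apply: fnn_fle => k; case: (psi_bounds k) => //.
apply: Rle_trans (Rle_trans _ _ _ (Rle_abs _) (hb n)).
rewrite {1}hrec /fmul -/fmul /PS_mult; apply: Rle_trans (Rsum_abs _ _) _; apply: sum_Rle => k hk.
rewrite Rabs_mult; apply: Rmult_le_compat; try exact: Rabs_pos; first exact: hpg.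
have : (n - k <= n)%nat by lia.
move: (n - k)%nat; apply: even_odd_ind => m hm; rewrite ?dil_even ?dil_odd; first by apply: IH; lia.
rewrite Rabs_R0; exact: Rle_refl.
Qed.

(* G - 1 = G (1 - theta(-T)) is dominated by 2 T G^2. *)
Lemma G4_shift j : fmul (fmul G G) (fmul G G) (S j) <= 8 * G5 j.
Proof.
set T : fps := fun n => match n with 1%nat => 1 | _ => 0 end.
have Tmul a n : fmul T a (S n) = a n.
  rewrite /fmul /PS_mult; case: n => [|n]; first by rewrite /T /=; ring.
  rewrite decomp_sum; last lia. rewrite decomp_sum; last by rewrite /=; lia.
  rewrite (sum_eq _ (fun _ => 0)) ?sum_cte; last by move=> i hi; rewrite /T; ring.
  rewrite /T /=; ring.
have T0 a : fmul T a 0%nat = 0 by rewrite fmul_0 /T /=; ring.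
have Tnn : fnn T by move=> [|[|n]]; rewrite /T; lra.
set D : fps := fun n => - tw theta (S n).
have hD : fadd (fcst 1) (fopp (tw theta)) = fmul T D.
  apply: functional_extensionality => -[|n]; rewrite ?T0 ?Tmul /fadd /fopp ?tw_theta_0 /D /=; ring.
have hDG : fle D (fmul (fcst 2) G).
  move=> n; rewrite /D Rabs_Ropp fcst_mul /tw Rabs_mult -RPow_abs.
  have -> : Rabs (-1) = 1 by rewrite Rabs_left; lra.
  rewrite pow1 Rmult_1_l Rabs_pos_eq; last exact: theta_nn.
  have := theta_bounds (S n); have := G_ge1 n; lra.
have hG1 : fadd G (fopp (fcst 1)) = fmul G (fmul T D).
  rewrite -hD; transitivity (fadd G (fopp (fmul G (tw theta)))); [by rewrite G_mul|ring].
have h1 : fle (fadd G (fopp (fcst 1))) (fmul G (fmul T (fmul (fcst 2) G))).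
  by rewrite hG1; apply: fle_mul G_refl _; apply: fle_mul hDG; apply: fnn_fle.
(* G^4 - 1 = (G - 1) (1 + G + G^2 + G^3), and each of the four summands is majorised by G^3. *)
set S4 := fadd (fcst 1) (fadd G (fadd (fmul G G) G3)).
have hG3 : fle G3 G3 by repeat apply: fle_mul; exact: G_refl.
have hone : fle (fcst 1) G3.
  have -> : G3 = fmul G3 (fcst 1) by ring.
  apply: fle_mul_one; [by apply: fnn_fle; apply: fnn_cst; lra|exact: fle_nn hG3|by rewrite /G3 !fmul_0 G_0; ring].
have hGG : fle (fmul G G) G3 by apply: fle_mul_one; [apply: fle_mul; exact: G_refl|exact: G_nn|exact: G_0].
have hG : fle G G3.
  by apply: fle_trans hGG; apply: fle_mul_one; [exact: G_refl|exact: G_nn|exact: G_0].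
have hS4 : fle S4 (fmul (fcst 4) G3).
  move=> n; rewrite /S4 /fadd fcst_mul.
  have := hone n; have := hG n; have := hGG n; have := hG3 n.
  have t (a b c d : R) : Rabs (a + (b + (c + d))) <= Rabs a + Rabs b + Rabs c + Rabs d.
    have := Rabs_triang a (b + (c + d)); have := Rabs_triang b (c + d); have := Rabs_triang c d; lra.
  have := t (fcst 1 n) (G n) (fmul G G n) (G3 n); lra.
have h2 := fle_mul _ _ _ _ h1 hS4.
have e1 : fmul (fadd G (fopp (fcst 1))) S4 = fadd (fmul (fmul G G) (fmul G G)) (fopp (fcst 1)).
  rewrite /S4 /G3; ring.
have e2 : fmul (fmul G (fmul T (fmul (fcst 2) G))) (fmul (fcst 4) G3) = fmul T (fmul (fcst 8) G5).
  have -> : fcst 8 = fmul (fcst 2) (fcst 4).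
    by apply: functional_extensionality => -[|n]; rewrite fcst_mul /=; ring.
  rewrite /G5 /G3; ring.
have := h2 (S j); rewrite e1 e2 Tmul fcst_mul /fadd /fopp => h.
have := Rle_trans _ _ _ (Rle_abs _) h; rewrite /=; lra.
Qed.

(** y = theta(T) / psi(T^4) is majorised by G(T) G(T^4)^3, hence by G^4; the coefficient at j + 1 is
    then passed through G^5 at j. *)
Lemma y_bound j : Rabs (y (S j)) <= 2 * P8 (8 * S (2 * j))%nat.
Proof.
have hpq : fmul Psi psi = fcst 1 := finv_mul _ psi_0.
have hpq2 : fmul (dil (dil Psi)) (dil (dil psi)) = fcst 1 by rewrite -!dil_mul hpq !dil_cst.
have hy : y = fmul theta (dil (dil Psi)).
  rewrite -Hy; transitivity (fmul y (fmul (dil (dil Psi)) (dil (dil psi)))); last by ring.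
  rewrite hpq2; ring.
have h1 : fle y (fmul G (dil (dil G3))).
  by rewrite hy; apply: fle_mul theta_G _; do 2 apply: fle_dil; exact: Psi_G3.
have hdd : fle (dil (dil G)) G := fle_trans _ _ _ (fle_dil _ _ dilG_G) dilG_G.
have h2 : fle (fmul G (dil (dil G3))) (fmul (fmul G G) (fmul G G)).
  have -> : fmul (fmul G G) (fmul G G) = fmul G (fmul G (fmul G G)) by ring.
  apply: fle_mul G_refl _; rewrite /G3 !dil_mul; by repeat apply: fle_mul.
have := fle_trans _ _ _ h1 h2 (S j); have := G4_shift j; have := P8_G5 j; lra.
Qed.

Lemma P8_nn : fnn P8. Proof. exact: fle_nn GG_P8. Qed.

Lemma P8_mono n : P8 n <= P8 (4 * n)%nat.
Proof.
have := P8_dil (4 * n)%nat; have e4 : (4 * n = 2 * (2 * n))%nat by lia.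
rewrite {1}e4 !dil_even => h; exact: Rle_trans (Rle_abs _) h.
Qed.
End Coeffs.

(** * The even and odd parts as theta quotients *)

Lemma hol_near phi eps : hol phi -> 0 < eps ->
  exists d, 0 < d /\ forall s, Cmod s < d -> Cmod (phi s - phi 0)%C <= eps.
Proof.
move=> /hol_lip0 [K [hK h]] he.
exists (Rmin (/ 2) (eps / K)); split.
  by apply: Rmin_glb_lt; [lra|apply: Rdiv_lt_0_compat].
move=> s hs; have h1 := Rmin_l (/ 2) (eps / K); have h2 := Rmin_r (/ 2) (eps / K).
apply: Rle_trans (h s _) _; first lra.
have -> : eps = K * (eps / K) by field; lra.
apply: Rmult_le_compat_l; lra.
Qed.

Lemma Cmod_near_neq0 (z c : C) e : Cmod (z - c)%C <= e -> e < Cmod c -> z <> 0.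
Proof.
move=> h1 h2 hz; move: h1; rewrite hz.
have -> : (0 - c = - c)%C by ring.
rewrite Cmod_opp; lra.
Qed.

Lemma psrep_cons c b phi : psrep b phi ->
  psrep (fun n => match n with O => c | S m => b m end) (fun s => c + s * phi s)%C.
Proof.
move=> h s hs; apply: is_series_decr_1.
have := Cseries_scal s _ _ (h s hs).
have -> : plus (c + s * phi s)%C (opp (c * s ^ 0))%C = (s * phi s)%C.
  rewrite /plus /opp /=; ring.
apply: Cseries_ext => n; rewrite /=; ring.
Qed.

Lemma psrep_real_mult c phi t psi u chi d : psrep c phi -> rrep t psi -> rrep u chi -> 0 < d ->
  (forall x, 0 < x < d -> (phi (RtoC x) * psi (RtoC x) = chi (RtoC x))%C) ->
  fmul (fun n => Re (c n)) t = u /\ fmul (fun n => Im (c n)) t = fcst 0.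
Proof.
move=> h1 h2 h3 hd h.
have e := psrep_unique _ _ _ _ _ (psrep_mult _ _ _ _ h1 h2) h3 hd h.
have key n : fmul (fun n => Re (c n)) t n = Re (RtoC (u n)) /\ fmul (fun n => Im (c n)) t n = Im (RtoC (u n)).
  rewrite -e /Cconv Csum_Re Csum_Im !sum_n_Reals; split; apply: sum_eq => k _; rewrite !Creim; ring.
split; apply: functional_extensionality => n; have [k1 k2] := key n; first by rewrite k1.
rewrite k2; by case: n {k1 k2}.
Qed.

(** E, O, X, Y belong to a point, E1, O1, X1, Y1 to its square x, with X, Y from theta and psi. The
    relations combine to k^2 (1 + k1^2 r^2) = k1 (1 + r^2). It holds for k = k1 = 1, and subtracting
    1 + k1^2 r^2 isolates the factors k - 1 and k1 - 1. *)
Lemma kappa_rel (E E1 O O1 X X1 Y Y1 x : C) : O <> 0 -> O1 <> 0 -> X1 <> 0 -> Y <> 0 -> Y1 <> 0 -> E1 <> 0 ->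
  (4 * (x * x * (E1 * E1) + O1 * O1) = E1 * E1 * (O1 * O1))%C ->
  (E * E * (E1 * O1) = 8 * (O * O))%C ->
  (X1 * X1 + 4 * (x * x) * (Y1 * Y1) = X * X)%C -> (Y * Y = X1 * Y1)%C ->
  let k := (E * X / (2 * (O * Y)))%C in let k1 := (E1 * X1 / (2 * (O1 * Y1)))%C in
  let r := (2 * x * Y1 / X1)%C in
  ((k - 1) * (k + 1) * (1 + k1 * k1 * (r * r)) = (k1 - 1) * (1 - k1 * (r * r)))%C.
Proof.
move=> hO hO1 hX1 hY hY1 hE1 hA hB hX hYY k k1 r; have c2 := C2_neq0; have c4 := C4_neq0.
have e1 : (1 + k1 * k1 * (r * r) = E1 * E1 / 4)%C.
  have -> : (1 + k1 * k1 * (r * r) = 4 * (x * x * (E1 * E1) + O1 * O1) / (4 * (O1 * O1)))%C.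
    rewrite /k1 /r; by field.
  rewrite hA; by field.
have e2 : (k * k = 2 * (X * X) / (E1 * O1 * X1 * Y1))%C.
  have -> : (k * k = (E * E * (E1 * O1)) * (X * X) / (4 * (O * O) * (Y * Y) * (E1 * O1)))%C.
    rewrite /k; by field.
  rewrite hB hYY; by field.
have e3 : (1 + r * r = X * X / (X1 * X1))%C by rewrite -hX /r; field.
have e4 : (k * k * (1 + k1 * k1 * (r * r)) = k1 * (1 + r * r))%C.
  rewrite e1 e2 e3 /k1; by field.
transitivity (k * k * (1 + k1 * k1 * (r * r)) - (1 + k1 * k1 * (r * r)))%C; first ring.
rewrite e4; ring.
Qed.

(* With w the ratio of even and odd parts of f_1 and r the same ratio for theta, k = w/r at x and
   k1 = w/r at x^2; hence k = 1 near 0. *)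
Lemma kappa_contract (k k1 r : C) : Cmod (k - 1)%C <= / 4 -> Cmod (k1 - 1)%C <= / 4 -> Cmod (r * r)%C <= / 16 ->
  ((k - 1) * (k + 1) * (1 + k1 * k1 * (r * r)) = (k1 - 1) * (1 - k1 * (r * r)))%C ->
  Cmod (k - 1)%C <= 3 / 4 * Cmod (k1 - 1)%C.
Proof.
move=> h h1 hr e; have := f_equal Cmod e; rewrite (Cmod_mult ((k - 1) * (k + 1))) (Cmod_mult (k - 1)) (Cmod_mult (k1 - 1)).
have hk1 : Cmod k1 <= 5 / 4.
  have -> : k1 = ((k1 - 1) + 1)%C by ring.
  apply: Rle_trans (Cmod_triangle _ _) _; rewrite Cmod_1; lra.
have hk : 7 / 4 <= Cmod (k + 1)%C.
  have := Cmod_triangle (k + 1)%C (- (k - 1))%C; rewrite Cmod_opp.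
  have -> : (k + 1 + - (k - 1) = 2)%C by ring.
  rewrite Cmod_R Rabs_pos_eq; lra.
have g0 := Cmod_ge_0 k1; have g1 := Cmod_ge_0 (r * r)%C.
have ha : Cmod (k1 * k1 * (r * r))%C <= 25 / 256.
  rewrite (Cmod_mult (k1 * k1)) (Cmod_mult k1).
  have : Cmod k1 * Cmod k1 <= 25 / 16 by nra.
  have := Rmult_le_pos _ _ g0 g0; nra.
have hb : Cmod (k1 * (r * r))%C <= 5 / 64 by rewrite (Cmod_mult k1); nra.
have hc : 231 / 256 <= Cmod (1 + k1 * k1 * (r * r))%C.
  have := Cmod_triangle (1 + k1 * k1 * (r * r))%C (- (k1 * k1 * (r * r)))%C; rewrite Cmod_opp.
  have -> : (1 + k1 * k1 * (r * r) + - (k1 * k1 * (r * r)) = 1)%C by ring.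
  rewrite Cmod_1; lra.
have hd : Cmod (1 - k1 * (r * r))%C <= 69 / 64.
  have := Cmod_triangle 1 (- (k1 * (r * r)))%C; rewrite Cmod_opp Cmod_1 /Cminus; lra.
move=> {}e.
have p0 := Cmod_ge_0 (k - 1)%C; have p1 := Cmod_ge_0 (k1 - 1)%C.
(* The contraction factor is (69/64) / (7/4 * 231/256), which is below 3/4. *)
have q : 7 / 4 * (231 / 256) <= Cmod (k + 1)%C * Cmod (1 + k1 * k1 * (r * r))%C.
  apply: Rmult_le_compat; lra.
have := Rmult_le_compat_l _ _ _ p0 q; have := Rmult_le_compat_l _ _ _ p1 hd; lra.
Qed.

Lemma quot_sq_small (u v w : C) : Cmod u <= / 16 -> Cmod (v - 1)%C <= / 5 -> Cmod (w - 1)%C <= / 5 ->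
  Cmod (2 * u * v / w * (2 * u * v / w))%C <= / 16.
Proof.
move=> hu hv hw.
have v4 : Cmod v <= 6 / 5 by have := Cmod_le_add v 1; rewrite Cmod_1; lra.
have w4 : 4 / 5 <= Cmod w by have := Cmod_le_add 1 w; rewrite (Cmod_minus_sym 1 w) Cmod_1; lra.
have hw0 : w <> 0 by move=> e; rewrite e Cmod_0 in w4; lra.
have -> : Cmod (2 * u * v / w * (2 * u * v / w))%C = (2 * Cmod u * Cmod v / Cmod w) ^ 2.
  rewrite Cmod_mult Cmod_div // (Cmod_mult (2 * u)) (Cmod_mult 2) Cmod_R (Rabs_pos_eq 2); [ring|lra].
have p0 := Cmod_ge_0 u; have p1 := Cmod_ge_0 v.
have h1 : 2 * Cmod u * Cmod v / Cmod w <= / 4.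
  apply: (Rmult_le_reg_r (Cmod w)); first lra.
  rewrite /Rdiv Rmult_assoc Rinv_l; last lra. nra.
have h2 : 0 <= 2 * Cmod u * Cmod v / Cmod w by apply: Rdiv_le_0_compat; [nra|lra].
nra.
Qed.

Section Link.
Variables (f : C -> C) (a : nat -> C) (H : data1 a f).
Let E := ev a.
Let O := ov a.
Let hps : psrep a (psum a). Proof. by case: H => _ [_ []]. Qed.

(** Numerator and denominator of k are kept apart as holomorphic functions; both have the value 2 at
    0. *)
Definition kN (x : C) : C := (E x * Th (pw2 (pw2 x)))%C.
Definition kD (x : C) : C := (2 * (O x * Ps (pw2 (pw2 (pw2 x)))))%C.

Lemma hol_rrep b phi : rrep b phi -> hol phi.
Proof. by exists (fun n => RtoC (b n)). Qed.

Lemma Th_hol4 : hol (fun x => Th (pw2 (pw2 x))).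
Proof. by eexists; exact: (rrep_dil _ _ (rrep_dil _ _ Th_rep)). Qed.
Lemma Ps_hol8 : hol (fun x => Ps (pw2 (pw2 (pw2 x)))).
Proof. by eexists; exact: (rrep_dil _ _ (rrep_dil _ _ (rrep_dil _ _ Ps_rep))). Qed.
Lemma kN_hol : hol kN. Proof. exact: hol_mult (hol_ev f a H) Th_hol4. Qed.
Lemma kD_hol : hol kD.
Proof. exact: (hol_mult _ _ (hol_const 2) (hol_mult _ _ (hol_ov f a H) Ps_hol8)). Qed.

Lemma pw2_0 : pw2 0 = 0. Proof. by rewrite /pw2; ring. Qed.
Lemma Th_0 : Th 0 = 1. Proof. exact: psrep_at0 Th_rep. Qed.
Lemma Ps_0 : Ps 0 = 1. Proof. by rewrite (psrep_at0 _ _ Ps_rep) psi_0. Qed.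

Lemma psi_sq_fun x : Cmod x < 1 -> (Ps x * Ps x = Th x * Ps (pw2 x))%C.
Proof.
move=> hx; have h1 := rrep_mul _ _ _ _ Ps_rep Ps_rep.
have h2 := rrep_mul _ _ _ _ Th_rep (rrep_dil _ _ Ps_rep).
rewrite psi_sq in h1; exact: Cseries_unique (h1 x hx) (h2 x hx).
Qed.

Lemma near0 : exists d, 0 < d <= / 4 /\ forall x : C, Cmod x < d ->
  Cmod (kN x - 2)%C <= / 5 /\ Cmod (kD x - 2)%C <= / 5 /\ Cmod (O x - 1)%C <= / 5 /\
  Cmod (E x - 2)%C <= / 5 /\ Cmod (Th x - 1)%C <= / 5 /\ Cmod (Ps x - 1)%C <= / 5.
Proof.
have h5 : 0 < / 5 by lra.
have [d1 [hd1 k1]] := hol_near _ _ kN_hol h5; have [d2 [hd2 k2]] := hol_near _ _ kD_hol h5.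
have [d3 [hd3 k3]] := hol_near _ _ (hol_ov f a H) h5; have [d4 [hd4 k4]] := hol_near _ _ (hol_ev f a H) h5.
have [d5 [hd5 k5]] := hol_near _ _ (hol_rrep _ _ Th_rep) h5.
have [d6 [hd6 k6]] := hol_near _ _ (hol_rrep _ _ Ps_rep) h5.
have eN : kN 0 = 2 by rewrite /kN /E (ev_0 f a H) (a0_eq_2 f a H) !pw2_0 Th_0; ring.
have eD : kD 0 = 2 by rewrite /kD /O (ov_0 a) !pw2_0 Ps_0; ring.
rewrite eN in k1; rewrite eD in k2; rewrite (ov_0 a) in k3; rewrite (ev_0 f a H) (a0_eq_2 f a H) in k4.
rewrite Th_0 in k5; rewrite Ps_0 in k6.
exists (Rmin (/ 4) (Rmin (Rmin d1 d2) (Rmin (Rmin d3 d4) (Rmin d5 d6)))); split.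
  split; last exact: Rmin_l.
  by repeat (apply: Rmin_glb_lt => //); lra.
move=> x hx.
have hm (p q : R) : Cmod x < Rmin p q -> Cmod x < p /\ Cmod x < q.
  by move=> h; split; apply: Rlt_le_trans h _; [exact: Rmin_l|exact: Rmin_r].
have [_ /hm [/hm [x1 x2] /hm [/hm [x3 x4] /hm [x5 x6]]]] := hm _ _ hx.
by repeat split; auto.
Qed.

(** x -> x^2 preserves (0, d), where |k - 1| <= 1/4. Applying the contraction n times gives |k - 1|
    <= (3/4)^n / 4 at every point. *)
Lemma kappa_one : exists d, 0 < d /\ forall x, 0 < x < d -> kN (RtoC x) = kD (RtoC x).
Proof.
have [d [[hd hd4] hn]] := near0; exists d; split=> //.
have hx1 x : 0 < x < d -> Cmod (RtoC x) < d by move=> hx; rewrite Cmod_R Rabs_pos_eq; lra.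
have hkap x : 0 < x < d -> Cmod (kN x / kD x - 1)%C <= / 4.
  move=> hx; have [k1 [k2 _]] := hn _ (hx1 x hx).
  have hD : kD x <> 0 by apply: Cmod_near_neq0 k2 _; rewrite Cmod_R Rabs_pos_eq; lra.
  have -> : (kN x / kD x - 1 = (kN x - kD x) / kD x)%C by field.
  rewrite Cmod_div //.
  have t1 : Cmod (kN x - kD x)%C <= 2 / 5.
    have -> : (kN x - kD x = (kN x - 2) + - (kD x - 2))%C by ring.
    apply: Rle_trans (Cmod_triangle _ _) _; rewrite Cmod_opp; lra.
  have t2 : 9 / 5 <= Cmod (kD x).
    have := Cmod_triangle (kD x) (- (kD x - 2))%C; rewrite Cmod_opp.
    have -> : (kD x + - (kD x - 2) = 2)%C by ring.
    rewrite Cmod_R Rabs_pos_eq; lra.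
  (* The quotient is at most (2/5) / (9/5) = 2/9, below 1/4; hence the tolerance 1/5 in [near0]. *)
  apply: (Rmult_le_reg_r (Cmod (kD x))); first lra.
  rewrite /Rdiv Rmult_assoc Rinv_l; lra.
have hc x : 0 < x < d -> Cmod (kN x / kD x - 1)%C <= 3 / 4 * Cmod (kN (RtoC (x * x)) / kD (RtoC (x * x)) - 1)%C.
  move=> hx; have hxx : 0 < x * x < d by nra.
  have hx0 : RtoC x <> 0 by move=> [] hh; lra.
  have hxx0 : RtoC (x * x) <> 0 by move=> [] hh; nra.
  have hd1 y : Cmod y < d -> Cmod y < 1 by lra.
  have e2 : RtoC (x * x) = pw2 x by rewrite RtoC_mult.
  have i1 := hx1 x hx; have i2 := hx1 _ hxx; rewrite e2 in i2 hxx0.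
  have hp y : Cmod y < d -> Cmod (pw2 y) < d by rewrite /pw2 Cmod_mult => h; have := Cmod_ge_0 y; nra.
  have i3 := hp _ i2; have i4 := hp _ i3; have i5 := hp _ i4.
  have nz (z c : C) : Cmod (z - c)%C <= / 5 -> / 5 < Cmod c -> z <> 0 by exact: Cmod_near_neq0.
  have c1 : / 5 < Cmod 1 by rewrite Cmod_1; lra.
  have c2 : / 5 < Cmod 2 by rewrite Cmod_R Rabs_pos_eq; lra.
  have [_ [_ [nO _]]] := hn _ i1.
  have [_ [_ [nO1 [nE1 _]]]] := hn _ i2.
  have [_ [_ [_ [_ [nX1 nY]]]]] := hn _ i4.
  have [_ [_ [_ [_ [_ nY1]]]]] := hn _ i5.
  apply: (kappa_contract _ _ (2 * pw2 x * Ps (pw2 (pw2 (pw2 (pw2 x)))) / Th (pw2 (pw2 (pw2 x))))%C).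
  - exact: hkap.
  - exact: hkap.
  - apply: quot_sq_small.
    + by rewrite /pw2 Cmod_mult; have := Cmod_ge_0 x; nra.
    + exact: nY1.
    + exact: nX1.
  - rewrite e2 /kN /kD.
    apply: (kappa_rel _ _ _ _ _ _ _ _ _ (nz _ _ nO c1) (nz _ _ nO1 c1) (nz _ _ nX1 c1) (nz _ _ nY c1)
      (nz _ _ nY1 c1) (nz _ _ nE1 c2)).
    + exact: (ident_A2 f a H _ hxx0 (hd1 _ i2)).
    + exact: (ident_B f a H _ hx0 (hd1 _ i1)).
    + have h := Th_XZ _ (hd1 _ i2); rewrite -h; set A := Th _; set B := Ps _; rewrite /pw2; ring.
    + exact: psi_sq_fun (hd1 _ i4).
have hit n : forall x, 0 < x < d -> Cmod (kN x / kD x - 1)%C <= (3 / 4) ^ n * / 4.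
  elim: n => [|n IH] x hx; first by rewrite /= Rmult_1_l; exact: hkap.
  apply: Rle_trans (hc x hx) _; have := IH (x * x) ltac:(nra); rewrite /=; lra.
move=> x hx.
have hD : kD x <> 0.
  have [_ [k2 _]] := hn _ (hx1 x hx); apply: Cmod_near_neq0 k2 _; rewrite Cmod_R Rabs_pos_eq; lra.
have e : (kN x / kD x = 1)%C.
  apply: Cmod_small_eq => eps heps.
  have [n hn'] := pow_lt_1_zero (3 / 4) ltac:(rewrite Rabs_pos_eq; lra) eps heps.
  have := hn' n (le_n _); rewrite Rabs_pos_eq; last by apply: pow_le; lra.
  have := hit n x hx; have : 0 <= (3 / 4) ^ n by apply: pow_le; lra.
  lra.
have -> : kN x = (kN x / kD x * kD x)%C by field.
rewrite e; ring.
Qed.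
End Link.

(** * Reality and bounds for the coefficients of f_1 *)

Section Coefficients.
Variables (f : C -> C) (a : nat -> C) (H : data1 a f).
Let hps : psrep a (psum a). Proof. by case: H => _ [_ []]. Qed.

(** With k = 1, [ident_A2] and [Th_XZ] give (E X)^2 = 4 W^2 for W = theta(x^2). Near 0 both E X and
    2 W are close to 2, which settles the sign. *)
Lemma ev_ov_theta : exists d, 0 < d /\ forall x, 0 < x < d ->
  (ev a (RtoC x) * Th (pw2 (pw2 (RtoC x))) = 2 * Th (pw2 (RtoC x)))%C /\
  (ov a (RtoC x) * Ps (pw2 (pw2 (pw2 (RtoC x)))) = Th (pw2 (RtoC x)))%C.
Proof.
have [d1 [hd1 h1]] := kappa_one f a H; have [d2 [[hd2 hd2'] h2]] := near0 f a H.
exists (Rmin d1 d2); split; first exact: Rmin_glb_lt.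
move=> x [hx hx']; have m1 := Rmin_l d1 d2; have m2 := Rmin_r d1 d2.
have hk := h1 x ltac:(lra); rewrite /kN /kD in hk.
have hx0 : RtoC x <> 0 by move=> [] hh; lra.
have hxd : Cmod (RtoC x) < d2 by rewrite Cmod_R Rabs_pos_eq; lra.
have hx1 : Cmod (RtoC x) < 1 by lra.
have hxx : Cmod (pw2 x) < d2 by rewrite /pw2 Cmod_mult; have := Cmod_ge_0 x; nra.
have [kN' [_ [nO _]]] := h2 _ hxd; have [_ [_ [_ [_ [nT _]]]]] := h2 _ hxx.
have hO : ov a x <> 0 by apply: Cmod_near_neq0 nO _; rewrite Cmod_1; lra.
have hA := ident_A2 f a H _ hx0 hx1; have hT := Th_XZ _ hx1.
rewrite /kN in kN'.
move: kN' nT hk hA hT hO.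
move: (ev a x) (ov a x) (Th (pw2 (pw2 x))) (Ps (pw2 (pw2 (pw2 x)))) (Th (pw2 x)) => E O X Y W nE nT hk hA hT hO.
have hs : ((E * X - 2 * W) * (E * X + 2 * W) = 0)%C.
  apply: (Cmult_eq_0_r (O * O)); first exact: Cmult_neq_0.
  transitivity (E * E * (O * O) * (X * X) - 4 * (O * O) * (W * W))%C; first ring.
  rewrite -hA -hT.
  transitivity (4 * pw2 x * ((E * X) * (E * X) - 4 * (O * O) * (Y * Y)))%C; first by rewrite /pw2; ring.
  rewrite hk; ring.
have hp : (E * X + 2 * W)%C <> 0.
  apply: (Cmod_near_neq0 _ 4 1); last by rewrite Cmod_R Rabs_pos_eq; lra.
  have -> : (E * X + 2 * W - 4 = (E * X - 2) + 2 * (W - 1))%C by ring.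
  apply: Rle_trans (Cmod_triangle _ _) _; rewrite (Cmod_mult 2) Cmod_R (Rabs_pos_eq 2); lra.
have e : (E * X = 2 * W)%C.
  apply: Cminus_eq0; apply: (Cmult_eq_0_r _ _ hp); rewrite Cmult_comm; exact: hs.
split=> //; apply: Cminus_eq0; apply: (Cmult_eq_0_r 2) C2_neq0 _.
transitivity (2 * (O * Y) - 2 * W)%C; first ring.
rewrite -hk e; ring.
Qed.

Definition ee_coef : nat -> C := fun n => (/ 2 * (a n + a n * (- (1)) ^ n))%C.
Definition oo_coef : nat -> C := fun n => (/ 2 * (a n + - (1) * (a n * (- (1)) ^ n)))%C.

Lemma psum_opp_rep : psrep (fun n => a n * (- (1)) ^ n)%C (fun s => psum a (- s)%C).
Proof.
have h := psrep_rot (- (1))%C _ _ ltac:(by rewrite Cmod_m1; lra) hps.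
by move=> s hs; have := h s hs; have -> : (- (1) * s = - s)%C by ring.
Qed.

Lemma ev_rep : psrep ee_coef (ev a).
Proof.
move=> s hs; have := psrep_scal (/ 2)%C _ _ (psrep_plus _ _ _ _ hps psum_opp_rep) s hs.
by rewrite /ev /Cdiv Cmult_comm.
Qed.
Lemma ov_rep : psrep (fun n => match n with O => 1 | S m => oo_coef m end) (ov a).
Proof.
have h := psrep_cons 1 _ _ (psrep_scal (/ 2)%C _ _ (psrep_plus _ _ _ _ hps (psrep_scal (- (1))%C _ _ psum_opp_rep))).
move=> s hs; have := h s hs; rewrite /ov.
by have -> : (1 + s * (/ 2 * (psum a s + - (1) * psum a (- s))) = 1 + s * ((psum a s - psum a (- s)) / 2))%C by rewrite /Cdiv; ring.
Qed.

Lemma pow_m1_even (n : nat) : ((- (1)) ^ (2 * n) = 1)%C.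
Proof.
elim: n => [|n IH] //; have -> : (2 * S n = S (S (2 * n)))%nat by lia.
rewrite !Cpow_S IH; ring.
Qed.

(** [g] is [Re] or [Im]: the two parts of the coefficients are treated separately until the
    coefficients are known to be real. *)
Definition ehat (g : C -> R) : fps := fun n => g (a (2 * n)%nat).
Definition yhat (c : R) (g : C -> R) : fps := fun n => match n with O => c | S m => g (a (S (2 * m))) end.

Lemma ee_dil (g : C -> R) : g 0 = 0 -> (fun n => g (ee_coef n)) = dil (ehat g).
Proof.
move=> h0; apply: functional_extensionality; apply: even_odd_ind => n; rewrite ?dil_even ?dil_odd /ee_coef /ehat.
  rewrite pow_m1_even; congr g; by field.
rewrite Cpow_S pow_m1_even -h0; congr g; ring.
Qed.
Lemma oo_dil (g : C -> R) : g 0 = 0 ->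
  (fun n => g (match n with O => RtoC 1 | S m => oo_coef m end)) = dil (yhat (g 1) g).
Proof.
move=> h0; apply: functional_extensionality; apply: even_odd_ind => n; rewrite ?dil_even ?dil_odd /yhat.
  case: n => [|n] //; have -> : (2 * S n = S (S (2 * n)))%nat by lia.
  rewrite /oo_coef Cpow_S pow_m1_even; congr g; by field.
rewrite /oo_coef pow_m1_even -h0; congr g; ring.
Qed.

Lemma ehat_eq : fmul (ehat Re) (dil theta) = fmul (fcst 2) theta /\ fmul (ehat Im) (dil theta) = fcst 0.
Proof.
have [d [hd h]] := ev_ov_theta.
have h1 := rrep_dil _ _ (rrep_dil _ _ Th_rep); have h2 := rrep_scal 2 _ _ (rrep_dil _ _ Th_rep).
have [k1 k2] := psrep_real_mult _ _ _ _ _ _ _ ev_rep h1 h2 hd (fun x hx => proj1 (h x hx)).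
rewrite (ee_dil Re) // in k1; rewrite (ee_dil Im) // in k2.
by split; apply: dil_inj; rewrite !dil_mul ?dil_cst.
Qed.
Lemma yhat_eq : fmul (yhat 1 Re) (dil (dil psi)) = theta /\ fmul (yhat 0 Im) (dil (dil psi)) = fcst 0.
Proof.
have [d [hd h]] := ev_ov_theta.
have h1 := rrep_dil _ _ (rrep_dil _ _ (rrep_dil _ _ Ps_rep)); have h2 := rrep_dil _ _ Th_rep.
have [k1 k2] := psrep_real_mult _ _ _ _ _ _ _ ov_rep h1 h2 hd (fun x hx => proj2 (h x hx)).
rewrite (oo_dil Re) // in k1; rewrite (oo_dil Im) // in k2.
by split; apply: dil_inj; rewrite !dil_mul ?dil_cst.
Qed.

Lemma fmul_zero u v w : fmul v w = fcst 1 -> fmul u v = fcst 0 -> u = fcst 0.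
Proof.
move=> h1 h2; transitivity (fmul (fmul u v) w); last by rewrite h2; ring.
transitivity (fmul u (fmul v w)); [rewrite h1; ring|ring].
Qed.

(** The imaginary parts satisfy the homogeneous equations, whose factors theta(T^2) and psi(T^4) are
    invertible. *)
Lemma a_real n : Im (a n) = 0.
Proof.
have e0 : ehat Im = fcst 0.
  apply: (fmul_zero _ _ (dil (tw G))) (proj2 ehat_eq).
  rewrite -dil_mul -(dil_cst 1) -twG_theta; congr dil; ring.
have y0 : yhat 0 Im = fcst 0.
  apply: (fmul_zero _ _ (dil (dil Psi))) (proj2 yhat_eq).
  rewrite -!dil_mul -(dil_cst 1) -(dil_cst 1) -(finv_mul psi psi_0); do 2 congr dil; rewrite /Psi; ring.
move: n; apply: even_odd_ind => n.
  have := f_equal (fun u => u n) e0; rewrite /ehat => ->; by case: n.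
exact: (f_equal (fun u => u (S n)) y0).
Qed.

Lemma a_even n : Rabs (Re (a (2 * n)%nat)) <= P8 n.
Proof. exact: (e_P8 _ (proj1 ehat_eq) n). Qed.
Lemma a_8 n : Re (a (8 * n)%nat) = P8 n.
Proof.
rewrite -(ep_ep_e _ (proj1 ehat_eq)) /ep /ehat; congr Re; congr a; lia.
Qed.
Lemma a_odd j : Rabs (Re (a (S (2 * j)))) <= 2 * P8 (8 * S (2 * j))%nat.
Proof. exact: (y_bound _ (proj1 yhat_eq) j). Qed.
Lemma a_64 n : Rabs (Re (a n)) <= 2 * P8 (8 * n)%nat.
Proof.
move: n; apply: even_odd_ind => n; last exact: a_odd.
apply: Rle_trans (a_even n) _.
have h1 := P8_mono n; have h2 := P8_mono (4 * n); have h3 := P8_nn (4 * (4 * n))%nat.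
have -> : (8 * (2 * n) = 4 * (4 * n))%nat by lia.
lra.
Qed.
End Coefficients.

(** * Nonnegativity for f_8 *)

(** For even n the budget is exact: the main term is 4 [P8 n], and the others are at most 2, 1 and 1
    times [P8 n]. For odd n only the main term remains, with the factor 1 + chi2(n) >= 0. *)
Theorem a8_nonneg f1 f8 a1 a8 : data1 a1 f1 -> data8 a8 f8 ->
  forall n : nat, Im (a8 n) = 0 /\ 0 <= Re (a8 n).
Proof.
move=> H1 H8 n; have hr := a_real f1 a1 H1.
have [e1 [e2 [e3 [-> [h1 [h2 [[h3 h3'] [ho [h4 h8]]]]]]]]] := a8_formula f1 f8 a1 a8 H1 H8 n.
have hri m : a1 m = RtoC (Re (a1 m)) by apply: C_ext; rewrite ?hr.
rewrite (hri (8 * n)%nat) (hri (2 * n)%nat) (hri (n / 2)%nat) (hri (n / 8)%nat) -!RtoC_mult -!RtoC_plus.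
rewrite re_RtoC im_RtoC; split=> //.
rewrite (a_8 f1 a1 H1).
have p0 := P8_nn n.
have hodd : Nat.Odd n -> 0 <= IZR (chi2 (Z.of_nat n)) + 1.
  move=> _; rewrite /chi2; case: Z.even; [lra|case: orb; lra].
have b2 : Rabs (2 * e1 * Re (a1 (2 * n)%nat)) <= 2 * P8 n.
  rewrite !Rabs_mult (Rabs_pos_eq 2); last lra.
  have := a_even f1 a1 H1 n; have := Rabs_pos e1; have := Rabs_pos (Re (a1 (2 * n)%nat)); nra.
have b1 : Rabs (e2 * Re (a1 (n / 2)%nat)) <= P8 n.
  case: (Req_dec e2 0) => [->|/h4 [m hm]]; first by rewrite Rmult_0_l Rabs_R0.
  rewrite Rabs_mult; have -> : (n / 2 = 2 * m)%nat by rewrite hm; have -> : (4 * m = 2 * m * 2)%nat by [lia]; rewrite Nat.div_mul.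
  have := a_even f1 a1 H1 m; have := P8_mono m; rewrite -hm.
  have := Rabs_pos e2; have := Rabs_pos (Re (a1 (2 * m)%nat)); nra.
have b3 : Rabs (/ 2 * e3 * Re (a1 (n / 8)%nat)) <= P8 n.
  case: (Req_dec e3 0) => [->|/h8 [m hm]]; first by rewrite Rmult_0_r Rmult_0_l Rabs_R0.
  rewrite !Rabs_mult (Rabs_pos_eq (/ 2)); last lra. rewrite (Rabs_pos_eq e3) //.
  have -> : (n / 8 = m)%nat by rewrite hm Nat.mul_comm Nat.div_mul.
  have := a_64 f1 a1 H1 m; rewrite -hm; have := Rabs_pos (Re (a1 m)); nra.
have [he|hod] := Nat.Even_or_Odd n.
  have -> : chi2 (Z.of_nat n) = 0%Z.
    by have [m hm] := he; rewrite /chi2 hm Nat2Z.inj_mul Z.even_mul.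
  move: b2 b1 b3 => /Rabs_le_between b2 /Rabs_le_between b1 /Rabs_le_between b3; lra.
rewrite (ho hod); have hc := hodd hod.
have z2 : e2 = 0.
  by case: (Req_dec e2 0) => // /h4 [m hm]; have [k hk] := hod; lia.
have z3 : e3 = 0.
  by case: (Req_dec e3 0) => // /h8 [m hm]; have [k hk] := hod; lia.
rewrite z2 z3; nra.
Qed.

Definition rfact (m : nat) : R := / INR (fact m).
(** * The main term *)

Definition expt (u : C) (m : nat) : C := (RtoC (rfact m) * u ^ m)%C.

Lemma rfact_pos m : 0 < rfact m.
Proof. by apply: Rinv_0_lt_compat; apply: INR_fact_lt_0. Qed.
Lemma rfact_S m : INR (S m) * rfact (S m) = rfact m.
Proof.
rewrite /rfact fact_simpl mult_INR; field; split; first exact: INR_fact_neq_0.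
exact: not_0_INR.
Qed.
Lemma exp_series x : is_series (fun m => rfact m * x ^ m) (exp x).
Proof.
have := is_exp_Reals x; apply: is_series_ext => n; rewrite /scal /= /mult /= pow_n_pow /rfact; ring.
Qed.
Lemma Cmod_expt u m : Cmod (expt u m) = rfact m * Cmod u ^ m.
Proof. by rewrite /expt Cmod_mult Cmod_pow Cmod_R Rabs_pos_eq //; apply: Rlt_le (rfact_pos m). Qed.

Lemma Csum_parity (u : nat -> C) n :
  Csum u (S (2 * n)) = (Csum (fun k => u (2 * k)%nat) n + Csum (fun k => u (S (2 * k))) n)%C.
Proof.
elim: n => [|n IH]; first by rewrite !Csum_S !Csum_0.
have -> : (S (2 * S n) = S (S (S (2 * n))))%nat by lia.
rewrite 2!Csum_S IH !Csum_S.
have -> : (S (S (2 * n)) = 2 * S n)%nat by lia.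
ring.
Qed.

Lemma expt_I y k : expt (Ci * RtoC y) (2 * k) = RtoC (cos_n k * (y * y) ^ k) /\
  expt (Ci * RtoC y) (S (2 * k)) = (Ci * RtoC (y * (sin_n k * (y * y) ^ k)))%C.
Proof.
have h : ((Ci * RtoC y) ^ (2 * k) = RtoC ((-1) ^ k * (y * y) ^ k))%C.
  elim: k => [|k IH]; first by rewrite /= Rmult_1_r.
  have -> : (2 * S k = S (S (2 * k)))%nat by lia.
  rewrite !Cpow_S IH.
  transitivity (Ci * Ci * (RtoC y * RtoC y) * RtoC ((-1) ^ k * (y * y) ^ k))%C; first ring.
  rewrite Ci_sqr -RtoC_opp -!RtoC_mult; congr RtoC; rewrite /=; ring.
split.
  rewrite /expt h -RtoC_mult; congr RtoC; rewrite /rfact /cos_n /Rdiv; ring.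
rewrite /expt Cpow_S h.
have -> : (S (2 * k) = 2 * k + 1)%nat by lia.
transitivity (Ci * (RtoC (rfact (2 * k + 1)) * RtoC y * RtoC ((-1) ^ k * (y * y) ^ k)))%C; first ring.
congr Cmult; rewrite -!RtoC_mult; congr RtoC; rewrite /rfact /sin_n /Rdiv; ring.
Qed.

Lemma is_series_Reals_sum (u : nat -> R) l : infinite_sum u l -> is_lim_seq (sum_f_R0 u) l.
Proof. by move=> /is_series_Reals h; apply: (is_lim_seq_ext (sum_n u)) => // n; exact: sum_n_Reals. Qed.

Lemma Cexp_I_series y : Cseries (expt (Ci * RtoC y)) (cos y, sin y).
Proof.
have [l hl] : exists l, Cseries (expt (Ci * RtoC y)) l.
  apply: (Cseries_ex _ (fun m => rfact m * Rabs y ^ m)); last by eexists; exact: exp_series.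
  move=> m; rewrite Cmod_expt Cmod_mult Cmod_Ci Rmult_1_l Cmod_R; exact: Rle_refl.
suff -> : (cos y, sin y) = l by [].
have hc : infinite_sum (fun i => cos_n i * (y * y) ^ i) (cos y).
  by rewrite /cos; case: exist_cos => x hx.
have hs : exists s, sin y = y * s /\ infinite_sum (fun i => sin_n i * (y * y) ^ i) s.
  by rewrite /sin; case: exist_sin => x hx; exists x.
have [s [es {}hs]] := hs.
have sub : filterlim (fun n => S (2 * n)) eventually eventually.
  by apply: eventually_subseq => n; lia.
move/Cseries_reim: hl => [hr hi].
have e n : Csum (expt (Ci * RtoC y)) (S (2 * n)) =
   (RtoC (sum_f_R0 (fun i => (cos_n i * (y * y) ^ i)%R) n) + Ci * RtoC (y * sum_f_R0 (fun i => (sin_n i * (y * y) ^ i)%R) n)%R)%C.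
  rewrite Csum_parity; congr Cplus.
    by rewrite -Csum_RtoC; apply: Csum_ext => k _; case: (expt_I y k).
  rewrite (Csum_ext _ (fun k => Ci * (RtoC y * RtoC (sin_n k * (y * y) ^ k)%R))%C); last first.
    by move=> k _; case: (expt_I y k) => _ ->; rewrite -RtoC_mult.
  by rewrite !Csum_scal Csum_RtoC RtoC_mult.
have hr' := filterlim_comp _ _ _ _ _ _ _ _ sub hr.
have hi' := filterlim_comp _ _ _ _ _ _ _ _ sub hi.
apply: C_ext.
  suff : Finite (cos y) = Finite (Re l) by case.
  rewrite -(is_lim_seq_unique _ _ (is_series_Reals_sum _ _ hc)).
  apply: is_lim_seq_unique; apply: (is_lim_seq_ext (fun n => sum_n (fun k => Re (expt (Ci * y) k)) (S (2 * n)))) => // n.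
  rewrite -Csum_Re e !Creim; rewrite /Re /Im /=; ring.
suff : Finite (sin y) = Finite (Im l) by case.
have hs' := is_lim_seq_scal_l _ y _ (is_series_Reals_sum _ _ hs).
rewrite es -[Finite (y * s)](is_lim_seq_unique _ _ hs').
apply: is_lim_seq_unique; apply: (is_lim_seq_ext (fun n => sum_n (fun k => Im (expt (Ci * y) k)) (S (2 * n)))) => // n.
rewrite -Csum_Im e !Creim; rewrite /Re /Im /=; ring.
Qed.

(** The binomial theorem in the form of a Cauchy product; the induction writes m + 1 = k + (m + 1 -
    k) and lowers one factorial in each part. *)
Lemma expt_plus u v n : Cconv (expt u) (expt v) n = expt (u + v) n.
Proof.
rewrite /Cconv.
suff h : forall n, (Csum (fun k => RtoC (INR (fact n)) * (expt u k * expt v (n - k))) n = (u + v) ^ n)%C.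
  have := h n; rewrite Csum_scal => e.
  rewrite /expt -e Cmult_assoc -RtoC_mult /rfact Rinv_l; [by rewrite Cmult_1_l|exact: INR_fact_neq_0].
have r0 : rfact 0 = 1 by rewrite /rfact /= Rinv_1.
elim=> [|m IH]; first by rewrite Csum_0 /expt Nat.sub_0_r r0 /=; ring.
rewrite Cpow_S -IH.
have key (k : nat) : (k <= S m)%nat ->
  (RtoC (INR (fact (S m))) * (expt u k * expt v (S m - k)) =
   RtoC (INR (fact m)) * (RtoC (INR k) * (expt u k * expt v (S m - k)) + RtoC (INR (S m - k)) * (expt u k * expt v (S m - k))))%C.
  move=> hk; rewrite fact_simpl mult_INR RtoC_mult.
  have -> : INR (S m) = INR k + INR (S m - k) by rewrite -plus_INR; congr INR; lia.
  rewrite RtoC_plus; ring.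
rewrite (Csum_ext _ _ _ key) Csum_scal Csum_plus Csum_scal.
transitivity (RtoC (INR (fact m)) * (u * Csum (fun k => expt u k * expt v (m - k)) m + v * Csum (fun k => expt u k * expt v (m - k)) m))%C; last by ring.
congr Cmult; congr Cplus.
  rewrite Csum_S_left; cbv beta; rewrite {1}/INR Cmult_0_l Cplus_0_l -Csum_scal; apply: Csum_ext => k hk.
  have -> : (S m - S k = m - k)%nat by lia.
  rewrite /expt Cpow_S -(rfact_S k) RtoC_mult; ring.
rewrite Csum_S Nat.sub_diag {2}/INR Cmult_0_l Cplus_0_r -Csum_scal; apply: Csum_ext => k hk.
have -> : (S m - k = S (m - k))%nat by lia.
rewrite /expt Cpow_S -(rfact_S (m - k)) RtoC_mult; ring.
Qed.

Lemma Cexp_series u : Cseries (expt u) (Cexp u).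
Proof.
have hu : u = (RtoC (Re u) + Ci * RtoC (Im u))%C by apply: C_ext; rewrite !Creim; rewrite /Re /Im /=; ring.
have -> : Cexp u = (RtoC (exp (Re u)) * (cos (Im u), sin (Im u)))%C.
  by apply: C_ext; rewrite !Creim; rewrite /Cexp /Re /Im /=; ring.
have h1 : Cseries (expt (RtoC (Re u))) (RtoC (exp (Re u))).
  apply/Cseries_reim; split.
    apply: is_series_ext (exp_series (Re u)) => n; rewrite /expt -RtoC_pow -RtoC_mult //.
  apply: (is_series_ext (fun _ => 0)); first by move=> n; rewrite /expt -RtoC_pow -RtoC_mult.
  by apply: is_lim_seq_ext (is_lim_seq_const 0) => n; rewrite sum_n_const Rmult_0_r.
have := Cseries_mult _ _ _ _ (fun n => rfact n * Rabs (Re u) ^ n) (fun n => rfact n * Rabs (Im u) ^ n) h1 (Cexp_I_series (Im u)).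
move=> h; apply: Cseries_ext (h _ _ _ _) => [n|n||n|].
- by rewrite expt_plus -hu.
- rewrite Cmod_expt Cmod_R; exact: Rle_refl.
- eexists; exact: exp_series.
- rewrite Cmod_expt Cmod_mult Cmod_Ci Rmult_1_l Cmod_R; exact: Rle_refl.
- eexists; exact: exp_series.
Qed.

Definition exptail (N : nat) (r : R) : R := exp r - sum_f_R0 (fun m => rfact m * r ^ m) N.

Lemma Cexp_tail u N r : Cmod u <= r -> Cmod (Cexp u - Csum (expt u) N)%C <= exptail N r.
Proof.
move=> hr; have hr0 : 0 <= r := Rle_trans _ _ _ (Cmod_ge_0 _) hr.
pose cut (b : nat -> C) := fun n => if Nat.leb n N then RtoC 0 else b n.
have hcut (b : nat -> C) l : Cseries b l -> Cseries (cut b) (l - Csum b N)%C.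
  move=> h.
  have h2 := Cseries_zero_from (fun n => if Nat.leb n N then b n else RtoC 0) N.
  have e : Csum (fun n => if Nat.leb n N then b n else RtoC 0) N = Csum b N.
    by apply: Csum_ext => k hk; rewrite (proj2 (Nat.leb_le k N)).
  rewrite e in h2.
  apply: Cseries_ext (Cseries_minus _ _ _ _ h (h2 _)) => n; last first.
    by move=> hn; rewrite (proj2 (Nat.leb_gt n N)).
  rewrite /cut; case: Nat.leb; ring.
have h1 := hcut _ _ (Cexp_series u); have h2 := hcut _ _ (Cexp_series (RtoC r)).
have er : (Cexp (RtoC r) - Csum (expt (RtoC r)) N)%C = RtoC (exptail N r).
  have -> : Cexp (RtoC r) = RtoC (exp r).
    by rewrite /Cexp re_RtoC im_RtoC cos_0 sin_0; apply: C_ext; rewrite /Re /Im /=; ring.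
  rewrite /exptail RtoC_minus -Csum_RtoC; congr Cminus; apply: Csum_ext => k _.
  by rewrite /expt RtoC_mult RtoC_pow.
rewrite er in h2; move/Cseries_reim: h2 => [h2 _].
apply: (Cseries_norm _ _ (fun n => Re (cut (expt (RtoC r)) n)) _ h1) => //.
move=> n; rewrite /cut; case: Nat.leb; first by rewrite Cmod_0; exact: Rle_refl.
rewrite Cmod_expt /expt -RtoC_pow -RtoC_mult re_RtoC; apply: Rmult_le_compat_l; first exact: Rlt_le (rfact_pos n).
by apply: pow_incr; split=> //; exact: Cmod_ge_0.
Qed.

Lemma exptail_lim r : is_lim_seq (fun N => exptail N r) 0.
Proof.
have h := is_lim_seq_minus' _ _ _ _ (is_lim_seq_const (exp r)) (exp_series r).
have -> : Finite 0 = Finite (exp r - exp r) by congr Finite; ring.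
by apply: is_lim_seq_ext h => N; rewrite /exptail sum_n_Reals.
Qed.

Section Entire.
Variable s : C.

(** The Taylor series of e^(-s) with multipliers c. Multipliers of modulus at most 1 give functions
    bounded by e^|s|, which yields all bounds at once. *)
Definition Aser (c : nat -> R) : C := Ctsum (fun m => RtoC (c m) * expt (- s) m)%C.

Lemma Aser_bound c : (forall m, Rabs (c m) <= 1) ->
  forall m, Cmod (RtoC (c m) * expt (- s) m)%C <= rfact m * Cmod s ^ m.
Proof.
move=> h m; rewrite Cmod_mult Cmod_expt Cmod_opp Cmod_R -[X in _ <= X]Rmult_1_l.
apply: Rmult_le_compat_r => //; apply: Rmult_le_pos; first exact: Rlt_le (rfact_pos m).
apply: pow_le; exact: Cmod_ge_0.
Qed.
Lemma Aser_series c : (forall m, Rabs (c m) <= 1) ->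
  Cseries (fun m => RtoC (c m) * expt (- s) m)%C (Aser c).
Proof.
move=> h; have [l hl] := Cseries_ex _ _ (Aser_bound c h) (ex_intro _ _ (exp_series (Cmod s))).
exact: Cseries_Ctsum hl.
Qed.
Lemma Aser_norm c : (forall m, Rabs (c m) <= 1) -> Cmod (Aser c) <= exp (Cmod s).
Proof. move=> h; exact: Cseries_norm (Aser_series c h) (Aser_bound c h) (exp_series _). Qed.
Lemma Aser_1 : Aser (fun _ => 1) = Cexp (- s).
Proof.
apply: Cseries_unique (Aser_series _ _) _; first by move=> _; rewrite Rabs_R1; lra.
apply: Cseries_ext (Cexp_series _) => m; ring.
Qed.
Lemma Aser_0 : Aser (fun m => match m with O => 1 | _ => 0 end) = 1.
Proof.
apply: Cseries_unique (Aser_series _ _) _.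
  by move=> [|m]; rewrite ?Rabs_R1 ?Rabs_R0; lra.
have := Cseries_zero_from (fun m => RtoC (match m with O => 1 | _ => 0 end) * expt (- s) m)%C 0.
rewrite Csum_0 /expt /rfact /= Rinv_1 !Cmult_1_l; apply=> -[|n] hn; [lia|ring].
Qed.
Lemma Aser_lin c c' c'' x : (forall m, Rabs (c m) <= 1) -> (forall m, Rabs (c' m) <= 1) ->
  (forall m, Rabs (c'' m) <= 1) -> (forall m, c'' m = c m + x * c' m) ->
  Aser c'' = (Aser c + RtoC x * Aser c')%C.
Proof.
move=> h h' h'' e; apply: Cseries_unique (Aser_series _ h'') _.
apply: Cseries_ext (Cseries_plus _ _ _ _ (Aser_series _ h) (Cseries_scal (RtoC x) _ _ (Aser_series _ h'))) => m.
rewrite e RtoC_plus RtoC_mult; ring.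
Qed.
(** Multiplication by s shifts the index: s (-s)^m / m! = - (m + 1) (-s)^(m+1) / (m + 1)!. *)
Lemma Aser_shift c c' : (forall m, Rabs (c m) <= 1) -> (forall m, Rabs (c' m) <= 1) ->
  c' 0%nat = 0 -> (forall m, c' (S m) = INR (S m) * c m) -> (s * Aser c = - Aser c')%C.
Proof.
move=> h h' h0 hS.
suff h1 : Cseries (fun m => RtoC (c' m) * expt (- s) m)%C (- (s * Aser c))%C.
  rewrite -(Cseries_unique _ _ _ h1 (Aser_series _ h')); ring.
apply: is_series_decr_1.
have -> : plus (- (s * Aser c))%C (opp (RtoC (c' 0%nat) * expt (- s) 0)%C) = (- (s * Aser c))%C.
  rewrite h0 /plus /opp /=; ring.
have -> : (- (s * Aser c) = - s * Aser c)%C by ring.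
apply: Cseries_ext (Cseries_scal (- s)%C _ _ (Aser_series _ h)) => m.
rewrite hS /expt Cpow_S -(rfact_S m) !RtoC_mult; ring.
Qed.

(* w1 k and w2 k are the t^k-coefficients of (1 - e^(-v))/v and (1 - (1 - e^(-v))/v)/v, where v = s - t.
   The generating function of the sigma_j(e^(-s)) is 1/(1 - e^(-v)), so its product with the former is 1/v. *)
Definition wc1 (k m : nat) : R := / INR (m + k + 1).
Definition wc2 (k m : nat) : R := / (INR (m + k + 1) * INR (m + k + 2)).
Definition w1 (k : nat) : C := (RtoC (rfact k) * Aser (wc1 k))%C.
Definition w2 (k : nat) : C := (RtoC (rfact k) * Aser (wc2 k))%C.

Lemma inv_le1 x : 1 <= x -> 0 <= / x <= 1.
Proof.
move=> h; split; first by apply: Rlt_le; apply: Rinv_0_lt_compat; lra.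
rewrite -[X in _ <= X]Rinv_1; apply: Rinv_le_contravar; lra.
Qed.
Lemma INR_ge1 n : 1 <= INR (n + 1).
Proof. have := pos_INR n; rewrite plus_INR /=; lra. Qed.
Lemma wc1_le k m : Rabs (wc1 k m) <= 1.
Proof. have := inv_le1 _ (INR_ge1 (m + k)); rewrite -/(wc1 k m) => h; rewrite Rabs_pos_eq; lra. Qed.
Lemma wc2_le k m : Rabs (wc2 k m) <= 1.
Proof.
have h1 := INR_ge1 (m + k); have h2 := INR_ge1 (m + k + 1).
have e : INR (m + k + 2) = INR (m + k + 1 + 1) by congr INR; lia.
have := inv_le1 (INR (m + k + 1) * INR (m + k + 2)) ltac:(rewrite e; nra).
by rewrite -/(wc2 k m) => h; rewrite Rabs_pos_eq; lra.
Qed.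

Definition dl0 (k : nat) : C := match k with O => RtoC 1 | _ => RtoC 0 end.
Definition prv (w : nat -> C) (k : nat) : C := match k with O => RtoC 0 | S k => w k end.

(** With W1 the generating function of the [w1 k], this is the t^k-coefficient of (s - t) W1 = 1 -
    e^(-s) e^t. *)
Lemma w1_rec k : (s * w1 k = prv w1 k + dl0 k - RtoC (rfact k) * Cexp (- s))%C.
Proof.
have h1 (m : nat) : Rabs 1 <= 1 by rewrite Rabs_R1; lra.
set c' := fun m => match m with O => 0 | S m => INR (S m) * wc1 k m end.
have hc' m : Rabs (c' m) <= 1.
  case: m => [|m]; first by rewrite /c' Rabs_R0; lra.
  rewrite /c' /wc1; have -> : (m + k + 1 = S m + k)%nat by lia.
  have p := lt_0_INR (S m) ltac:(lia); have q := pos_INR k.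
  rewrite plus_INR Rabs_pos_eq; last by apply: Rdiv_le_0_compat; lra.
  apply: (Rmult_le_reg_r (INR (S m) + INR k)); first lra.
  rewrite Rmult_assoc Rinv_l; lra.
have hs := Aser_shift _ c' (wc1_le k) hc' (eq_refl _) (fun m => eq_refl _).
case: k @c' hc' hs => [|k] c' hc' hs.
  have e : Aser c' = (Cexp (- s) + RtoC (-1) * 1)%C.
    rewrite -Aser_1 -Aser_0; apply: Aser_lin => //.
      by move=> [|m]; rewrite ?Rabs_R1 ?Rabs_R0; lra.
    move=> [|m]; rewrite /c'; first by ring.
    rewrite /wc1; have -> : (m + 0 + 1 = S m)%nat by lia.
    rewrite Rinv_r; [ring|exact: not_0_INR].
  rewrite /w1 /= /rfact /= Rinv_1; transitivity (s * Aser (wc1 0))%C; first ring.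
  rewrite hs e; ring.
have e : Aser c' = (Cexp (- s) + RtoC (- INR (S k)) * Aser (wc1 k))%C.
  rewrite -Aser_1; apply: Aser_lin => //; first exact: wc1_le.
  move=> [|m]; rewrite /c' /wc1.
    have -> : (0 + k + 1 = S k)%nat by lia.
    field; exact: not_0_INR.
  have -> : (m + S k + 1 = S m + k + 1)%nat by lia.
  rewrite (plus_INR (S m + k)) (plus_INR (S m)) (S_INR k) (_ : INR 1 = 1) //.
  have p := lt_0_INR (S m) ltac:(lia); have q := pos_INR k.
  field; lra.
rewrite /w1 /prv /dl0; transitivity (RtoC (rfact (S k)) * (s * Aser (wc1 (S k))))%C; first ring.
rewrite hs e -(rfact_S k) RtoC_opp RtoC_mult; ring.
Qed.

(** In the same way, this is the t^k-coefficient of (s - t) W2 = 1 - W1. *)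
Lemma w2_rec k : (s * w2 k = prv w2 k + dl0 k - w1 k)%C.
Proof.
set c' := fun m => match m with O => 0 | S m => INR (S m) * wc2 k m end.
have hc' m : Rabs (c' m) <= 1.
  case: m => [|m]; first by rewrite /c' Rabs_R0; lra.
  rewrite /c' /wc2; have -> : (m + k + 1 = S m + k)%nat by lia.
  have -> : (m + k + 2 = S m + k + 1)%nat by lia.
  have p := lt_0_INR (S m) ltac:(lia); have q := pos_INR k.
  rewrite (plus_INR (S m + k)) (plus_INR (S m)) (_ : INR 1 = 1) //.
  set D := (INR (S m) + INR k) * (INR (S m) + INR k + 1).
  have hD : INR (S m) <= D by rewrite /D; nra.
  rewrite Rabs_pos_eq; last by apply: Rdiv_le_0_compat; lra.
  apply: (Rmult_le_reg_r D); first lra.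
  rewrite Rmult_assoc Rinv_l; lra.
have hs := Aser_shift _ c' (wc2_le k) hc' (eq_refl _) (fun m => eq_refl _).
case: k @c' hc' hs => [|k] c' hc' hs.
  have e : Aser c' = (Aser (wc1 0) + RtoC (-1) * 1)%C.
    rewrite -Aser_0; apply: Aser_lin => //; first exact: wc1_le.
      by move=> [|m]; rewrite ?Rabs_R1 ?Rabs_R0; lra.
    move=> [|m]; rewrite /c' /wc1 /wc2; first by rewrite /= Rinv_1; ring.
    have -> : (m + 0 + 1 = S m)%nat by lia.
    have -> : (m + 0 + 2 = S m + 0 + 1)%nat by lia.
    rewrite (plus_INR (S m + 0)) (plus_INR (S m)) (_ : INR 1 = 1) // (_ : INR 0 = 0) //.
    have p := lt_0_INR (S m) ltac:(lia).
    field; lra.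
  rewrite /w2 /w1 /= /rfact /= Rinv_1; transitivity (s * Aser (wc2 0))%C; first ring.
  rewrite hs e; ring.
have e : Aser c' = (Aser (wc1 (S k)) + RtoC (- INR (S k)) * Aser (wc2 k))%C.
  apply: Aser_lin => //; [exact: wc1_le|exact: wc2_le|].
  move=> [|m]; rewrite /c' /wc1 /wc2.
    have -> : (0 + S k + 1 = k + 2)%nat by lia.
    have -> : (0 + k + 1 = S k)%nat by lia.
    have -> : (0 + k + 2 = k + 2)%nat by lia.
    field; split; apply: not_0_INR; lia.
  have -> : (m + S k + 1 = S m + k + 1)%nat by lia.
  have -> : (m + S k + 2 = S m + k + 1 + 1)%nat by lia.
  have -> : (S m + S k + 1 = S m + k + 1 + 1)%nat by lia.
  have -> : (S m + k + 2 = S m + k + 1 + 1)%nat by lia.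
  rewrite !(plus_INR _ 1) (plus_INR (S m)) (S_INR k) (_ : INR 1 = 1) //.
  have p := lt_0_INR (S m) ltac:(lia); have q := pos_INR k.
  field; lra.
rewrite /w2 /w1 /prv /dl0; transitivity (RtoC (rfact (S k)) * (s * Aser (wc2 (S k))))%C; first ring.
rewrite hs e -(rfact_S k) RtoC_opp RtoC_mult; ring.
Qed.
End Entire.

Lemma rfact_0 : rfact 0 = 1.
Proof. by rewrite /rfact /= Rinv_1. Qed.

Lemma exp_term x j : 0 <= x -> rfact j * x ^ j <= exp x.
Proof.
move=> hx; have h := exp_series x.
have hp k : 0 <= rfact k * x ^ k by apply: Rmult_le_pos; [exact: Rlt_le (rfact_pos k)|exact: pow_le].
apply: Rle_trans (sum_n_le_series _ _ j hp h).
case: j => [|j]; first by rewrite sum_O; exact: Rle_refl.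
rewrite sum_Sn /plus /=; have : 0 <= sum_n (fun k => rfact k * x ^ k) j; last by rewrite /=; lra.
elim: j => [|j IH]; first by rewrite sum_O.
rewrite sum_Sn /plus /=; have := hp (S j); rewrite /= in IH *; lra.
Qed.

Lemma npow_geom j r : 0 <= r < 1 -> exists K, forall n, INR n ^ j * r ^ n <= K.
Proof.
move=> hr; set r' := Rmax r (/ 2).
have h1 : r <= r' by exact: Rmax_l.
have h2 : 0 < r' < 1 by split; [have := Rmax_r r (/ 2); rewrite -/r'; lra|apply: Rmax_lub_lt; lra].
set t := - ln r'.
have ht : 0 < t by rewrite /t; have := ln_increasing r' 1 (proj1 h2) (proj2 h2); rewrite ln_1; lra.
exists (/ (rfact j * t ^ j)) => n.
have hp : 0 < rfact j * t ^ j by apply: Rmult_lt_0_compat; [exact: rfact_pos|exact: pow_lt].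
apply: (Rmult_le_reg_r _ _ _ hp); rewrite Rinv_l; last lra.
have hn := pos_INR n.
have h3 := exp_term (INR n * t) j ltac:(nra).
have h4 : r ^ n <= exp (- (INR n * t)).
  have -> : exp (- (INR n * t)) = r' ^ n.
    by rewrite -Rpower_pow ?/Rpower; [congr exp; rewrite /t; ring|lra].
  apply: pow_incr; lra.
have h5 : exp (INR n * t) * exp (- (INR n * t)) = 1 by rewrite -exp_plus Rplus_opp_r exp_0.
have h6 : 0 <= r ^ n by apply: pow_le; lra.
have h7 := exp_pos (INR n * t).
have -> : INR n ^ j * r ^ n * (rfact j * t ^ j) = rfact j * (INR n * t) ^ j * r ^ n by rewrite Rpow_mult_distr; ring.
apply: Rle_trans (Rmult_le_compat_r _ _ _ h6 h3) _; nra.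
Qed.

(** * The series with coefficients n^j / j! and their singular parts *)

Definition sg (j n : nat) : R := INR n ^ j * rfact j.
Definition sigma (j : nat) : C -> C := psum (fun n => RtoC (sg j n)).

Lemma sigma_rep j : rrep (sg j) (sigma j).
Proof.
apply: psrep_psum => r hr; have [K hK] := npow_geom j r hr; exists (rfact j * K) => n.
have hj := rfact_pos j.
rewrite Cmod_R Rabs_pos_eq; last by apply: Rmult_le_pos; [apply: pow_le; exact: pos_INR|lra].
have := Rmult_le_compat_l _ _ _ (Rlt_le _ _ hj) (hK n); rewrite /sg; lra.
Qed.

(** The generating function S = sum over j of [sigma j q] t^j is 1 / (1 - q e^t); the recursion is
    the t^j-coefficient of S = 1 + q e^t S. *)
Lemma sigma_rec j q : Cmod q < 1 ->
  sigma j q = (dl0 j + q * Csum (fun i => RtoC (rfact (j - i)) * sigma i q) j)%C.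
Proof.
move=> hq; apply: Cseries_unique (sigma_rep j q hq) _.
have h := psrep_cons (dl0 j) _ _ (psrep_Csum _ _ j (fun i => psrep_scal (RtoC (rfact (j - i))) _ _ (sigma_rep i))).
apply: Cseries_ext (h q hq) => -[|n]; congr Cmult.
  by rewrite /sg; case: j {h} => [|j]; rewrite /dl0 /= ?rfact_0; congr RtoC; ring.
have -> : RtoC (sg j (S n)) = expt (RtoC (INR n) + RtoC 1) j.
  by rewrite /expt /sg -RtoC_plus -RtoC_pow -RtoC_mult S_INR; congr RtoC; ring.
rewrite -expt_plus /Cconv; apply: Csum_ext => i _.
rewrite /expt -!RtoC_pow pow1 -!RtoC_mult; congr RtoC; rewrite /sg; ring.
Qed.

Lemma Cmult_reg_l (r x y : C) : r <> 0 -> (r * x = r * y)%C -> x = y.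
Proof.
move=> hr e; apply: Cminus_eq0; apply: (Cmult_eq_0_r _ _ hr).
transitivity (r * x - r * y)%C; [ring|rewrite e; ring].
Qed.

Section Compare.
Variables (s : C) (Hs : 0 < Re s).
Let q := Cexp (- s).
Let s0 : s <> 0. Proof. by move=> h; move: Hs; rewrite h re_RtoC; lra. Qed.
Let hq : Cmod q < 1.
Proof.
rewrite /q Cmod_Cexp Re_opp -exp_0; apply: exp_increasing; lra.
Qed.

(** The t^j-coefficient of 1 / (s - t), which is the singular part of [sigma j] at s = 0. *)
Definition ip (j : nat) : C := (/ s ^ S j)%C.
Definition dd (j : nat) : C := (sigma j q - ip j)%C.

Lemma ip_S j : (s * ip (S j) = ip j)%C.
Proof. have h := Cpow_nz s (S j) s0; rewrite /ip (Cpow_S s (S j)); by field. Qed.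
Lemma ip_0 : (s * ip 0 = 1)%C.
Proof. rewrite /ip /=; by field. Qed.

Lemma w1_0 : (s * w1 s 0 = 1 - q)%C.
Proof. rewrite w1_rec /= rfact_0 /q; ring. Qed.

Lemma conv1 j : Csum (fun i => w1 s (j - i) * sigma i q)%C j = ip j.
Proof.
elim: j => [|j IH]; apply: (Cmult_reg_l _ _ _ s0).
  have h := sigma_rec 0 q hq; rewrite Csum_0 rfact_0 /dl0 in h.
  rewrite Csum_0 Cmult_assoc w1_0 ip_0.
  transitivity (sigma 0 q - q * sigma 0 q)%C; first ring.
  rewrite {1}h; ring.
rewrite ip_S Csum_S Nat.sub_diag Cmult_plus_distr_l Cmult_assoc w1_0 -Csum_scal.
rewrite (Csum_ext _ (fun i => w1 s (j - i) * sigma i q + - q * (RtoC (rfact (S j - i)) * sigma i q))%C); last first.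
  move=> i hi; have -> : (S j - i = S (j - i))%nat by lia.
  rewrite Cmult_assoc w1_rec /= -/q; ring.
rewrite Csum_plus IH Csum_scal.
have h := sigma_rec (S j) q hq; rewrite Csum_S Nat.sub_diag rfact_0 /dl0 in h.
transitivity (ip j + (sigma (S j) q - (0 + q * (Csum (fun i => RtoC (rfact (S j - i)) * sigma i q) j + 1 * sigma (S j) q))))%C; first ring.
rewrite -h; ring.
Qed.

Lemma conv2 j : (Csum (fun i => w1 s (j - i) * ip i) j + w2 s j = ip j)%C.
Proof.
elim: j => [|j IH]; apply: (Cmult_reg_l _ _ _ s0).
  rewrite Csum_0 Cmult_plus_distr_l w2_rec ip_0 /=.
  transitivity (w1 s 0 * (s * ip 0) + 1 - w1 s 0)%C; first by ring.
  rewrite ip_0; ring.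
rewrite ip_S -IH Csum_S_left; cbv beta; rewrite Nat.sub_0_r 2!Cmult_plus_distr_l w2_rec /= -Csum_scal.
rewrite (Csum_ext _ (fun i => w1 s (j - i) * ip i)%C); last first.
  by move=> i hi; rewrite -(ip_S i); change (S j - S i)%nat with (j - i)%nat; ring.
transitivity (w1 s (S j) * (s * ip 0) + Csum (fun i => w1 s (j - i) * ip i) j + (w2 s j + 0 - w1 s (S j)))%C; first ring.
rewrite ip_0; ring.
Qed.

(** The singular parts have cancelled: both [w1] and [w2] stay bounded near s = 0, so [dd j] is
    recovered by dividing by [w1 s 0]. *)
Lemma conv3 j : Csum (fun i => w1 s (j - i) * dd i)%C j = w2 s j.
Proof.
rewrite (Csum_ext _ (fun i => w1 s (j - i) * sigma i q + - (1) * (w1 s (j - i) * ip i))%C); last first.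
  by move=> i _; rewrite /dd; ring.
rewrite Csum_plus conv1 Csum_scal -(conv2 j); ring.
Qed.

Lemma rfact_le1 k : rfact k <= 1.
Proof.
apply: Rle_trans (proj2 (inv_le1 _ _)) (Rle_refl _).
have : (1 <= fact k)%nat by have := lt_O_fact k; lia.
by move/le_INR.
Qed.

Lemma w_norm k : Cmod (w1 s k) <= exp (Cmod s) /\ Cmod (w2 s k) <= exp (Cmod s).
Proof.
have h1 := Aser_norm s _ (wc1_le k); have h2 := Aser_norm s _ (wc2_le k).
have p := rfact_pos k; have l := rfact_le1 k.
have g1 := Cmod_ge_0 (Aser s (wc1 k)); have g2 := Cmod_ge_0 (Aser s (wc2 k)).
rewrite /w1 /w2 !Cmod_mult Cmod_R (Rabs_pos_eq (rfact k)); last lra.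
split; nra.
Qed.

Variables (M : R) (HM : exp (Cmod s) <= M) (Hw : Cmod s <= 5 * Cmod (1 - q)%C).
Let L := 5 * M.
Let M0 : 0 < M. Proof. have := exp_pos (Cmod s); lra. Qed.

Lemma w1_0_low : / 5 <= Cmod (w1 s 0).
Proof.
have h := f_equal Cmod w1_0; rewrite Cmod_mult in h.
have hs : 0 < Cmod s by apply/Cmod_gt_0.
apply: (Rmult_le_reg_l (Cmod s)) => //; rewrite h; lra.
Qed.

(** [conv3] bounds |[dd j]| by L (1 + the sum of the earlier |[dd i]|); such a recursion grows at
    most geometrically with ratio 1 + L. *)
Lemma dd_bound j : Cmod (dd j) <= L * (1 + L) ^ j.
Proof.
have hL : 0 < L by rewrite /L; lra.
elim/(well_founded_ind lt_wf): j => j IH.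
have hj : Cmod (dd j) <= L * (1 + match j with O => 0 | S k => sum_f_R0 (fun i => Cmod (dd i)) k end).
  have h := conv3 j; have [_ h2] := w_norm j.
  have hw0 : w1 s 0 <> 0.
    by move=> e; have := w1_0_low; rewrite e Cmod_0; lra.
  have fin (X : C) (B : R) : (X + w1 s 0 * dd j = w2 s j)%C -> Cmod X <= M * B -> Cmod (dd j) <= L * (1 + B).
    move=> e hX.
    have : Cmod (w1 s 0 * dd j)%C <= M + M * B.
      have -> : (w1 s 0 * dd j = w2 s j + - X)%C by rewrite -e; ring.
      apply: Rle_trans (Cmod_triangle _ _) _; rewrite Cmod_opp; lra.
    rewrite Cmod_mult; have := w1_0_low; have := Cmod_ge_0 (dd j); rewrite /L; nra.
  case: j IH h fin {h2} => [|j] IH h fin.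
    apply: (fin (RtoC 0)); last by rewrite Cmod_0; lra.
    by rewrite -h Csum_0 Cplus_0_l.
  apply: (fin (Csum (fun i => w1 s (S j - i) * dd i)%C j)).
    by rewrite -h Csum_S Nat.sub_diag.
  rewrite scal_sum -sum_n_Reals; apply: Csum_norm => k.
  rewrite Cmod_mult Rmult_comm; apply: Rmult_le_compat_l; first exact: Cmod_ge_0.
  have [h1 _] := w_norm (S j - k); lra.
apply: Rle_trans hj _; apply: Rmult_le_compat_l; first lra.
case: j IH => [|j] IH; first by rewrite /=; lra.
have key k : (k <= j)%nat -> sum_f_R0 (fun i => Cmod (dd i)) k <= (1 + L) ^ S k - 1.
  elim: k => [|k IHk] hk; first by have := IH 0%nat ltac:(lia); rewrite /=; lra.
  rewrite tech5; have := IHk ltac:(lia); have := IH (S k) ltac:(lia).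
  change ((1 + L) ^ S (S k)) with ((1 + L) * (1 + L) ^ S k); lra.
have := key j (le_n _); lra.
Qed.

(** Replacing each [sigma j q] by its singular part gives a Taylor polynomial of e^(al/s) - 1. The
    differences add up to at most e^(al (1 + L)), whatever N is; the rest is the tail of the
    exponential. *)
Lemma compare (al r : R) N : 0 < al -> Cmod (al / s)%C <= r ->
  Cmod (Csum (fun j => RtoC (al ^ S j * rfact (S j)) * sigma j q) N - (Cexp (al / s) - 1))%C
  <= exp (al * (1 + L)) + exptail (S N) r.
Proof.
move=> hal hr; have hL : 0 < L by rewrite /L; lra.
have e1 : Csum (fun j => RtoC (al ^ S j * rfact (S j)) * sigma j q)%C N =
  (Csum (fun j => RtoC (al ^ S j * rfact (S j)) * dd j) N + (Csum (expt (al / s)) (S N) - 1))%C.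
  have e0 : expt (al / s) 0 = 1 by rewrite /expt rfact_0 /=; ring.
  rewrite Csum_S_left e0.
  transitivity (Csum (fun j => RtoC (al ^ S j * rfact (S j)) * dd j + expt (al / s) (S j))%C N).
    apply: Csum_ext => j _; rewrite /dd /expt /ip /Cdiv Cpow_mult_l Cpow_inv // -RtoC_pow RtoC_mult.
    ring.
  rewrite Csum_plus; ring.
rewrite e1.
have -> : forall X Y Z : C, (X + (Y - 1) - (Z - 1) = X + - (Z - Y))%C by move=> X Y Z; ring.
apply: Rle_trans (Cmod_triangle _ _) _; rewrite Cmod_opp; apply: Rplus_le_compat; last exact: Cexp_tail.
apply: Rle_trans (Csum_norm _ (fun j => rfact (S j) * (al * (1 + L)) ^ S j) N _) _.
  move=> j; rewrite Cmod_mult Cmod_R Rabs_pos_eq; last first.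
    by apply: Rmult_le_pos; [apply: pow_le; lra|exact: Rlt_le (rfact_pos _)].
  have h := dd_bound j; have hp := rfact_pos (S j); have ha : 0 < al ^ S j by exact: pow_lt.
  rewrite Rpow_mult_distr.
  have h2 : L * (1 + L) ^ j <= (1 + L) ^ S j.
    have : 0 < (1 + L) ^ j by apply: pow_lt; lra.
    rewrite /=; nra.
  have -> : rfact (S j) * (al ^ S j * (1 + L) ^ S j) = al ^ S j * rfact (S j) * (1 + L) ^ S j by ring.
  apply: Rmult_le_compat_l; first nra. lra.
have hx : 0 < al * (1 + L) by apply: Rmult_lt_0_compat; lra.
apply: Rle_trans (sum_n_le_series _ _ (S N) _ (exp_series (al * (1 + L)))); last first.
  by move=> k; apply: Rmult_le_pos; [exact: Rlt_le (rfact_pos k)|apply: pow_le; lra].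
rewrite !sum_n_Reals [X in _ <= X]decomp_sum; last lia.
rewrite rfact_0 [pred _]/= pow_O; lra.
Qed.
End Compare.

Lemma sin_lower x : 0 <= x <= 2 -> x / 3 <= sin x.
Proof.
move=> hx; have [|h _] := SIN x (proj1 hx); first by have := PI2_3_2; lra.
apply: Rle_trans h.
(* [sin_lb] is the Taylor polynomial of degree 7, a lower bound for the sine on [0, pi]. *)
have -> : sin_lb x = x * (1 - x * x / 6 + x * x * (x * x) / 120 - x * x * (x * x) * (x * x) / 5040).
  have f (m : nat) (z : Z) : Z.of_nat (fact m) = z -> INR (fact m) = IZR z by move=> <-; exact: INR_IZR_INZ.
  rewrite /sin_lb /sin_approx /sin_term !tech5 [sum_f_R0 _ 0]/= -[(2 * 1 + 1)%nat]/3%nat -[(2 * 2 + 1)%nat]/5%nat -[(2 * 3 + 1)%nat]/7%nat.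
  rewrite (f 3%nat 6%Z) // (f 5%nat 120%Z) // (f 7%nat 5040%Z) //= ; field.
have h2 : 0 <= x * x <= 4 by nra.
move: (x * x) h2 => u h2.
have : / 3 <= 1 - u / 6 + u * u / 120 - u * u * u / 5040.
  have : 0 <= u * u * (42 - u) by nra.
  nra.
nra.
Qed.

(** With rho = e^(-t), |1 - e^(-s)|^2 = (1 - rho)^2 + 4 rho sin^2(v/2), and the two summands control
    t and v. The bound on u keeps s away from the zeros 2 pi i k with k nonzero. *)
Lemma one_minus_ee_low y u : 0 < y <= / 16 -> Rabs u <= / 2 ->
  Cmod (RtoC (2 * PI * y) - 2 * PI * Ci * u)%C <= 5 * Cmod (1 - Cexp (- (RtoC (2 * PI * y) - 2 * PI * Ci * u)))%C.
Proof.
move=> hy hu; have p4 := PI_4; have p3 := PI2_3_2; have p0 := PI_RGT_0.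
set t := 2 * PI * y; set v := 2 * PI * u.
have -> : (RtoC t - 2 * PI * Ci * u)%C = (t, - v).
  by apply: C_ext; rewrite !Creim; rewrite /Re /Im /= /v; ring.
have ht : 0 < t <= / 2 by rewrite /t; nra.
have hsin : (v / 2) * (v / 2) / 9 <= sin (v / 2) * sin (v / 2).
  have hv : v / 2 = PI * u by rewrite /v; field.
  have hs w : 0 <= w <= / 2 -> (PI * w) * (PI * w) / 9 <= sin (PI * w) * sin (PI * w).
    move=> hw; have := sin_lower (PI * w) ltac:(nra) => h.
    have : 0 <= PI * w / 3 by nra.
    nra.
  rewrite hv; case: (Rle_dec 0 u) => hu0.
    by apply: hs; rewrite Rabs_pos_eq in hu; lra.
  have := hs (- u); rewrite Rabs_left in hu; last lra.
  have -> : PI * - u = - (PI * u) by ring.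
  rewrite sin_antisym => h; have := h ltac:(lra); lra.
set rho := exp (- t).
have hr : / 2 <= rho.
  have := exp_ineq1_le (- t); rewrite /rho; lra.
have hr1 : t * rho <= 1 - rho.
  have h1 := exp_ineq1_le t; have h2 : exp t * rho = 1 by rewrite /rho -exp_plus Rplus_opp_r exp_0.
  have := exp_pos (- t); rewrite -/rho; nra.
have hc : cos v = 1 - 2 * (sin (v / 2) * sin (v / 2)).
  have -> : cos v = cos (2 * (v / 2)) by congr cos; field.
  rewrite cos_2a_sin; ring.
have e1 : Cexp (- (t, - v)) = (rho * cos v, rho * sin v).
  by rewrite /Cexp /Re /Im /= Ropp_involutive.
rewrite e1; set Z : C := (rho * cos v, rho * sin v).
have hsq : Cmod (t, - v) * Cmod (t, - v) <= 25 * (Cmod (1 - Z)%C * Cmod (1 - Z)%C).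
  have z1 : Re (1 - Z)%C = 1 - rho * cos v by rewrite !Creim.
  have z2 : Im (1 - Z)%C = - (rho * sin v) by rewrite !Creim /Z /Im /=; ring.
  have z3 : Re (t, - v) = t by []. have z4 : Im (t, - v) = - v by [].
  rewrite !Cmod_sqr z1 z2 z3 z4.
  have hcs := sin2_cos2 v; rewrite /Rsqr in hcs.
  have -> : (1 - rho * cos v) * (1 - rho * cos v) + - (rho * sin v) * - (rho * sin v) =
    1 - 2 * rho * cos v + rho * rho * (sin v * sin v + cos v * cos v) by ring.
  rewrite hcs hc.
  have h1 : t * t / 4 <= (1 - rho) * (1 - rho).
    have h : t / 2 <= 1 - rho by nra.
    have := Rmult_le_compat _ _ _ _ (ltac:(lra) : 0 <= t / 2) (ltac:(lra) : 0 <= t / 2) h h; lra.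
  have h2 : 2 * (v / 2 * (v / 2) / 9) <= 4 * rho * (sin (v / 2) * sin (v / 2)).
    have : 0 <= sin (v / 2) * sin (v / 2) by nra.
    nra.
  have : 0 <= v * v by nra. have : 0 <= t * t by nra.
  lra.
have g1 := Cmod_ge_0 (t, - v); have g2 := Cmod_ge_0 (1 - Z)%C.
apply: Rnot_lt_le => hlt; nra.
Qed.

(** (2 pi)^2 / 64, so that e^(al/s) = e(1/(64 tau)) for s = -2 pi i tau. *)
Definition al : R := PI * PI / 16.

(* As N grows, the coefficients of trunc N tend to pi / (4 sqrt n) I_1(pi sqrt n / 2). *)
Definition trunc (N : nat) (q : C) : C := Csum (fun j => RtoC (al ^ S j * rfact (S j)) * sigma j q)%C N.
Definition tcoef (N n : nat) : R := sum_f_R0 (fun j => al ^ S j * rfact (S j) * sg j n) N.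

Lemma trunc_rep N : rrep (tcoef N) (trunc N).
Proof.
apply: psrep_ext_b (psrep_Csum _ _ N (fun j => psrep_scal (RtoC (al ^ S j * rfact (S j))) _ _ (sigma_rep j))) _ => n.
rewrite /tcoef -Csum_RtoC; apply: Csum_ext => j _; by rewrite -RtoC_mult.
Qed.

Lemma al_pos : 0 < al.
Proof. rewrite /al; have := PI_RGT_0; nra. Qed.

(** The bound is uniform in N and tau apart from the tail, so N can tend to infinity afterwards for
    each coefficient separately. *)
Lemma trunc_near : exists K, forall N (tau : C), 0 < Im tau <= / 16 -> Rabs (Re tau) <= / 2 ->
  Cmod (trunc N (ee tau) - ee (1 / (64 * tau)))%C <= K + exptail (S N) (al / (2 * PI * Im tau)).
Proof.
have p0 := PI_RGT_0; have p4 := PI_4.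
(* 7 is a bound for |s| on the strip, and 5 is the constant of [one_minus_ee_low]. *)
exists (exp (al * (1 + 5 * exp 7)) + 1) => N tau hy hu.
set s := (RtoC (2 * PI * Im tau) - 2 * PI * Ci * Re tau)%C.
have es : s = (- (RtoC (2 * PI) * Ci * tau))%C.
  apply: C_ext; rewrite /s !Creim; rewrite /Re /Im /=; ring.
have hRe : Re s = 2 * PI * Im tau by rewrite /s !Creim; rewrite /Re /Im /=; ring.
have hs : 0 < Re s by rewrite hRe; nra.
have hm : Cmod s <= 7.
  rewrite /s; apply: Rle_trans (Cmod_triangle _ _) _; rewrite Cmod_opp.
  rewrite (Cmod_mult (2 * PI * Ci)) (Cmod_mult (2 * PI)) Cmod_Ci !Cmod_mult !Cmod_R (Rabs_pos_eq 2) ?(Rabs_pos_eq PI) ?(Rabs_pos_eq (2 * PI * _)); try nra.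
have hlow := one_minus_ee_low _ _ hy hu; rewrite -/s in hlow.
have hM : exp (Cmod s) <= exp 7.
  by case: hm => [h|->]; [apply: Rlt_le; exact: exp_increasing|exact: Rle_refl].
have s0 : s <> 0 by move=> e; move: hs; rewrite e re_RtoC; lra.
have hal := al_pos.
have hr : Cmod (RtoC al / s)%C <= al / (2 * PI * Im tau).
  rewrite Cmod_div // Cmod_R Rabs_pos_eq; last lra.
  apply: Rmult_le_compat_l; first lra.
  apply: Rinv_le_contravar; first nra.
  rewrite -hRe; apply: Rle_trans (Rle_abs _) (re_le_Cmod s).
have h := compare s hs (exp 7) hM hlow al _ N hal hr.
have e1 : Cexp (- s) = ee tau by rewrite es /ee; congr Cexp; ring.
have c64 := C64_neq0; have t0 : tau <> 0 by apply: Im_neq0; lra.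
have i0 : Ci <> 0 by move=> h0; have := f_equal Im h0; rewrite /Im /=; lra.
have e2 : Cexp (RtoC al / s)%C = ee (1 / (64 * tau))%C.
  rewrite /ee; congr Cexp; rewrite es.
  have c2 : RtoC (2 * PI) <> 0 by move=> [] hh; nra.
  have -> : RtoC al = (RtoC (2 * PI) * RtoC (2 * PI) / 64)%C.
    rewrite -RtoC_mult -RtoC_div; last lra. congr RtoC; rewrite /al; field.
  transitivity (- (1) * RtoC (2 * PI) / (Ci * (64 * tau)))%C; first by field.
  rewrite -Ci_sqr; by field.
rewrite e1 e2 -/(trunc N (ee tau)) in h.
have -> : (trunc N (ee tau) - ee (1 / (64 * tau)) = (trunc N (ee tau) - (ee (1 / (64 * tau)) - 1)) + - (1))%C by ring.
apply: Rle_trans (Cmod_triangle _ _) _; rewrite Cmod_opp Cmod_1; lra.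
Qed.

(** * The circle method *)

Lemma is_RInt_harmonic (d : C) (m : Z) : m <> 0%Z ->
  is_RInt (fun x => Re (d * ee (RtoC (IZR m * x)))%C) 0 1 0.
Proof.
move=> hm; have hm' : IZR m <> 0 by apply: not_0_IZR.
have p := PI_RGT_0; set w := 2 * PI * IZR m.
have hw : w <> 0 by rewrite /w; do 2 apply: Rmult_integral_contrapositive_currified => //; lra.
set F := fun x => (Re d * sin (w * x) + Im d * cos (w * x)) / w.
have e : minus (F 1) (F 0) = 0.
  rewrite /minus /plus /opp /=.
  rewrite /F !Rmult_1_r !Rmult_0_r sin_0 cos_0.
  have -> : sin w = 0 by apply: sin_eq_0_1; exists (2 * m)%Z; rewrite mult_IZR /w; ring.
  have -> : cos w = 1.
    have := ee_Z m; rewrite ee_R -/w => h; exact: (f_equal Re h).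
  field => //.
have h : is_RInt (fun x => Re d * cos (w * x) - Im d * sin (w * x)) 0 1 (minus (F 1) (F 0)).
  apply: is_RInt_derive => x _.
    rewrite /F; auto_derive => //; by field.
  apply: (ex_derive_continuous (V := R_NormedModule)); by auto_derive.
rewrite e in h; apply: is_RInt_ext h => x _.
rewrite ee_R; have -> : 2 * PI * (IZR m * x) = w * x by rewrite /w; ring.
by rewrite Re_mult /Re /Im /=.
Qed.

Lemma is_RInt_trig_poly (c : nat -> C) (om : C) (y : R) (n : nat) N :
  is_RInt (fun x => Re (om * Csum (fun k => c k * ee (RtoC x + Ci * RtoC y) ^ k) N * ee (RtoC (- INR n * x)))%C) 0 1
    (if Nat.leb n N then Re (om * c n)%C * exp (- (2 * PI * y)) ^ n else 0).
Proof.
have e1 x : ee (RtoC x + Ci * RtoC y)%C = (RtoC (exp (- (2 * PI * y))) * ee (RtoC x))%C.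
  rewrite ee_plus Cmult_comm; congr Cmult; rewrite /ee /Cexp.
  apply: C_ext; rewrite !Creim; rewrite /Re /Im /=.
    have -> : (2 * PI * 0 - 0 * 1) * (0 * y - 1 * 0) - ((2 * PI) * 1 + 0 * 0) * (0 * 0 + 1 * y) = - (2 * PI * y) by ring.
    have -> : (2 * PI * 0 - 0 * 1) * (0 * 0 + 1 * y) + (2 * PI * 1 + 0 * 0) * (0 * y - 1 * 0) = 0 by ring.
    by rewrite cos_0 Rmult_1_r.
  have -> : (2 * PI * 0 - 0 * 1) * (0 * 0 + 1 * y) + (2 * PI * 1 + 0 * 0) * (0 * y - 1 * 0) = 0 by ring.
  by rewrite sin_0 Rmult_0_r.
set r := exp (- (2 * PI * y)).
have e2 x k : (om * (c k * ee (RtoC x + Ci * RtoC y) ^ k) * ee (RtoC (- INR n * x)) =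
   om * c k * RtoC (r ^ k) * ee (RtoC (IZR (Z.of_nat k - Z.of_nat n) * x)))%C.
  rewrite e1 Cpow_mult_l -ee_pow RtoC_pow -/r minus_IZR -!INR_IZR_INZ.
  have -> : RtoC ((INR k - INR n) * x) = (RtoC (INR k) * RtoC x + RtoC (- INR n * x))%C.
    by rewrite -RtoC_mult -RtoC_plus; congr RtoC; ring.
  rewrite ee_plus; ring.
have e3 k : is_RInt (fun x => Re (om * (c k * ee (RtoC x + Ci * RtoC y) ^ k) * ee (RtoC (- INR n * x)))%C) 0 1
    (if Nat.eqb n k then Re (om * c n)%C * r ^ n else 0).
  case: (Nat.eqb_spec n k) => [<-|hk].
    have -> : Re (om * c n)%C * r ^ n = scal (1 - 0) (Re (om * c n)%C * r ^ n) by rewrite /scal /= /mult /=; ring.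
    apply: (is_RInt_ext (fun _ => Re (om * c n)%C * r ^ n)); last exact: is_RInt_const.
    by move=> x _; rewrite e2 Z.sub_diag Rmult_0_l ee_0 Cmult_1_r [RHS]Re_mult re_RtoC im_RtoC Rmult_0_r Rminus_0_r.
  apply: is_RInt_ext (is_RInt_harmonic (om * c k * RtoC (r ^ k)) (Z.of_nat k - Z.of_nat n) _); last lia.
  by move=> x _; rewrite e2.
elim: N => [|N IH].
  have := e3 0%nat; have -> : Nat.leb n 0 = Nat.eqb n 0 by case: n {e2 e3}.
  apply: is_RInt_ext => x _; by rewrite Csum_0.
have -> : (if Nat.leb n (S N) then Re (om * c n)%C * r ^ n else 0) =
  (if Nat.leb n N then Re (om * c n)%C * r ^ n else 0) + (if Nat.eqb n (S N) then Re (om * c n)%C * r ^ n else 0).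
  case: (Nat.leb_spec n (S N)); case: (Nat.leb_spec n N); case: (Nat.eqb_spec n (S N)); try lia; move=> *; ring.
apply: is_RInt_ext (is_RInt_plus _ _ _ _ _ _ IH (e3 (S N))) => x _.
have hplus (u v : R) : plus u v = u + v by [].
by rewrite hplus -Re_plus Csum_S; congr Re; ring.
Qed.

(** Cauchy's estimate with an integrable bound on the circle instead of a supremum. The partial sums
    approximate phi uniformly there, so only trigonometric polynomials are integrated exactly. *)
Lemma coef_bound (c : nat -> C) phi (y : R) (B : R -> R) n : psrep c phi -> 0 < y -> ex_RInt B 0 1 ->
  (forall x, 0 < x < 1 -> Cmod (phi (ee (RtoC x + Ci * RtoC y))) <= B x) ->
  Cmod (c n) * exp (- (2 * PI * y)) ^ n <= RInt B 0 1.
Proof.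
move=> hc hy hB hb; set r := exp (- (2 * PI * y)).
have p := PI_RGT_0.
have hr : 0 < r < 1.
  split; first exact: exp_pos.
  rewrite /r -exp_0; apply: exp_increasing; nra.
have [->|hcn] := classic (c n = 0).
  rewrite Cmod_0 Rmult_0_l; apply: RInt_ge_0 => //; first lra.
  move=> x hx; exact: Rle_trans (Cmod_ge_0 _) (hb x hx).
have hm : 0 < Cmod (c n) by apply/Cmod_gt_0.
(* This factor rotates the coefficient onto the positive axis, so that a real integral suffices. *)
set om := (RtoC (Cmod (c n)) / c n)%C.
have hom : Cmod om = 1.
  rewrite /om Cmod_div // Cmod_R Rabs_pos_eq; last lra. field; lra.
have hre : Re (om * c n)%C = Cmod (c n).
  have -> : (om * c n = RtoC (Cmod (c n)))%C by rewrite /om; field.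
  exact: re_RtoC.
apply: le_epsilon => eps heps.
have [K [q [hK [hq hbd]]]] := psrep_bound _ _ r hc ltac:(lra).
have [N0 hN0] : exists N0, forall N, (N0 <= N)%nat -> forall s, Cmod s = r -> Cmod (phi s - Csum (fun k => c k * s ^ k) N)%C <= eps.
  have hq1 : 0 < eps * (1 - q) by apply: Rmult_lt_0_compat; lra.
  have hK1 : 0 < K + 1 by lra.
  have [N0 h0] := pow_lt_1_zero q ltac:(rewrite Rabs_pos_eq; lra) (eps * (1 - q) / (K + 1)) ltac:(exact: Rdiv_lt_0_compat).
  exists N0 => N hN s hs.
  apply: Rle_trans (pser_tail _ _ r K q N hc ltac:(lra) hq hbd s ltac:(lra)) _.
  have h1 := h0 (S N) ltac:(lia); rewrite Rabs_pos_eq in h1; last by apply: pow_le; lra.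
  have h2 : 0 <= q ^ S N by apply: pow_le; lra.
  apply: (Rmult_le_reg_r (1 - q)); first lra.
  rewrite /Rdiv Rmult_assoc Rinv_l; last lra.
  have h3 : q ^ S N * (K + 1) < eps * (1 - q).
    have := Rmult_lt_compat_r _ _ _ hK1 h1; rewrite /Rdiv Rmult_assoc Rinv_l; lra.
  nra.
set N := max N0 n.
have hi := is_RInt_trig_poly c om y n N.
rewrite (proj2 (Nat.leb_le n N)) in hi; last by rewrite /N; lia.
rewrite hre -/r in hi.
have hi2 : is_RInt (fun x => B x + eps) 0 1 (RInt B 0 1 + eps).
  apply: is_RInt_plus; first exact: RInt_correct.
  have e : scal (1 - 0) eps = eps by rewrite /scal /= /mult /=; ring.
  have := is_RInt_const 0 1 eps; by rewrite e.
apply: (is_RInt_le _ _ 0 1 _ _ Rle_0_1 hi hi2) => x hx.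
apply: Rle_trans (Rle_abs _) _; apply: Rle_trans (re_le_Cmod _) _.
rewrite (Cmod_mult (om * _)) (Cmod_mult om) hom (Cmod_ee (RtoC _)) im_RtoC Rmult_0_r Ropp_0 exp_0 Rmult_1_r Rmult_1_l.
set s := ee (RtoC x + Ci * RtoC y)%C.
have hs : Cmod s = r.
  rewrite /s Cmod_ee /r; congr exp; rewrite !Creim; rewrite /Re /Im /=; ring.
have h1 := hN0 N ltac:(rewrite /N; lia) s hs; have h2 := hb x hx; rewrite -/s in h2.
have := Cmod_le_add (Csum (fun k => c k * s ^ k)%C N) (phi s); rewrite (Cmod_minus_sym _ (phi s)); lra.
Qed.

Lemma lorentz_int (e y : R) : 0 < y ->
  ex_RInt (fun x => / (1 + ((x - e) / y) ^ 2)) 0 1 /\ RInt (fun x => / (1 + ((x - e) / y) ^ 2)) 0 1 <= PI * y.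
Proof.
move=> hy.
have h : is_RInt (fun x => / (1 + ((x - e) / y) ^ 2)) 0 1 (y * atan ((1 - e) / y) - y * atan ((0 - e) / y)).
  apply: (is_RInt_derive (fun x => y * atan ((x - e) / y))) => x _.
    auto_derive => //; field; split; first lra.
    have := pow2_ge_0 (x - e); have := pow_lt y 2 hy => *; apply: Rgt_not_eq; lra.
  apply: (ex_derive_continuous (V := R_NormedModule)); auto_derive.
  have := pow2_ge_0 ((x - e) / y); rewrite /= => *; try split => //; apply: Rgt_not_eq; lra.
split; first by eexists; exact: h.
rewrite (is_RInt_unique _ _ _ _ h).
have [h1 h2] := atan_bound ((1 - e) / y); have [h3 h4] := atan_bound ((0 - e) / y); nra.
Qed.

(** The chord bound takes a Lorentzian s out of the exponent, where its integral can be evaluated by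
    an arctangent. *)
Lemma exp_convex A s : 0 <= s <= 1 -> exp (A * s) <= (1 - s) + s * exp A.
Proof.
move=> hs; have h1 := exp_ineq1_le (A - A * s); have h2 := exp_ineq1_le (- (A * s)).
have e1 : exp A = exp (A * s) * exp (A - A * s) by rewrite -exp_plus; congr exp; ring.
have e2 : 1 = exp (A * s) * exp (- (A * s)) by rewrite -exp_plus Rplus_opp_r exp_0.
have p := exp_pos (A * s).
have k1 : exp (A * s) * (1 + (A - A * s)) <= exp A by rewrite e1; apply: Rmult_le_compat_l; lra.
have k2 : exp (A * s) * (1 + - (A * s)) <= 1 by rewrite {2}e2; apply: Rmult_le_compat_l; lra.
have := Rmult_le_compat_l _ _ _ (proj1 hs) k1.
have := Rmult_le_compat_l (1 - s) _ _ ltac:(lra) k2; lra.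
Qed.

Lemma sum_ge_term (u : nat -> R) k n : (forall k, 0 <= u k) -> (k <= n)%nat -> u k <= sum_f_R0 u n.
Proof.
move=> h; elim: n => [|n IH] hk; first by have -> : k = 0%nat by [lia]; exact: Rle_refl.
rewrite tech5; have [->|e] := Nat.eq_dec k (S n); first by have := cond_pos_sum u n h; lra.
have := IH ltac:(lia); have := h (S n); lra.
Qed.

Lemma Im_neg_inv (z : C) : 0 < Im z -> Im (- (1) / (64 * z))%C = Im z / (64 * (Re z * Re z + Im z * Im z)).
Proof.
case: z => u y; rewrite /Im /Re /= => hy; field.
have : 0 < y * y by nra. have : 0 <= u * u by nra. move=> h1 h2.
split; apply: Rgt_not_eq; nra.
Qed.

Definition lorentz (y x : R) (d : nat) : R := / (1 + ((x - INR d / 16) / y) ^ 2).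
Lemma lorentz_01 y x d : 0 <= lorentz y x d <= 1.
Proof. rewrite /lorentz; apply: inv_le1; have := pow2_ge_0 ((x - INR d / 16) / y); lra. Qed.

Section Bound.
Variables (f : C -> C) (a : nat -> C) (H : data1 a f).
Let M : modular8 f. Proof. by case: H. Qed.

Lemma bounded_high phi : hol phi -> exists K, 0 <= K /\ forall z, 1 / 2 <= Im z -> Cmod (phi (ee (z / 64))) <= K.
Proof.
move=> h; have p := PI_RGT_0.
have [K [hK hb]] := hol_bounded phi (exp (- (PI / 64))) h (exp_neg_lt1 (PI / 64) ltac:(lra)).
exists K; split=> // z hz; apply: hb; exact: ee_64_bound.
Qed.

Lemma cusp_bounds : exists K, 0 <= K /\
  (forall i z, i <> Cinf -> 1 / 2 <= Im z -> Cmod (f (cuspmap i z)) <= K) /\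
  (forall z, 1 / 2 <= Im z -> Cmod (psum a (ee z)) <= K).
Proof.
have hc i : i <> Cinf -> exists K, 0 <= K /\ forall z, 1 / 2 <= Im z -> Cmod (f (cuspmap i z)) <= K.
  move=> hi; have [phi [hphi [_ e]]] := data1_cusp a f i 0 H hi.
  have [K [hK hb]] := bounded_high phi hphi; exists K; split=> // z hz.
  have := e z ltac:(lra); rewrite Cplus_0_r => ->; exact: hb.
have [K0 [h0 b0]] := hc C0 ltac:(by []); have [K2 [h2 b2]] := hc C2 ltac:(by []); have [K4 [h4 b4]] := hc C4 ltac:(by []).
have [K1 [h1 b1]] := bounded_high _ (hol_comp_pow 64 _ ltac:(lia) (data1_hol _ _ H)).
exists (K0 + K2 + K4 + K1); split; first lra; split.
  move=> i z hi hz; case: i hi => // _; [have := b0 z hz|have := b2 z hz|have := b4 z hz]; lra.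
move=> z hz; have := b1 z hz; have -> : (ee (z / 64) ^ 64 = ee z)%C; last by lra.
rewrite -ee_pow; congr ee; rewrite INR_C /=; field.
Qed.

(** Reduce tau to height 1/2. Cusps other than infinity contribute O(1). At infinity c = 8 c' and Im
    w = y / |p' - c tau|^2: c' = 0 is too low, |c'| = 1 is the subtracted pole at k/8, |c'| = 2
    gives the Lorentzians, and |c'| >= 3 gives Im w <= 1/(576 y). *)
Lemma main_bound : exists K, 0 <= K /\ forall y x (k : Z), 0 < y <= / 16 -> 0 <= x <= 1 -> Z.Odd k ->
  Rabs (x - IZR k / 8) <= / 8 ->
  Cmod (f (RtoC x + Ci * RtoC y)
    - RtoC (IZR (chi2 k)) * (ee (RtoC (IZR k) / 8) * ee (1 / (64 * (RtoC x + Ci * RtoC y - RtoC (IZR k) / 8)))))%C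
  <= K + exp (2 * PI / (576 * y)) + exp (2 * PI / (256 * y)) * sum_f_R0 (lorentz y x) 16.
Proof.
have [K [hK [hc hp]]] := cusp_bounds; have p := PI_RGT_0.
exists (2 * K + 1 + exp PI); split; first by have := exp_pos PI; lra.
move=> y x k hy hx hk hxk; set tau := (RtoC x + Ci * RtoC y)%C.
have ht : Im tau = y by rewrite /tau !Creim; rewrite /Im /Re /=; ring.
have hr : Re tau = x by rewrite /tau !Creim; rewrite /Im /Re /=; ring.
set del := (tau - RtoC (IZR k) / 8)%C.
have edel : del = (x - IZR k / 8, y).
  have -> : del = (tau + RtoC (- (IZR k / 8)))%C by rewrite /del RtoC_opp RtoC_div //; lra.
  by apply: C_ext; rewrite !Creim ?hr ?ht; rewrite /Im /Re /=; ring.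
have hd : 0 < Im del by rewrite edel /Im /=; lra.
have d0 := Im_neq0 _ hd; have c64 := C64_neq0.
set w' := (- (1) / (64 * del))%C.
have hw' : Im w' = y / ((IZR k - 8 * x) * (IZR k - 8 * x) + 64 * (y * y)).
  rewrite /w' Im_neg_inv // edel /Re /Im /=; congr Rdiv; field.
have yy : 0 < y * y by nra.
have hw0 : 0 < Im w'.
  rewrite hw'; apply: Rdiv_lt_0_compat; first lra.
  have := Rle_0_sqr (IZR k - 8 * x); rewrite /Rsqr; lra.
have hodd : Z.odd k = true by apply/Z.odd_spec.
have hchi : Cmod (RtoC (IZR (chi2 k))) = 1 by exact: Cmod_chi_odd.
have eL : (1 / (64 * del) = - w')%C by rewrite /w'; field.
have L0 : 0 <= exp (2 * PI / (256 * y)) * sum_f_R0 (lorentz y x) 16.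
  apply: Rmult_le_pos; first exact/Rlt_le/exp_pos.
  by apply: cond_pos_sum => d; case: (lorentz_01 y x d).
have E0 := exp_pos (2 * PI / (576 * y)).
(* [w'] is, up to a translation, the image of tau under the matrix attached to k/8. If it is high,
   the pole of f there is exactly the subtracted term; otherwise that term is at most e^pi. *)
case: (Rle_lt_dec (1 / 2) (Im w')) => hcase.
  have [m hm] := hk.
  have e := f_near8 f M k (m * (m + 1) / 2) w' _ hw0.
  have hkk : (k * k - 1 = 8 * (m * (m + 1) / 2))%Z.
    have [q [hq|hq]] : exists q, (m = 2 * q \/ m = 2 * q + 1)%Z by case: (Z.Even_or_Odd m) => -[q ->]; exists q; [left|right].
      have -> : (m * (m + 1) = q * (m + 1) * 2)%Z by rewrite hq; ring.
      rewrite Z.div_mul // hm hq; ring.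
    have -> : (m * (m + 1) = m * (q + 1) * 2)%Z by rewrite {2}hq; ring.
    rewrite Z.div_mul // hm hq; ring.
  have {}e := e hkk.
  have et : (- (1) / (64 * w') + RtoC (IZR k) / 8 = tau)%C.
    have -> : (- (1) / (64 * w') = del)%C by rewrite /w'; by field.
    rewrite /del; ring.
  rewrite et in e; rewrite e.
  have hz : Im (w' + RtoC (IZR (- k)) / 8)%C = Im w' by exact: Im_plus_div8.
  rewrite (data1_exp a f H) ?hz // eL.
  have -> : ee (- (w' + RtoC (IZR (- k)) / 8))%C = (ee (RtoC (IZR k) / 8) * ee (- w'))%C.
    rewrite -ee_plus; congr ee; rewrite opp_IZR RtoC_opp; field.
  have -> : forall u v r : C, (r * (u + v) - r * u = r * v)%C by move=> u v r; ring.
  rewrite Cmod_mult hchi Rmult_1_l; have := hp (w' + RtoC (IZR (- k)) / 8)%C ltac:(rewrite hz; lra).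
  have := exp_pos PI; lra.
have hmain : Cmod (RtoC (IZR (chi2 k)) * (ee (RtoC (IZR k) / 8) * ee (1 / (64 * del))))%C <= exp PI.
  rewrite Cmod_mult hchi Rmult_1_l Cmod_mult eL !Cmod_ee Im_opp.
  have -> : Im (RtoC (IZR k) / 8)%C = 0 by rewrite -RtoC_div ?im_RtoC //; lra.
  rewrite Rmult_0_r Ropp_0 exp_0 Rmult_1_l; apply: exp_le; nra.
suff hf : Cmod (f tau) <= 2 * K + 1 + exp (2 * PI / (576 * y)) + exp (2 * PI / (256 * y)) * sum_f_R0 (lorentz y x) 16.
  apply: Rle_trans (Cmod_triangle _ _) _; rewrite Cmod_opp; lra.
have [p' [b [c [d [i [w [hdet [h8 [hw et]]]]]]]]] := cusp_reduction tau ltac:(rewrite ht; lra).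
have hcw : 0 < Im (cuspmap i w) by apply: cuspmap_H; lra.
have hfe : Cmod (f tau) = Cmod (f (cuspmap i w)).
  rewrite et M // Cmod_mult Cmod_chi_odd ?Rmult_1_l //; exact: (det8_odd p' b c d).
rewrite hfe.
case ei : i; try (have := hc i w ltac:(by rewrite ei) hw; rewrite ei; lra).
rewrite ei /cuspmap in et hcw *.
have hwf : Cmod (f w) <= exp (2 * PI * Im w) + K.
  rewrite (data1_exp a f H) //; apply: Rle_trans (Cmod_triangle _ _) _.
  rewrite Cmod_ee Im_opp; have -> : - (2 * PI * - Im w) = 2 * PI * Im w by ring.
  have := hp w hw; lra.
apply: Rle_trans hwf _.
have ew : moebius d (- b) (- c) p' tau = w by rewrite et; exact: moebius_inv.
have hIm : Im w * ((IZR p' - IZR c * x) * (IZR p' - IZR c * x) + IZR c * IZR c * (y * y)) = y.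
  have hdet' : (d * p' - - b * - c = 1)%Z by lia.
  have hn := den_neq0 _ _ tau (det_cd _ _ _ _ hdet') ltac:(rewrite ht; lra).
  have := moebius_Im d (- b) (- c) p' tau hdet' ltac:(rewrite ht; lra).
  rewrite ew Cmod_sqr opp_IZR.
  have -> : Re (RtoC (- IZR c) * tau + RtoC (IZR p'))%C = IZR p' - IZR c * x by rewrite Re_plus Re_mult !re_RtoC im_RtoC hr; ring.
  have -> : Im (RtoC (- IZR c) * tau + RtoC (IZR p'))%C = - (IZR c * y) by rewrite Im_plus Im_mult !re_RtoC !im_RtoC ht; ring.
  rewrite ht => ->.
  have : 0 < (IZR p' - IZR c * x) * (IZR p' - IZR c * x) + - (IZR c * y) * - (IZR c * y).
    have h := Cmod_gt_0 (RtoC (IZR (- c)) * tau + RtoC (IZR p'))%C; have := proj1 h hn => h'.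
    have := Rmult_lt_0_compat _ _ h' h'; rewrite Cmod_sqr opp_IZR.
    by rewrite Re_plus Im_plus Re_mult Im_mult !re_RtoC !im_RtoC hr ht => hh; apply: Rlt_le_trans hh _; apply: Req_le; ring.
  move=> hpos; have -> : IZR c * IZR c * (y * y) = - (IZR c * y) * - (IZR c * y) by ring.
  field; lra.
have [c' hc'] := h8.
have odp : Z.odd p' = true by apply: (det8_odd d b c p') => //; lia.
have contra (D : R) : Im w * D = y -> 1 <= D -> False.
  move=> h1 h2; have : 1 / 2 * 1 <= Im w * D by apply: Rmult_le_compat; lra.
  lra.
have absform (m : Z) : (c = m \/ c = - m)%Z -> exists e : Z, Z.odd e = true /\
    Im w * ((IZR e - IZR m * x) * (IZR e - IZR m * x) + IZR m * IZR m * (y * y)) = y.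
  case=> hcm; [exists p'|exists (- p')%Z]; split=> //.
  - by rewrite -hcm.
  - by rewrite Z.odd_opp.
  - rewrite -[RHS]hIm hcm !opp_IZR; ring.
have hsq0 := Rle_0_sqr (IZR p' - IZR c * x); rewrite /Rsqr in hsq0.
case: (Z.eq_dec c' 0) => hc0.
  exfalso; apply: (contra _ hIm); have -> : c = 0%Z by lia.
  have : (1 <= p' * p')%Z by have : p' <> 0%Z by [move=> e0; rewrite e0 in odp]; nia.
  move/IZR_le; rewrite mult_IZR; lra.
(* Here e is odd with |e - 8 x| < 1, hence |e - k| < 2 and e = k. Then Im w = Im w', against the
   case assumption. *)
case: (Z.eq_dec (Z.abs c') 1) => hc1.
  have [e [oe he]] := absform 8%Z ltac:(lia).
  have hlt : Rabs (IZR e - 8 * x) < 1.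
    apply: Rnot_le_lt => hge; apply: (contra _ he).
    have : 1 <= (IZR e - 8 * x) * (IZR e - 8 * x).
      by have := Rsqr_abs (IZR e - 8 * x); rewrite /Rsqr => ->; nra.
    nra.
  have eek : e = k.
    have h1 : -2 < IZR e - IZR k < 2.
      move: hlt hxk => /Rabs_lt_between h1 /Rabs_le_between h2; lra.
    have h2 : (-2 < e - k < 2)%Z by split; apply: lt_IZR; rewrite minus_IZR; lra.
    move/Z.odd_spec: oe => [u hu]; have [v hv] := hk; lia.
  exfalso; rewrite eek in he.
  have hD : 0 < (IZR k - 8 * x) * (IZR k - 8 * x) + 64 * (y * y) by nra.
  have : Im w = Im w'.
    rewrite hw' -{1}he; field; lra.
  lra.
(* Now 2 pi Im w is 2 pi / (256 y) times the Lorentzian centred at e/16. *)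
case: (Z.eq_dec (Z.abs c') 2) => hc2.
  have [e [oe he]] := absform 16%Z ltac:(lia).
  have hlt : Rabs (IZR e - 16 * x) < 1.
    apply: Rnot_le_lt => hge; apply: (contra _ he).
    have : 1 <= (IZR e - 16 * x) * (IZR e - 16 * x).
      by have := Rsqr_abs (IZR e - 16 * x); rewrite /Rsqr => ->; nra.
    nra.
  have he16 : (0 <= e <= 16)%Z.
    move/Rabs_lt_between: hlt => hlt.
    have h1 : (-1 < e < 17)%Z by split; apply: lt_IZR; lra.
    lia.
  have hwL : 2 * PI * Im w = 2 * PI / (256 * y) * lorentz y x (Z.to_nat e).
    rewrite /lorentz INR_IZR_INZ Z2Nat.id; last lia.
    have hD : 0 < (IZR e - 16 * x) * (IZR e - 16 * x) + 16 * 16 * (y * y) by nra.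
    have hs2 := pow2_ge_0 (x - IZR e / 16).
    have -> : Im w = y / ((IZR e - 16 * x) * (IZR e - 16 * x) + 16 * 16 * (y * y)).
      by rewrite -{1}he; field; lra.
    field; repeat split; try lra; apply: Rgt_not_eq; nra.
  rewrite hwL.
  have [l0 l1] := lorentz_01 y x (Z.to_nat e).
  have h1 := exp_convex (2 * PI / (256 * y)) _ (conj l0 l1).
  have h2 : lorentz y x (Z.to_nat e) <= sum_f_R0 (lorentz y x) 16.
    by apply: sum_ge_term; [move=> d'; case: (lorentz_01 y x d')|lia].
  have := Rmult_le_compat_l _ _ _ (Rlt_le _ _ (exp_pos (2 * PI / (256 * y)))) h2; lra.
(* 576 is the square of 24, the next possible modulus of c. *)
have hcc : 576 <= IZR c * IZR c.
  have : (576 <= c * c)%Z by nia.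
  by move/IZR_le; rewrite mult_IZR.
have hle : Im w * (576 * y) <= 1.
  apply: (Rmult_le_reg_r y); first lra.
  have : Im w * (576 * (y * y)) <= y.
    rewrite -[X in _ <= X]hIm; apply: Rmult_le_compat_l; first lra. nra.
  lra.
have : exp (2 * PI * Im w) <= exp (2 * PI / (576 * y)).
  apply: exp_le; rewrite /Rdiv; apply: Rmult_le_compat_l; first lra.
  apply: (Rmult_le_reg_r (576 * y)); first lra.
  rewrite Rinv_l; lra.
lra.
Qed.
End Bound.

(** * Asymptotics of the coefficients of f_1 *)

Definition main1 (n : nat) : R :=
  PI / sqrt (INR n) * sin (PI * (INR n - 1) / 2) * sin (PI * (INR n - 1) / 4) * BesselI 1 (PI * sqrt (INR n) / 2).

Lemma bessel_series x : is_series (fun k => (x / 2) ^ (2 * k + 1) / (INR (fact k) * INR (fact (k + 1)))) (BesselI 1 x).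
Proof.
apply: Series_correct.
apply: (ex_series_le _ (fun k => Rabs (x / 2) * (rfact k * (x / 2 * (x / 2)) ^ k))); last first.
  apply: ex_series_scal_l; eexists; exact: exp_series.
move=> k; have p := rfact_pos k; have p1 := rfact_pos (k + 1); have l := rfact_le1 (k + 1).
have -> : (x / 2) ^ (2 * k + 1) / (INR (fact k) * INR (fact (k + 1))) =
   x / 2 * (rfact k * (x / 2 * (x / 2)) ^ k) * rfact (k + 1).
  rewrite pow_add pow_mult /rfact.
  have -> : (x / 2) ^ 2 = x / 2 * (x / 2) by ring.
  field; split; exact: INR_fact_neq_0.
rewrite /norm /= /abs /= (Rabs_mult (x / 2 * _)) (Rabs_mult (x / 2)) (Rabs_mult (rfact k)) (Rabs_pos_eq (rfact k)); last lra.
rewrite (Rabs_pos_eq (rfact (k + 1))); last lra.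
have h : 0 <= (x / 2 * (x / 2)) ^ k by apply: pow_le; nra.
rewrite (Rabs_pos_eq (_ ^ k)) //.
have : 0 <= Rabs (x / 2) * (rfact k * (x / 2 * (x / 2)) ^ k).
  apply: Rmult_le_pos; first exact: Rabs_pos. apply: Rmult_le_pos; lra.
nra.
Qed.

(** For x = pi sqrt n / 2 one has (x/2)^2 = [al] n, so the summands of [tcoef] are those of the
    Bessel series up to the factor pi / (4 sqrt n). *)
Lemma tcoef_lim n : (1 <= n)%nat ->
  is_lim_seq (fun N => tcoef N n) (PI / (4 * sqrt (INR n)) * BesselI 1 (PI * sqrt (INR n) / 2)).
Proof.
move=> hn; have hN : 0 < INR n by apply: lt_0_INR; lia.
have hs : 0 < sqrt (INR n) by exact: sqrt_lt_R0.
have hss : sqrt (INR n) * sqrt (INR n) = INR n by apply: sqrt_sqrt; lra.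
have h0 : is_lim_seq (sum_n _) (Finite _) := bessel_series (PI * sqrt (INR n) / 2).
have h := is_lim_seq_scal_l _ (PI / (4 * sqrt (INR n))) _ h0.
apply: is_lim_seq_ext h => N; rewrite /tcoef sum_n_Reals scal_sum; apply: sum_eq => j _.
rewrite /sg pow_add pow_mult /rfact.
have -> : (PI * sqrt (INR n) / 2 / 2) ^ 2 = al * INR n.
  transitivity (al * (sqrt (INR n) * sqrt (INR n))); [rewrite /al; field|by rewrite hss].
have -> : (j + 1 = S j)%nat by lia.
rewrite Rpow_mult_distr /al.
have -> : (PI * PI / 16) ^ S j = PI * PI / 16 * (PI * PI / 16) ^ j by [].
field; repeat split; try exact: INR_fact_neq_0; lra.
Qed.

Definition chk (k : Z) : C := (RtoC (IZR (chi2 k)) * ee (RtoC (IZR k) / 8))%C.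

(** The Gauss sum of chi2 at n - 1 in trigonometric form: the terms k and 8 - k are conjugate, and
    cos t - cos 3t is a product of sines. This is the origin of the sines in the main term. *)
Lemma chk_trig n : (chk 1 * ee (RtoC (IZR (-1)) / 8) ^ n + chk 3 * ee (RtoC (IZR (-3)) / 8) ^ n
  + chk 5 * ee (RtoC (IZR (-5)) / 8) ^ n + chk 7 * ee (RtoC (IZR (-7)) / 8) ^ n)%C
  = RtoC (4 * (sin (PI * (INR n - 1) / 2) * sin (PI * (INR n - 1) / 4))).
Proof.
set t := PI * (INR n - 1) / 4.
have e (k : Z) : (ee (RtoC (IZR k) / 8) * ee (RtoC (IZR (- k)) / 8) ^ n)%C = (cos (IZR k * t), - sin (IZR k * t)).
  rewrite -ee_pow -ee_plus opp_IZR.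
  have -> : (RtoC (IZR k) / 8 + RtoC (INR n) * (RtoC (- IZR k) / 8))%C = RtoC (- (IZR k * (INR n - 1) / 8)).
    by apply: C_ext; rewrite /Re /Im /=; field.
  rewrite ee_R; have -> : 2 * PI * - (IZR k * (INR n - 1) / 8) = - (IZR k * t) by rewrite /t; field.
  by rewrite cos_neg sin_neg.
have per (k : Z) : cos (IZR (8 - k) * t) = cos (IZR k * t) /\ sin (IZR (8 - k) * t) = - sin (IZR k * t).
  have e8 : ee (RtoC (INR n - 1)) = 1.
    have -> : RtoC (INR n - 1) = (RtoC (INR n) + RtoC (IZR (-1)))%C by rewrite -RtoC_plus; congr RtoC; ring.
    by rewrite ee_plus_Z ee_nat.
  rewrite ee_R in e8; have hc := f_equal Re e8; have hs := f_equal Im e8; rewrite /Re /Im /= in hc hs.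
  have -> : IZR (8 - k) * t = 2 * PI * (INR n - 1) - IZR k * t by rewrite minus_IZR /t; field.
  rewrite cos_minus sin_minus hc hs; split; ring.
have [c5 s5] := per 3%Z; have [c7 s7] := per 1%Z.
rewrite /chk !chi2_vals -!Cmult_assoc (e 1%Z) (e 3%Z) (e 5%Z) (e 7%Z).
have i5 : IZR (8 - 3) = 5 by []. have i7 : IZR (8 - 1) = 7 by [].
rewrite i5 in c5 s5; rewrite i7 in c7 s7; rewrite c5 s5 c7 s7.
have -> : PI * (INR n - 1) / 2 = 2 * t by rewrite /t; field.
have hp : cos (1 * t) - cos (3 * t) = 2 * (sin (2 * t) * sin t).
  have -> : 1 * t = 2 * t - t by ring. have -> : 3 * t = 2 * t + t by ring.
  rewrite cos_minus cos_plus; ring.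
apply: C_ext; rewrite !Creim; rewrite /Re /Im /=; lra.
Qed.

Section Asymptotics.
Variables (f : C -> C) (a : nat -> C) (H : data1 a f).

Definition herr (N n : nat) : C := (a n - RtoC (tcoef N n) * RtoC (4 * (sin (PI * (INR n - 1) / 2) * sin (PI * (INR n - 1) / 4))))%C.
Definition hfun (N : nat) (q : C) : C := (psum a q + - (1) * (chk 1 * trunc N (ee (RtoC (IZR (-1)) / 8) * q)
  + chk 3 * trunc N (ee (RtoC (IZR (-3)) / 8) * q) + chk 5 * trunc N (ee (RtoC (IZR (-5)) / 8) * q)
  + chk 7 * trunc N (ee (RtoC (IZR (-7)) / 8) * q)))%C.

Lemma hfun_rep N : psrep (herr N) (hfun N).
Proof.
have hr (k : Z) : Cmod (ee (RtoC (IZR k) / 8)) <= 1.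
  by rewrite -RtoC_div ?Cmod_ee ?im_RtoC ?Rmult_0_r ?Ropp_0 ?exp_0; lra.
have ht (k : Z) := psrep_scal (chk (- k)) _ _ (psrep_rot _ _ _ (hr k) (trunc_rep N)).
have hps : psrep a (psum a) by case: H => _ [_ []].
apply: psrep_ext_b (psrep_plus _ _ _ _ hps (psrep_scal (- (1))%C _ _ (psrep_plus _ _ _ _ (psrep_plus _ _ _ _
  (psrep_plus _ _ _ _ (ht (-1)%Z) (ht (-3)%Z)) (ht (-5)%Z)) (ht (-7)%Z)))) _ => n.
rewrite /herr -chk_trig; cbn [Z.opp]; ring.
Qed.

(** Only the point k/8 nearest to x matters; there [main_bound] and [trunc_near] have the same
    singular term. At the other three points the distance modulo 1 is at least 1/8 and the
    comparison functions stay bounded. *)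
Lemma hfun_bound : exists K, 0 <= K /\ forall N y x, 0 < y <= / 16 -> 0 < x < 1 ->
  Cmod (hfun N (ee (RtoC x + Ci * RtoC y))) <= K + 4 * exptail (S N) (al / (2 * PI * y))
    + exp (2 * PI / (576 * y)) + exp (2 * PI / (256 * y)) * sum_f_R0 (lorentz y x) 16.
Proof.
have [K1 [hK1 h1]] := main_bound f a H; have [K2 h2] := trunc_near.
have p := PI_RGT_0; have p4 := PI_4.
exists (K1 + 4 * Rabs K2 + 4 * exp 1); split.
  have := Rabs_pos K2; have := exp_pos 1; lra.
move=> N y x hy hx; set tau := (RtoC x + Ci * RtoC y)%C; set tl := exptail _ _.
have ht : Im tau = y by rewrite /tau !Creim; rewrite /Im /Re /=; ring.
have hr : Re tau = x by rewrite /tau !Creim; rewrite /Im /Re /=; ring.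
have K2a := Rle_abs K2.
have hodd k : In k (1 :: 3 :: 5 :: 7 :: nil)%Z -> Cmod (chk k) = 1.
  move=> hk; rewrite /chk Cmod_mult -RtoC_div; last lra.
  rewrite Cmod_ee im_RtoC Rmult_0_r Ropp_0 exp_0 Rmult_1_r; apply: Cmod_chi_odd.
  by case: hk => [<-|[<-|[<-|[<-|[]]]]].
have eq k : (ee (RtoC (IZR (- k)) / 8) * ee tau)%C = ee (tau - RtoC (IZR k) / 8)%C.
  rewrite -ee_plus; congr ee; rewrite opp_IZR RtoC_opp; field.
have him k : Im (tau - RtoC (IZR k) / 8)%C = y.
  have -> : (tau - RtoC (IZR k) / 8 = tau + RtoC (IZR (- k)) / 8)%C by rewrite opp_IZR RtoC_opp; field.
  by rewrite Im_plus_div8.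
have hre k : Re (tau - RtoC (IZR k) / 8)%C = x - IZR k / 8.
  have -> : (tau - RtoC (IZR k) / 8 = tau + RtoC (- (IZR k / 8)))%C by rewrite RtoC_opp RtoC_div //; lra.
  by rewrite Re_plus re_RtoC hr.
have far k : In k (1 :: 3 :: 5 :: 7 :: nil)%Z -> / 8 <= Rabs (x - IZR k / 8) <= 7 / 8 ->
   Cmod (chk k * trunc N (ee (RtoC (IZR (- k)) / 8) * ee tau))%C <= exp 1 + Rabs K2 + tl.
  move=> hk hv; rewrite Cmod_mult hodd // Rmult_1_l eq.
  (* An integer translation brings the real part into [-1/2, 1/2], as [trunc_near] asks, and keeps
     it at distance at least 1/8 from 0. *)
  have [m hm] : exists m : Z, / 8 <= Rabs (x - IZR k / 8 + IZR m) <= / 2.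
    case: (Rle_dec (Rabs (x - IZR k / 8)) (/ 2)) => hd; first by exists 0%Z; rewrite Rplus_0_r; lra.
    case: (Rle_dec 0 (x - IZR k / 8)) => hsgn; [exists (-1)%Z|exists 1%Z].
      rewrite Rabs_pos_eq in hv hd; try lra. rewrite Rabs_left; lra.
    rewrite Rabs_left in hv hd; try lra. rewrite Rabs_pos_eq; lra.
  set z := (tau - RtoC (IZR k) / 8 + RtoC (IZR m))%C.
  have ez : ee (tau - RtoC (IZR k) / 8)%C = ee z by rewrite /z ee_plus_Z.
  have zi : Im z = y by rewrite /z Im_plus_Z him.
  have zr : Re z = x - IZR k / 8 + IZR m by rewrite /z Re_plus re_RtoC hre.
  have hz0 : 0 < Im z by rewrite zi; lra.
  have hn := h2 N z ltac:(by rewrite zi) ltac:(rewrite zr; lra); rewrite zi -/tl in hn.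
  rewrite ez; have := Cmod_le_add (trunc N (ee z)) (ee (1 / (64 * z))%C).
  have : Cmod (ee (1 / (64 * z))%C) <= exp 1; last by lra.
  have z0 := Im_neq0 z hz0; have c64 := C64_neq0.
  have -> : (1 / (64 * z) = - (- (1) / (64 * z)))%C by field.
  rewrite Cmod_ee Im_opp Im_neg_inv // zi; apply: exp_le.
  have hD : / 64 <= Re z * Re z + y * y.
    have : / 8 * / 8 <= Rabs (Re z) * Rabs (Re z) by rewrite zr; apply: Rmult_le_compat; lra.
    have := Rsqr_abs (Re z); rewrite /Rsqr => ->; nra.
  have hq : y / (64 * (Re z * Re z + y * y)) <= y.
    apply: (Rmult_le_reg_r (64 * (Re z * Re z + y * y))); first lra.
    rewrite /Rdiv Rmult_assoc Rinv_l; last lra. nra.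
  have : 2 * PI * (y / (64 * (Re z * Re z + y * y))) <= 2 * PI * y by apply: Rmult_le_compat_l; lra.
  have : PI * y <= 4 * / 16 by apply: Rmult_le_compat; lra.
  lra.
have near k : In k (1 :: 3 :: 5 :: 7 :: nil)%Z -> Rabs (x - IZR k / 8) <= / 8 ->
   Cmod (f tau - chk k * trunc N (ee (RtoC (IZR (- k)) / 8) * ee tau))%C <=
    K1 + exp (2 * PI / (576 * y)) + exp (2 * PI / (256 * y)) * sum_f_R0 (lorentz y x) 16 + Rabs K2 + tl.
  move=> hk hv; rewrite eq.
  have hko : Z.Odd k by apply/Z.odd_spec; case: hk => [<-|[<-|[<-|[<-|[]]]]].
  have g1 := h1 y x k hy ltac:(lra) hko hv; rewrite -/tau in g1.
  have g2 := h2 N (tau - RtoC (IZR k) / 8)%C ltac:(by rewrite him) ltac:(rewrite hre; lra).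
  rewrite him -/tl in g2.
  have -> : (f tau - chk k * trunc N (ee (tau - RtoC (IZR k) / 8)) =
    (f tau - RtoC (IZR (chi2 k)) * (ee (RtoC (IZR k) / 8) * ee (1 / (64 * (tau - RtoC (IZR k) / 8)))))
    + - (chk k * (trunc N (ee (tau - RtoC (IZR k) / 8)) - ee (1 / (64 * (tau - RtoC (IZR k) / 8))))))%C.
    rewrite /chk; ring.
  apply: Rle_trans (Cmod_triangle _ _) _; rewrite Cmod_opp (Cmod_mult (chk k)) hodd // Rmult_1_l; lra.
have hf : psum a (ee tau) = (f tau + - ee (- tau))%C by rewrite (data1_exp a f H) ?ht; [ring|lra].
have hee : Cmod (ee (- tau)) <= exp 1.
  rewrite Cmod_ee Im_opp ht; apply: exp_le.
  have : PI * y <= 4 * / 16 by apply: Rmult_le_compat; lra.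
  lra.
have tri (F T1 T2 T3 T4 E : C) : Cmod (F + - E + - (1) * (T1 + T2 + T3 + T4))%C <= Cmod (F - T1)%C + Cmod T2 + Cmod T3 + Cmod T4 + Cmod E.
  have -> : (F + - E + - (1) * (T1 + T2 + T3 + T4) = (F - T1) + - T2 + - T3 + - T4 + - E)%C by ring.
  do 4 (apply: Rle_trans (Cmod_triangle _ _) _; rewrite Cmod_opp; apply: Rplus_le_compat_r).
  exact: Rle_refl.
rewrite /hfun hf.
have f1 := far 1%Z ltac:(by left); have f3 := far 3%Z ltac:(by right; left).
have f5 := far 5%Z ltac:(by do 2 right; left); have f7 := far 7%Z ltac:(by do 3 right; left).
have n1 := near 1%Z ltac:(by left); have n3 := near 3%Z ltac:(by right; left).
have n5 := near 5%Z ltac:(by do 2 right; left); have n7 := near 7%Z ltac:(by do 3 right; left).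
cbn [Z.opp] in f1, f3, f5, f7, n1, n3, n5, n7.
move: f1 f3 f5 f7 n1 n3 n5 n7.
set T1 := (chk 1 * _)%C. set T3 := (chk 3 * _)%C. set T5 := (chk 5 * _)%C. set T7 := (chk 7 * _)%C.
move=> f1 f3 f5 f7 n1 n3 n5 n7.
have ab (c : R) : / 8 <= c <= 7 / 8 \/ - (7 / 8) <= c <= - / 8 -> / 8 <= Rabs c <= 7 / 8.
  by case=> h; [rewrite Rabs_pos_eq; lra|rewrite Rabs_left; lra].
have ab' (c : R) : - / 8 <= c <= / 8 -> Rabs c <= / 8 by move=> h; apply/Rabs_le_between; lra.
case: (Rle_dec x (2 / 8)) => x2.
  have := n1 ltac:(apply: ab'; lra); have := f3 ltac:(apply: ab; lra); have := f5 ltac:(apply: ab; lra); have := f7 ltac:(apply: ab; lra).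
  have := tri (f tau) T1 T3 T5 T7 (ee (- tau)); lra.
case: (Rle_dec x (4 / 8)) => x4.
  have := n3 ltac:(apply: ab'; lra); have := f1 ltac:(apply: ab; lra); have := f5 ltac:(apply: ab; lra); have := f7 ltac:(apply: ab; lra).
  have := tri (f tau) T3 T1 T5 T7 (ee (- tau)); rewrite (Cplus_comm T3 T1); lra.
case: (Rle_dec x (6 / 8)) => x6.
  have := n5 ltac:(apply: ab'; lra); have := f1 ltac:(apply: ab; lra); have := f3 ltac:(apply: ab; lra); have := f7 ltac:(apply: ab; lra).
  have := tri (f tau) T5 T1 T3 T7 (ee (- tau)).
  have -> : (T5 + T1 + T3 + T7 = T1 + T3 + T5 + T7)%C by [ring]; lra.
have := n7 ltac:(apply: ab'; lra); have := f1 ltac:(apply: ab; lra); have := f3 ltac:(apply: ab; lra); have := f5 ltac:(apply: ab; lra).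
have := tri (f tau) T7 T1 T3 T5 (ee (- tau)).
have -> : (T7 + T1 + T3 + T5 = T1 + T3 + T5 + T7)%C by [ring]; lra.
Qed.

Lemma lorentz_sum_int (y : R) m : 0 < y ->
  ex_RInt (fun x => sum_f_R0 (lorentz y x) m) 0 1 /\ RInt (fun x => sum_f_R0 (lorentz y x) m) 0 1 <= INR (S m) * (PI * y).
Proof.
move=> hy; elim: m => [|m [IH1 IH2]].
  have [h1 h2] := lorentz_int (INR 0 / 16) y hy; split=> //.
  by have -> : INR 1 * (PI * y) = PI * y by rewrite /=; ring.
have [h1 h2] := lorentz_int (INR (S m) / 16) y hy.
split; first exact: ex_RInt_plus IH1 h1.
have hplus (u v : R) : plus u v = u + v by [].
rewrite (RInt_plus _ _ _ _ IH1 h1) hplus (S_INR (S m)) Rmult_plus_distr_r Rmult_1_l.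
exact: Rplus_le_compat IH2 h2.
Qed.

(** 17 is the number of points d/16 in [0, 1], and each Lorentzian has integral at most pi y = pi /
    (16 sqrt n). *)
Lemma coef_asymp : exists K, 0 <= K /\ forall n, (1 <= n)%nat ->
  Cmod (a n - RtoC (main1 n))%C <= exp (PI * sqrt (INR n) / 8) *
   (K + exp (PI * sqrt (INR n) / 18) + 17 * PI / (16 * sqrt (INR n)) * exp (PI * sqrt (INR n) / 8)).
Proof.
have [K [hK hb]] := hfun_bound; exists K; split=> // n hn.
have p := PI_RGT_0.
have hN : 1 <= INR n by rewrite -INR_1; apply: le_INR.
have hs : 1 <= sqrt (INR n) by rewrite -sqrt_1; apply: sqrt_le_1_alt.
have hss : sqrt (INR n) * sqrt (INR n) = INR n by apply: sqrt_sqrt; lra.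
set r := sqrt (INR n) in hs hss *.
set y := / (16 * r).
have hy : 0 < y <= / 16.
  split; first by apply: Rinv_0_lt_compat; lra.
  apply: Rinv_le_contravar; lra.
have e1 : exp (2 * PI / (576 * y)) = exp (PI * r / 18) by congr exp; rewrite /y; field; lra.
have e2 : exp (2 * PI / (256 * y)) = exp (PI * r / 8) by congr exp; rewrite /y; field; lra.
have e3 : exp (- (2 * PI * y)) ^ n * exp (PI * r / 8) = 1.
  rewrite -Rpower_pow ?/Rpower; last exact: exp_pos.
  rewrite ln_exp -exp_plus -exp_0; congr exp; rewrite -hss /y; field; lra.
have step N : Cmod (herr N n) <= exp (PI * r / 8) * (K + 4 * exptail (S N) (al / (2 * PI * y))
    + exp (PI * r / 18) + 17 * PI / (16 * r) * exp (PI * r / 8)).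
  have [i1 i2] := lorentz_sum_int y 16 (proj1 hy).
  set c0 := K + 4 * exptail (S N) (al / (2 * PI * y)) + exp (2 * PI / (576 * y)).
  have hB : is_RInt (fun x => c0 + exp (2 * PI / (256 * y)) * sum_f_R0 (lorentz y x) 16) 0 1
     (c0 + exp (2 * PI / (256 * y)) * RInt (fun x => sum_f_R0 (lorentz y x) 16) 0 1).
    apply: (is_RInt_plus (V := R_NormedModule)).
      have e : scal (1 - 0) c0 = c0 by rewrite /scal /= /mult /=; ring.
      have := is_RInt_const (V := R_NormedModule) 0 1 c0; by rewrite e.
    apply: (is_RInt_scal (V := R_NormedModule)); exact: RInt_correct.
  have h := coef_bound _ _ y _ n (hfun_rep N) (proj1 hy) (ex_intro _ _ hB) (fun x hx => hb N y x hy hx).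
  rewrite (is_RInt_unique _ _ _ _ hB) in h.
  have h3 : c0 + exp (2 * PI / (256 * y)) * RInt (fun x => sum_f_R0 (lorentz y x) 16) 0 1 <=
     K + 4 * exptail (S N) (al / (2 * PI * y)) + exp (PI * r / 18) + 17 * PI / (16 * r) * exp (PI * r / 8).
    rewrite /c0 e1 e2; apply: Rplus_le_compat_l.
    have -> : 17 * PI / (16 * r) * exp (PI * r / 8) = exp (PI * r / 8) * (17 * (PI * y)) by rewrite /y; field; lra.
    apply: Rmult_le_compat_l; first exact/Rlt_le/exp_pos.
    have -> : 17 = INR 17 by rewrite INR_IZR_INZ. exact: i2.
  have -> : Cmod (herr N n) = exp (PI * r / 8) * (Cmod (herr N n) * exp (- (2 * PI * y)) ^ n).
    by rewrite Rmult_comm Rmult_assoc e3 Rmult_1_r.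
  apply: Rmult_le_compat_l; [exact/Rlt_le/exp_pos|lra].
(* For fixed n let N grow: the truncated coefficient tends to the Bessel value and the exponential
   tail to 0. *)
apply: le_epsilon => eps heps.
set S4 := 4 * (sin (PI * (INR n - 1) / 2) * sin (PI * (INR n - 1) / 4)).
have l1 := tcoef_lim n hn; have l2 := exptail_lim (al / (2 * PI * y)).
have l2' : is_lim_seq (fun N => exptail (S N) (al / (2 * PI * y))) 0 by apply/(is_lim_seq_incr_1 (fun N => exptail N (al / (2 * PI * y)))).
have hE := exp_pos (PI * r / 8).
have l3 : is_lim_seq (fun N => exp (PI * r / 8) * (4 * exptail (S N) (al / (2 * PI * y))) + Rabs (tcoef N n * S4 - main1 n)) 0.
  have -> : Finite 0 = Finite (exp (PI * r / 8) * (4 * 0) + Rabs (main1 n - main1 n)).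
    by congr Finite; rewrite Rminus_diag Rabs_R0; ring.
  apply: is_lim_seq_plus'.
    apply: (is_lim_seq_scal_l _ _ (Finite (4 * 0))); exact: (is_lim_seq_scal_l _ _ (Finite 0)).
  apply: (is_lim_seq_abs _ (Finite (main1 n - main1 n))); apply: is_lim_seq_minus'; last exact: is_lim_seq_const.
  have -> : main1 n = PI / (4 * r) * BesselI 1 (PI * r / 2) * S4.
    by rewrite /main1 /S4 -/r; field; lra.
  exact: (is_lim_seq_scal_r _ S4 (Finite _) l1).
move/is_lim_seq_spec: l3 => /(_ (mkposreal _ heps)) [N0 h0].
have := h0 N0 (le_n _); rewrite /= Rminus_0_r => h4.
have h5 := step N0.
have h6 : Cmod (a n - RtoC (main1 n))%C <= Cmod (herr N0 n) + Rabs (tcoef N0 n * S4 - main1 n).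
  have -> : (a n - RtoC (main1 n) = herr N0 n + RtoC (tcoef N0 n * S4 - main1 n))%C.
    rewrite /herr -/S4 RtoC_minus RtoC_mult; ring.
  by apply: Rle_trans (Cmod_triangle _ _) _; rewrite Cmod_R; lra.
have h7 := Rle_abs (exp (PI * r / 8) * (4 * exptail (S N0) (al / (2 * PI * y))) + Rabs (tcoef N0 n * S4 - main1 n)).
rewrite /= in h7; lra.
Qed.
End Asymptotics.

(** * Bessel functions and conclusion *)

Definition besselt (x : R) (k : nat) : R := (x / 2) ^ (2 * k + 1) / (INR (fact k) * INR (fact (k + 1))).

Lemma besselt_rfact x k : besselt x k = rfact k * (x / 2) ^ k * (rfact (S k) * (x / 2) ^ S k).
Proof.
rewrite /besselt /rfact; have -> : (k + 1 = S k)%nat by lia.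
have -> : (2 * k + 1 = k + S k)%nat by lia.
rewrite pow_add; field; split; exact: INR_fact_neq_0.
Qed.
Lemma besselt_pos x k : 0 <= x -> 0 <= besselt x k.
Proof.
move=> hx; rewrite besselt_rfact.
by do 2 apply: Rmult_le_pos; try (exact/Rlt_le/rfact_pos); apply: pow_le; lra.
Qed.

(** Each term is a product of two consecutive terms of the series of e^(x/2); one factor is at most
    e^(x/2), and the others sum to at most e^(x/2). *)
Lemma bessel_le_exp x : 0 <= x -> 0 <= BesselI 1 x <= exp x.
Proof.
move=> hx; have h := bessel_series x; split.
  apply: Rle_trans (sum_n_le_series _ _ 0 (fun k => besselt_pos x k hx) h).
  rewrite sum_O; exact: besselt_pos.
have hu : 0 <= x / 2 by lra.
have hp k : 0 <= rfact k * (x / 2) ^ k by apply: Rmult_le_pos; [exact/Rlt_le/rfact_pos|exact: pow_le].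
have hb n : sum_n (besselt x) n <= exp x.
  rewrite sum_n_Reals; have -> : exp x = exp (x / 2) * exp (x / 2) by rewrite -exp_plus; congr exp; field.
  have h1 := sum_n_le_series _ _ (S n) hp (exp_series (x / 2)).
  rewrite sum_n_Reals decomp_sum in h1; last lia.
  apply: (Rle_trans _ (exp (x / 2) * sum_f_R0 (fun k => rfact (S k) * (x / 2) ^ S k) n)); last first.
    apply: Rmult_le_compat_l; first exact/Rlt_le/exp_pos.
    by have := hp 0%nat; rewrite [pred _]/= in h1; lra.
  rewrite scal_sum; apply: sum_Rle => k _; rewrite besselt_rfact Rmult_comm.
  apply: Rmult_le_compat_l; first exact: hp. exact: exp_term.
have hl : is_lim_seq (sum_n (besselt x)) (Finite (BesselI 1 x)) := h.
exact: (is_lim_seq_le _ _ (Finite _) (Finite _) hb hl (is_lim_seq_const _)).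
Qed.

Lemma sum_parity (u : nat -> R) n : sum_f_R0 u (S (2 * n)) = sum_f_R0 (fun k => u (2 * k)%nat + u (S (2 * k))) n.
Proof.
elim: n => [|n IH] //.
have -> : (S (2 * S n) = S (S (S (2 * n))))%nat by lia.
rewrite 2!tech5 IH tech5; have -> : (2 * S n = S (S (2 * n)))%nat by lia. ring.
Qed.

(* c^2 >= 1/(4m) for c the normalised central binomial coefficient, and m^(-1/2) lies above its tangent at m = x. *)
Lemma central_lower k x : 1 <= x ->
  rfact (2 * k + 1) * (3 - INR (S k) / x) / (4 * sqrt x) <= rfact k * rfact (S k) / 2 ^ (2 * k + 1).
Proof.
move=> hx.
set c := INR (fact (2 * k + 1)) * (rfact k * rfact (S k) / 2 ^ (2 * k + 1)).
have hc : 0 < c /\ 1 <= 4 * INR (S k) * (c * c).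
  rewrite /c; elim: k {c} => [|k [IH1 IH2]].
    by rewrite /rfact /=; split; lra.
  have e : INR (fact (2 * S k + 1)) * (rfact (S k) * rfact (S (S k)) / 2 ^ (2 * S k + 1)) =
     (2 * INR k + 3) / (2 * (INR k + 2)) * (INR (fact (2 * k + 1)) * (rfact k * rfact (S k) / 2 ^ (2 * k + 1))).
    have -> : (2 * S k + 1 = S (S (2 * k + 1)))%nat by lia.
    rewrite !fact_simpl !mult_INR -(rfact_S k) -(rfact_S (S k)) !S_INR plus_INR mult_INR.
    have -> : 2 ^ S (S (2 * k + 1)) = 4 * 2 ^ (2 * k + 1) by rewrite /=; ring.
    have h2 : 0 < 2 ^ (2 * k + 1) by apply: pow_lt; lra.
    have hk := pos_INR k; have -> : INR 2 = 2 by []. have -> : INR 1 = 1 by [].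
    field; split; lra.
  rewrite e; set c := INR _ * _ in IH1 IH2 *; have hk := pos_INR k.
  set q := (2 * INR k + 3) / (2 * (INR k + 2)).
  have hq : 0 < q by apply: Rdiv_lt_0_compat; lra.
  split; first exact: Rmult_lt_0_compat.
  have hqq : INR (S k) <= INR (S (S k)) * (q * q).
    rewrite !S_INR; have -> : (INR k + 1 + 1) * (q * q) = (2 * INR k + 3) * (2 * INR k + 3) / (4 * (INR k + 2)).
      rewrite /q; field; lra.
    apply: (Rmult_le_reg_r (4 * (INR k + 2))); first lra.
    rewrite /Rdiv Rmult_assoc Rinv_l; last lra. nra.
  have hcc : 0 < c * c by nra.
  have := Rmult_le_compat_r _ _ _ (Rlt_le _ _ hcc) hqq; lra.
move: hc => [hc0 hc1].
have hm : 0 < INR (S k) by apply: lt_0_INR; lia.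
have hs : 0 < sqrt x by apply: sqrt_lt_R0; lra.
have hss : sqrt x * sqrt x = x by apply: sqrt_sqrt; lra.
have hf : 0 < rfact (2 * k + 1) by exact: rfact_pos.
have -> : rfact k * rfact (S k) / 2 ^ (2 * k + 1) = rfact (2 * k + 1) * c.
  have hh : rfact (2 * k + 1) * INR (fact (2 * k + 1)) = 1 by rewrite /rfact Rinv_l //; exact: INR_fact_neq_0.
  by rewrite /c -Rmult_assoc hh Rmult_1_l.
rewrite /Rdiv Rmult_assoc; apply: Rmult_le_compat_l; first lra.
set z := INR (S k) * / x.
have hz : 0 < z by apply: Rmult_lt_0_compat => //; apply: Rinv_0_lt_compat; lra.
have ez : INR (S k) = z * x by rewrite /z; field; lra.
case: (Rle_dec 3 z) => h3.
  apply: Rle_trans (Rlt_le _ _ hc0); have := Rinv_0_lt_compat (4 * sqrt x) ltac:(lra); nra.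
apply: Rnot_lt_le => hlt.
have h4 : c * (4 * sqrt x) < 3 - z.
  have := Rmult_lt_compat_r (4 * sqrt x) _ _ ltac:(lra) hlt; rewrite Rmult_assoc Rinv_l; lra.
have h5 : c * (4 * sqrt x) * (c * (4 * sqrt x)) < (3 - z) * (3 - z).
  have : 0 < c * (4 * sqrt x) by apply: Rmult_lt_0_compat; lra.
  nra.
have h6 : c * (4 * sqrt x) * (c * (4 * sqrt x)) = 16 * x * (c * c).
  transitivity (16 * (sqrt x * sqrt x) * (c * c)); [ring|by rewrite hss].
(* 4 - z (3 - z)^2 = (1 - z)^2 (4 - z). *)
have h7 : z * ((3 - z) * (3 - z)) <= 4.
  have : 0 <= (1 - z) * (1 - z) * (4 - z) by apply: Rmult_le_pos; [exact: Rle_0_sqr|lra].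
  lra.
rewrite h6 in h5; rewrite ez in hc1.
have := Rmult_lt_compat_l z _ _ hz h5; lra.
Qed.

(** The lower bound of [central_lower] is linear in k, so after multiplication by x^(2k+1) it sums
    to a combination of e^x and e^(-x); the result is at least (e^x - 3/2 e^(-x)) / (4 sqrt x). *)
Lemma bessel_ge x : 1 <= x -> exp x / (8 * sqrt x) <= BesselI 1 x.
Proof.
move=> hx; have hs : 0 < sqrt x by apply: sqrt_lt_R0; lra.
set S1 := fun n => sum_f_R0 (fun m => rfact m * x ^ m) n.
set S2 := fun n => sum_f_R0 (fun m => rfact m * (- x) ^ m) n.
have hb n : (S1 (S (2 * n)) - 3 / 2 * S2 (S (2 * n))) / (4 * sqrt x) <= BesselI 1 x.
  apply: Rle_trans (sum_n_le_series _ _ n (fun k => besselt_pos x k ltac:(lra)) (bessel_series x)).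
  rewrite sum_n_Reals /S1 /S2 !sum_parity scal_sum -minus_sum /Rdiv Rmult_comm scal_sum.
  apply: sum_Rle => k _.
  have h := central_lower k x hx.
  have hp : 0 < x ^ (2 * k + 1) by apply: pow_lt; lra.
  have e1 : besselt x k = rfact k * rfact (S k) / 2 ^ (2 * k + 1) * x ^ (2 * k + 1).
    rewrite besselt_rfact; have -> : (2 * k + 1 = k + S k)%nat by lia.
    rewrite !Rdiv_def !Rpow_mult_distr !pow_inv !pow_add; field; split; apply: pow_nonzero; lra.
  have e2 : S (2 * k) = (2 * k + 1)%nat by lia.
  rewrite -/(besselt x k) e1 e2.
  apply: Rle_trans (Rmult_le_compat_r _ _ _ (Rlt_le _ _ hp) h).
  have em : (- x) ^ (2 * k) = x ^ (2 * k) by rewrite !pow_mult; congr pow; ring.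
  have em' : (- x) ^ (2 * k + 1) = - x ^ (2 * k + 1) by rewrite (pow_add (- x)) em (pow_add x) !pow_1; ring.
  rewrite em em'; have -> : x ^ (2 * k + 1) = x * x ^ (2 * k) by rewrite (pow_add x) pow_1; ring.
  have hf := rfact_S (2 * k); rewrite e2 plus_INR mult_INR (_ : INR 2 = 2) // (_ : INR 1 = 1) // in hf.
  rewrite -hf S_INR.
  set F := rfact _; set X := x ^ (2 * k); have hF : 0 < F by exact: rfact_pos. have hX : 0 < X by apply: pow_lt; lra.
  have hk := pos_INR k.
  have -> : F * (3 - (INR k + 1) / x) / (4 * sqrt x) * (x * X) = F * X * (3 * x - (INR k + 1)) * / (4 * sqrt x) by field; lra.
  apply: Rmult_le_compat_r; first by apply: Rlt_le; apply: Rinv_0_lt_compat; lra.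
  have hFX : 0 < F * X by exact: Rmult_lt_0_compat.
  (* Without the common factor F X the two sides differ by (x - 1)/2, which is nonnegative. *)
  nra.
have l1 : is_lim_seq S1 (exp x).
  have h : is_lim_seq (sum_n _) (Finite _) := exp_series x; apply: is_lim_seq_ext h => n; exact: sum_n_Reals.
have l2 : is_lim_seq S2 (exp (- x)).
  have h : is_lim_seq (sum_n _) (Finite _) := exp_series (- x); apply: is_lim_seq_ext h => n; exact: sum_n_Reals.
have sub (u : nat -> R) (l : R) : is_lim_seq u l -> is_lim_seq (fun n => u (S (2 * n))) l.
  by move=> h; apply: (is_lim_seq_subseq u l (fun n => S (2 * n))) => //; apply: eventually_subseq => n; lia.
have l3 : is_lim_seq (fun n => (S1 (S (2 * n)) - 3 / 2 * S2 (S (2 * n))) / (4 * sqrt x)) ((exp x - 3 / 2 * exp (- x)) / (4 * sqrt x)).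
  apply: (is_lim_seq_scal_r _ _ (Finite _)); apply: is_lim_seq_minus'; first exact: sub.
  apply: (is_lim_seq_scal_l _ _ (Finite _)); exact: sub.
have h := is_lim_seq_le _ _ (Finite _) (Finite _) hb l3 (is_lim_seq_const _).
rewrite /= in h; apply: Rle_trans h.
have h1 : exp x * exp (- x) = 1 by rewrite -exp_plus Rplus_opp_r exp_0.
have h2 := exp_ineq1_le x; have h3 := exp_pos (- x); have h4 := exp_pos x.
have h5 : 3 * exp (- x) <= exp x.
  have : exp (- x) <= / 2.
    apply: (Rmult_le_reg_l (exp x)) => //; rewrite h1; lra.
  have := exp_ineq1_le (x / 2); have : exp x = exp (x / 2) * exp (x / 2) by rewrite -exp_plus; congr exp; field.
  move=> e he; have : 9 / 4 <= exp x by rewrite e; nra.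
  lra.
have -> : exp x / (8 * sqrt x) = (exp x / 2) / (4 * sqrt x) by field; lra.
apply: Rmult_le_compat_r; first by apply: Rlt_le; apply: Rinv_0_lt_compat; lra.
lra.
Qed.

(** The real part of the Gauss sum at n, where k and 8 - k have equal cosines. *)
Lemma sin_chi n : sqrt 2 * sin (PI * INR n / 2) * sin (PI * INR n / 4) = IZR (chi2 (Z.of_nat n)).
Proof.
set t := PI * INR n / 4.
have hz k : Re (z8 ^ (k * n))%C = cos (INR k * t).
  rewrite -ee_div8 ee_R {1}/Re /= mult_INR; congr cos; rewrite /t; field.
have h := f_equal Re (gauss_sum n).
have e (k k' : nat) : (k + k' = 8)%nat -> cos (INR k * t) = cos (INR k' * t).
  move=> hk; have -> : INR k * t = - (INR k' * t) + 2 * INR n * PI.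
    have : INR k + INR k' = 8 by rewrite -plus_INR hk INR_IZR_INZ.
    move=> h8; have -> : INR k = 8 - INR k' by lra. rewrite /t; field.
  by rewrite cos_period cos_neg.
have er : Re (2 * sqrt 2 * RtoC (IZR (chi2 (Z.of_nat n))))%C = 2 * sqrt 2 * IZR (chi2 (Z.of_nat n)).
  by rewrite -!RtoC_mult re_RtoC.
rewrite er in h; have z1 : (z8 ^ n = z8 ^ (1 * n))%C by rewrite Nat.mul_1_l.
rewrite z1 in h; unfold Cminus in h.
rewrite !Re_plus !Re_opp !hz (e 5%nat 3%nat) // (e 7%nat 1%nat) // in h.
have i1 : INR 1 = 1 by []. have i3 : INR 3 = 3 by rewrite /=; lra.
rewrite i1 i3 in h.
have -> : PI * INR n / 2 = 2 * t by rewrite /t; field.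
have hp : cos (1 * t) - cos (3 * t) = 2 * (sin (2 * t) * sin t).
  have -> : 1 * t = 2 * t - t by ring. have -> : 3 * t = 2 * t + t by ring.
  rewrite cos_minus cos_plus; ring.
have h2 := sqrt2_sqr; have h0 := Rlt_sqrt2_0.
have h3 : 4 * (sin (2 * t) * sin t) = 2 * sqrt 2 * IZR (chi2 (Z.of_nat n)) by lra.
have -> : sqrt 2 * sin (2 * t) * sin t = sqrt 2 * (4 * (sin (2 * t) * sin t)) / 4 by field.
rewrite h3; transitivity (sqrt 2 * sqrt 2 * IZR (chi2 (Z.of_nat n)) / 2); [field|rewrite h2; field].
Qed.

(** * Comparison with the stated error terms *)

Definition err1 (n : nat) : R :=
  2 * sqrt PI * ln (PI * sqrt (INR n) / 2) / Rpower (INR n) (1 / 4) * BesselI 1 (PI * sqrt (INR n) / 4).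

Lemma sqrt_INR_ge1 n : (1 <= n)%nat -> 1 <= sqrt (INR n).
Proof. by move=> hn; rewrite -sqrt_1; apply: sqrt_le_1_alt; rewrite -INR_1; apply: le_INR. Qed.

Lemma le_exp x : x <= exp x.
Proof. have := exp_ineq1_le x; lra. Qed.

Section FirstFunction.
Variables (f : C -> C) (a : nat -> C) (H : data1 a f).

Lemma coef_main1 : exists K, 0 <= K /\ forall n, (1 <= n)%nat ->
  Cmod (a n - RtoC (main1 n))%C <= K * (exp (PI * sqrt (INR n) / 4) / sqrt (INR n)).
Proof.
have [K [hK h]] := coef_asymp f a H; have p3 := PI2_3_2; have p4 := PI_4.
exists (8 / 3 * K + 24 / 5 + 17 * PI / 16); split; first lra.
move=> n hn; apply: Rle_trans (h n hn) _; have hr := sqrt_INR_ge1 n hn.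
move: (sqrt (INR n)) hr => r hr.
have e1 : exp (PI * r / 4) = exp (PI * r / 8) * exp (PI * r / 8) by rewrite -exp_plus; congr exp; field.
have e2 : exp (PI * r / 8) = exp (PI * r / 18) * exp (5 * PI * r / 72) by rewrite -exp_plus; congr exp; field.
(* The smaller terms are absorbed by t <= e^t; pi > 3 gives the constants 8/3 and 72/15 = 24/5. *)
have l1 : r <= 8 / 3 * exp (PI * r / 8) by have := le_exp (PI * r / 8); nra.
have l2 : r <= 24 / 5 * exp (5 * PI * r / 72) by have := le_exp (5 * PI * r / 72); nra.
have x1 := exp_pos (PI * r / 8); have x2 := exp_pos (PI * r / 18).
apply: (Rmult_le_reg_r r); first lra.
have -> : (8 / 3 * K + 24 / 5 + 17 * PI / 16) * (exp (PI * r / 4) / r) * r =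
  (8 / 3 * K + 24 / 5 + 17 * PI / 16) * exp (PI * r / 4) by field; lra.
rewrite e1.
have -> : exp (PI * r / 8) * (K + exp (PI * r / 18) + 17 * PI / (16 * r) * exp (PI * r / 8)) * r =
  exp (PI * r / 8) * (K * r + exp (PI * r / 18) * r + 17 * PI / 16 * exp (PI * r / 8)) by field; lra.
rewrite [X in _ <= X](_ : _ = exp (PI * r / 8) * ((8 / 3 * K + 24 / 5 + 17 * PI / 16) * exp (PI * r / 8))); last by ring.
apply: Rmult_le_compat_l; first lra.
have h1 : K * r <= K * (8 / 3 * exp (PI * r / 8)) by apply: Rmult_le_compat_l.
have h2 : exp (PI * r / 18) * r <= 24 / 5 * exp (PI * r / 8).
  rewrite [X in _ <= _ * X]e2; have := Rmult_le_compat_l _ _ _ (Rlt_le _ _ x2) l2; lra.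
lra.
Qed.

Lemma coef_bound1 : exists K, 0 <= K /\ forall n, (1 <= n)%nat ->
  Cmod (a n) <= K * (exp (PI * sqrt (INR n) / 2) / sqrt (INR n)).
Proof.
have [K [hK h]] := coef_main1; have p := PI_RGT_0; exists (K + PI); split; first lra.
move=> n hn; have hr := sqrt_INR_ge1 n hn; have h1 := h n hn.
have hm : Rabs (main1 n) <= PI * (exp (PI * sqrt (INR n) / 2) / sqrt (INR n)).
  rewrite /main1; move: (sqrt (INR n)) hr => r hr.
  have [b0 b1] := bessel_le_exp (PI * r / 2) ltac:(nra).
  have s1 : Rabs (sin (PI * (INR n - 1) / 2)) <= 1 by apply/Rabs_le_between; exact: SIN_bound.
  have s2 : Rabs (sin (PI * (INR n - 1) / 4)) <= 1 by apply/Rabs_le_between; exact: SIN_bound.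
  have hpr : 0 <= PI / r by apply: Rdiv_le_0_compat; lra.
  have ab (u v w z : R) : Rabs (u * v * w * z) = Rabs u * Rabs v * Rabs w * Rabs z by rewrite !Rabs_mult.
  rewrite ab (Rabs_pos_eq (BesselI _ _)) // (Rabs_pos_eq (PI / r)) //.
  have q1 : PI / r * Rabs (sin (PI * (INR n - 1) / 2)) * Rabs (sin (PI * (INR n - 1) / 4)) <= PI / r * 1 * 1.
    apply: Rmult_le_compat => //; try exact: Rabs_pos; first by apply: Rmult_le_pos => //; exact: Rabs_pos.
    by apply: Rmult_le_compat_l.
  have q2 : 0 <= PI / r * Rabs (sin (PI * (INR n - 1) / 2)) * Rabs (sin (PI * (INR n - 1) / 4)).
    by do 2 (apply: Rmult_le_pos; last exact: Rabs_pos).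
  have := Rmult_le_compat _ _ _ _ q2 b0 q1 b1; rewrite /Rdiv; lra.
have h2 := Cmod_le_add (a n) (RtoC (main1 n)); rewrite Cmod_R in h2.
have h3 : exp (PI * sqrt (INR n) / 4) / sqrt (INR n) <= exp (PI * sqrt (INR n) / 2) / sqrt (INR n).
  apply: Rmult_le_compat_r; first by apply: Rlt_le; apply: Rinv_0_lt_compat; lra.
  apply: exp_le; nra.
have := Rmult_le_compat_l _ _ _ hK h3; lra.
Qed.
End FirstFunction.

Lemma Rpower_quarter x : 0 < x -> Rpower x (1 / 4) = sqrt (sqrt x).
Proof.
move=> hx; have hs : 0 < sqrt x by exact: sqrt_lt_R0.
rewrite -(Rpower_sqrt (sqrt x)) // -(Rpower_sqrt x) // Rpower_mult; congr Rpower; field.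
Qed.

(** From n = 2 on, the argument pi sqrt n / 4 is at least 1, as [bessel_ge] requires, and the
    logarithm is at least ln (3/2). *)
Lemma err1_ge : exists c, 0 < c /\ forall n, (2 <= n)%nat ->
  c * (exp (PI * sqrt (INR n) / 4) / sqrt (INR n)) <= err1 n.
Proof.
have p3 := PI2_3_2; have p := PI_RGT_0.
have hl : 0 < ln (3 / 2) by rewrite -ln_1; apply: ln_increasing; lra.
exists (ln (3 / 2) / 2); split; first lra.
move=> n hn; have hr1 := sqrt_INR_ge1 n ltac:(lia).
have hN : 2 <= INR n by have -> : 2 = INR 2 by []; apply: le_INR.
have hr : 7 / 5 <= sqrt (INR n).
  have h : sqrt (INR n) * sqrt (INR n) = INR n by apply: sqrt_sqrt; lra.
  nra.
rewrite /err1 Rpower_quarter; last lra.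
move: (sqrt (INR n)) hr => r hr.
have hb := bessel_ge (PI * r / 4) ltac:(nra).
have hsr : 0 < sqrt r by apply: sqrt_lt_R0; lra.
have hsp : 0 < sqrt PI by exact: sqrt_lt_R0.
have hss : sqrt r * sqrt r = r by apply: sqrt_sqrt; lra.
have hpp : sqrt PI * sqrt PI = PI by apply: sqrt_sqrt; lra.
have e : sqrt (PI * r / 4) = sqrt PI * sqrt r / 2.
  apply: sqrt_lem_1; [nra|by apply: Rlt_le; nra|].
  transitivity (sqrt PI * sqrt PI * (sqrt r * sqrt r) / 4); [field|by rewrite hss hpp].
rewrite e in hb.
have hln : ln (3 / 2) <= ln (PI * r / 2) by apply: ln_le; nra.
have hc : 0 < 2 * sqrt PI / sqrt r by apply: Rdiv_lt_0_compat; lra.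
have E := exp_pos (PI * r / 4).
have -> : ln (3 / 2) / 2 * (exp (PI * r / 4) / r) =
   2 * sqrt PI / sqrt r * ln (3 / 2) * (exp (PI * r / 4) / (8 * (sqrt PI * sqrt r / 2))).
  transitivity (ln (3 / 2) / 2 * (exp (PI * r / 4) / (sqrt r * sqrt r))); [by rewrite hss|field; lra].
have -> : 2 * sqrt PI * ln (PI * r / 2) / sqrt r * BesselI 1 (PI * r / 4) =
   2 * sqrt PI / sqrt r * ln (PI * r / 2) * BesselI 1 (PI * r / 4) by field; lra.
apply: Rmult_le_compat => //.
- by apply: Rmult_le_pos; lra.
- apply: Rlt_le; apply: Rdiv_lt_0_compat => //; nra.
- apply: Rmult_le_compat_l; lra.
Qed.

Lemma sqrt_8n n : sqrt (INR (8 * n)) = 2 * sqrt (2 * INR n).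
Proof.
have hn := pos_INR n; rewrite mult_INR (_ : INR 8 = 8); last by rewrite INR_IZR_INZ.
have -> : 8 * INR n = 2 * 2 * (2 * INR n) by ring.
rewrite sqrt_mult_alt; last lra.
by rewrite sqrt_square; [|lra].
Qed.

Lemma sqrt_2n n : sqrt (2 * INR n) = sqrt 2 * sqrt (INR n).
Proof. by apply: sqrt_mult_alt; lra. Qed.

Lemma main1_8 n : (1 <= n)%nat -> main1 (8 * n) = PI / (4 * sqrt (INR n)) * BesselI 1 (PI * sqrt (2 * INR n)).
Proof.
move=> hn; have hr := sqrt_INR_ge1 n hn; have h2 := Rlt_sqrt2_0; have hs2 := sqrt2_sqr.
rewrite /main1 sqrt_8n.
have -> : PI * (2 * sqrt (2 * INR n)) / 2 = PI * sqrt (2 * INR n) by field.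
have e8 : INR (8 * n) = 8 * INR n by rewrite mult_INR (_ : INR 8 = 8) // INR_IZR_INZ.
rewrite e8.
have -> : sin (PI * (8 * INR n - 1) / 2) = -1.
  have -> : PI * (8 * INR n - 1) / 2 = - (PI / 2) + 2 * INR (2 * n) * PI.
    rewrite mult_INR (_ : INR 2 = 2) //; field.
  by rewrite sin_period sin_neg sin_PI2.
have -> : sin (PI * (8 * INR n - 1) / 4) = - (1 / sqrt 2).
  have -> : PI * (8 * INR n - 1) / 4 = - (PI / 4) + 2 * INR n * PI by field.
  by rewrite sin_period sin_neg sin_PI4.
rewrite sqrt_2n.
have -> : PI / (2 * (sqrt 2 * sqrt (INR n))) * -1 * - (1 / sqrt 2) = PI / (2 * (sqrt 2 * sqrt 2) * sqrt (INR n)).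
  field; lra.
rewrite hs2; congr Rmult; field; lra.
Qed.

Lemma err1_8 n : (1 <= n)%nat -> err1 (8 * n) =
  Rpower 2 (1 / 4) * sqrt PI * ln (PI * sqrt (2 * INR n)) / Rpower (INR n) (1 / 4) * BesselI 1 (PI * sqrt (INR n) / sqrt 2).
Proof.
move=> hn; have hr := sqrt_INR_ge1 n hn; have h2 := Rlt_sqrt2_0; have hs2 := sqrt2_sqr.
have hN : 0 < INR n by apply: lt_0_INR; lia.
rewrite /err1 sqrt_8n.
have -> : PI * (2 * sqrt (2 * INR n)) / 2 = PI * sqrt (2 * INR n) by field.
have -> : PI * (2 * sqrt (2 * INR n)) / 4 = PI * sqrt (INR n) / sqrt 2.
  rewrite sqrt_2n; transitivity (PI * (sqrt 2 * sqrt 2) * sqrt (INR n) / (2 * sqrt 2)); [field; lra|].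
  rewrite hs2; field; lra.
have -> : Rpower (INR (8 * n)) (1 / 4) = Rpower 8 (1 / 4) * Rpower (INR n) (1 / 4).
  rewrite mult_INR (_ : INR 8 = 8); last by rewrite INR_IZR_INZ.
  by rewrite Rpower_mult_distr //; lra.
(* The factor 2 of [err1] divided by 8^(1/4) is the 2^(1/4) of the error for f_8. *)
have e : Rpower 2 (1 / 4) * Rpower 8 (1 / 4) = 2.
  rewrite Rpower_mult_distr; try lra.
  have -> : 2 * 8 = Rpower 2 4.
    have -> : 4 = INR 4 by rewrite INR_IZR_INZ.
    rewrite Rpower_pow; [ring|lra].
  rewrite Rpower_mult; have -> : 4 * (1 / 4) = 1 by field.
  rewrite Rpower_1; lra.
have p8 : 0 < Rpower 8 (1 / 4) by exact: exp_pos.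
have pn : 0 < Rpower (INR n) (1 / 4) by exact: exp_pos.
rewrite -{1}e; congr Rmult; field; lra.
Qed.

Lemma bigO_a1 f a : data1 a f -> eq_bigO a main1 err1.
Proof.
move=> H; have [K [hK h]] := coef_main1 f a H; have [c [hc hw]] := err1_ge.
exists (K / c), 2%nat => n hn; apply: Rle_trans (h n ltac:(lia)) _.
have := hw n hn; set X := exp _ / _ => hX; have hr := Rle_abs (err1 n).
have -> : K * X = K / c * (c * X) by field; lra.
apply: Rmult_le_compat_l; [by apply: Rdiv_le_0_compat|lra].
Qed.

(** For the indices k = 2n, n/2, n/8 of the Hecke relation a_1(k) stays within the error allowed at
    8n; for k = 2n the exponentials agree exactly. *)
Lemma growth_compare (k n : nat) : (1 <= k)%nat -> (k <= 2 * n)%nat -> (n <= 16 * k)%nat ->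
  exp (PI * sqrt (INR k) / 2) / sqrt (INR k) <= 8 * sqrt 2 * (exp (PI * sqrt (INR (8 * n)) / 4) / sqrt (INR (8 * n))).
Proof.
move=> hk h1 h2; have hrk := sqrt_INR_ge1 k hk; have hrn := sqrt_INR_ge1 n ltac:(lia).
have p := PI_RGT_0; have q := Rlt_sqrt2_0.
rewrite sqrt_8n sqrt_2n.
have e1 : sqrt (INR k) <= sqrt 2 * sqrt (INR n).
  rewrite -sqrt_2n; apply: sqrt_le_1_alt; have -> : 2 = INR 2 by []; rewrite -mult_INR; exact: le_INR.
have e2 : sqrt (INR n) <= 4 * sqrt (INR k).
  have -> : 4 = sqrt (4 * 4) by rewrite sqrt_square; lra.
  rewrite -sqrt_mult_alt; last lra.
  apply: sqrt_le_1_alt; have := le_INR _ _ h2; rewrite mult_INR (_ : INR 16 = 16); last by rewrite INR_IZR_INZ. lra.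
move: (sqrt (INR k)) (sqrt (INR n)) hrk hrn e1 e2 => r s hr hs e1 e2.
have -> : 8 * sqrt 2 * (exp (PI * (2 * (sqrt 2 * s)) / 4) / (2 * (sqrt 2 * s))) = exp (PI * (2 * (sqrt 2 * s)) / 4) * (4 / s) by field; lra.
rewrite /Rdiv; apply: Rmult_le_compat.
- exact/Rlt_le/exp_pos.
- apply: Rlt_le; apply: Rinv_0_lt_compat; lra.
- apply: exp_le; nra.
- apply: (Rmult_le_reg_r (r * s)); first nra.
  have -> : / r * (r * s) = s by field; lra.
  have -> : 4 * / s * (r * s) = 4 * r by field; lra.
  lra.
Qed.

Lemma bigO_a8 f1 f8 a1 a8 : data1 a1 f1 -> data8 a8 f8 ->
  eq_bigO a8 (fun n => 4 * (1 + IZR (chi2 (Z.of_nat n))) * main1 (8 * n)) (fun n => err1 (8 * n)).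
Proof.
move=> H1 H8; have [K [hK h]] := coef_main1 f1 a1 H1; have [L [hL hb]] := coef_bound1 f1 a1 H1.
have [c [hc hw]] := err1_ge; have q := Rlt_sqrt2_0.
(* From 8 on, n / 8 is at least 1, so that the bounds for a_1 apply to all four terms. *)
exists ((8 * K + 4 * L * (8 * sqrt 2)) / c), 8%nat => n hn.
have [e1 [e2 [e3 [-> [h1 [h2 [[h3 h3'] _]]]]]]] := a8_formula f1 f8 a1 a8 H1 H8 n.
set X := exp (PI * sqrt (INR (8 * n)) / 4) / sqrt (INR (8 * n)).
have hX := hw (8 * n)%nat ltac:(lia); rewrite -/X in hX.
have small k : (1 <= k)%nat -> (k <= 2 * n)%nat -> (n <= 16 * k)%nat -> Cmod (a1 k) <= L * (8 * sqrt 2 * X).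
  move=> k1 k2 k3; apply: Rle_trans (hb k k1) _; apply: Rmult_le_compat_l => //; exact: growth_compare.
have m2 := Nat.div_mod n 2 ltac:(lia); have m8 := Nat.div_mod n 8 ltac:(lia).
have u2 := Nat.mod_upper_bound n 2 ltac:(lia); have u8 := Nat.mod_upper_bound n 8 ltac:(lia).
have s1 := small (2 * n)%nat ltac:(lia) ltac:(lia) ltac:(lia).
have s2 := small (n / 2)%nat ltac:(lia) ltac:(lia) ltac:(lia).
have s3 := small (n / 8)%nat ltac:(lia) ltac:(lia) ltac:(lia).
have g := h (8 * n)%nat ltac:(lia); rewrite -/X in g.
set ch := 4 * (1 + IZR (chi2 (Z.of_nat n))).
have hch : Rabs ch <= 8.
  have : -1 <= IZR (chi2 (Z.of_nat n)) <= 1.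
    by rewrite /chi2; case: Z.even; [lra|case: orb; lra].
  by move=> hh; apply/Rabs_le_between; rewrite /ch; lra.
have -> : forall u v w z : C, (RtoC ch * a1 (8 * n)%nat + u + v + w - RtoC (ch * main1 (8 * n)) =
    RtoC ch * (a1 (8 * n)%nat - RtoC (main1 (8 * n))) + u + v + w)%C.
  by move=> u v w z; rewrite RtoC_mult; ring.
2: exact: (RtoC 0).
have t (u v w z : C) : Cmod (u + v + w + z)%C <= Cmod u + Cmod v + Cmod w + Cmod z.
  by do 3 (apply: Rle_trans (Cmod_triangle _ _) _; apply: Rplus_le_compat_r); exact: Rle_refl.
apply: Rle_trans (t _ _ _ _) _; rewrite !Cmod_mult !Cmod_R.
have g0 := Cmod_ge_0 (a1 (8 * n)%nat - RtoC (main1 (8 * n)))%C.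
have b1 : Rabs ch * Cmod (a1 (8 * n)%nat - RtoC (main1 (8 * n)))%C <= 8 * (K * X).
  by apply: Rmult_le_compat => //; exact: Rabs_pos.
have Y0 : 0 <= L * (8 * sqrt 2 * X) := Rle_trans _ _ _ (Cmod_ge_0 _) s1.
have bb (e C0 : R) (z : C) : Rabs e <= C0 -> Cmod z <= L * (8 * sqrt 2 * X) -> Rabs e * Cmod z <= C0 * (L * (8 * sqrt 2 * X)).
  by move=> he hz; apply: Rmult_le_compat => //; [exact: Rabs_pos|exact: Cmod_ge_0].
have b2 := bb (2 * e1) 2 _ ltac:(rewrite Rabs_mult (Rabs_pos_eq 2); lra) s1.
have b3 := bb e2 1 _ h2 s2.
have b4 := bb (/ 2 * e3) 1 _ ltac:(rewrite Rabs_pos_eq; lra) s3.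
have hr := Rle_abs (err1 (8 * n)).
apply: (Rle_trans _ ((8 * K + 4 * L * (8 * sqrt 2)) / c * (c * X))).
  have -> : (8 * K + 4 * L * (8 * sqrt 2)) / c * (c * X) = 8 * (K * X) + 4 * (L * (8 * sqrt 2 * X)) by field; lra.
  lra.
apply: Rmult_le_compat_l; last lra.
apply: Rdiv_le_0_compat => //.
have : 0 <= L * sqrt 2 by apply: Rmult_le_pos; lra.
lra.
Qed.

Lemma eq_bigO_ext u v w v' w' : (forall n, (1 <= n)%nat -> v n = v' n) -> (forall n, (1 <= n)%nat -> w n = w' n) ->
  eq_bigO u v w -> eq_bigO u v' w'.
Proof.
move=> hv hw [K [n0 h]]; exists K, (S n0) => n hn.
rewrite -hv -?hw; try lia. apply: h; lia.
Qed.

Theorem proposition6p5 :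
  forall (f1 f8 : C -> C) (a1 a8 : nat -> C),
    is_f 1 f1 -> f_expansion 1 f1 a1 ->
    is_f 8 f8 -> f_expansion 8 f8 a8 ->
    eq_bigO a1
      (fun n =>
         PI / sqrt (INR n)
         * sin (PI * (INR n - 1) / 2) * sin (PI * (INR n - 1) / 4)
         * BesselI 1 (PI * sqrt (INR n) / 2))
      (fun n =>
         2 * sqrt PI * ln (PI * sqrt (INR n) / 2) / Rpower (INR n) (1 / 4)
         * BesselI 1 (PI * sqrt (INR n) / 4))
    /\ (forall n : nat, Im (a8 n) = 0 /\ 0 <= Re (a8 n))
    /\ eq_bigO a8
      (fun n =>
         PI / sqrt (INR n) * BesselI 1 (PI * sqrt (2 * INR n))
         * (1 + sqrt 2 * sin (PI * INR n / 2) * sin (PI * INR n / 4)))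
      (fun n =>
         Rpower 2 (1 / 4) * sqrt PI * ln (PI * sqrt (2 * INR n))
         / Rpower (INR n) (1 / 4)
         * BesselI 1 (PI * sqrt (INR n) / sqrt 2)).
Proof.
move=> f1 f8 a1 a8 [A1 _] E1 [A8 _] E8.
have [M1 P1] := Aeps8_modular f1 A1; have [M8 P8] := Aeps8_modular f8 A8.
have H1 : data1 a1 f1.
  split=> //; split=> //; have := f_expansion_data 1 f1 a1 E1.
  by rewrite s8_1 INR_1 Rinv_1.
have H8 : data8 a8 f8.
  split=> //; split=> //; have := f_expansion_data 8 f8 a8 E8.
  by rewrite s8_8.
split; first exact: (bigO_a1 f1).
split; first exact: (a8_nonneg f1 f8 a1 a8).
apply: eq_bigO_ext (bigO_a8 f1 f8 a1 a8 H1 H8) => n hn; last exact: err1_8.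
have hr := sqrt_INR_ge1 n hn.
rewrite main1_8 // sin_chi; field; lra.
Qed.
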